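(* Let $(M,\omega)$ be a complete non-compact Kähler manifold of complex dimension $n\geq 2$ with sub-quadratic volume growth (along a sequence $\rho_i\to+\infty$, with associated constant $c_{vol}$). Let $f$ be a continuous real-valued function on $M$ that is bounded from above. 1. Suppose $\omega$ has strictly sub-quadratic volume growth. Then any bounded $C^{1,1}$ sub-solution, super-solution, or solution $\phi$ to $$(\omega+i\partial\overline{\partial}\phi)^{n}=\omega^{n}$$ is a constant. 2. Suppose $e^{f}-1$ is integrable, i.e. $\int_{M}|e^{f}-1|\,\omega^{n}<+\infty$. Then any bounded $C^{1,1}$ solution $\phi$ to $$(\omega+i\partial\overline{\partial}\phi)^{n}=e^{f}\omega^{n}$$ has bounded Dirichlet energy, i.e. $$\int_{M}|\nabla_{\omega}\phi|^{2}\,\omega^{n}\leq c_{DE}<+\infty,$$ where $$c_{DE}=1000\,n^{4n+4}\,|\phi|_{C^{0}(M)}\left[(1+K)^{2n}c_{vol}+|e^{f}-1|_{L^{1}(M,\omega^{n})}\right]$$ and $K$ is the constant in the definition of bounded $C^{1,1}$ solution, i.e. $0<\omega+i\partial\overline{\partial}\phi\leq K\omega$ on $M$. 3. Suppose, in addition to sub-quadratic volume growth, that $\omega$ satisfies the weak Neumann Poincaré inequality on annulus. Then any bounded $C^{1,1}$ solution $\phi$ to $(\omega+i\partial\overline{\partial}\phi)^{n}=\omega^{n}$ is a constant.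
   Context: Conventions. Manifolds are connected. A Kähler metric is identified with its Kähler form $\omega$. All integrals and volumes are with respect to the top degree form $\omega^n$; gradients $\nabla=\nabla_\omega$ and their norms are with respect to (the Riemannian metric of) $\omega$. $|\phi|_{C^0(M)}=\sup_M|\phi|$. Fix a point $o\in M$; $r$ is the distance from $o$ and $B(\rho)$ is the geodesic ball of radius $\rho$ centered at $o$, both with respect to $\omega$. Bounded $C^{1,1}$ solution, sub-solution, super-solution. Given $f$, a bounded $C^{1,1}$ solution (respectively sub-solution, super-solution) to $(\omega+i\partial\overline\partial\phi)^n=e^f\omega^n$ is a real-valued function $\phi$ on $M$ such that: (i) $\phi$ is twice continuously differentiable on the manifold (not necessarily with bounds on norms of derivatives); (ii) $(\omega+i\partial\overline\partial\phi)^n=e^f\omega^n$ (respectively $\geq e^f\omega^n$, $\leq e^f\omega^n$); (iii) there is a positive number $K<\infty$ such that $\sup_M|\phi|<\infty$ and $0<\omega_\phi:=\omega+i\partial\overline\partial\phi\leq K\omega$ on the whole of $M$. The equation $(\omega+i\partial\overline\partial\phi)^n=\omega^n$ is the case $f\equiv 0$. Volume growth. $\omega$ has sub-quadratic volume growth if there is a positive sequence $\rho_i\to+\infty$ such that $$c_{vol}:=\limsup_{i\to\infty}\frac{Vol[B(2\rho_i)\setminus B(\rho_i)]}{\rho_i^2}<+\infty.$$ It has strictly sub-quadratic volume growth if $c_{vol}=0$, i.e. $\lim_{i\to\infty}Vol[B(2\rho_i)\setminus B(\rho_i)]/\rho_i^2=0$. Weak Neumann Poincaré inequality on annulus. With $\rho_i$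 the sequence in the volume growth condition, $\omega$ satisfies this inequality if there are a sequence $\underline{\rho}_i\to\infty$ with $\underline{\rho}_i\leq\rho_i$ for large $i$, and a constant $c_P$ independent of $i$ and of $\phi$, such that for every twice continuously differentiable real function $\phi$ on $M$ there are real numbers $\mu_i$ (which may depend on $\phi$) with $$\int_{B(2\rho_i)\setminus B(\rho_i)}|\phi-\mu_i|^2\leq c_P\,\rho_i^2\int_{\{r\geq\underline{\rho}_i\}}|\nabla\phi|^2 .$$ *)

(* Defs.v *)
From HB Require Import structures.
From mathcomp Require Import all_boot all_order all_algebra perm.
From mathcomp Require Import all_classical all_reals all_analysis.
Set Implicit Arguments.
Unset Strict Implicit.
Unset Printing Implicit Defensive.
Import Order.TTheory GRing.Theory Num.Theory.
Import numFieldNormedType.Exports.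
Local Open Scope classical_set_scope.
Local Open Scope ring_scope.

(* C^n is 'rV[R]_(n + n) with real coordinates (x_1..x_n, y_1..y_n),           *)
(* z_j = x_j + i y_j.  Tangent vectors are row vectors, so linear maps act by  *)
(* right multiplication.  A 2-form is given, in a chart, by the matrix         *)
(* W a b = W(d_a, d_b), i.e. W(u, v) = u W v^T.                                *)

Section Euclidean.
Variables (R : realType) (m : nat).
Implicit Types (V : set 'rV[R]_m) (h : 'rV[R]_m -> R).

Definition partial (a : 'I_m) h : 'rV[R]_m -> R :=
  fun x => 'D_(delta_mx 0 a) (h : 'rV[R]_m -> R^o) x.

Fixpoint Ck_on (k : nat) V h : Prop :=
  (forall x, V x -> {for x, continuous h}) /\
  (if k is k'.+1 then
     forall a : 'I_m,
       (forall x, V x -> derivable (h : 'rV[R]_m -> R^o) x (delta_mx 0 a)) /\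
       Ck_on k' V (partial a h)
   else True).

Definition smooth_on V h : Prop := forall k, Ck_on k V h.

Definition diff1 h (x : 'rV[R]_m) : 'rV[R]_m := \row_a partial a h x.

Definition jac (F : 'rV[R]_m -> 'rV[R]_m) (x : 'rV[R]_m) : 'M[R]_m :=
  \matrix_(a, b) partial a (fun y => F y 0 b) x.

Definition ext_d (alpha : 'rV[R]_m -> 'rV[R]_m) (x : 'rV[R]_m) : 'M[R]_m :=
  \matrix_(a, b) (partial a (fun y => alpha y 0 b) x
                  - partial b (fun y => alpha y 0 a) x).

Definition closed_form (W : 'rV[R]_m -> 'M[R]_m) V : Prop :=
  forall x, V x -> forall a b c : 'I_m,
    partial a (fun y => W y b c) x + partial b (fun y => W y c a) x
    + partial c (fun y => W y a b) x = 0.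

End Euclidean.

(* For Borel h >= 0 this is, by Tonelli, the integral of h against Lebesgue    *)
(* measure on R^m.                                                             *)
Fixpoint lebesgue_int (R : realType) (m : nat) :
    ('rV[R]_m -> \bar R) -> \bar R :=
  match m with
  | 0%N => fun h => h 0
  | m'.+1 => fun h =>
      (\int[@lebesgue_measure R]_(t in setT)
         lebesgue_int (fun v : 'rV[R]_m' =>
           h (row_mx (t%:M : 'rV[R]_1) v : 'rV[R]_(1 + m'))))%E
  end.

Section Pointwise.
Variables (R : realType) (n : nat).
Implicit Types (W : 'M[R]_(n + n)) (v : 'rV[R]_(n + n)).

(* J d_{x_j} = d_{y_j}, J d_{y_j} = - d_{x_j}. *)
Definition Jmx : 'M[R]_(n + n) := block_mx 0 1%:M (- 1%:M) 0.

Definition form_app W (u v : 'rV[R]_(n + n)) : R := (u *m W *m v^T) 0 0.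

Definition real11 W : Prop := W^T = - W /\ Jmx *m W *m Jmx^T = W.

Definition form_pos W : Prop :=
  forall v, v != 0 -> 0 < form_app W v (v *m Jmx).

Definition form_le W1 W2 : Prop :=
  forall v, form_app W1 v (v *m Jmx) <= form_app W2 v (v *m Jmx).

(* The coefficient of the n-th wedge power W^n with respect to the oriented    *)
(* volume element dx_1 dy_1 ... dx_n dy_n, from                                *)
(* W^n(v_1, .., v_2n) = 2^-n \sum_s sgn(s) \prod_j W(v_{s(2j-1)}, v_{s(2j)}).  *)
Definition wedge_top W : R :=
  (2 ^+ n)^-1 * \sum_(s : 'S_(n + n))
    (-1) ^+ s * \prod_(j < n) W (s (lshift n j)) (s (rshift n j)).

(* The Riemannian metric g(u, v) = W(u, J v). *)
Definition metric W : 'M[R]_(n + n) := W *m Jmx^T.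

Definition metric_sq W v : R := form_app (metric W) v v.

Definition gradient W (h : 'rV[R]_(n + n) -> R) x : 'rV[R]_(n + n) :=
  diff1 h x *m invmx (metric W).

(* i ddbar h = i d(dbar h), where dbar h = (dh + i dh o J) / 2 is the          *)
(* (0,1)-part of dh; hence i ddbar h = - d(dh o J) / 2.                        *)
Definition i_ddbar (h : 'rV[R]_(n + n) -> R) (x : 'rV[R]_(n + n)) :
    'M[R]_(n + n) :=
  - (2^-1 *: ext_d (fun y => diff1 h y *m Jmx^T) x).

End Pointwise.

(* Transition maps are holomorphic: smooth with C-linear differential. *)
Record complex_manifold (R : realType) (M : ptopologicalType) (n : nat) := {
  cm_hausdorff : hausdorff_space M;
  cm_second_countable : @second_countable M;
  cm_connected : connected [set: M];
  chart : Type;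
  chart_dom : chart -> set M;
  chart_cod : chart -> set 'rV[R]_(n + n);
  coord : chart -> M -> 'rV[R]_(n + n);
  param : chart -> 'rV[R]_(n + n) -> M;
  chart_at : M -> chart;
  chart_at_dom : forall x, chart_dom (chart_at x) x;
  chart_dom_open : forall i, open (chart_dom i);
  chart_cod_open : forall i, open (chart_cod i);
  coord_cod : forall i x, chart_dom i x -> chart_cod i (coord i x);
  param_dom : forall i y, chart_cod i y -> chart_dom i (param i y);
  coordK : forall i x, chart_dom i x -> param i (coord i x) = x;
  paramK : forall i y, chart_cod i y -> coord i (param i y) = y;
  coord_continuous : forall i x, chart_dom i x -> {for x, continuous (coord i)};
  param_continuous : forall i y, chart_cod i y -> {for y, continuous (param i)};
  transition_smooth : forall i j (a : 'I_(n + n)),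
    smooth_on (chart_cod i `&` param i @^-1` chart_dom j)
      (fun y => coord j (param i y) 0 a);
  transition_holomorphic : forall i j y,
    chart_cod i y -> chart_dom j (param i y) ->
    jac (coord j \o param i) y *m Jmx R n = Jmx R n *m jac (coord j \o param i) y
}.

Section Kahler.
Variables (R : realType) (M : ptopologicalType) (n : nat).
Variable X : complex_manifold R M n.

Record kahler_form := {
  kform : chart X -> 'rV[R]_(n + n) -> 'M[R]_(n + n);
  kform_smooth : forall i a b,
    smooth_on (chart_cod i) (fun y => kform i y a b);
  kform_compat : forall i j y, chart_cod i y -> chart_dom j (param i y) ->
    let D := jac (coord j \o param i) y in
    kform i y = D *m kform j (coord j (param i y)) *m D^T;
  kform_real11 : forall i y, chart_cod i y -> real11 (kform i y);
  kform_pos : forall i y, chart_cod i y -> form_pos (kform i y);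
  kform_closed : forall i, closed_form (kform i) (chart_cod i)
}.

Variable w : kahler_form.
Implicit Types (phi f : M -> R) (x : M).

Definition in_chart (i : chart X) phi : 'rV[R]_(n + n) -> R :=
  fun y => phi (param i y).

Definition C2_manifold phi : Prop :=
  forall i, Ck_on 2 (chart_cod i) (in_chart i phi).

(* [joined x y l]: a piecewise C^1 curve of length l runs from x to y.  Each   *)
(* piece lies in a chart domain, which subdividing a curve always achieves; a  *)
(* C^1 map on the closed interval [0, 1] is the restriction of a C^1 map on R. *)
Inductive joined : M -> M -> R -> Prop :=
| joined_refl x : joined x x 0
| joined_step x z l (i : chart X) (c : R -> 'rV[R]_(n + n)) :
    (forall t, derivable (c : R^o -> 'rV[R]_(n + n)) t 1) ->
    continuous (fun t : R => 'D_1 (c : R^o -> 'rV[R]_(n + n)) t) ->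
    (forall t, 0 <= t <= 1 -> chart_cod i (c t)) ->
    param i (c 0) = x ->
    joined (param i (c 1)) z l ->
    joined x z
      (Rintegral (@lebesgue_measure R) `[0, 1]%classic
         (fun t => Num.sqrt (metric_sq (kform w i (c t))
                               ('D_1 (c : R^o -> 'rV[R]_(n + n)) t))) + l).

Definition dist (x y : M) : R := inf [set l | joined x y l].

Definition gball (o : M) (r : R) : set M := [set x | dist o x < r].

Definition complete_metric : Prop :=
  forall u : nat -> M,
    (forall e : R, 0 < e -> exists N, forall p q,
        (N <= p)%N -> (N <= q)%N -> dist (u p) (u q) < e) ->
    exists x, (fun k => dist (u k) x) @ \oo --> (0 : R).

Notation borel := (g_sigma_algebraType (@open M)).

(* The measure defined by the volume form w^n; these local values determine it *)
(* since M is second countable.                                                *)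
Definition is_volume (mu : {measure set borel -> \bar R}) : Prop :=
  forall (i : chart X) (A : set borel), measurable A -> A `<=` chart_dom i ->
    mu A = lebesgue_int (fun y =>
      (wedge_top (kform w i y) * \1_(coord i @` A) y)%:E).

Definition grad_sq phi x : R :=
  let i := chart_at X x in
  let W := kform w i (coord i x) in
  metric_sq W (gradient W (in_chart i phi) (coord i x)).

Definition kform_phi phi (i : chart X) y : 'M[R]_(n + n) :=
  kform w i y + i_ddbar (in_chart i phi) y.

Definition bounded_C11 phi (K : R) : Prop :=
  [/\ C2_manifold phi, 0 < K, exists C, forall x, `|phi x| <= C
    & forall i y, chart_cod i y ->
        form_pos (kform_phi phi i y) /\
        form_le (kform_phi phi i y) (K *: kform w i y)].

Definition bounded_C11_solution f phi K : Prop :=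
  bounded_C11 phi K /\ forall i y, chart_cod i y ->
    wedge_top (kform_phi phi i y)
    = expR (f (param i y)) * wedge_top (kform w i y).

Definition bounded_C11_subsolution f phi K : Prop :=
  bounded_C11 phi K /\ forall i y, chart_cod i y ->
    wedge_top (kform_phi phi i y)
    >= expR (f (param i y)) * wedge_top (kform w i y).

Definition bounded_C11_supersolution f phi K : Prop :=
  bounded_C11 phi K /\ forall i y, chart_cod i y ->
    wedge_top (kform_phi phi i y)
    <= expR (f (param i y)) * wedge_top (kform w i y).

Definition sup_norm phi : R := sup (range (fun x => `|phi x|)).

Variables (mu : {measure set borel -> \bar R}) (o : M) (rho : nat -> R).

Definition annulus (i : nat) : set M := gball o (2 * rho i) `\` gball o (rho i).

Definition c_vol : \bar R :=
  limn_esup (fun i => (mu (annulus i) * ((rho i ^+ 2)^-1)%:E)%E).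

Definition dirichlet_energy phi : \bar R :=
  (\int[mu]_(x in setT) (grad_sq phi x)%:E)%E.

Definition L1_norm (h : M -> R) : \bar R :=
  (\int[mu]_(x in setT) (`|h x|)%:E)%E.

Definition c_DE f phi (K : R) : \bar R :=
  ((1000 * n%:R ^+ (4 * n + 4) * sup_norm phi)%:E *
   (((1 + K) ^+ (2 * n))%:E * c_vol + L1_norm (fun x => expR (f x) - 1)%R))%E.

Definition weak_neumann_poincare : Prop :=
  exists (rlow : nat -> R) (cP : R),
    [/\ rlow @ \oo --> +oo, \forall i \near \oo, rlow i <= rho i
      & forall phi, C2_manifold phi -> exists c : nat -> R, forall i,
          (\int[mu]_(x in annulus i) ((phi x - c i) ^+ 2)%:E <=
           (cP * rho i ^+ 2)%:E *
           \int[mu]_(x in [set x | (rlow i <= dist o x)%R])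
              (grad_sq phi x)%:E)%E].

End Kahler.

Notation borel M := (g_sigma_algebraType (@open M)).

(* Main.v *)
(* By the arithmetic-geometric mean inequality a sub-solution phi satisfies    *)
(* Delta_omega phi >= 2 n (exp (f / n) - 1), and a super-solution satisfies    *)
(* Delta_{omega_phi} phi <= 0.  Both read tr (G^-1 Hess h) >= q, where G is the *)
(* metric of a (1,1)-form Omega <= K omega and (Omega, h) is (omega, phi) or   *)
(* (omega_phi, - phi).  Although omega_phi is only continuous, mollifying phi  *)
(* shows that it is closed in the weak sense, so that tr (G^-1 Hess h) is in   *)
(* divergence form for the volume of Omega and can be tested against           *)
(* eta^2 (h - min h), with eta a cutoff function at scale rho_k; balls are     *)
(* precompact by completeness.  As Omega <= K omega, the energy of eta for the *)
(* volume of Omega is O(Vol (annulus) / rho_k^2) = O(1), and absorbing the     *)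
(* cross term bounds the energy of h.  Once this energy is known to be finite, *)
(* its part in the annulus tends to 0, and so does the cross term: the energy  *)
(* is at most - inf \int psi q over test functions 0 <= psi <= osc h.  For     *)
(* f = 0 this is 0 and h is constant; otherwise it is at most                  *)
(* 2 n osc phi |exp f - 1|_{L^1}.                                              *)
Require Import Defs.
From HB Require Import structures.
From mathcomp Require Import all_boot all_order all_algebra perm.
From mathcomp Require Import all_classical all_reals all_analysis.
From mathcomp Require Import ring lra measurable_realfun.
Set Implicit Arguments.
Unset Strict Implicit.
Unset Printing Implicit Defensive.
Import Order.TTheory GRing.Theory Num.Theory.
Import numFieldNormedType.Exports.
Local Open Scope classical_set_scope.
Local Open Scope ring_scope.

(** * Positive definite matrices *)

(** Everything rests on one energy estimate for a bounded function [h] and a positive form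
    [Om = w + i ddbar u] with [Om <= K w]. Let [G] and [g] be the metrics of [Om] and [w]. Suppose
    that [sqrt (det G) tr (G^-1 Hess h) >= sqrt (det g) q], and that [- \int psi q <= S] for all
    test functions with [0 <= psi <= B], where [B] bounds the oscillation of [h]. Then the energy of
    [h], taken in the metric and the volume of [Om], is at most [S] ([dens_integral_le],
    [energy_eq0], [energy_integral_le]).

    The trace bound comes from the Monge-Ampere inequality. The top wedge power is a fixed multiple
    of the square root of the determinant ([wedge_top_det]), and the arithmetic-geometric mean
    inequality for relative eigenvalues ([trace_ge_det]) compares determinants with traces. A
    sub-solution gives the estimate with [u = 0], [h = phi] and [q = 2 n (exp (f / n) - 1)]; a
    super-solution for [f = 0] gives it with [u = phi], [h = - phi] and [q = 0]. When [q = 0] one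
    may take [S = 0], so the gradient of [h] vanishes and [h] is constant. When [exp f - 1] is
    integrable, [S] is a multiple of its L^1 norm.

    The weak form uses that [Om] is closed: the Hamiltonian fields of the coordinates preserve the
    volume of [Om] ([symplectic_divergence]), and since [G^-1 = Om^-1 J] the operator
    [tr (G^-1 Hess h)] is a divergence for that volume. As [u] is only C^2, this is obtained as a
    limit over mollified [u] ([weak_divergence]), and leads to [weak_inequality_global].

    Testing against [eta_k^2 (h - m0)], where [eta_k] cuts off at scale [rho_k], leaves a cross term
    between [d eta_k] and [dh]. By [cofactor_bound], [sqrt (det G) G^-1 <= K^(n-1) sqrt (det g)
    g^-1], so the energy of [eta_k] is a constant times the volume of the annulus over [rho_k^2],
    which is bounded. Absorbing half of the cross term bounds the energy of [h] uniformly in [k]. As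
    [d eta_k] lives in the annulus, the cross term only sees an increment of the energy; increments
    of a bounded quantity can be made small, and the cross term disappears ([absorb_limit]).

    On the geometric side, completeness makes balls precompact ([gball_precompact]), so that cutoffs
    built from a smoothed truncated distance have compact support ([cutoff]). Integrals against the
    volume measure are Lebesgue integrals in charts ([chart_integral]), and [window_induction] plays
    the role of a partition of unity. *)

Section MatrixAnalysis.
Variable R : realType.

Definition bil (m : nat) (G : 'M[R]_m) (u v : 'rV[R]_m) : R :=
  (u *m G *m v^T) 0 0.

Definition posdef (m : nat) (G : 'M[R]_m) : Prop :=
  G^T = G /\ forall v, v != 0 -> 0 < bil G v v.

Lemma bilDl m (G : 'M[R]_m) u v x : bil G (u + v) x = bil G u x + bil G v x.
Proof. by rewrite /bil !mulmxDl mxE. Qed.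

Lemma bilDr m (G : 'M[R]_m) u v x : bil G x (u + v) = bil G x u + bil G x v.
Proof. by rewrite /bil linearD /= mulmxDr mxE. Qed.

Lemma bilZl m (G : 'M[R]_m) a u v : bil G (a *: u) v = a * bil G u v.
Proof. by rewrite /bil -!scalemxAl mxE. Qed.

Lemma bilZr m (G : 'M[R]_m) a u v : bil G u (a *: v) = a * bil G u v.
Proof. by rewrite /bil linearZ /= -scalemxAr mxE. Qed.

Lemma bil_sym m (G : 'M[R]_m) u v : G^T = G -> bil G u v = bil G v u.
Proof.
move=> GT; rewrite /bil -[in LHS](trmxK (u *m G *m v^T)) mxE.
by rewrite !trmx_mul trmxK GT mulmxA.
Qed.

Lemma bilDm m (G H : 'M[R]_m) u v : bil (G + H) u v = bil G u v + bil H u v.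
Proof. by rewrite /bil mulmxDr mulmxDl mxE. Qed.

Lemma bilZm m (G : 'M[R]_m) a u v : bil (a *: G) u v = a * bil G u v.
Proof. by rewrite /bil -scalemxAr -scalemxAl mxE. Qed.

Lemma bil_sum m (G : 'M[R]_m) u v :
  bil G u v = \sum_a \sum_b u 0 a * G a b * v 0 b.
Proof.
rewrite /bil mxE exchange_big /=; apply: eq_bigr => b _.
by rewrite !mxE mulr_suml.
Qed.

Lemma bil_conj m p (E : 'M[R]_(p, m)) (G : 'M[R]_m) u v :
  bil (E *m G *m E^T) u v = bil G (u *m E) (v *m E).
Proof. by rewrite /bil trmx_mul !mulmxA. Qed.

Lemma bil1_ge0 m (u : 'rV[R]_m) : 0 <= bil 1%:M u u.
Proof.
rewrite /bil mulmx1 mxE; apply: sumr_ge0 => i _.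
by rewrite mxE -expr2 sqr_ge0.
Qed.

Lemma bil1_gt0 m (u : 'rV[R]_m) : u != 0 -> 0 < bil 1%:M u u.
Proof.
move=> u0; rewrite lt_neqAle bil1_ge0 andbT eq_sym.
apply: contra u0; rewrite /bil mulmx1 mxE psumr_eq0 => [/allP h|i _]; last first.
  by rewrite mxE -expr2 sqr_ge0.
apply/eqP/rowP => i; rewrite mxE; apply/eqP.
by move: (h i (mem_index_enum _)); rewrite mxE -expr2 /= sqrf_eq0.
Qed.

Lemma bil_delta m (G : 'M[R]_m) a b : bil G (delta_mx 0 a) (delta_mx 0 b) = G a b.
Proof. by rewrite /bil -rowE trmx_delta -colE !mxE. Qed.

Lemma sym_entry m (G : 'M[R]_m) i j : G^T = G -> G i j = G j i.
Proof. by move=> GT; rewrite -[in LHS]GT mxE. Qed.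

Lemma posdef_ge0 m (G : 'M[R]_m) v : posdef G -> 0 <= bil G v v.
Proof.
move=> [_ G0]; have [->|/G0/ltW//] := eqVneq v 0.
by rewrite /bil !mul0mx mxE.
Qed.

Lemma posdef_conj m (E G : 'M[R]_m) :
  E \in unitmx -> posdef G -> posdef (E *m G *m E^T).
Proof.
move=> Eu [GT G0]; split; first by rewrite !trmx_mul trmxK GT mulmxA.
move=> v v0; rewrite bil_conj; apply: G0; apply: contra v0 => /eqP vE0.
by apply/eqP; rewrite -[v]mulmx1 -(mulmxV Eu) mulmxA vE0 mul0mx.
Qed.

Lemma posdef_diag m (G : 'M[R]_m) i : posdef G -> 0 < G i i.
Proof.
move=> [_ G0].
have d0 : delta_mx 0 i != 0 :> 'rV[R]_m.
  apply/negP => /eqP/rowP/(_ i); rewrite !mxE !eqxx /= => /eqP.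
  by rewrite oner_eq0.
by rewrite -(bil_delta G); exact: G0.
Qed.

(** Induction on the size, factoring the Schur complement [S] of the corner entry. A triangular
    factor makes the determinant the product of the diagonal, which is what the determinant
    inequalities below exploit. *)
Lemma cholesky m (G : 'M[R]_m) : posdef G ->
  exists E : 'M[R]_m,
    [/\ G = E *m E^T, is_trig_mx E & forall i, 0 < E i i].
Proof.
elim: m G => [|m IH] G [GT G0].
  by exists 0; split; [apply/matrixP => -[]|apply/is_trig_mxP => -[]|case].
pose G' : 'M[R]_(1 + m) := G.
have GS i j : G' i j = G' j i by exact: sym_entry.
pose a := ulsubmx G' 0 0; pose b := ursubmx G'; pose D := drsubmx G'.
have a0 : 0 < a.
  by have := posdef_diag (lshift m (0 : 'I_1)) (conj GT G0 : posdef G'); rewrite /a !mxE.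
have GE : G' = block_mx a%:M b b^T D.
  rewrite -[LHS]submxK -/b -/D [ulsubmx _]mx11_scalar -/a.
  congr block_mx; rewrite /b /ursubmx /dlsubmx.
  by apply/matrixP => i j; rewrite !mxE GS.
have DT : D^T = D.
  by apply/matrixP => i j; rewrite !mxE GS.
pose S := D - a^-1 *: (b^T *m b).
have aU := lt0r_neq0 a0.
have Sp : posdef S.
  split; first by rewrite linearB /= DT linearZ /= trmx_mul trmxK.
  move=> v v0.
  (* This first entry makes [w] orthogonal for [G'] to the first basis vector, so that [bil G' w w]
     is [bil S v v]. *)
  pose w := row_mx (- a^-1 *: (v *m b^T)) v : 'rV[R]_(1 + m).
  have w0 : w != 0.
    apply: contra v0 => /eqP w0; apply/eqP.
    by have := congr1 rsubmx w0; rewrite row_mxKr linear0.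
  have : 0 < bil G' w w := G0 _ w0; rewrite GE /bil /w mul_row_block.
  rewrite mul_mx_scalar scalerA mulrN mulfV // scaleN1r addNr.
  rewrite tr_row_mx mul_row_col mul0mx add0r.
  suff -> : (- a^-1 *: (v *m b^T)) *m b + v *m D = v *m S by [].
  by rewrite -scalemxAl scaleNr addrC /S mulmxBr -scalemxAr mulmxA.
have [E1 [SE E1t E1p]] := IH S Sp.
pose s := Num.sqrt a.
have s0 : 0 < s by rewrite sqrtr_gt0.
have ss : s * s = a by rewrite -expr2 sqr_sqrtr // ltW.
have su := lt0r_neq0 s0.
pose E : 'M[R]_(1 + m) := block_mx s%:M 0 (s^-1 *: b^T) E1.
exists E; split.
- suff : G' = E *m E^T by [].
  rewrite GE /E tr_block_mx mulmx_block !trmx0 !mulmx0 !mul0mx !addr0.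
  rewrite tr_scalar_mx !linearZ /= trmxK -!scalar_mxM ss -SE.
  rewrite !mul_scalar_mx !mul_mx_scalar !scalerA !mulfV // !scale1r.
  rewrite mulVf // scale1r -scalemxAl scalerA -invfM ss /S addrC.
  by rewrite subrK.
- rewrite /E; apply/(@is_trig_mxP _ (1 + m) (1 + m)) => i j.
  rewrite -[i](@splitK 1 m) -[j](@splitK 1 m).
  case: (@fintype.split 1 m i) => i'; case: (@fintype.split 1 m j) => j' /=.
  + by rewrite !ord1 ltnn.
  + by rewrite block_mxEur mxE.
  + by rewrite ord1 ltn0.
  + by rewrite block_mxEdr ltn_add2l => ij; move/is_trig_mxP: E1t; apply.
- move=> i; suff : 0 < (E : 'M[R]_(1 + m)) i i by [].
  rewrite /E -[i](@splitK 1 m); case: (@fintype.split 1 m i) => i' /=.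
    by rewrite block_mxEul ord1 mxE eqxx mulr1n.
  by rewrite block_mxEdr.
Qed.

Lemma posdef_frame m (G : 'M[R]_m) : posdef G ->
  exists E : 'M[R]_m, [/\ G = E *m E^T, E \in unitmx & 0 < \det E].
Proof.
move=> /cholesky[E [-> Et Ep]]; exists E.
have dE : 0 < \det E by rewrite det_trig // prodr_gt0.
by split => //; rewrite unitmxE unitfE gt_eqF.
Qed.

Lemma posdef_det m (G : 'M[R]_m) : posdef G -> 0 < \det G.
Proof.
by move=> /posdef_frame[E [-> _ dE]]; rewrite det_mulmx det_tr mulr_gt0.
Qed.

Lemma posdef_unit m (G : 'M[R]_m) : posdef G -> G \in unitmx.
Proof. by move=> /posdef_det d; rewrite unitmxE unitfE gt_eqF. Qed.

(** Hadamard's inequality: in the Cholesky factor, [\det G] multiplies the squares of the diagonal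
    entries, while [G i i] is the squared length of a whole row. *)
Lemma det_le_prod_diag m (G : 'M[R]_m) :
  posdef G -> \det G <= \prod_i G i i.
Proof.
move=> /cholesky[E [-> Et Ep]]; rewrite det_mulmx det_tr det_trig //.
rewrite -big_split /=; apply: ler_prod => i _; have Ei := ltW (Ep i); rewrite mulr_ge0 //=.
rewrite mxE (bigD1 i) //= mxE lerDl; apply: sumr_ge0 => j _.
by rewrite mxE -expr2 sqr_ge0.
Qed.

Lemma invmx_tr_sym m (G : 'M[R]_m) : G^T = G -> (invmx G)^T = invmx G.
Proof. by move=> GT; rewrite trmx_inv GT. Qed.

Lemma posdef_inv m (G : 'M[R]_m) : posdef G -> posdef (invmx G).
Proof.
move=> Gp; have Gu := posdef_unit Gp; have GT := Gp.1.
have -> : invmx G = invmx G *m G *m (invmx G)^T.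
  by rewrite invmx_tr_sym // mulVmx // mul1mx.
by apply: posdef_conj => //; rewrite unitmx_inv.
Qed.

(** Passes to a frame orthonormal for [E *m E^T], so that of two metrics one becomes the
    identity. *)
Lemma posdef_relative m (E A : 'M[R]_m) : E \in unitmx -> posdef A ->
  let A' := invmx E *m A *m (invmx E)^T in
  [/\ posdef A', \det A = \det A' * \det (E *m E^T),
      \tr (invmx (E *m E^T) *m A) = \tr A' & A = E *m A' *m E^T].
Proof.
move=> Eu Ap A'; have EV : invmx E \in unitmx by rewrite unitmx_inv.
have AE : A = E *m A' *m E^T.
  rewrite /A' -!mulmxA -trmx_mul mulmxV // trmx1 mulmx1.
  by rewrite mulmxA mulmxV // mul1mx.
split => //; first exact: posdef_conj.
  by rewrite {1}AE !det_mulmx; ring.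
have -> : invmx (E *m E^T) = (invmx E)^T *m invmx E.
  have EEu : E *m E^T \in unitmx by rewrite unitmx_mul Eu unitmx_tr.
  apply: (row_free_inj (A := E *m E^T)); rewrite ?row_free_unit // mulVmx //.
  by rewrite -!mulmxA (mulmxA (invmx E)) mulVmx // mul1mx -trmx_mul mulmxV // trmx1.
by rewrite -mulmxA mxtrace_mulC.
Qed.

(** The arithmetic-geometric mean inequality for the eigenvalues of [G] relative to [g]. In a frame
    orthonormal for [g], Hadamard's inequality lets the diagonal entries stand in for the
    eigenvalues. *)
Lemma trace_ge_det m (g G : 'M[R]_m) (c : R) : (0 < m)%N -> posdef g ->
  posdef G -> 0 <= c -> c ^+ m * \det g <= \det G ->
  m%:R * c <= \tr (invmx g *m G).
Proof.
move=> m0 /posdef_frame[E [gE Eu dE]] Gp c0; rewrite gE => le.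
have [A'p dA trA _] := posdef_relative Eu Gp.
set A' := _ *m (invmx E)^T in A'p dA trA; rewrite trA.
have d0 : 0 < \det (E *m E^T) by rewrite det_mulmx det_tr mulr_gt0.
move: le; rewrite dA ler_pM2r // => le.
have A'0 i : 0 <= A' i i by rewrite ltW // posdef_diag.
have := leif_AGM (A := [pred _ : 'I_m | true]) (E := fun i => A' i i) (fun i _ => A'0 i).
have -> : #|[pred _ : 'I_m | true]| = m.
  by rewrite -[RHS]card_ord; apply: eq_card.
move=> [AG _].
have m0' : 0 < m%:R :> R by rewrite ltr0n.
rewrite mulrC -ler_pdivlMr // -(@ler_pXn2r _ m) ?nnegrE //.
  by apply: le_trans le (le_trans (det_le_prod_diag A'p) AG).
by apply: divr_ge0; [exact: sumr_ge0 | exact: ltW].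
Qed.

(** In a frame orthonormal for [B] the diagonal entries of [A] are at most 1, and Hadamard's
    inequality concludes. *)
Lemma det_le_mono m (A B : 'M[R]_m) : posdef A -> posdef B ->
  (forall v, bil A v v <= bil B v v) -> \det A <= \det B.
Proof.
move=> Ap /posdef_frame[E [BE Eu dE]] le.
have [A'p dA _ AE] := posdef_relative Eu Ap; move: A'p dA AE.
set A' := _ *m (invmx E)^T; clearbody A' => A'p dA AE; rewrite dA BE.
have d0 : 0 < \det (E *m E^T) by rewrite det_mulmx det_tr mulr_gt0.
apply: ler_piMl; first exact: ltW.
apply: (le_trans (det_le_prod_diag A'p)); rewrite -[leRHS](@big1_eq _ 1 *%R 'I_m (index_enum _) xpredT).
apply: ler_prod => i _; have A'i := ltW (posdef_diag i A'p); rewrite A'i /=.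
have := le (delta_mx 0 i *m invmx E).
have BE1 : B = E *m 1%:M *m E^T by rewrite mulmx1.
rewrite [in leLHS]AE [in leRHS]BE1 !bil_conj mulmxKV //.
by rewrite !bil_delta mxE eqxx.
Qed.

(* Sylvester's identity, by factoring the block matrix [[1, -V], [U, 1]]. *)
Lemma det_add1_mul m p (U : 'M[R]_(m, p)) (V : 'M[R]_(p, m)) :
  \det (1%:M + U *m V) = \det (1%:M + V *m U).
Proof.
have e1 : block_mx 1%:M (- V) U 1%:M =
    block_mx 1%:M 0 U 1%:M *m block_mx 1%:M (- V) 0 (1%:M + U *m V).
  rewrite mulmx_block !mul1mx !mul0mx !mulmx1 !addr0 mulmxN addrC.
  by rewrite addrK.
have e2 : block_mx 1%:M (- V) U 1%:M =
    block_mx (1%:M + V *m U) (- V) 0 1%:M *m block_mx 1%:M 0 U 1%:M.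
  by rewrite mulmx_block !mulmx1 !mul1mx !mulmx0 !add0r mulNmx addrK.
move: (congr1 determinant e1); rewrite e2 !det_mulmx !det_lblock !det_ublock.
by rewrite !det1 !mul1r !mulr1.
Qed.

(* Letting [s] go to infinity below extracts the largest inverse eigenvalue,  *)
(* which has multiplicity two for a [J]-invariant [G].                        *)
Lemma det_add_rank2 m (G : 'M[R]_m) (x y : 'rV[R]_m) (s : R) : posdef G ->
  bil (invmx G) x x = bil (invmx G) y y -> bil (invmx G) x y = 0 ->
  \det (G + s *: (x^T *m x + y^T *m y)) =
  \det G * (1 + s * bil (invmx G) x x) ^+ 2.
Proof.
move=> Gp xy xy0; have Gu := posdef_unit Gp.
pose V := col_mx x y; pose U := s *: (invmx G *m row_mx x^T y^T).
have -> : G + s *: (x^T *m x + y^T *m y) = G *m (1%:M + U *m V).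
  rewrite mulmxDr mulmx1 /U -scalemxAl -scalemxAr !mulmxA mulmxV //.
  by rewrite mul1mx mul_row_col.
rewrite det_mulmx det_add1_mul; congr (_ * _).
have xy0' : bil (invmx G) y x = 0.
  by rewrite bil_sym // invmx_tr_sym //; case: Gp.
have e (u v : 'rV[R]_m) : u *m (invmx G *m v^T) = (bil (invmx G) u v)%:M.
  by rewrite [LHS]mx11_scalar mulmxA.
rewrite /U /V -scalemxAr mul_mx_row mul_col_row !e xy0 xy0' -xy.
rewrite scale_block_mx !scale_scalar_mx mulr0 -scalemx1.
rewrite scalemx1 (scalar_mx_block 1 1) add_block_mx raddf0 !addr0.
by rewrite det_ublock -raddfD det_scalar1 expr2.
Qed.

(** Comparison of leading coefficients as [s] grows; one sufficiently large [s] already gives the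
    contradiction. *)
Lemma lin_dom_limit (a b c d : R) : 0 <= a -> 0 <= b -> 0 <= c -> 0 <= d ->
  (forall s, 0 < s -> c * (1 + s * a) <= d * (1 + s * b)) -> c * a <= d * b.
Proof.
move=> a0 b0 c0 d0 le; rewrite leNgt; apply/negP => lt.
have e0 : 0 < c * a - d * b by rewrite subr_gt0.
have := le ((1 + d) / (c * a - d * b)) (divr_gt0 (ltr_pwDl ltr01 d0) e0).
rewrite -subr_ge0; set s := _ / _.
have -> : d * (1 + s * b) - c * (1 + s * a) = d - c - s * (c * a - d * b) by ring.
by rewrite /s divfK ?gt_eqF //; lra.
Qed.

Lemma inv_invariant m (J G : 'M[R]_m) : J^T = - J -> J *m J = - 1%:M ->
  posdef G -> J *m G *m J^T = G -> J *m invmx G *m J^T = invmx G.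
Proof.
move=> JT JJ Gp GJ; have Gu := posdef_unit Gp.
have JJT : J *m J^T = 1%:M by rewrite JT mulmxN JJ opprK.
have JTJ : J^T *m J = 1%:M by rewrite JT mulNmx JJ opprK.
apply: (row_free_inj (A := G)); rewrite ?row_free_unit // mulVmx //.
rewrite -[X in _ *m X]GJ -!mulmxA (mulmxA J^T) JTJ mul1mx.
by rewrite (mulmxA (invmx G)) mulVmx // mul1mx.
Qed.

(** For a [J]-invariant inner product, [J] is an isometry turning each vector by a right angle.
    These are the hypotheses of [det_add_rank2] for the pair [x], [x J]. *)
Lemma inv_J_orthogonal m (J G : 'M[R]_m) (x : 'rV[R]_m) :
  J^T = - J -> J *m J = - 1%:M -> posdef G -> J *m G *m J^T = G ->
  bil (invmx G) x x = bil (invmx G) (x *m J) (x *m J) /\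
  bil (invmx G) x (x *m J) = 0.
Proof.
move=> JT JJ Gp GJ; have iJ := inv_invariant JT JJ Gp GJ.
split; first by rewrite -bil_conj iJ.
have GT := invmx_tr_sym Gp.1.
have JTJ : J^T *m J = 1%:M by rewrite JT mulNmx JJ opprK.
have anti : J *m invmx G = invmx G *m J.
  by rewrite -[in RHS]iJ -!mulmxA JTJ mulmx1.
have : bil (invmx G) x (x *m J) = - bil (invmx G) x (x *m J).
  rewrite [LHS]bil_sym // /bil -!mulmxA (mulmxA J) anti -mulmxA.
  by rewrite trmx_mul JT mulNmx !mulmxN [in RHS]mxE opprK.
by move/eqP; rewrite -subr_eq0 opprK -mulr2n mulrn_eq0 => /eqP.
Qed.

(** The claim is that [sqrt (det G) G^-1] is monotone in the [J]-invariant metric [G], applied to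
    [G <= K g]. Adding the same [J]-invariant rank-two form with weight [s] to both metrics
    multiplies each determinant by the square of an affine function of [s]; the determinants stay
    ordered, and after taking square roots the coefficients of [s] compare as claimed. The power
    [K^(n-1)] is that of complex dimension [n]. *)
Lemma cofactor_bound n (G g J : 'M[R]_(n + n)) (K : R) x :
  J^T = - J -> J *m J = - 1%:M ->
  posdef G -> posdef g -> J *m G *m J^T = G -> J *m g *m J^T = g ->
  0 < K -> (forall v, bil G v v <= K * bil g v v) ->
  Num.sqrt (\det G) * bil (invmx G) x x <=
  K ^+ n / K * Num.sqrt (\det g) * bil (invmx g) x x.
Proof.
move=> JT JJ Gp gp GJ gJ K0 le.
have Ku := lt0r_neq0 K0.
have Kgp : posdef (K *: g).
  split; first by rewrite linearZ /= gp.1.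
  by move=> v v0; rewrite bilZm mulr_gt0 //; exact: gp.2.
have invK : invmx (K *: g) = K^-1 *: invmx g.
  apply: (row_free_inj (A := K *: g)); rewrite ?row_free_unit ?posdef_unit //.
  rewrite mulVmx ?posdef_unit // -scalemxAl -scalemxAr scalerA mulVf //.
  by rewrite scale1r mulVmx ?posdef_unit.
have bK u v : bil (invmx (K *: g)) u v = K^-1 * bil (invmx g) u v.
  by rewrite invK bilZm.
have [xx xy] := inv_J_orthogonal x JT JJ Gp GJ.
have [xx' xy'] := inv_J_orthogonal x JT JJ gp gJ.
have a0 := posdef_ge0 x (posdef_inv Gp).
have b0 := posdef_ge0 x (posdef_inv gp).
set a := bil (invmx G) x x in xx a0 *; set b := bil (invmx g) x x in xx' b0 *.
have -> : K ^+ n / K * Num.sqrt (\det g) * b =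
    Num.sqrt (\det (K *: g)) * (K^-1 * b).
  rewrite detZ exprD sqrtrM ?mulr_ge0 ?exprn_ge0 ?ltW // -expr2 sqrtr_sqr.
  by rewrite ger0_norm ?exprn_ge0 ?ltW //; ring.
apply: lin_dom_limit; rewrite ?sqrtr_ge0 ?mulr_ge0 ?invr_ge0 //; first exact: ltW.
move=> s s0.
pose P := s *: (x^T *m x + (x *m J)^T *m (x *m J)).
have P0 v : 0 <= bil P v v.
  rewrite /P bilZm bilDm; apply: mulr_ge0; first exact: ltW.
  have sq (z : 'rV[R]_(n + n)) : 0 <= bil (z^T *m z) v v.
    rewrite /bil mulmxA -mulmxA; have -> : z *m v^T = (v *m z^T)^T.
      by rewrite trmx_mul trmxK.
    by rewrite mxE big_ord1 [_^T 0 0]mxE -expr2 sqr_ge0.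
  by rewrite addr_ge0.
have PT : P^T = P by rewrite /P linearZ /= linearD /= !trmx_mul !trmxK.
have DP (A : 'M[R]_(n + n)) : posdef A -> posdef (A + P).
  move=> Ap; split; first by rewrite linearD /= PT Ap.1.
  by move=> v v0; rewrite /bil mulmxDr mulmxDl mxE ltr_pwDl //; [exact: Ap.2|exact: P0].
have : \det (G + P) <= \det (K *: g + P).
  apply: det_le_mono; [exact: DP|exact: DP|move=> v].
  by rewrite !bilDm lerD2r bilZm.
rewrite !det_add_rank2 ?bK -?xx -?xx' ?xy ?xy' ?mulr0 // => {}le.
have sa0 : 0 <= 1 + s * a by rewrite addr_ge0 // mulr_ge0 // ltW.
have sb0 : 0 <= 1 + s * (K^-1 * b).
  by rewrite addr_ge0 // mulr_ge0 ?mulr_ge0 ?invr_ge0 //; exact: ltW.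
rewrite -(@ler_pXn2r _ 2) ?nnegrE ?mulr_ge0 ?sqrtr_ge0 //.
by rewrite !exprMn !sqr_sqrtr //; apply: ltW; exact: posdef_det.
Qed.
End MatrixAnalysis.

(** * Differential calculus on row vectors *)

Section Calculus.
Variable R : realType.

Lemma cont_sum (T : topologicalType) (I : Type) (r : seq I) (P : pred I)
    (F : I -> T -> R) x :
  (forall i, {for x, continuous (F i)}) ->
  {for x, continuous (fun y => \sum_(i <- r | P i) F i y)}.
Proof.
move=> cF; elim: r => [|i r IH].
  rewrite (_ : (fun _ => _) = cst 0); first exact: cst_continuous.
  by apply/funext => y; rewrite big_nil.
rewrite (_ : (fun _ => _) = fun y => (if P i then F i y else 0) +
    \sum_(j <- r | P j) F j y).
  apply: (@continuousD R R^o T (fun y => if P i then F i y else 0)) => //.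
  by case: (P i); [exact: cF|exact: cst_continuous].
by apply/funext => y; rewrite big_cons; case: (P i) => //; rewrite add0r.
Qed.

Lemma cont_prod (T : topologicalType) (I : Type) (r : seq I) (P : pred I)
    (F : I -> T -> R) x :
  (forall i, {for x, continuous (F i)}) ->
  {for x, continuous (fun y => \prod_(i <- r | P i) F i y)}.
Proof.
move=> cF; elim: r => [|i r IH].
  rewrite (_ : (fun _ => _) = cst 1); first exact: cst_continuous.
  by apply/funext => y; rewrite big_nil.
rewrite (_ : (fun _ => _) = fun y => (if P i then F i y else 1) *
    \prod_(j <- r | P j) F j y).
  apply: (@continuousM R T (fun y => if P i then F i y else 1)) => //.
  by case: (P i); [exact: cF|exact: cst_continuous].
by apply/funext => y; rewrite big_cons; case: (P i) => //; rewrite mul1r.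
Qed.

Lemma mxnorm_le m (x : 'rV[R]_m) e : 0 <= e -> (forall a, `|x 0 a| <= e) -> `|x| <= e.
Proof.
move=> e0 xe; rewrite /Num.Def.normr/= mx_normrE (bigmax_le _ e0)//= => -[i j] _.
by rewrite /= ord1.
Qed.

Lemma coord_le m (x : 'rV[R]_m) a : `|x 0 a| <= `|x|.
Proof.
rewrite [leRHS]/Num.Def.normr/= mx_normrE.
exact: (le_bigmax _ (fun ij : 'I_1 * 'I_m => `|x ij.1 ij.2|) (0, a)).
Qed.

Lemma cont_row (T : topologicalType) m (F : T -> 'rV[R]_m) x :
  (forall b, {for x, continuous (fun y => F y 0 b)}) -> {for x, continuous F}.
Proof.
move=> cF; apply/cvgrPdist_le => /= e e0.
near=> y; apply: mxnorm_le; first exact: ltW.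
near: y; apply: filter_forall => b.
have /cvgrPdist_le/(_ _ e0) := cF b.
by apply: filterS => y; rewrite !mxE.
Unshelve. all: by end_near. Qed.

Lemma cont_coord (T : topologicalType) m p (F : T -> 'M[R]_(m, p)) x a b :
  {for x, continuous F} -> {for x, continuous (fun y => F y a b)}.
Proof.
move=> cF; apply: (@continuous_comp _ _ _ F (fun M : 'M[R]_(m, p) => M a b)) => //.
exact: coord_continuous.
Qed.

Lemma MVT_signless (g g' : R -> R) (c : R) :
  (forall t, `|t| <= `|c| -> is_derive t (1 : R) (g : R -> R^o) (g' t)) ->
  exists2 t, `|t| <= `|c| & g c - g 0 = c * g' t.
Proof.
move=> dg.
have cg t : `|t| <= `|c| -> {for t, continuous g}.
  move=> tc; have [+ _] := dg t tc.
  by move=> /derivable1_diffP/differentiable_continuous.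
have cw (a b : R) : (forall t, a <= t <= b -> `|t| <= `|c|) ->
    {within `[a, b], continuous g}.
  move=> ab; apply: continuous_in_subspaceT => t.
  by rewrite inE /= in_itv /= => /ab; exact: cg.
have [c0|c0] := leP 0 c.
  have tc t : 0 <= t <= c -> `|t| <= `|c|.
    by move=> /andP[t0 tc]; rewrite !ger0_norm.
  have dI t : t \in `]0, c[ -> is_derive t (1 : R) (g : R -> R^o) (g' t).
    by rewrite in_itv /= => /andP[t0 t1]; apply/dg/tc; rewrite !ltW.
  have [t tI e] := MVT_segment c0 dI (cw _ _ tc).
  exists t; first by apply: tc; move: tI; rewrite in_itv.
  by rewrite e subr0 mulrC.
have tc t : c <= t <= 0 -> `|t| <= `|c|.
  by move=> /andP[t0 t1]; rewrite !ler0_norm ?lerN2 // ltW.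
have dI t : t \in `]c, 0[ -> is_derive t (1 : R) (g : R -> R^o) (g' t).
  by rewrite in_itv /= => /andP[t0 t1]; apply/dg/tc; rewrite !ltW.
have [t tI e] := MVT_segment (ltW c0) dI (cw _ _ tc).
exists t; first by apply: tc; move: tI; rewrite in_itv.
by rewrite -opprB e; ring.
Qed.

Lemma is_derive_line m (h : 'rV[R]_m -> R) (p v : 'rV[R]_m) (t : R) :
  derivable (h : 'rV[R]_m -> R^o) (p + t *: v) v ->
  is_derive t (1 : R) ((fun s => h (p + s *: v)) : R -> R^o)
    ('D_v (h : 'rV[R]_m -> R^o) (p + t *: v)).
Proof.
move=> dh.
have e : (fun s : R => s^-1 *: ((h (p + (s *: (1 : R^o) + t) *: v) : R^o) - h (p + t *: v)))
    = (fun s : R => s^-1 *: ((h (s *: v + (p + t *: v)) : R^o) - h (p + t *: v))).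
  apply/funext => s; congr (_ *: (h _ - _)).
  by rewrite [s *: 1]mulr1 scalerDl addrCA.
by split; rewrite /derivable /derive /= ?e.
Qed.

(** The pairing of a covector with a vector, typed in [R^o] so that it can be registered as a linear
    map and serve as a differential. *)
Definition dotl m (c v : 'rV[R]_m) : R^o := \sum_a v 0 a * c 0 a.

Lemma dotl_is_linear m (c : 'rV[R]_m) : linear (dotl c).
Proof.
move=> k u v; rewrite /dotl scaler_sumr -big_split /=; apply: eq_bigr => a _.
by rewrite !mxE mulrDl -mulrA.
Qed.

HB.instance Definition _ m (c : 'rV[R]_m) :=
  GRing.isLinear.Build R 'rV[R]_m R^o *:%R (dotl c) (dotl_is_linear c).

Lemma dotl_continuous m (c : 'rV[R]_m) : continuous (dotl c).
Proof.
move=> x; apply: (@cont_sum _ _ _ _ (fun a (v : 'rV[R]_m) => v 0 a * c 0 a)) => a.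
apply: (@continuousM R _ (fun v : 'rV[R]_m => v 0 a)); last exact: cst_continuous.
exact: coord_continuous.
Qed.

(** The increment is telescoped by changing one coordinate at a time; each step is a mean value of a
    partial derivative, and these are continuous at [x]. *)
Lemma C1_is_diff m (V : set 'rV[R]_m) (h : 'rV[R]_m -> R) x :
  open V -> Ck_on 1 V h -> V x ->
  is_diff x (h : 'rV[R]_m -> R^o) (dotl (diff1 h x)).
Proof.
move=> Vo [_ dh] Vx.
pose h' : 'rV[R]_m -> R^o := h; pose d' : 'rV[R]_m -> R^o := dotl (diff1 h x).
have key : h' \o shift x = cst (h' x) + d' +o_ (0 : 'rV[R]_m) id.
  apply/eqaddoP => _/posnumP[e].
  (* Each of the [m] coordinate steps contributes an error [e1]; dividing by [m.+1] also covers
     [m = 0]. *)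
  pose e1 := e%:num / m.+1%:R.
  have e10 : 0 < e1 by rewrite divr_gt0.
  have : \forall y \near x, V y /\ forall a, `|partial a h x - partial a h y| <= e1.
    near=> y; split; first by near: y; exact: open_nbhs_nbhs.
    near: y; apply: filter_forall => a.
    by have [_ [+ _]] := dh a => /(_ x Vx)/cvgrPdist_le/(_ _ e10).
  move=> /nbhs_ballP[r /= r0 rV].
  near=> v.
  have vr : `|v| < r.
    by near: v; apply/nbhs_ballP; exists r => //= y; rewrite -ball_normE /= sub0r normrN.
  pose T (k : nat) := \row_(a < m) (if (a < k)%N then v 0 a else 0).
  pose hT k := h (x + T k).
  have nT k (a : 'I_m) s : k = a -> `|s| <= `|v 0 a| -> `|T k + s *: delta_mx 0 a| <= `|v|.
    move=> -> sv; apply: mxnorm_le => // b; rewrite !mxE eqxx /=.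
    have [->|ba] := eqVneq b a.
      by rewrite ltnn add0r mulr1 (le_trans sv) ?coord_le.
    by rewrite mulr0 addr0; case: ifP => _; rewrite ?normr0 ?coord_le.
  have TS (a : 'I_m) : T a.+1 = T a + v 0 a *: delta_mx 0 a.
    apply/rowP => b; rewrite !mxE eqxx /= ltnS leq_eqVlt.
    have [->|ba] := eqVneq b a; first by rewrite eqxx ltnn add0r mulr1.
    by rewrite (inj_eq val_inj) (negPf ba) /= mulr0 addr0.
  have step (a : 'I_m) : `|hT a.+1 - hT a - v 0 a * partial a h x| <= e1 * `|v|.
    have B s : `|s| <= `|v 0 a| -> ball x r (x + T a + s *: delta_mx 0 a).
      move=> sv; rewrite -ball_normE /= -addrA opprD addNKr normrN.
      by apply: le_lt_trans vr; exact: nT.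
    have [|s sv es] := @MVT_signless (fun s => h (x + T a + s *: delta_mx 0 a))
        (fun s => partial a h (x + T a + s *: delta_mx 0 a)) (v 0 a).
      move=> s sv; apply: is_derive_line.
      by have [+ _] := dh a; apply; exact: (rV _ (B s sv)).1.
    rewrite /hT TS addrA; move: es; rewrite scale0r addr0 => ->.
    rewrite -mulrBr normrM mulrC ler_pM ?coord_le //.
    by rewrite distrC; exact: (rV _ (B s sv)).2.
  have -> : (h' \o shift x - (cst (h' x) + d')) v =
      \sum_(a < m) (hT a.+1 - hT a - v 0 a * partial a h x).
    rewrite sumrB.
    have -> : \sum_(a < m) (hT a.+1 - hT a) = hT m - hT 0%N.
      rewrite -(big_mkord xpredT (fun k => hT k.+1 - hT k)) telescope_sumr //.
    rewrite /hT; have -> : T m = v.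
      by apply/rowP => b; rewrite mxE ltn_ord.
    have -> : T 0%N = 0 by apply/rowP => b; rewrite !mxE.
    rewrite addr0 /= !fctE /dotl opprD addrA [v + x]addrC.
    by congr (_ - _); apply: eq_bigr => a _; rewrite mxE.
  apply: (le_trans (ler_norm_sum _ _ _)).
  apply: (le_trans (ler_sum _ (fun a _ => step a))).
  rewrite sumr_const card_ord -[_ *+ m]mulr_natl mulrA ler_wpM2r //.
  by rewrite /e1 mulrCA ger_pMr // ler_pdivrMr // mul1r ler_nat.
have de := diff_unique (@dotl_continuous m (diff1 h x)) key.
split => //; apply/diff_locallyP; rewrite de; split => //.
exact: dotl_continuous.
Unshelve. all: by end_near. Qed.

Lemma C1_differentiable m (V : set 'rV[R]_m) (h : 'rV[R]_m -> R) x :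
  open V -> Ck_on 1 V h -> V x -> differentiable (h : 'rV[R]_m -> R^o) x.
Proof. by move=> Vo hC Vx; have [] := C1_is_diff Vo hC Vx. Qed.

Lemma diff_dotl m (h : 'rV[R]_m -> R) x v :
  differentiable (h : 'rV[R]_m -> R^o) x ->
  'd (h : 'rV[R]_m -> R^o) x v = dotl (diff1 h x) v.
Proof.
move=> dh; rewrite [v in LHS]row_sum_delta linear_sum /dotl.
apply: eq_bigr => a _; rewrite linearZ /= mxE /partial deriveE //.
Qed.

Lemma is_derive_curve m (h : 'rV[R]_m -> R) (c : R -> 'rV[R]_m) t :
  differentiable (h : 'rV[R]_m -> R^o) (c t) ->
  derivable (c : R^o -> 'rV[R]_m) t 1 ->
  is_derive t (1 : R) ((fun s => h (c s)) : R -> R^o)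
    (dotl (diff1 h (c t)) ('D_1 (c : R^o -> 'rV[R]_m) t)).
Proof.
move=> dh /derivable1_diffP dc.
have dhc : differentiable (fun s => h (c s) : R^o) (t : R^o).
  exact: (differentiable_comp dc dh).
split; first exact: diff_derivable.
by rewrite !deriveE // (diff_comp dc dh) /= diff_dotl.
Qed.

Lemma differentiable_row (V : normedModType R) m (F : V -> 'rV[R]_m) x :
  (forall b, differentiable (fun y => F y 0 b : R^o) x) -> differentiable F x.
Proof.
move=> dF.
have -> : F = \sum_(b < m) (fun y => (F y 0 b : R^o) *: (delta_mx 0 b : 'rV[R]_m)).
  by apply/funext => y; rewrite fct_sumE -row_sum_delta.
apply: differentiable_sum => b.
exact: (@differentiableZl R V 'rV[R]_m (fun y => F y 0 b)).
Qed.

Lemma is_derive_comp p m (h : 'rV[R]_m -> R) (F : 'rV[R]_p -> 'rV[R]_m) x v :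
  differentiable (h : 'rV[R]_m -> R^o) (F x) ->
  (forall b, differentiable (fun y => F y 0 b : R^o) x) ->
  is_derive x v ((fun y => h (F y)) : 'rV[R]_p -> R^o)
    (\sum_b 'D_v (fun y => F y 0 b : R^o) x * partial b h (F x)).
Proof.
move=> dh dFb; have dF := differentiable_row dFb.
have dhF : differentiable (fun y => h (F y) : R^o) x.
  exact: (differentiable_comp dF dh).
split; first exact: diff_derivable.
rewrite deriveE // (diff_comp dF dh) /= diff_dotl //.
apply: eq_bigr => b _; rewrite mxE; congr (_ * _).
rewrite -deriveE // derive_mx ?mxE //; exact: diff_derivable.
Qed.

End Calculus.

(** * Functions of class C^k and symmetry of second derivatives *)

Section CkCalculus.
Variables (R : realType) (m : nat).

Lemma is_derive_sum_seq (E : normedModType R) (I : Type) (r : seq I) (P : pred I)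
    (F : I -> E -> R) (dF : I -> R) (x v : E) :
  (forall i, is_derive x v (F i : E -> R^o) (dF i)) ->
  is_derive x v ((fun y => \sum_(i <- r | P i) F i y) : E -> R^o)
    (\sum_(i <- r | P i) dF i).
Proof.
move=> D; elim: r => [|i r IH].
  rewrite big_nil (_ : (fun _ => _) = cst 0); first exact: is_derive_cst.
  by apply/funext => y; rewrite big_nil.
rewrite big_cons; case: (boolP (P i)) => Pi.
  rewrite (_ : (fun _ => _) =
      (F i : E -> R^o) + (fun y => \sum_(j <- r | P j) F j y : R^o)).
    exact: is_deriveD.
  by apply/funext => y; rewrite big_cons Pi.
rewrite (_ : (fun _ => _) = (fun y => \sum_(j <- r | P j) F j y)) //.
by apply/funext => y; rewrite big_cons (negPf Pi).
Qed.

Implicit Types (V : set 'rV[R]_m) (h f g : 'rV[R]_m -> R) (x : 'rV[R]_m).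

Lemma Ck_on_sub k V V' h : V `<=` V' -> Ck_on k V' h -> Ck_on k V h.
Proof.
elim: k h => [|k IH] h VV [ch dh]; split => //; try by move=> x /VV; exact: ch.
by move=> a; have [da Ca] := dh a; split; [move=> x /VV; exact: da|exact: IH].
Qed.

Lemma Ck_onW k V h : Ck_on k.+1 V h -> Ck_on k V h.
Proof.
elim: k h => [|k IH] h [ch dh]; split => // a.
by have [da Ca] := dh a; split => //; exact: IH.
Qed.

(** [Ck_on] states pointwise facts about a function defined everywhere, so it can be checked on any
    cover. *)
Lemma Ck_on_cover k V h :
  (forall x, V x -> exists U, U x /\ Ck_on k U h) -> Ck_on k V h.
Proof.
elim: k h => [|k IH] h cov; split => //.
- by move=> x /cov[U [Ux [+ _]]]; apply.
- by move=> x /cov[U [Ux [+ _]]]; apply.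
move=> a; split; first by move=> x /cov[U [Ux [_ /(_ a)[+ _]]]]; apply.
by apply: IH => x /cov[U [Ux [_ /(_ a)[_ ?]]]]; exists U.
Qed.

Lemma near_partial a f g x : (\forall y \near x, f y = g y) ->
  partial a f x = partial a g x.
Proof. by move=> fg; apply: near_eq_derive. Qed.

Lemma open_near (T : topologicalType) (V : set T) (x : T) (P : T -> Prop) :
  open V -> V x -> (forall y, V y -> P y) -> \forall y \near x, P y.
Proof.
by move=> Vo Vx VP; apply: filterS VP _; exact: open_nbhs_nbhs.
Qed.

Lemma near_eq_cont (T : topologicalType) (f g : T -> R) (x : T) :
  (\forall y \near x, f y = g y) -> {for x, continuous f} ->
  {for x, continuous g}.
Proof.
move=> fg; have e := nbhs_singleton fg.
rewrite /prop_for /continuous_at -e; apply: cvg_trans.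
by apply: near_eq_cvg; apply: filterS fg => y ->.
Qed.

Lemma Ck_on_eq k V f g : open V -> (forall x, V x -> f x = g x) ->
  Ck_on k V f -> Ck_on k V g.
Proof.
move=> Vo; elim: k f g => [|k IH] f g fg [cf df]; split => //.
- by move=> x Vx; apply: near_eq_cont (cf x Vx); exact: open_near fg.
- by move=> x Vx; apply: near_eq_cont (cf x Vx); exact: open_near fg.
move=> a; have [da Ca] := df a; split.
  move=> x Vx; apply: near_eq_derivable (da x Vx).
  exact: open_near fg.
apply: IH Ca => x Vx; apply: near_partial; exact: open_near fg.
Qed.

Lemma C1_intro V h :
  (forall x, V x -> differentiable (h : 'rV[R]_m -> R^o) x) ->
  (forall a x, V x -> {for x, continuous (partial a h)}) -> Ck_on 1 V h.
Proof.
move=> dh ch; split; first by move=> x /dh/differentiable_continuous.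
move=> a; split; last by split => // x; exact: ch.
by move=> x /dh; exact: diff_derivable.
Qed.

Lemma C1_cont V h x : Ck_on 1 V h -> V x -> {for x, continuous h}.
Proof. by move=> [+ _]; apply. Qed.

Lemma Ck_derivable k V h a x : Ck_on k.+1 V h -> V x ->
  derivable (h : 'rV[R]_m -> R^o) x (delta_mx 0 a).
Proof. by move=> [_ /(_ a)[+ _]]; apply. Qed.

Lemma C1_contd V h a x : Ck_on 1 V h -> V x ->
  {for x, continuous (partial a h)}.
Proof. by move=> [_ /(_ a)[_ [+ _]]]; apply. Qed.

Lemma Ck_partial k V h a : Ck_on k.+1 V h -> Ck_on k V (partial a h).
Proof. by move=> [_ /(_ a)[_]]. Qed.

Lemma is_derive_partial a h x : derivable (h : 'rV[R]_m -> R^o) x (delta_mx 0 a) ->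
  is_derive x (delta_mx 0 a) (h : 'rV[R]_m -> R^o) (partial a h x).
Proof. exact: derivableP. Qed.

Lemma partialD a f g x : derivable (f : 'rV[R]_m -> R^o) x (delta_mx 0 a) ->
  derivable (g : 'rV[R]_m -> R^o) x (delta_mx 0 a) ->
  partial a (fun y => f y + g y) x = partial a f x + partial a g x.
Proof. by move=> df dg; rewrite /partial -deriveD. Qed.

Lemma partialN a f x : derivable (f : 'rV[R]_m -> R^o) x (delta_mx 0 a) ->
  partial a (fun y => - f y) x = - partial a f x.
Proof. by move=> df; rewrite /partial -deriveN. Qed.

Lemma partialB a f g x : derivable (f : 'rV[R]_m -> R^o) x (delta_mx 0 a) ->
  derivable (g : 'rV[R]_m -> R^o) x (delta_mx 0 a) ->
  partial a (fun y => f y - g y) x = partial a f x - partial a g x.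
Proof. by move=> df dg; rewrite /partial -deriveB. Qed.

Lemma partialM a f g x : derivable (f : 'rV[R]_m -> R^o) x (delta_mx 0 a) ->
  derivable (g : 'rV[R]_m -> R^o) x (delta_mx 0 a) ->
  partial a (fun y => f y * g y) x = f x * partial a g x + g x * partial a f x.
Proof. by move=> df dg; rewrite /partial -[_ * _ in RHS]/(_ *: _) -(deriveM df dg). Qed.

Lemma partial_cst a (c : R) x : partial a (fun _ => c) x = 0.
Proof. by rewrite /partial derive_cst. Qed.

Lemma partial_sum a (I : Type) (r : seq I) (P : pred I)
    (F : I -> 'rV[R]_m -> R) x :
  (forall i, derivable (F i : 'rV[R]_m -> R^o) x (delta_mx 0 a)) ->
  partial a (fun y => \sum_(i <- r | P i) F i y) x =
  \sum_(i <- r | P i) partial a (F i) x.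
Proof.
move=> D; have [_] := is_derive_sum_seq r P (fun i => is_derive_partial (D i)).
by [].
Qed.

Section OnOpen.
Variable V : set 'rV[R]_m.
Hypothesis Vo : open V.

Lemma C1_diff f x : Ck_on 1 V f -> V x -> differentiable (f : 'rV[R]_m -> R^o) x.
Proof. exact: C1_differentiable. Qed.

Lemma C1_cst c : Ck_on 1 V (fun _ : 'rV[R]_m => c).
Proof.
apply: C1_intro => [x _|a x _]; first exact: differentiable_cst.
rewrite (_ : partial a _ = cst 0); first exact: cst_continuous.
by apply/funext => y; rewrite partial_cst.
Qed.

Lemma C1D f g : Ck_on 1 V f -> Ck_on 1 V g -> Ck_on 1 V (fun y => f y + g y).
Proof.
move=> Cf Cg; apply: C1_intro => [x Vx|a x Vx].
  exact: (differentiableD (C1_diff Cf Vx) (C1_diff Cg Vx)).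
apply: (@near_eq_cont _ (fun y => partial a f y + partial a g y)).
  apply: (open_near Vo Vx) => y Vy.
  by rewrite (partialD (Ck_derivable Cf Vy) (Ck_derivable Cg Vy)).
by apply: (@continuousD R R^o); [exact: C1_contd Cf Vx|exact: C1_contd Cg Vx].
Qed.

Lemma C1M f g : Ck_on 1 V f -> Ck_on 1 V g -> Ck_on 1 V (fun y => f y * g y).
Proof.
move=> Cf Cg; apply: C1_intro => [x Vx|a x Vx].
  have := differentiableM (C1_diff Cf Vx) (C1_diff Cg Vx).
  by [].
apply: (@near_eq_cont _ (fun y => f y * partial a g y + g y * partial a f y)).
  apply: (open_near Vo Vx) => y Vy.
  by rewrite (partialM (Ck_derivable Cf Vy) (Ck_derivable Cg Vy)).
by apply: (@continuousD R R^o); apply: (@continuousM R);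
  [exact: C1_cont Cf Vx|exact: C1_contd Cg Vx|exact: C1_cont Cg Vx|exact: C1_contd Cf Vx].
Qed.

Lemma C1Z c f : Ck_on 1 V f -> Ck_on 1 V (fun y => c * f y).
Proof. by apply: C1M; exact: C1_cst. Qed.

Lemma C1N f : Ck_on 1 V f -> Ck_on 1 V (fun y => - f y).
Proof.
move=> /(C1Z (-1)); apply: Ck_on_eq => // x _; by rewrite mulN1r.
Qed.

Lemma C1B f g : Ck_on 1 V f -> Ck_on 1 V g -> Ck_on 1 V (fun y => f y - g y).
Proof. by move=> Cf /C1N; exact: C1D. Qed.

Lemma C1_sum (I : Type) (r : seq I) (P : pred I) (F : I -> 'rV[R]_m -> R) :
  (forall i, Ck_on 1 V (F i)) -> Ck_on 1 V (fun y => \sum_(i <- r | P i) F i y).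
Proof.
move=> CF; elim: r => [|i r IH].
  by apply: Ck_on_eq (C1_cst 0) => // x _; rewrite big_nil.
case: (boolP (P i)) => Pi; last first.
  by apply: Ck_on_eq IH => // x _; rewrite big_cons (negPf Pi).
by apply: Ck_on_eq (C1D (CF i) IH) => // x _; rewrite big_cons Pi.
Qed.

Lemma C1_prod (I : Type) (r : seq I) (P : pred I) (F : I -> 'rV[R]_m -> R) :
  (forall i, Ck_on 1 V (F i)) -> Ck_on 1 V (fun y => \prod_(i <- r | P i) F i y).
Proof.
move=> CF; elim: r => [|i r IH].
  by apply: Ck_on_eq (C1_cst 1) => // x _; rewrite big_nil.
case: (boolP (P i)) => Pi; last first.
  by apply: Ck_on_eq IH => // x _; rewrite big_cons (negPf Pi).
by apply: Ck_on_eq (C1M (CF i) IH) => // x _; rewrite big_cons Pi.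
Qed.

Lemma partial_comp1 a (t t' : R -> R) f x :
  differentiable (f : 'rV[R]_m -> R^o) x ->
  is_derive (f x) (1 : R) (t : R -> R^o) (t' (f x)) ->
  differentiable ((fun y => t (f y)) : 'rV[R]_m -> R^o) x /\
  partial a (fun y => t (f y)) x = t' (f x) * partial a f x.
Proof.
move=> df [/derivable1_diffP dt Dt].
have dtf : differentiable ((fun y => t (f y)) : 'rV[R]_m -> R^o) x.
  exact: (differentiable_comp df dt).
split => //; rewrite /partial !deriveE // (diff_comp df dt) /=.
rewrite -Dt deriveE // mulrC -[in RHS]linearZ /=; congr ('d _ _ _).
by rewrite [RHS]mulr1.
Qed.

Lemma C1_comp1 (t t' : R -> R) f : Ck_on 1 V f ->
  (forall x, V x -> is_derive (f x) (1 : R) (t : R -> R^o) (t' (f x))) ->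
  (forall x, V x -> {for f x, continuous t'}) ->
  Ck_on 1 V (fun y => t (f y)).
Proof.
move=> Cf Dt Ct; apply: C1_intro => [x Vx|a x Vx].
  have e : 'I_m -> differentiable ((fun y => t (f y)) : 'rV[R]_m -> R^o) x.
    by move=> a; exact: (partial_comp1 a (C1_diff Cf Vx) (Dt x Vx)).1.
  have [/derivable1_diffP dt _] := Dt x Vx.
  exact: (differentiable_comp (C1_diff Cf Vx) dt).
apply: (@near_eq_cont _ (fun y => t' (f y) * partial a f y)).
  apply: (open_near Vo Vx) => y Vy.
  by have [_ ->] := partial_comp1 a (C1_diff Cf Vy) (Dt y Vy).
apply: (@continuousM R); last exact: C1_contd Vx.
by apply: (@continuous_comp _ _ _ f t'); [exact: C1_cont Vx|exact: Ct].
Qed.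

Lemma C1V f : Ck_on 1 V f -> (forall x, V x -> f x != 0) ->
  Ck_on 1 V (fun y => (f y)^-1).
Proof.
move=> Cf f0; apply: (@C1_comp1 (fun y => y^-1) (fun y => - y ^- 2)) => // x /f0 fx.
  have D := @is_deriveV R id (f x) 1 1 fx (is_derive_id _ _).
  by move: D; rewrite [_ *: 1]mulr1.
apply: (@continuousN R R^o); apply: (@continuousV R).
  by rewrite expf_neq0.
exact: exprn_continuous.
Qed.

Lemma C1_sqrt f : Ck_on 1 V f -> (forall x, V x -> 0 < f x) ->
  Ck_on 1 V (fun y => Num.sqrt (f y)).
Proof.
move=> Cf f0; apply: (@C1_comp1 Num.sqrt (fun y => (2 * Num.sqrt y)^-1)) => //.
  by move=> x /f0; exact: is_derive1_sqrt.
move=> x /f0 fx; apply: (@continuousV R).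
  by rewrite mulf_neq0 ?pnatr_eq0 // gt_eqF // sqrtr_gt0.
apply: (@continuousM R); first exact: cst_continuous.
exact: sqrt_continuous.
Qed.

Lemma C1_det k (W : 'rV[R]_m -> 'M[R]_k) :
  (forall i j, Ck_on 1 V (fun y => W y i j)) -> Ck_on 1 V (fun y => \det (W y)).
Proof.
move=> CW; apply: C1_sum => s; apply: C1Z; apply: C1_prod => i; exact: CW.
Qed.

Lemma C1_invmx k (W : 'rV[R]_m -> 'M[R]_k) i j :
  (forall i j, Ck_on 1 V (fun y => W y i j)) ->
  (forall x, V x -> W x \in unitmx) -> Ck_on 1 V (fun y => invmx (W y) i j).
Proof.
move=> CW Wu.
have := @C1M (fun y => (\det (W y))^-1) (fun y => cofactor (W y) j i).
move=> /(_ _ _)/Ck_on_eq; apply => //.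
- move=> x Vx; rewrite /invmx Wu // !mxE //.
- apply: C1V; first exact: C1_det.
  by move=> x /Wu; rewrite unitmxE unitfE.
apply: C1Z; apply: C1_det => a b.
by apply: Ck_on_eq (CW (lift j a) (lift i b)) => // x _; rewrite !mxE.
Qed.

End OnOpen.

Lemma second_difference (V : set 'rV[R]_m) h x (a b : 'I_m) (s : R) :
  Ck_on 2 V h -> 0 <= s -> (forall y, `|y - x| <= 2 * s -> V y) ->
  exists2 p, `|p - x| <= 2 * s &
    h (x + s *: delta_mx 0 a + s *: delta_mx 0 b) - h (x + s *: delta_mx 0 a)
    - h (x + s *: delta_mx 0 b) + h x = s * (s * partial b (partial a h) p).
Proof.
move=> Ch s0 sV; have sn : `|s| = s by rewrite ger0_norm.
pose ea : 'rV[R]_m := delta_mx 0 a; pose eb : 'rV[R]_m := delta_mx 0 b.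
have nd (c : 'I_m) (t : R) : `|t| <= s -> `|t *: delta_mx 0 c : 'rV[R]_m| <= s.
  move=> ts; rewrite normrZ (le_trans _ ts) // ler_piMr //.
  by apply: mxnorm_le => // d; rewrite mxE; case: (_ && _); rewrite ?normr1 ?normr0.
have nab (t u : R) : `|t| <= s -> `|u| <= s -> `|x + t *: ea + u *: eb - x| <= 2 * s.
  move=> ts us; rewrite (_ : _ - x = t *: ea + u *: eb); last first.
    by apply/rowP => i; rewrite !mxE; ring.
  rewrite mulr2n mulrDl mul1r.
  by apply: (le_trans (ler_normD _ _)); rewrite lerD //; exact: nd.
have n0 : `|0 : R| <= s by rewrite normr0.
have der c t u : `|t| <= s -> `|u| <= s ->
    derivable (h : 'rV[R]_m -> R^o) (x + t *: ea + u *: eb) (delta_mx 0 c).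
  by move=> ts us; apply: (Ck_derivable Ch); apply/sV/nab.
have [|t] := @MVT_signless R
    (fun t => h (x + s *: eb + t *: ea) - h (x + t *: ea))
    (fun t => partial a h (x + s *: eb + t *: ea) - partial a h (x + t *: ea)) s.
  move=> t; rewrite sn => ts; apply: is_deriveB; apply: is_derive_line.
    by rewrite addrAC; apply: der; rewrite ?sn.
  by have := der a t 0 ts n0; rewrite scale0r addr0.
rewrite sn => ts et.
have [|u] := @MVT_signless R (fun u => partial a h (x + t *: ea + u *: eb))
    (fun u => partial b (partial a h) (x + t *: ea + u *: eb)) s.
  move=> u; rewrite sn => us; apply: is_derive_line.
  by apply: (Ck_derivable (Ck_partial a Ch)); apply/sV/nab.
rewrite sn => us eu; exists (x + t *: ea + u *: eb); first exact: nab.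
move: et eu; rewrite !scale0r !addr0 => et eu.
rewrite -eu [x + t *: ea + _]addrAC -et -/ea -/eb [x + s *: eb + _]addrAC; ring.
Qed.

(** Both mixed derivatives are limits of the same second difference, which by two mean values equals
    either of them at a nearby point. *)
Lemma partial_sym (V : set 'rV[R]_m) h x (a b : 'I_m) : open V ->
  Ck_on 2 V h -> V x -> partial a (partial b h) x = partial b (partial a h) x.
Proof.
move=> Vo Ch Vx; apply/eqP; rewrite -subr_eq0 -normr_le0; apply/ler_addgt0Pl => e e0.
rewrite addr0.
have e2 : 0 < e / 2 by rewrite divr_gt0.
have C c d : \forall y \near x, `|partial c (partial d h) x - partial c (partial d h) y| <= e / 2.
  have := C1_contd (a:=c) (Ck_partial d Ch) Vx.
  by move=> /cvgrPdist_le/(_ _ e2).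
have : \forall y \near x, V y /\
    `|partial a (partial b h) x - partial a (partial b h) y| <= e / 2 /\
    `|partial b (partial a h) x - partial b (partial a h) y| <= e / 2.
  exact: (filterI (open_nbhs_nbhs (conj Vo Vx)) (filterI (C a b) (C b a))).
move=> /nbhs_ballP[r /= r0 rV].
pose s := r / 4.
have s0 : 0 < s by rewrite divr_gt0.
have sB (y : 'rV[R]_m) : `|y - x| <= 2 * s -> ball x r y.
  rewrite -ball_normE /= distrC => /le_lt_trans; apply.
  by rewrite /s; lra.
have sV (y : 'rV[R]_m) : `|y - x| <= 2 * s -> V y by move=> /sB/rV[].
have [p /sB/rV[_ [_ pB]] ep] := second_difference a b Ch (ltW s0) sV.
have [q /sB/rV[_ [qB _]] eq] := second_difference b a Ch (ltW s0) sV.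
have pq : partial b (partial a h) p = partial a (partial b h) q.
  apply: (mulfI (lt0r_neq0 s0)); apply: (mulfI (lt0r_neq0 s0)).
  apply: (etrans (esym ep)); apply: (etrans _ eq).
  have -> : x + s *: delta_mx 0 b + s *: delta_mx 0 a =
      x + s *: delta_mx 0 a + s *: delta_mx 0 b by exact: addrAC.
  by rewrite [X in X + _]addrAC.
move: pB qB; rewrite {}pq => pB qB; move: pB qB.
move: (partial b _ x) (partial a (partial b h) x) (partial a _ q) => B A Q pB qB.
have -> : A - B = (A - Q) - (B - Q) by ring.
apply: (le_trans (ler_normB _ _)); rewrite [leRHS]splitr; exact: lerD.
Qed.

End CkCalculus.

(** * Divergence of closed forms *)

Section MatrixCalculus.
Variables (R : realType) (m : nat).
Implicit Types (x v : 'rV[R]_m).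

Lemma is_derive_prod_seq (E : normedModType R) (I : eqType) (r : seq I) (F : I -> E -> R)
    (dF : I -> R) (x v : E) : uniq r ->
  (forall i, is_derive x v (F i : E -> R^o) (dF i)) ->
  is_derive x v ((fun y => \prod_(i <- r) F i y) : E -> R^o)
    (\sum_(i <- r) dF i * \prod_(j <- r | j != i) F j x).
Proof.
move=> + D; elim: r => [_|i r IH /= /andP[ir ur]].
  rewrite big_nil (_ : (fun _ => _) = cst 1); first exact: is_derive_cst.
  by apply/funext => y; rewrite big_nil.
have := @is_deriveM _ _ _ _ x v _ _ (D i) (IH ur).
rewrite (_ : F i * (fun y => _) = (fun y => \prod_(j <- (i :: r)) F j y)); last first.
  by apply/funext => y; rewrite big_cons.
congr is_derive; rewrite big_cons addrC; congr (_ + _).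
  rewrite mulrC big_cons eqxx /=; congr (_ * _).
  rewrite big_seq [RHS]big_seq_cond; apply: eq_bigl => j.
  by case: (boolP (j \in r)) => //= jr; apply/esym; apply: contraNneq ir => <-.
rewrite [LHS]mulr_sumr; apply: eq_big_seq => j jr.
rewrite big_cons; case: eqVneq => [ij|_]; first by rewrite ij jr in ir.
by rewrite mulrCA.
Qed.

(** Jacobi's formula: the product rule on the Leibniz expansion, regrouped by the differentiated
    entry, produces the cofactors. *)
Lemma is_derive_det (E : normedModType R) k (W : E -> 'M[R]_k) (dW : 'M[R]_k) (x v : E) :
  (forall i j, is_derive x v ((fun y => W y i j) : E -> R^o) (dW i j)) ->
  is_derive x v ((fun y => \det (W y)) : E -> R^o)
    (\tr (dW *m \adj (W x))).
Proof.
move=> D.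
have Ds (s : 'S_k) : is_derive x v
    ((fun y => (-1) ^+ s * \prod_i W y i (s i)) : E -> R^o)
    ((-1) ^+ s * \sum_i dW i (s i) * \prod_(j | j != i) W x j (s j)).
  apply: (@is_deriveZ _ _ _ (fun y => \prod_i W y i (s i) : R^o)).
  exact: (is_derive_prod_seq (index_enum_uniq _) (fun i => D i (s i))).
have := is_derive_sum_seq (index_enum _) xpredT Ds.
congr is_derive; rewrite /mxtrace.
under eq_bigr do rewrite mulr_sumr.
rewrite exchange_big /=; apply: eq_bigr => i _.
rewrite mxE (partition_big (fun s : 'S_k => s i) xpredT) //=.
apply: eq_bigr => j _; rewrite mxE expand_cofactor mulr_sumr.
apply: eq_bigr => s /eqP si; rewrite si mulrCA; congr (_ * (_ * _)).
by apply: eq_bigl => l; rewrite eq_sym.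
Qed.

Lemma partial_invmx (V : set 'rV[R]_m) k (W : 'rV[R]_m -> 'M[R]_k) x a :
  open V -> V x ->
  (forall i j, Ck_on 1 V (fun y => W y i j)) ->
  (forall x, V x -> W x \in unitmx) ->
  (\matrix_(i, j) partial a (fun y => invmx (W y) i j) x) =
  - (invmx (W x) *m (\matrix_(i, j) partial a (fun y => W y i j) x) *m invmx (W x)).
Proof.
move=> Vo Vx CW Wu; set D := LHS; set dW := (X in _ *m X *m _).
have CI i j : Ck_on 1 V (fun y => invmx (W y) i j) by exact: C1_invmx.
have key : W x *m D + dW *m invmx (W x) = 0.
  apply/matrixP => i j; rewrite !mxE -big_split /=.
  have e : partial a (fun y => \sum_l W y i l * invmx (W y) l j) x =
      \sum_l (W x i l * D l j + dW i l * invmx (W x) l j).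
    rewrite partial_sum => [|l]; last exact: (Ck_derivable (C1M Vo (CW i l) (CI l j))).
    apply: eq_bigr => l _.
    rewrite (partialM (Ck_derivable (CW i l) Vx) (Ck_derivable (CI l j) Vx)) !mxE.
    by rewrite [X in _ + X]mulrC.
  rewrite -e (@near_partial _ _ _ _ (fun _ => (i == j)%:R)) ?partial_cst //.
  apply: (open_near Vo Vx) => y Vy.
  have := congr1 (fun A : 'M[R]_k => A i j) (mulmxV (Wu y Vy)).
  by rewrite !mxE.
have /(congr1 (mulmx (invmx (W x)))) := key.
rewrite mulmx0 mulmxDr mulmxA mulVmx ?Wu // mul1mx mulmxA => /eqP.
by rewrite addr_eq0 => /eqP.
Qed.

(* The Hamiltonian vector fields of a symplectic form preserve its volume.    *)
Lemma closed_contraction k (T : 'I_k -> 'M[R]_k) (U : 'M[R]_k) (c : 'I_k) :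
  U^T = - U -> (forall a b d, T a b d + T b d a + T d a b = 0) ->
  (forall a, (T a)^T = - T a) ->
  \sum_a (U *m T a *m U) a c = 2^-1 * \sum_a \tr (T a *m U) * U a c.
Proof.
move=> UT Tc Ta.
have Us a b : U a b = - U b a.
  by have := congr1 (fun A : 'M[R]_k => A b a) UT; rewrite !mxE.
have Ts a b d : T a b d = - T a d b.
  by have := congr1 (fun A : 'M[R]_k => A d b) (Ta a); rewrite !mxE.
pose S q := \sum_a \sum_p U a p * T a p q.
(* By antisymmetry of [U] and of each [T a], two of the three terms of the cyclic identity contract
   with [U] to [S q]; the third is the trace. *)
have SE q : S q = - 2^-1 * \sum_a \sum_p U a p * T q a p.
  have S2 : S q = \sum_a \sum_p U a p * T p q a.
    rewrite /S exchange_big /=; apply: eq_bigr => a _; apply: eq_bigr => p _.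
    by rewrite Us Ts mulrNN.
  have : S q + S q = - \sum_a \sum_p U a p * T q a p.
    rewrite {1}/S S2 -big_split -sumrN /=; apply: eq_bigr => a _.
    rewrite -big_split -sumrN /=; apply: eq_bigr => p _.
    rewrite -mulrDr -mulrN; congr (_ * _).
    by apply/eqP; rewrite -subr_eq0 opprK Tc.
  lra.
transitivity (\sum_q S q * U q c).
  rewrite /S; under eq_bigr do rewrite mxE.
  rewrite exchange_big /=; apply: eq_bigr => q _; rewrite mulr_suml.
  by apply: eq_bigr => a _; rewrite mxE.
rewrite mulr_sumr; apply: eq_bigr => q _; rewrite SE mulrA; congr (_ * _).
rewrite mulNr -mulrN; congr (_ * _); rewrite /mxtrace exchange_big /= -sumrN.
apply: eq_bigr => p _; rewrite mxE -sumrN; apply: eq_bigr => a _.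
by rewrite (Ts q a p) mulrN opprK mulrC.
Qed.

(** Column [c] of [W^-1] is, up to sign, the Hamiltonian field of the coordinate [c]. The derivative
    of the density contributes half a trace, which [closed_contraction] cancels against the
    derivative of the inverse. *)
Lemma symplectic_divergence (V : set 'rV[R]_m) (W : 'rV[R]_m -> 'M[R]_m) x c :
  open V -> V x -> (forall i j, Ck_on 1 V (fun y => W y i j)) ->
  (forall y, V y -> 0 < \det (W y)) -> (forall y, V y -> (W y)^T = - W y) ->
  closed_form W V ->
  \sum_a partial a (fun y => Num.sqrt (\det (W y)) * invmx (W y) a c) x = 0.
Proof.
move=> Vo Vx CW Wd WT Wc.
have Wu y : V y -> W y \in unitmx by move=> /Wd d; rewrite unitmxE unitfE gt_eqF.
pose dW a : 'M[R]_m := \matrix_(i, j) partial a (fun y => W y i j) x.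
set U := invmx (W x).
have UT : U^T = - U.
  rewrite /U trmx_inv; have Wux := Wu x Vx.
  apply: (row_free_inj (A := (W x)^T)); rewrite ?row_free_unit ?unitmx_tr //.
  by rewrite mulVmx ?unitmx_tr // WT // mulNmx mulmxN opprK mulVmx.
have Cdet := C1_det Vo CW; have Cs := C1_sqrt Vo Cdet Wd.
pose p := Num.sqrt (\det (W x)).
have p0 : 0 < p by rewrite sqrtr_gt0 Wd.
have dp a : partial a (fun y => Num.sqrt (\det (W y))) x = p * (2^-1 * \tr (dW a *m U)).
  have dI : is_derive (\det (W x)) (1 : R) (Num.sqrt : R -> R^o) (2 * Num.sqrt (\det (W x)))^-1.
    by apply: is_derive1_sqrt; exact: Wd.
  have [_ ->] := @partial_comp1 R m a (@Num.sqrt R) (fun y => (2 * Num.sqrt y)^-1)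
    (fun y => \det (W y)) x (C1_diff Vo Cdet Vx) dI.
  have Dd := @is_derive_det _ _ W (dW a) x (delta_mx 0 a) _.
  have {}Dd : partial a (fun y => \det (W y)) x = \tr (dW a *m \adj (W x)).
    have [|_ ] // := Dd => i j; rewrite mxE.
    exact: (is_derive_partial (Ck_derivable (CW i j) Vx)).
  rewrite Dd -/p; have -> : \adj (W x) = \det (W x) *: U.
    by rewrite /U /invmx Wu // scalerA mulfV ?scale1r // gt_eqF ?Wd.
  have -> : \det (W x) = p ^+ 2 by rewrite sqr_sqrtr // ltW // Wd.
  rewrite -scalemxAr mxtraceZ invfM expr2 !mulrA; congr (_ * _).
  by rewrite divfK ?gt_eqF // mulrC.
have dU a b : partial a (fun y => invmx (W y) b c) x = - (U *m dW a *m U) b c.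
  have := congr1 (fun A : 'M[R]_m => A b c) (partial_invmx a Vo Vx CW Wu).
  by rewrite mxE [in RHS]mxE.
transitivity (p * \sum_a (2^-1 * (\tr (dW a *m U) * U a c) - (U *m dW a *m U) a c)).
  rewrite mulr_sumr; apply: eq_bigr => a _.
  have CI : Ck_on 1 V (fun y => invmx (W y) a c) by exact: C1_invmx.
  by rewrite (partialM (Ck_derivable Cs Vx) (Ck_derivable CI Vx)) dU dp -/U -/p; ring.
rewrite sumrB -mulr_sumr closed_contraction ?subrr ?mulr0 //.
  by move=> a b d; rewrite !mxE; exact: Wc.
move=> a; apply/matrixP => i j; rewrite !mxE.
rewrite -(partialN (Ck_derivable (CW i j) Vx)).
apply: near_partial; apply: (open_near Vo Vx) => y Vy.
by have := congr1 (fun A : 'M[R]_m => A i j) (WT y Vy); rewrite !mxE.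
Qed.

End MatrixCalculus.

(** * The iterated Lebesgue integral *)

Section LineIntegral.
Variable R : realType.
Implicit Types (l : R -> R) (r M c t : R).

Definition int1 l : R :=
  Rintegral (@lebesgue_measure R) setT l.

Lemma int_itv l a b : (forall t, t \notin `[a, b] -> l t = 0) ->
  (\int[@lebesgue_measure R]_(t in setT) (l t)%:E =
   \int[@lebesgue_measure R]_(t in `[a, b]) (l t)%:E)%E.
Proof.
move=> l0; rewrite [RHS]integral_mkcond; congr integral; apply/funext => t.
rewrite patchE; case: ifPn => // tn; rewrite l0 //.
by apply: contra tn => tn; rewrite inE.
Qed.

Definition supp1 (r : R) l := forall t, r <= `|t| -> l t = 0.

Lemma supp1_itv r l : supp1 r l -> forall t, t \notin `[-r, r] -> l t = 0.
Proof.
move=> l0 t; rewrite in_itv /= -ler_norml => /negP/negP; rewrite -ltNge => /ltW.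
exact: l0.
Qed.

Lemma int1_integrable r l : continuous l -> supp1 r l ->
  (@lebesgue_measure R).-integrable setT (EFin \o l).
Proof.
move=> cl l0.
have /integrable_mkcond : (@lebesgue_measure R).-integrable `[-r, r] (EFin \o l).
  apply: continuous_compact_integrable; first exact: segment_compact.
  exact: continuous_subspaceT.
move=> /(_ (measurable_itv _)); congr integrable; apply/funext => t.
rewrite patchE; case: ifPn => // tn /=; rewrite (supp1_itv l0) //.
by apply: contra tn => tn; rewrite inE.
Qed.

Lemma int1_fin r l : continuous l -> supp1 r l ->
  (\int[@lebesgue_measure R]_(t in setT) (l t)%:E = (int1 l)%:E)%E.
Proof.
move=> cl l0; rewrite /int1 /Rintegral fineK //.
by have := integrable_fin_num measurableT (int1_integrable cl l0).
Qed.

Lemma int1D r l k : continuous l -> supp1 r l -> continuous k -> supp1 r k ->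
  int1 (fun t => l t + k t) = int1 l + int1 k.
Proof.
move=> cl l0 ck k0; rewrite /int1 RintegralD //.
  exact: int1_integrable l0.
exact: int1_integrable k0.
Qed.

Lemma int1Z r l c : continuous l -> supp1 r l ->
  int1 (fun t => c * l t) = c * int1 l.
Proof.
by move=> cl l0; rewrite /int1 RintegralZl //; exact: int1_integrable l0.
Qed.

Lemma int1_ge0 l : (forall t, 0 <= l t) -> 0 <= int1 l.
Proof. by move=> l0; apply: Rintegral_ge0 => t _. Qed.

Lemma int1_bound r l M : 0 <= r -> continuous l -> supp1 r l ->
  (forall t, `|l t| <= M) -> `|int1 l| <= M * (2 * r).
Proof.
move=> r0 cl l0 lM.
have -> : int1 l = (\int[@lebesgue_measure R]_(t in `[-r, r]) l t)%R.
  by rewrite /int1 /Rintegral (int_itv (supp1_itv l0)).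
have I (k : R -> R) : continuous k -> (@lebesgue_measure R).-integrable `[-r, r] (EFin \o k).
  move=> ck; apply: continuous_compact_integrable; first exact: segment_compact.
  exact: continuous_subspaceT.
apply: le_trans (le_normr_Rintegral _ (I _ cl)) _; first exact: measurable_itv.
have lm : fine ((@lebesgue_measure R) `[-r, r]%classic) = 2 * r.
  rewrite lebesgue_measure_itv /= lte_fin; case: ltP => [_|rr] /=.
    by rewrite opprK mulr2n mulrDl mul1r.
  by apply: le_anti; apply/andP; split; lra.
rewrite -lm -Rintegral_cst //; apply: le_Rintegral => //.
- apply: (I (fun t => `|l t|)) => t.
  by apply: (@continuous_comp _ _ _ l (fun x => `|x|)); [exact: cl|exact: norm_continuous].
- by apply: (I (fun=> M)) => t; exact: cst_continuous.
Qed.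

Lemma int1_shift r l c : continuous l -> supp1 r l ->
  int1 (fun t => l (t + c)) = int1 l.
Proof.
move=> cl l0; rewrite /int1 /Rintegral; congr fine.
(* With this half-length one interval contains the support of the translate and the shifted interval
   that of [l], for any signs of [r] and [c]. *)
pose r' : R := `|r| + `|c|.
have r'0 : - r' <= r' by rewrite ge0_cp // addr_ge0.
rewrite (@int_itv (fun t => l (t + c)) (-r') r'); last first.
  move=> t; rewrite in_itv /= negb_and -!ltNge => rt; apply: l0.
  have := (ler_norm c, ler_norm (- c), ler_norm r, ler_norm (t + c), ler_norm (- (t + c))).
  by rewrite !normrN => -[[[[? ?] ?] ?] ?]; case/orP: rt; rewrite /r'; lra.
rewrite (@int_itv l (- r' + c) (r' + c)); last first.
  move=> t; rewrite in_itv /= negb_and -!ltNge => rt; apply: l0.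
  have := (ler_norm c, ler_norm (- c), ler_norm r, ler_norm (t), ler_norm (- (t))).
  by rewrite !normrN => -[[[[? ?] ?] ?] ?]; case/orP: rt; rewrite /r'; lra.
pose F := fun t : R => t + c.
have F' : (F^`())%classic = cst 1.
  apply/funext => t; rewrite derive1E /F.
  by rewrite deriveD ?derive_id ?derive_cst ?addr0.
have := @integration_by_substitution_increasing R F l (- r') r' r'0.
rewrite /F => -> //.
- by apply: eq_integral => t _; rewrite F' /= mulr1.
- by move=> x y _ _; rewrite ltrD2r.
- by rewrite F' => x _; exact: cst_continuous.
- by rewrite F'; exact: is_cvg_cst.
- by rewrite F'; exact: is_cvg_cst.
- have cF : continuous F.
    by move=> x; apply: continuousD => //; exact: cst_continuous.
  split => /=.
  + by move=> x _; apply: derivableD.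
  + exact/cvg_at_right_filter/cF.
  + exact/cvg_at_left_filter/cF.
- exact: continuous_subspaceT.
Qed.

Lemma int1_gt0 r l t0 : continuous l -> supp1 r l -> (forall t, 0 <= l t) ->
  0 < l t0 -> 0 < int1 l.
Proof.
move=> cl l0 lp lt0.
have lt02 : 0 < l t0 / 2 by rewrite divr_gt0.
have /cvgrPdist_le/(_ _ lt02)/nbhs_ballP[d /= d0 dl] : {for t0, continuous l}.
  exact: cl.
pose e : R := d / 2; have e0 : 0 < e by rewrite divr_gt0.
rewrite -lte_fin -(int1_fin cl l0); pose a := t0 - e; pose b := t0 + e.
apply: (@lt_le_trans _ _ (\int[@lebesgue_measure R]_(t in `[a, b]) (l t0 / 2)%:E)%E).
  rewrite integral_cst //= lebesgue_measure_itv /= /a /b lte_fin ltrD2l gtrN //.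
  by rewrite -EFinB -EFinM lte_fin mulr_gt0 ?divr_gt0 //; rewrite /e; lra.
have /integrableP[ml _] := int1_integrable cl l0.
apply: (@le_trans _ _ (\int[@lebesgue_measure R]_(t in `[a, b]) (l t)%:E)%E).
  apply: ge0_le_integral => //.
  - by move=> t _; rewrite lee_fin divr_ge0 // ltW.
  - exact: (measurable_funS measurableT (fun _ _ => I) ml).
  move=> t; rewrite /= in_itv /= => /andP[t1 t2]; rewrite lee_fin.
  have /dl : ball t0 d t.
    rewrite -ball_normE /= ltr_norml; move: t1 t2; rewrite /a /b /e => t1 t2.
    by apply/andP; split; lra.
  by rewrite /= ler_norml => /andP[_]; lra.
apply: ge0_subset_integral => //.
by move=> t _; rewrite lee_fin.
Qed.

End LineIntegral.

(** * Iterated integrals of compactly supported continuous functions *)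

Section CompactSupportIntegral.
Variable R : realType.
Implicit Types (r c t e M C : R).

Lemma cont_cst (T : topologicalType) (a : R) : continuous (fun _ : T => a).
Proof. by move=> x; exact: cvg_cst. Qed.

(** The shape in which [lebesgue_int] splits off its first variable. *)
Definition rowc m (t : R) (v : 'rV[R]_m) : 'rV[R]_m.+1 :=
  row_mx (t%:M : 'rV[R]_1) v : 'rV[R]_(1 + m).

Lemma rowc0 m t (v : 'rV[R]_m) : rowc t v 0 0 = t.
Proof.
transitivity ((t%:M : 'rV[R]_1) 0 0); last by rewrite mxE.
rewrite -(row_mxEl (t%:M : 'rV[R]_1) v 0 0).
by congr (row_mx _ _ _ _); exact: val_inj.
Qed.

Lemma rowcS m t (v : 'rV[R]_m) a : rowc t v 0 (lift 0 a) = v 0 a.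
Proof.
rewrite -(row_mxEr (t%:M : 'rV[R]_1) v 0 a).
by congr (row_mx _ _ _ _); exact: val_inj.
Qed.

Lemma rowcK m (x : 'rV[R]_m.+1) : x = rowc (x 0 0) (\row_a x 0 (lift 0 a)).
Proof.
apply/rowP => i; case: (unliftP 0 i) => [a|] ->; first by rewrite rowcS mxE.
by rewrite rowc0.
Qed.

Lemma rowcD m t s (v u : 'rV[R]_m) : rowc t v + rowc s u = rowc (t + s) (v + u).
Proof.
apply/rowP => i; rewrite mxE; case: (unliftP 0 i) => [a|] ->.
  by rewrite !rowcS mxE.
by rewrite !rowc0.
Qed.

Lemma norm_rowc_l m t (v : 'rV[R]_m) : `|t| <= `|rowc t v|.
Proof. by rewrite -{1}(rowc0 t v) coord_le. Qed.

Lemma norm_rowc_r m t (v : 'rV[R]_m) : `|v| <= `|rowc t v|.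
Proof. by apply: mxnorm_le => // a; rewrite -(rowcS t v) coord_le. Qed.

Lemma norm_rowc m t (v : 'rV[R]_m) e : `|t| <= e -> `|v| <= e -> `|rowc t v| <= e.
Proof.
move=> te ve; apply: mxnorm_le => [|i]; first exact: le_trans te.
case: (unliftP 0 i) => [a|] ->; last by rewrite rowc0.
by rewrite rowcS (le_trans (coord_le _ _)).
Qed.

Definition supp m (r : R) (F : 'rV[R]_m -> R) := forall x, r <= `|x| -> F x = 0.

(** On this class every partial integral is again continuous with compact support, so the iterated
    integral is finite, linear and monotone. *)
Definition Cc m (F : 'rV[R]_m -> R) := continuous F /\ exists r, supp r F.

Lemma supp_le m r s (F : 'rV[R]_m -> R) : r <= s -> supp r F -> supp s F.
Proof. by move=> rs F0 x sx; apply: F0; exact: le_trans sx. Qed.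

Lemma ball_compact m (r : R) : compact [set x : 'rV[R]_m | `|x| <= r].
Proof.
apply: bounded_closed_compact.
  by exists r; split => [|s rs x /= /le_trans]; [exact: num_real|apply; exact: ltW].
apply: (@closed_comp _ _ (fun x : 'rV[R]_m => `|x|) [set y | y <= r]).
  by move=> x _; exact: norm_continuous.
exact: closed_le.
Qed.

(** Compactness turns joint continuity at the points [(s0, x)] into an estimate uniform in [x], in
    the manner of the tube lemma. *)
Lemma param_unif (T : topologicalType) (S : pseudoMetricType R) (K : set T)
    (F : S -> T -> R) (s0 : S) :
  compact K -> (forall x, K x -> {for (s0, x), continuous (fun p => F p.1 p.2)}) ->
  forall e, 0 < e -> \forall s \near s0, forall x, K x -> `|F s0 x - F s x| <= e.
Proof.
move=> /compact_near_coveringP cK cF e e0.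
have e2 : 0 < e / 2 by rewrite divr_gt0.
have := cK S (nbhs s0) (fun (s : S) x => `|F s0 x - F s x| <= e) _; apply => x Kx.
have /cvgrPdist_le/(_ _ e2) := cF x Kx.
move=> [[A B] /= [As Bx] AB]; exists (B, A) => //= -[y s] [/= By As'].
have h1 := AB (s0, y) (conj (nbhs_singleton As) By).
have h2 := AB (s, y) (conj As' By).
rewrite /= in h1 h2.
rewrite (_ : F s0 y - F s y = (F s0 x - F s y) - (F s0 x - F s0 y)); last by ring.
by apply: (le_trans (ler_normB _ _)); rewrite [leRHS]splitr lerD.
Qed.

Lemma unif_cont m r (F : 'rV[R]_m -> R) : continuous F -> supp r F ->
  forall e : R, 0 < e -> exists2 d : R, 0 < d &
    forall x y, `|x - y| < d -> `|F x - F y| <= e.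
Proof.
move=> cF F0 e e0.
have /nbhs_ballP[d /= d0 dF] : \forall s \near (0 : 'rV[R]_m),
    forall x, [set x : 'rV[R]_m | `|x| <= r + 1] x -> `|F (x + 0) - F (x + s)| <= e.
  have := @param_unif 'rV[R]_m 'rV[R]_m _ (fun s x => F (x + s)) 0 (@ball_compact m (r + 1)).
  move=> /(_ _ _ e0); apply => x _.
  apply: (@continuous_comp _ _ _ (fun p : 'rV[R]_m * 'rV[R]_m => p.2 + p.1) F).
    by apply: (@continuousD R 'rV[R]_m); [exact: cvg_snd|exact: cvg_fst].
  exact: cF.
(* At distance below 1, either [x] lies in the ball of radius [r + 1] or both points lie outside the
   support. *)
exists (Num.min d 1); first by rewrite lt_min d0 ltr01.
move=> x y; rewrite lt_min => /andP[xyd xy1].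
have [xr|xr] := leP `|x| (r + 1).
  have := dF (y - x) _ x xr; rewrite addr0 [x + _]addrC subrK; apply.
  by rewrite -ball_normE /= sub0r normrN distrC.
have yr : r <= `|y|.
  by have := ler_normD (x - y) y; rewrite subrK; lra.
by rewrite !F0 //; [rewrite subrr normr0 ltW|lra].
Qed.

Definition Lint m (F : 'rV[R]_m -> R) : R := fine (lebesgue_int (fun x => (F x)%:E)).

Definition slice m (F : 'rV[R]_m.+1 -> R) (t : R) (v : 'rV[R]_m) : R := F (rowc t v).

Lemma rowc_continuous m t : continuous (@rowc m t).
Proof.
move=> v; apply: cont_row => b; case: (unliftP 0 b) => [a|] ->.
  rewrite (_ : (fun _ => _) = fun u : 'rV[R]_m => u 0 a).
    exact: coord_continuous.
  by apply/funext => q; rewrite rowcS.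
rewrite (_ : (fun _ => _) = cst t); first exact: cont_cst.
by apply/funext => q; rewrite rowc0.
Qed.

Lemma slice_cont m (F : 'rV[R]_m.+1 -> R) t : continuous F -> continuous (slice F t).
Proof.
move=> cF v; apply: (@continuous_comp _ _ _ (rowc t) F); last exact: cF.
exact: rowc_continuous.
Qed.

Lemma slice_supp m r (F : 'rV[R]_m.+1 -> R) t : supp r F -> supp r (slice F t).
Proof. by move=> F0 v rv; apply: F0; apply: le_trans rv (norm_rowc_r _ _). Qed.

(** The five properties are proved in one induction on the dimension: continuity of the partial
    integral [ell F] uses linearity and the uniform bound one dimension below, and the
    one-dimensional integral then applies to [ell F]. *)
Lemma Lint_package m :
  [/\ forall r (F : 'rV[R]_m -> R), continuous F -> supp r F ->
        lebesgue_int (fun x => (F x)%:E) = (Lint F)%:E,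
      forall r (F G : 'rV[R]_m -> R), continuous F -> supp r F ->
        continuous G -> supp r G -> Lint (fun x => F x + G x) = Lint F + Lint G,
      forall r c (F : 'rV[R]_m -> R), continuous F -> supp r F ->
        Lint (fun x => c * F x) = c * Lint F,
      forall r (F : 'rV[R]_m -> R), continuous F -> supp r F ->
        (forall x, 0 <= F x) -> 0 <= Lint F &
      forall r, exists2 C : R, 0 <= C & forall (F : 'rV[R]_m -> R) M,
        continuous F -> supp r F -> (forall x, `|F x| <= M) -> `|Lint F| <= C * M].
Proof.
elim: m => [|m [Lfin LD LZ Lge0 Lb]].
  split=> //; first by move=> r F _ _ Fp; exact: Fp.
  by move=> r; exists 1 => // F M _ _ FM; rewrite mul1r; exact: FM.
have L0 : Lint (fun _ : 'rV[R]_m => 0) = 0.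
  have [C _ hC] := Lb 0; apply/eqP; rewrite -normr_le0.
  have := hC (fun _ => 0) 0 (@cont_cst _ 0) (fun x _ => erefl).
  by rewrite mulr0; apply => x; rewrite normr0.
pose ell (F : 'rV[R]_m.+1 -> R) t := Lint (slice F t).
have ell0 r F : supp r F -> supp1 r (ell F).
  move=> F0 t rt; rewrite /ell -L0; congr Lint; apply/funext => v.
  by apply: F0; apply: le_trans rt (norm_rowc_l _ _).
have ellc r F : continuous F -> supp r F -> continuous (ell F).
  move=> cF F0 t; apply/cvgrPdist_le => /= e e0.
  have [C C0 hC] := Lb r.
  have e1 : 0 < e / (C + 1) by rewrite divr_gt0 // ltr_pwDr.
  have [d d0 hd] := unif_cont cF F0 e1.
  apply/nbhs_ballP; exists d => // s ts; have {}ts : `|t - s| < d by [].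
  have -> : ell F t - ell F s = Lint (fun v => slice F t v + -1 * slice F s v).
    rewrite (LD r); try by [exact: slice_cont|exact: slice_supp].
    - by rewrite (LZ r) ?mulN1r //; [exact: slice_cont|exact: slice_supp].
    - move=> v; apply: (@continuousM R _ (fun _ => -1)); first exact: cont_cst.
      exact: slice_cont.
    - by move=> v rv; rewrite (slice_supp s F0) ?mulr0.
  apply: (@le_trans _ _ (C * (e / (C + 1)))); last first.
    by rewrite mulrCA ger_pMr // ler_pdivrMr ?ltr_pwDr // mul1r lerDl.
  apply: hC.
  - move=> v; apply: (@continuousD R R^o); first exact: slice_cont.
    apply: (@continuousM R _ (fun _ => -1)); first exact: cont_cst.
    exact: slice_cont.
  - by move=> v rv; rewrite !(slice_supp _ F0) // mulr0 addr0.
  move=> v; rewrite mulN1r; apply: hd.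
  apply: le_lt_trans ts.
  have -> : rowc t v - rowc s v = rowc (t - s) 0.
    apply/eqP; rewrite subr_eq rowcD subrK add0r; apply/eqP; congr rowc; ring.
  by apply: norm_rowc => //; rewrite normr0.
have Lell r F : continuous F -> supp r F ->
    lebesgue_int (fun x => (F x)%:E) = (int1 (ell F))%:E.
  move=> cF F0; rewrite -(int1_fin (ellc r F cF F0) (ell0 r F F0)) /=.
  apply: eq_integral => t _; rewrite /ell -(Lfin r) //; first exact: slice_cont.
  exact: slice_supp.
have LE r F : continuous F -> supp r F -> Lint F = int1 (ell F).
  by move=> cF F0; rewrite /Lint (Lell r).
split.
- by move=> r F cF F0; rewrite (Lell r F cF F0) (LE r F cF F0).
- move=> r F G cF F0 cG G0.
  have cFG : continuous (fun x => F x + G x).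
    by move=> x; apply: (@continuousD R R^o); [exact: cF|exact: cG].
  have FG0 : supp r (fun x => F x + G x) by move=> x rx; rewrite F0 // G0 // addr0.
  rewrite (LE r _ cFG FG0) (LE r F cF F0) (LE r G cG G0).
  rewrite -(int1D (r := r)); [|exact: (ellc r)|exact: ell0|exact: (ellc r)|exact: ell0].
  congr int1; apply/funext => t; rewrite /ell.
  by rewrite -(LD r) //; [exact: slice_cont|exact: slice_supp|exact: slice_cont|exact: slice_supp].
- move=> r c F cF F0.
  have cG : continuous (fun x => c * F x).
    by move=> x; apply: (@continuousM R _ (fun _ => c)); [exact: cont_cst|exact: cF].
  have G0 : supp r (fun x => c * F x) by move=> x rx; rewrite F0 // mulr0.
  rewrite (LE r _ cG G0) (LE r F cF F0) -(int1Z (r := r)); [|exact: (ellc r)|exact: ell0].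
  congr int1; apply/funext => t; rewrite /ell.
  by rewrite -(LZ r) //; [exact: slice_cont|exact: slice_supp].
- move=> r F cF F0 Fp; rewrite (LE r F cF F0); apply: int1_ge0 => t.
  by apply: (Lge0 r); [exact: slice_cont|exact: slice_supp|move=> v; exact: Fp].
- move=> r; have [C C0 hC] := Lb r; exists (C * (2 * `|r|)).
    by rewrite !mulr_ge0.
  move=> F M cF F0 FM; rewrite (LE r F cF F0).
  apply: (@le_trans _ _ ((C * M) * (2 * `|r|))); last by rewrite mulrAC.
  apply: int1_bound => //; first exact: (ellc r).
    by move=> t rt; apply: (ell0 r F F0); apply: le_trans rt; exact: ler_norm.
  move=> t; apply: hC; [exact: slice_cont|exact: slice_supp|].
  by move=> v; exact: FM.
Qed.

End CompactSupportIntegral.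

Lemma norm_scale_delta (R : realType) m (h : R) (a : 'I_m) :
  `|h *: delta_mx 0 a : 'rV[R]_m| <= `|h|.
Proof.
rewrite normrZ ler_piMr //.
by apply: mxnorm_le => // b; rewrite mxE; case: (_ && _); rewrite ?normr1 ?normr0.
Qed.

(** * The integral as a positive linear functional *)

Section Functional.
Variables (R : realType) (m : nat).
Implicit Types (F G k : 'rV[R]_m -> R) (r c t e M C : R) (x y v : 'rV[R]_m).

Lemma cont_add (T : topologicalType) (f g : T -> R) :
  continuous f -> continuous g -> continuous (fun x : T => f x + g x).
Proof. by move=> cf cg x; apply: (@continuousD R R^o); [exact: cf|exact: cg]. Qed.

Lemma cont_mul (T : topologicalType) (f g : T -> R) :
  continuous f -> continuous g -> continuous (fun x : T => f x * g x).
Proof. by move=> cf cg x; apply: (@continuousM R); [exact: cf|exact: cg]. Qed.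

Lemma cont_scale (T : topologicalType) (c : R) (f : T -> R) :
  continuous f -> continuous (fun x : T => c * f x).
Proof. by move=> cf; apply: cont_mul => //; exact: cont_cst. Qed.

Lemma cont_shift F x : continuous F -> continuous (fun y => F (y + x)).
Proof.
move=> cF y; apply: (@continuous_comp _ _ _ (fun y => y + x) F); last exact: cF.
by apply: (@continuousD R 'rV[R]_m _ id (cst x)); [exact: cvg_id|exact: cst_continuous].
Qed.

Lemma supp_common F G : Cc F -> Cc G -> exists r, [/\ 0 <= r, supp r F & supp r G].
Proof.
move=> [_ [r Fr]] [_ [s Gs]]; exists (`|r| + `|s|); split; first exact: addr_ge0.
  by apply: supp_le Fr; rewrite (le_trans (ler_norm _)) // lerDl.
by apply: supp_le Gs; rewrite (le_trans (ler_norm _)) // lerDr.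
Qed.

Lemma supp_nneg F : Cc F -> exists2 r, 0 <= r & supp r F.
Proof. by move=> CF; have [r []] := supp_common CF CF; exists r. Qed.

Lemma CcD F G : Cc F -> Cc G -> Cc (fun x => F x + G x).
Proof.
move=> CF CG; have [r [_ Fr Gr]] := supp_common CF CG.
split; first by apply: cont_add; [exact: CF.1|exact: CG.1].
by exists r => x rx; rewrite Fr // Gr // addr0.
Qed.

Lemma CcMl F G : continuous G -> Cc F -> Cc (fun x => G x * F x).
Proof.
move=> cG [cF [r Fr]]; split; first exact: cont_mul.
by exists r => x rx; rewrite Fr // mulr0.
Qed.

Lemma CcZ c F : Cc F -> Cc (fun x => c * F x).
Proof. by apply: CcMl; exact: cont_cst. Qed.

Lemma CcN F : Cc F -> Cc (fun x => - F x).
Proof. by move=> /(CcZ (-1)); congr Cc; apply/funext => x; rewrite mulN1r. Qed.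

Lemma CcB F G : Cc F -> Cc G -> Cc (fun x => F x - G x).
Proof. by move=> CF /CcN; exact: CcD. Qed.

Lemma Cc0 : Cc (fun _ : 'rV[R]_m => 0).
Proof. by split; [exact: cont_cst|exists 0]. Qed.

Lemma Cc_sum (I : Type) (s : seq I) (P : pred I) (H : I -> 'rV[R]_m -> R) :
  (forall i, Cc (H i)) -> Cc (fun x => \sum_(i <- s | P i) H i x).
Proof.
move=> CH; elim: s => [|i s IH].
  by rewrite (_ : (fun _ => _) = fun=> 0); [exact: Cc0|apply/funext => x; rewrite big_nil].
case: (boolP (P i)) => Pi.
  rewrite (_ : (fun _ => _) = fun x => H i x + \sum_(j <- s | P j) H j x).
    exact: CcD.
  by apply/funext => x; rewrite big_cons Pi.
rewrite (_ : (fun _ => _) = fun x => \sum_(j <- s | P j) H j x) //.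
by apply/funext => x; rewrite big_cons (negPf Pi).
Qed.

Lemma Lint_fin F : Cc F -> lebesgue_int (fun x => (F x)%:E) = (Lint F)%:E.
Proof. by have [h _ _ _ _] := Lint_package R m; move=> [cF [r Fr]]; exact: (h r). Qed.

Lemma LintD F G : Cc F -> Cc G -> Lint (fun x => F x + G x) = Lint F + Lint G.
Proof.
have [_ h _ _ _] := Lint_package R m; move=> CF CG.
by have [r [_ Fr Gr]] := supp_common CF CG; apply: (h r) => //; [exact: CF.1|exact: CG.1].
Qed.

Lemma LintZ c F : Cc F -> Lint (fun x => c * F x) = c * Lint F.
Proof. by have [_ _ h _ _] := Lint_package R m; move=> [cF [r Fr]]; exact: (h r). Qed.

Lemma LintN F : Cc F -> Lint (fun x => - F x) = - Lint F.
Proof.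
move=> CF; rewrite -[RHS]mulN1r -LintZ //; congr Lint.
by apply/funext => x; rewrite mulN1r.
Qed.

Lemma LintB F G : Cc F -> Cc G -> Lint (fun x => F x - G x) = Lint F - Lint G.
Proof. by move=> CF CG; rewrite LintD ?LintN //; exact: CcN. Qed.

Lemma Lint_ge0 F : Cc F -> (forall x, 0 <= F x) -> 0 <= Lint F.
Proof. by have [_ _ _ h _] := Lint_package R m; move=> [cF [r Fr]]; exact: (h r). Qed.

Lemma Lint_le F G : Cc F -> Cc G -> (forall x, F x <= G x) -> Lint F <= Lint G.
Proof.
move=> CF CG FG; rewrite -subr_ge0 -LintB //; apply: Lint_ge0; first exact: CcB.
by move=> x; rewrite subr_ge0.
Qed.

Lemma Lint0 : Lint (fun _ : 'rV[R]_m => 0) = 0.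
Proof.
by have := LintZ 0 Cc0; rewrite !mul0r.
Qed.

Lemma Lint_sum (I : Type) (s : seq I) (P : pred I) (H : I -> 'rV[R]_m -> R) :
  (forall i, Cc (H i)) ->
  Lint (fun x => \sum_(i <- s | P i) H i x) = \sum_(i <- s | P i) Lint (H i).
Proof.
move=> CH; elim: s => [|i s IH].
  by rewrite big_nil; apply: etrans Lint0; congr Lint; apply/funext => x; rewrite big_nil.
rewrite big_cons; case: (boolP (P i)) => Pi.
  rewrite -IH -LintD //; last exact: Cc_sum.
  by congr Lint; apply/funext => x; rewrite big_cons Pi.
by rewrite -IH; congr Lint; apply/funext => x; rewrite big_cons (negPf Pi).
Qed.

Lemma Lint_bound r : exists2 C, 0 <= C & forall F M,
  continuous F -> supp r F -> (forall x, `|F x| <= M) -> `|Lint F| <= C * M.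
Proof. by have [_ _ _ _ h] := Lint_package R m. Qed.

Lemma supp_partial r F a : supp r F -> supp (r + 1) (partial a F).
Proof.
move=> Fr x rx; rewrite (@near_partial _ _ _ _ (fun=> 0)) ?partial_cst //.
have xr : 0 < `|x| - r by rewrite subr_gt0; apply: lt_le_trans rx; rewrite ltrDl.
apply/nbhs_ballP; exists (`|x| - r) => // y; rewrite -ball_normE /= => xy.
apply: Fr; have := ler_normD (x - y) y; rewrite subrK; lra.
Qed.

Lemma Cc_partial F a : Ck_on 1 setT F -> Cc F -> Cc (partial a F).
Proof.
move=> C1F [_ [r Fr]]; split; first by move=> x; exact: (C1_contd C1F).
by exists (r + 1); exact: supp_partial.
Qed.

End Functional.

(** * Translation invariance and strict positivity *)

Section Translation.
Variable R : realType.

Lemma LintS m (F : 'rV[R]_m.+1 -> R) : Cc F ->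
  [/\ Lint F = int1 (fun t => Lint (slice F t)), continuous (fun t => Lint (slice F t))
    & exists r, supp1 r (fun t => Lint (slice F t))].
Proof.
move=> CF; have [cF [r Fr]] := CF.
have CS t : Cc (slice F t) by split; [exact: slice_cont|exists r; exact: slice_supp].
have s1 : supp1 r (fun t => Lint (slice F t)).
  move=> t rt; rewrite -(Lint0 R m); congr Lint; apply/funext => v.
  by apply: Fr; apply: le_trans rt (norm_rowc_l _ _).
have cl : continuous (fun t => Lint (slice F t)).
  move=> t; apply/cvgrPdist_le => /= e e0.
  have [C C0 hC] := Lint_bound m r.
  have e1 : 0 < e / (C + 1) by rewrite divr_gt0 // ltr_pwDr.
  have [d d0 hd] := unif_cont cF Fr e1.
  apply/nbhs_ballP; exists d => // s ts; have {}ts : `|t - s| < d by [].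
  rewrite -LintB //; apply: (@le_trans _ _ (C * (e / (C + 1)))); last first.
    by rewrite mulrCA ger_pMr // ler_pdivrMr ?ltr_pwDr // mul1r lerDl.
  apply: hC.
  - by have [] := CcB (CS t) (CS s).
  - by move=> v rv; rewrite !(slice_supp _ Fr) // subr0.
  move=> v; apply: hd; apply: le_lt_trans ts.
  have -> : rowc t v - rowc s v = rowc (t - s) 0.
    apply/eqP; rewrite subr_eq rowcD subrK add0r; apply/eqP; congr rowc; ring.
  by apply: norm_rowc => //; rewrite normr0.
split; [|exact: cl|by exists r].
rewrite [LHS]/Lint /= /int1 /Rintegral; congr fine.
by apply: eq_integral => t _; rewrite -Lint_fin.
Qed.

Lemma Lint_shift m (F : 'rV[R]_m -> R) x : Cc F ->
  Lint (fun y => F (y + x)) = Lint F.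
Proof.
elim: m F x => [|m IH] F x CF.
  by congr Lint; apply/funext => y; congr F; apply/rowP => -[].
have [cF [r Fr]] := CF.
have CG : Cc (fun y => F (y + x)).
  split; first exact: cont_shift.
  exists (r + `|x|) => y rx; apply: Fr.
  by have := ler_normB (y + x) x; rewrite addrK; lra.
have [-> _ _] := LintS CG; have [-> cl [s ls]] := LintS CF.
rewrite -(int1_shift (x 0 0) cl ls); congr int1; apply/funext => t.
rewrite -(IH (slice F (t + x 0 0)) (\row_a x 0 (lift 0 a))).
  by congr Lint; apply/funext => v; rewrite /slice -rowcD -rowcK.
by split; [exact: slice_cont|exists r; exact: slice_supp].
Qed.

Lemma Lint_gt0 m (F : 'rV[R]_m -> R) x : Cc F -> (forall y, 0 <= F y) -> 0 < F x ->
  0 < Lint F.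
Proof.
elim: m F x => [|m IH] F x CF F0 Fx.
  by rewrite /Lint /= (_ : 0 = x) //; apply/rowP => -[].
have [cF [r Fr]] := CF.
have CS t : Cc (slice F t) by split; [exact: slice_cont|exists r; exact: slice_supp].
have [-> cl [s ls]] := LintS CF.
apply: (@int1_gt0 R s _ (x 0 0) cl ls).
  by move=> t; apply: Lint_ge0 => // v; exact: F0.
apply: (IH _ (\row_a x 0 (lift 0 a))) => //; first by move=> v; exact: F0.
by rewrite /slice -rowcK.
Qed.

End Translation.

(** * Integration by parts and convolution *)

Section Convolution.
Variables (R : realType) (m : nat).
Implicit Types (F G k : 'rV[R]_m -> R) (r c t e M C : R) (x y v : 'rV[R]_m).

Lemma small_le C e : 0 <= C -> (forall d, 0 < d -> e <= C * d) -> e <= 0.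
Proof.
move=> C0 h; rewrite leNgt; apply/negP => e0.
have d0 : 0 < e / (2 * (C + 1)) by rewrite divr_gt0 // mulr_gt0 // ltr_pwDr.
have := h _ d0; apply/negP; rewrite -ltNge.
rewrite mulrA ltr_pdivrMr ?mulr_gt0 ?ltr_pwDr //.
by rewrite mulrC ltr_pM2l //; lra.
Qed.

(** The quotient is a value of the derivative at a nearby point, and a compactly supported
    continuous derivative is uniformly continuous. *)
Lemma diff_quotient_unif F a : Ck_on 1 setT F -> Cc F ->
  forall e, 0 < e -> exists2 d, 0 < d & forall h x, h != 0 -> `|h| < d ->
    `|h^-1 * (F (x + h *: delta_mx 0 a) - F x) - partial a F x| <= e.
Proof.
move=> C1F CF e e0; have [cD [r Dr]] := Cc_partial a C1F CF.
have [d d0 hd] := unif_cont cD Dr e0; exists d => // h x h0 hd'.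
have [s _|s sh] := @MVT_signless R (fun s => F (x + s *: delta_mx 0 a))
    (fun s => partial a F (x + s *: delta_mx 0 a)) h.
  by apply: is_derive_line; exact: (Ck_derivable C1F).
rewrite scale0r addr0 => ->; rewrite mulKf //; apply: hd.
rewrite addrC addKr (le_lt_trans (norm_scale_delta _ _)) //.
exact: le_lt_trans sh hd'.
Qed.

(** By translation invariance the difference quotients have integral zero; they converge uniformly
    to the derivative, with supports in a common ball. *)
Lemma Lint_partial F a : Ck_on 1 setT F -> Cc F -> Lint (partial a F) = 0.
Proof.
move=> C1F CF; have CD := Cc_partial a C1F CF.
have [r r0 Fr] := supp_nneg CF; have [C C0 hC] := Lint_bound m (r + 1).
apply/eqP; rewrite -normr_le0; apply: (small_le C0) => e e0.
have [d d0 hd] := diff_quotient_unif a C1F CF e0.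
pose h := Num.min (d / 2) 1; have h0 : 0 < h by rewrite lt_min divr_gt0 //=.
have h1 : h <= 1 by rewrite ge_min lexx orbT.
have hd2 : h <= d / 2 by rewrite ge_min lexx.
pose Q x := h^-1 * (F (x + h *: delta_mx 0 a) - F x).
have nh : `|h *: delta_mx 0 a : 'rV[R]_m| <= 1.
  by apply: (le_trans (norm_scale_delta _ _)); rewrite gtr0_norm.
have CS : Cc (fun x => F (x + h *: delta_mx 0 a)).
  split; first by apply: cont_shift; exact: CF.1.
  exists (r + 1) => x rx; apply: Fr.
  by have := ler_normB (x + h *: delta_mx 0 a) (h *: delta_mx 0 a); rewrite addrK; lra.
have CQ : Cc Q by apply: CcZ; exact: CcB.
have LQ : Lint Q = 0 by rewrite LintZ ?LintB ?Lint_shift ?subrr ?mulr0 //; exact: CcB.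
have -> : Lint (partial a F) = - Lint (fun x => Q x - partial a F x).
  by rewrite LintB // LQ sub0r opprK.
rewrite normrN; apply: hC.
- by have [] := CcB CQ CD.
- move=> x rx; rewrite (supp_partial a Fr) // subr0 /Q Fr; last first.
    have := ler_normB (x + h *: delta_mx 0 a) (h *: delta_mx 0 a); rewrite addrK; lra.
  by rewrite Fr ?subrr ?mulr0 //; lra.
move=> x; apply: hd; first exact: lt0r_neq0.
by rewrite gtr0_norm //; lra.
Qed.

(** The kernel is evaluated at [y - x], so a derivative in [x] that falls on the kernel changes
    sign. *)
Definition conv F k x := Lint (fun y => F y * k (y - x)).

Lemma Cc_shift k x : Cc k -> Cc (fun y => k (y - x)).
Proof.
move=> [ck [r kr]]; split; first exact: cont_shift.
exists (r + `|x|) => y ry; apply: kr.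
by have := ler_normD (y - x) x; rewrite subrK; lra.
Qed.

Lemma Cc_conv F k x : continuous F -> Cc k -> Cc (fun y => F y * k (y - x)).
Proof. by move=> cF Ck; apply: CcMl => //; exact: Cc_shift. Qed.

Lemma convE F k x : continuous F -> Cc k ->
  conv F k x = Lint (fun v => F (x + v) * k v).
Proof.
move=> cF Ck; rewrite /conv -(Lint_shift x (Cc_conv x cF Ck)).
by congr Lint; apply/funext => y; rewrite addrK [y + x]addrC.
Qed.

Lemma cont_bounded F r : continuous F -> exists2 M, 0 <= M &
  forall x, `|x| <= r -> `|F x| <= M.
Proof.
move=> cF.
have /compact_bounded[M [_ hM]] : compact (F @` [set x | `|x| <= r]).
  apply: continuous_compact; last exact: ball_compact.
  exact: continuous_subspaceT.
exists (`|M| + 1); first by rewrite addr_ge0.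
move=> x xr; apply: (hM (`|M| + 1)); last by exists x.
by rewrite ltr_pwDr // ler_norm.
Qed.

Lemma conv_dist F r s : continuous F -> exists2 C, 0 <= C &
  forall G M x, continuous G -> supp r G -> (forall v, `|G v| <= M) -> `|x| <= s ->
  `|conv F G x| <= C * M.
Proof.
move=> cF; have [B B0 hB] := cont_bounded (r + s) cF.
have [C C0 hC] := Lint_bound m r; exists (C * B); first exact: mulr_ge0.
move=> G M x cG Gr GM xs; rewrite convE //; last by split; [|exists r].
have M0 : 0 <= M by exact: le_trans (GM 0).
rewrite -mulrA; apply: hC.
- apply: cont_mul => // v.
  by have := @cont_shift R m F x cF v; under eq_fun do rewrite [_ + x]addrC.
- by move=> v rv; rewrite Gr // mulr0.
move=> v; rewrite normrM; have [vr|rv] := leP `|v| r.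
  apply: ler_pM => //; apply: hB; apply: le_trans (ler_normD _ _) _; lra.
by rewrite (Gr _ (ltW rv)) normr0 mulr0; exact: mulr_ge0.
Qed.

Lemma conv_cont F k : continuous F -> Cc k -> continuous (conv F k).
Proof.
move=> cF Ck x; have [ck [r0 kr0]] := Ck.
pose r := r0 + 1.
have kr : supp r k by apply: supp_le kr0; rewrite lerDl.
have [C C0 hC] := conv_dist (r + 1) `|x| cF.
rewrite /continuous_at; apply/(@cvgrPdist_le _ _ _ _ (nbhs_filter (x : 'rV[R]_m))) => e e0.
have e1 : 0 < e / (C + 1) by rewrite divr_gt0 // ltr_pwDr.
have [d d0 hd] := unif_cont ck kr e1.
apply/nbhs_ballP; exists (Num.min d 1); first by rewrite /= lt_min d0 /=.
move=> y; rewrite -ball_normE /= lt_min => /andP[xyd xy1].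
have -> : conv F k x - conv F k y = conv F (fun v => k v - k (v - (y - x))) x.
  rewrite /conv -LintB //; [|exact: Cc_conv..].
  congr Lint; apply/funext => v; rewrite -mulrBr; congr (F v * (k _ - k _)).
  by rewrite opprB addrA subrK.
apply: (@le_trans _ _ (C * (e / (C + 1)))); last first.
  by rewrite mulrCA ger_pMr // ler_pdivrMr ?ltr_pwDr // mul1r lerDl.
apply: hC => //.
- by have [] := CcB Ck (Cc_shift (y - x) Ck).
- move=> v rv; rewrite !kr ?subrr //; last by lra.
  by have := ler_normD (v - (y - x)) (y - x); rewrite subrK -[`|y - x|]distrC; lra.
move=> v; apply: hd; rewrite subKr; by rewrite distrC.
Qed.

Lemma conv_partial F k x a : continuous F -> Ck_on 1 setT k -> Cc k ->
  is_derive x (delta_mx 0 a) (conv F k : 'rV[R]_m -> R^o) (- conv F (partial a k) x).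
Proof.
move=> cF C1k Ck; have CD := Cc_partial a C1k Ck.
have [r r0 kr] := supp_nneg Ck.
have [C C0 hC] := conv_dist (r + 1) `|x| cF.
have key : (fun h : R => h^-1 *: ((conv F k (h *: delta_mx 0 a + x) : R^o) - conv F k x))
    @ 0^' --> (- conv F (partial a k) x : R^o).
  apply/cvgrPdist_le => /= e e0.
  have e1 : 0 < e / (C + 1) by rewrite divr_gt0 // ltr_pwDr.
  have [d d0 hd] := diff_quotient_unif a C1k Ck e1.
  exists (Num.min d 1); first by rewrite /= lt_min d0 /=.
  move=> h; rewrite /= sub0r normrN lt_min => /andP[hd' h1] h0.
  have nh : `|h *: delta_mx 0 a : 'rV[R]_m| <= 1.
    exact: le_trans (norm_scale_delta _ _) (ltW h1).
  pose G v := (- h)^-1 * (k (v - h *: delta_mx 0 a) - k v) - partial a k v.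
  have CG : Cc G by apply: CcB => //; apply: CcZ; apply: CcB => //; exact: Cc_shift.
  have -> : - conv F (partial a k) x - h^-1 *: (conv F k (h *: delta_mx 0 a + x) - conv F k x)
      = conv F G x.
    have -> : h^-1 *: (conv F k (h *: delta_mx 0 a + x) - conv F k x) =
        Lint (fun y => h^-1 * (F y * k (y - (h *: delta_mx 0 a + x)) - F y * k (y - x))).
      by rewrite LintZ ?LintB //; [exact: Cc_conv|exact: Cc_conv|apply: CcB; exact: Cc_conv].
    rewrite {1}/conv -LintN; last exact: Cc_conv.
    rewrite -LintB; last 2 first.
    - by apply: CcN; exact: Cc_conv.
    - by apply: CcZ; apply: CcB; exact: Cc_conv.
    congr Lint; apply/funext => y; rewrite /G opprD addrA addrAC invrN; ring.
  apply: (@le_trans _ _ (C * (e / (C + 1)))); last first.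
    by rewrite mulrCA ger_pMr // ler_pdivrMr ?ltr_pwDr // mul1r lerDl.
  apply: hC => //; first exact: CG.1.
  - move=> v rv; rewrite /G (supp_partial a kr) // !kr ?subrr ?mulr0 ?subr0 //; first by lra.
    by have := ler_normD (v - h *: delta_mx 0 a) (h *: delta_mx 0 a); rewrite subrK; lra.
  move=> v; rewrite /G -scaleNr; apply: hd; rewrite ?oppr_eq0 ?normrN //.
split; first by apply/cvg_ex; exists (- conv F (partial a k) x : R^o).
exact: cvg_lim key.
Qed.

Lemma conv_C1 F k : continuous F -> Ck_on 1 setT k -> Cc k -> Ck_on 1 setT (conv F k).
Proof.
move=> cF C1k Ck; split; first by move=> x _; exact: conv_cont.
move=> a; split; first by move=> x _; have [] := conv_partial x a cF C1k Ck.
split => // x _.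
have -> : partial a (conv F k) = (fun y => - conv F (partial a k) y).
  by apply/funext => y; have [_] := conv_partial y a cF C1k Ck.
apply: (@continuousN R R^o); apply: conv_cont => //; exact: Cc_partial.
Qed.

Lemma is_derive_translate k y x a : derivable (k : 'rV[R]_m -> R^o) (y - x) (delta_mx 0 a) ->
  is_derive y (delta_mx 0 a) ((fun y => k (y - x)) : 'rV[R]_m -> R^o)
    (partial a k (y - x)).
Proof.
move=> dk.
have e : (fun s : R => s^-1 *: ((k (s *: delta_mx 0 a + y - x) : R^o) - k (y - x)))
  = (fun s : R => s^-1 *: ((k (s *: delta_mx 0 a + (y - x)) : R^o) - k (y - x))).
  by apply/funext => s; rewrite addrA.
by split; rewrite /derivable /partial /derive /= ?e.
Qed.

Lemma C1_translate k x : Ck_on 1 setT k -> Ck_on 1 setT (fun y => k (y - x)).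
Proof.
move=> C1k.
have ck : continuous k by move=> y; exact: (C1_cont C1k).
have pE b y := @is_derive_translate k y x b (Ck_derivable C1k (I : setT (y - x))).
split; first by move=> y _; exact: cont_shift.
move=> b; split; first by move=> y _; have [] := pE b y.
split => // y _.
have -> : partial b (fun y => k (y - x)) = (fun y => partial b k (y - x)).
  by apply/funext => z; have [_] := pE b z.
by apply: cont_shift => z; exact: (C1_contd C1k).
Qed.

(** The derivative falls on the kernel, and integration by parts moves it to [F]; the two signs
    cancel. *)
Lemma partial_conv F k x a : Ck_on 1 setT F -> Ck_on 1 setT k -> Cc k ->
  partial a (conv F k) x = conv (partial a F) k x.
Proof.
move=> C1F C1k Ck.
have cF : continuous F by move=> y; exact: (C1_cont C1F).
have cDF : continuous (partial a F) by move=> y; exact: (C1_contd C1F).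
have [_ e0] := conv_partial x a cF C1k Ck; apply: (etrans e0).
have CDk := Cc_partial a C1k Ck.
have C1S := C1_translate x C1k.
have C1P := C1M openT C1F C1S.
have := Lint_partial a C1P (Cc_conv x cF Ck).
have -> : partial a (fun y => F y * k (y - x)) =
    (fun y => F y * partial a k (y - x) + partial a F y * k (y - x)).
  apply/funext => y.
  have [d2 e2] := @is_derive_translate k y x a (Ck_derivable C1k (I : setT (y - x))).
  rewrite (partialM (Ck_derivable C1F (I : setT y)) d2); congr (_ + _).
    by congr (_ * _); exact: e2.
  exact: mulrC.
rewrite LintD; [|exact: Cc_conv|exact: Cc_conv].
by move=> /eqP; rewrite addr_eq0 /conv => /eqP ->; rewrite opprK.
Qed.

Lemma conv_avg F k x c e r : continuous F -> Cc k -> (forall v, 0 <= k v) ->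
  supp r k -> (forall v, `|v| < r -> `|F (x + v) - c| <= e) ->
  `|conv F k x - c * Lint k| <= e * Lint k.
Proof.
move=> cF Ck k0 kr h; rewrite convE //.
have cFx : continuous (fun v => F (x + v)).
  by move=> v; have := @cont_shift R m F x cF v; under eq_fun do rewrite [_ + x]addrC.
have CP : Cc (fun v => F (x + v) * k v) by apply: CcMl.
rewrite -LintZ // -LintB //; last exact: CcZ.
have CQ : Cc (fun v => F (x + v) * k v - c * k v) by apply: CcB => //; exact: CcZ.
rewrite ler_norml -LintZ // -LintN; last exact: CcZ.
have b v : `|F (x + v) * k v - c * k v| <= e * k v.
  rewrite -mulrBl normrM (ger0_norm (k0 v)).
  have [vr|rv] := ltP `|v| r; first by rewrite ler_wpM2r // h.
  by rewrite kr // !mulr0.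
by apply/andP; split; apply: Lint_le => //; try exact: CcZ; try (apply: CcN; exact: CcZ);
  move=> v; have := b v; rewrite ler_norml => /andP[].
Qed.

End Convolution.

(** * Cutoff functions and mollifiers *)

Section Bumps.
Variable R : realType.
Implicit Types (s t e d c : R).

Lemma quad_derive (g : R -> R) s c K :
  (forall h, `|g (s + h) - g s - h * c| <= K * h ^+ 2) ->
  is_derive s (1 : R) (g : R -> R^o) c.
Proof.
move=> gK.
have K0 : 0 <= K by have := le_trans (normr_ge0 _) (gK 1); rewrite expr1n mulr1.
have key : (fun h : R => h^-1 *: ((g (h *: (1 : R^o) + s) : R^o) - g s)) @ 0^' --> (c : R^o).
  apply/cvgrPdist_le => /= e e0.
  exists (e / (K + 1)); first by rewrite /= divr_gt0 // ltr_pwDr.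
  move=> h; rewrite /= sub0r normrN => he h0.
  rewrite [h *: 1]mulr1 [h + s]addrC.
  have -> : c - h^-1 *: (g (s + h) - g s) = - (h^-1 * (g (s + h) - g s - h * c)).
    by rewrite [in RHS]mulrBr mulKf // opprB.
  rewrite normrN normrM normfV ler_pdivrMl ?normr_gt0 //.
  apply: le_trans (gK h) _; rewrite -(real_normK (num_real h)) expr2 mulrCA ler_wpM2l //.
  apply: (@le_trans _ _ ((K + 1) * `|h|)); first by rewrite ler_wpM2r // lerDl.
  by rewrite mulrC -ler_pdivlMr ?ltW // ltr_pwDr.
split; first by apply/cvg_ex; exists (c : R^o).
exact: cvg_lim key.
Qed.

(** The square of the positive part: a function of class C^1 vanishing exactly on a half-line, from
    which all cutoffs and kernels are built. *)
Definition posq s := (Num.max 0 s) ^+ 2.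

Lemma posq_ge0 s : 0 <= posq s. Proof. exact: sqr_ge0. Qed.

Lemma posq_le0 s : s <= 0 -> posq s = 0.
Proof. by move=> s0; rewrite /posq max_l // expr0n. Qed.

Lemma posq_gt0 s : 0 < s -> 0 < posq s.
Proof. by move=> s0; rewrite /posq max_r ?exprn_gt0 ?ltW. Qed.

Lemma is_derive_posq s : is_derive s (1 : R) (posq : R -> R^o) (2 * Num.max 0 s).
Proof.
apply: (@quad_derive _ _ _ 1) => h; rewrite mul1r /posq !expr2.
have hh : 0 <= h * h by rewrite -expr2 sqr_ge0.
have [s0|s0] := leP s 0; have [h0|h0] := leP (s + h) 0.
- by rewrite !mul0r !mulr0 !subr0 normr0.
- by rewrite !mul0r !mulr0 !subr0 ger0_norm; nra.
- by rewrite mul0r sub0r ger0_norm; nra.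
- by rewrite (_ : _ - _ = h * h) ?ger0_norm //; ring.
Qed.

Lemma C1_posq m (V : set 'rV[R]_m) f : open V -> Ck_on 1 V f ->
  Ck_on 1 V (fun y => posq (f y)).
Proof.
move=> Vo Cf; apply: (@C1_comp1 _ _ V Vo posq (fun s => 2 * Num.max 0 s)) => //.
  by move=> x _; exact: is_derive_posq.
move=> x _; apply: cont_scale => y.
apply: (@continuous_max R R (fun _ => 0) id); first exact: cont_cst.
exact: cvg_id.
Qed.

Definition step s := posq s / (posq s + posq (1 - s)).

Lemma step_den s : 0 < posq s + posq (1 - s).
Proof.
have [s0|s0] := leP s 0; last by rewrite ltr_pwDl ?posq_gt0 ?posq_ge0.
by rewrite ltr_wpDl ?posq_ge0 // posq_gt0 //; lra.
Qed.

Lemma step_ge0 s : 0 <= step s.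
Proof. by rewrite divr_ge0 ?posq_ge0 // ltW // step_den. Qed.

Lemma step_le1 s : step s <= 1.
Proof. by rewrite ler_pdivrMr ?step_den // mul1r lerDl posq_ge0. Qed.

Lemma step_le0 s : s <= 0 -> step s = 0.
Proof. by move=> s0; rewrite /step posq_le0 // mul0r. Qed.

Lemma step_ge1 s : 1 <= s -> step s = 1.
Proof.
move=> s1; rewrite /step [posq (1 - s)]posq_le0 ?subr_le0 // addr0 divff //.
by rewrite gt_eqF // posq_gt0 // (lt_le_trans ltr01).
Qed.

Lemma C1_step m (V : set 'rV[R]_m) f : open V -> Ck_on 1 V f ->
  Ck_on 1 V (fun y => step (f y)).
Proof.
move=> Vo Cf; have C1f := C1B Vo (C1_cst V 1) Cf.
have Cp := C1_posq Vo Cf; have Cq := C1_posq Vo C1f.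
apply: (C1M Vo Cp); apply: (C1V Vo (C1D Vo Cp Cq)) => x _.
by rewrite gt_eqF // step_den.
Qed.

Lemma partial_coord m a b (x : 'rV[R]_m) : partial a (fun y : 'rV[R]_m => y 0 b) x = (a == b)%:R.
Proof.
have lin : linear (fun M : 'rV[R]_m => M 0 b : R^o) by move=> k u v; rewrite !mxE.
pose LM := GRing.isLinear.Build R 'rV[R]_m R^o *:%R _ lin.
pose L : {linear 'rV[R]_m -> R^o} := HB.pack (fun M : 'rV[R]_m => M 0 b : R^o) LM.
rewrite /partial deriveE; last exact: differentiable_coord.
have := @diff_lin _ _ _ L x (@coord_continuous _ _ _ _ _) => -> /=.
by rewrite mxE eqxx eq_sym.
Qed.

Lemma C1_coord m (a : 'I_m) : Ck_on 1 setT (fun y : 'rV[R]_m => y 0 a).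
Proof.
apply: C1_intro => [x _|b x _]; first exact: differentiable_coord.
have -> : partial b (fun y : 'rV[R]_m => y 0 a) = (fun=> (b == a)%:R).
  by apply/funext => y; rewrite partial_coord.
exact: cont_cst.
Qed.

(* [step] is Lipschitz; only the existence of a bound for its derivative      *)
(* matters.                                                                   *)
Lemma step_derive : exists (st' : R -> R) (B : R), [/\ 0 <= B,
  forall s, is_derive s (1 : R) (step : R -> R^o) (st' s),
  forall s, `|st' s| <= B & forall s, s < 0 \/ 1 < s -> st' s = 0].
Proof.
have C1s : Ck_on 1 setT (fun y : 'rV[R]_1 => step (y 0 0)).
  by apply: C1_step; [exact: openT|exact: C1_coord].
pose D := partial 0 (fun y : 'rV[R]_1 => step (y 0 0)).
pose st' s := D (s *: delta_mx 0 0).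
have dst s : is_derive s (1 : R) (step : R -> R^o) (st' s).
  have := @is_derive_line R 1 (fun y => step (y 0 0)) 0 (delta_mx 0 0) s.
  rewrite add0r => /(_ (Ck_derivable C1s (I : setT _))).
  congr is_derive; apply/funext => t.
  by rewrite add0r mxE mxE eqxx mulr1.
have st0 s : s < 0 \/ 1 < s -> st' s = 0.
  move=> h; have [_ <-] := dst s.
  have nbh c : (\forall t \near s, step t = c) -> 'D_1 (step : R -> R^o) s = 0.
    by move=> /near_eq_derive ->; rewrite derive_cst.
  case: h => h.
    by apply: (nbh 0); apply: filterS (lt_nbhsl h) => t /ltW; exact: step_le0.
  by apply: (nbh 1); apply: filterS (lt_nbhsr h) => t /ltW; exact: step_ge1.
have cst' : continuous st'.
  move=> s; apply: (@continuous_comp _ _ _ (fun s : R => s *: (delta_mx 0 0 : 'rV[R]_1)) D).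
    exact: scalel_continuous.
  exact: (C1_contd C1s).
have /compact_bounded[M [_ hM]] : compact (st' @` `[(-1), 2]).
  by apply: continuous_compact; [exact: continuous_subspaceT|exact: segment_compact].
exists st', (`|M| + 1); split => //.
move=> s; have [s1|s1] := ltP s 0; first by rewrite st0 ?normr0 ?addr_ge0 //; left.
have [s2|s2] := ltP 1 s; first by rewrite st0 ?normr0 ?addr_ge0 //; right.
apply: (hM (`|M| + 1)); first by rewrite ltr_pwDr // ler_norm.
by exists s => //; rewrite /= in_itv /=; apply/andP; split; lra.
Qed.

(** * Mollification *)

Section Mollifier.
Variable m : nat.
Implicit Types (F : 'rV[R]_m -> R) (x v w : 'rV[R]_m).

(** The squared Euclidean distance, which is differentiable, unlike the max norm carried by row
    vectors. *)
Definition sqdist x0 x : R := \sum_a (x 0 a - x0 0 a) ^+ 2.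

Lemma C1_sqdist x0 : Ck_on 1 setT (sqdist x0).
Proof.
apply: (C1_sum openT) => a.
have Ca : Ck_on 1 setT (fun y : 'rV[R]_m => y 0 a - x0 0 a).
  exact: (C1B openT (C1_coord a) (C1_cst _ _)).
exact: (C1M openT Ca Ca).
Qed.

Lemma norm_coord v e : 0 < e -> e <= `|v| -> exists a, e <= `|v 0 a|.
Proof.
move=> e0 ev.
have v0 : mx_norm v != 0.
  by have : 0 < `|v| by [exact: lt_le_trans ev]; rewrite /Num.Def.normr /= => /lt0r_neq0.
have [[i a] vi] := mx_norm_neq0 v0; exists a.
by move: vi ev; rewrite /Num.Def.normr /= [i]ord1 => ->.
Qed.

Lemma sqdist_ge x0 x e : 0 < e -> e <= `|x - x0| -> e ^+ 2 <= sqdist x0 x.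
Proof.
move=> e0 /(norm_coord e0)[a ea]; rewrite /sqdist (bigD1 a) //=.
apply: ler_wpDr; first by apply: sumr_ge0 => b _; exact: sqr_ge0.
rewrite !mxE in ea; rewrite -(real_normK (num_real (x 0 a - x0 0 a))).
by rewrite lerXn2r ?nnegrE // ltW.
Qed.

Lemma sqdist_refl x : sqdist x x = 0.
Proof. by rewrite /sqdist big1 // => a _; rewrite subrr expr0n. Qed.

Definition kern e v := posq (e ^+ 2 - sqdist 0 v).

Lemma C1_kern e : Ck_on 1 setT (kern e).
Proof.
apply: (C1_posq openT); exact: (C1B openT (C1_cst _ _) (C1_sqdist 0)).
Qed.

Lemma kern_supp e : 0 < e -> supp e (kern e).
Proof.
move=> e0 v ev; rewrite /kern posq_le0 // subr_le0; apply: sqdist_ge => //.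
by rewrite subr0.
Qed.

Lemma Cc_kern e : 0 < e -> Cc (kern e).
Proof.
move=> e0; split; last by exists e; exact: kern_supp.
by move=> x; exact: (C1_cont (C1_kern e)).
Qed.

Lemma Lint_kern e : 0 < e -> 0 < Lint (kern e).
Proof.
move=> e0; apply: (@Lint_gt0 _ _ _ 0); [exact: Cc_kern|by move=> y; exact: posq_ge0|].
by rewrite /kern sqdist_refl subr0 posq_gt0 // exprn_gt0.
Qed.

Definition nkern e v := (Lint (kern e))^-1 * kern e v.

Definition moll e F := conv F (nkern e).

Lemma nkern_ge0 e v : 0 < e -> 0 <= nkern e v.
Proof. by move=> e0; rewrite mulr_ge0 ?posq_ge0 // invr_ge0 ltW // Lint_kern. Qed.

Lemma Cc_nkern e : 0 < e -> Cc (nkern e).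
Proof. by move=> e0; exact/CcZ/Cc_kern. Qed.

Lemma C1_nkern e : Ck_on 1 setT (nkern e).
Proof. exact: (C1Z openT _ (C1_kern e)). Qed.

Lemma Lint_nkern e : 0 < e -> Lint (nkern e) = 1.
Proof.
by move=> e0; rewrite LintZ ?mulVf ?gt_eqF ?Lint_kern //; exact: Cc_kern.
Qed.

Lemma nkern_supp e : 0 < e -> supp e (nkern e).
Proof. by move=> e0 v ev; rewrite /nkern kern_supp // mulr0. Qed.

Lemma moll_C1 e F : 0 < e -> continuous F -> Ck_on 1 setT (moll e F).
Proof. move=> e0 cF; exact: (conv_C1 cF (C1_nkern e) (Cc_nkern e0)). Qed.

Lemma partial_moll e F x a : 0 < e -> Ck_on 1 setT F ->
  partial a (moll e F) x = moll e (partial a F) x.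
Proof. move=> e0 CF; exact: (partial_conv x a CF (C1_nkern e) (Cc_nkern e0)). Qed.

Lemma moll_avg e F x c d : 0 < e -> continuous F ->
  (forall v, `|v| < e -> `|F (x + v) - c| <= d) -> `|moll e F x - c| <= d.
Proof.
move=> e0 cF h.
have := conv_avg cF (Cc_nkern e0) (fun v => nkern_ge0 v e0) (nkern_supp e0) h.
by rewrite Lint_nkern // !mulr1.
Qed.

(** A mollification averages translates with total weight 1, so a bound on the increments of all
    nearby translates in the direction [w] bounds its directional derivative. This will bound the
    gradient of a smoothed distance function. *)
Lemma moll_slope e F x w c : 0 < e -> continuous F ->
  (exists2 d, 0 < d & forall t v, 0 < t -> t < d -> `|v| < e ->
     F (x + t *: w + v) - F (x + v) <= t * c) ->
  dotl (diff1 (moll e F) x) w <= c.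
Proof.
move=> e0 cF [d d0 h].
have Cm := moll_C1 e0 cF.
have dm := C1_differentiable openT Cm (I : setT x).
rewrite -diff_dotl // -deriveE // leNgt; apply/negP => lt.
have cv := @diff_derivable _ _ _ (moll e F : 'rV[R]_m -> R^o) x w dm.
have {cv} /cvgrPdist_lt : (fun h : R => h^-1 *: ((moll e F (h *: w + x) : R^o) - moll e F x))
    @ 0^' --> ('D_w (moll e F : 'rV[R]_m -> R^o) x : R^o) by [].
set l := 'D_w _ x in lt *.
have lc : 0 < l - c by rewrite subr_gt0.
move=> /(_ _ lc)[r /= r0 hr].
pose t := Num.min r d / 2.
have t0 : 0 < t by rewrite divr_gt0 // lt_min r0.
have tm : t < Num.min r d by rewrite /t ltr_pdivrMr // mulr_natr mulr2n ltr_pwDl // lt_min r0.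
move: (tm); rewrite lt_min => /andP[tr td].
have := hr t; rewrite /= sub0r normrN gtr0_norm // => /(_ tr (lt0r_neq0 t0)).
apply/negP; rewrite -leNgt.
suff le : t^-1 *: (moll e F (t *: w + x) - moll e F x) <= c.
  by rewrite ger0_norm; [rewrite lerD2l lerN2|rewrite subr_ge0 (le_trans le) // ltW].
rewrite [_ *: _]/(_ * _) ler_pdivrMl // /moll !convE //; try exact: Cc_nkern.
have cFs y : continuous (fun v => F (y + v)).
  by move=> v; have := @cont_shift R m F y cF v; under eq_fun do rewrite [_ + y]addrC.
have CP y : Cc (fun v => F (y + v) * nkern e v) by apply: CcMl => //; exact: Cc_nkern.
rewrite -LintB // -[t * c]mulr1 -(Lint_nkern e0) -LintZ; last exact: Cc_nkern.
apply: Lint_le; [exact: CcB|apply: CcZ; exact: Cc_nkern|move=> v].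
rewrite -mulrBl; have [ve|ve] := ltP `|v| e.
  by rewrite ler_wpM2r ?nkern_ge0 // [t *: w + x]addrC h.
by rewrite nkern_supp // !mulr0.
Qed.

End Mollifier.
End Bumps.

(** * The volume form *)

Section WedgeTop.
Variables (R : realType) (n : nat).
Implicit Types (W D : 'M[R]_(n + n)).

(** For antisymmetric [W], this is [2^n n!] times the Pfaffian in the basis ordered by pairs
    [lshift n j], [rshift n j]. *)
Definition pairing W : R :=
  \sum_(s : 'S_(n + n))
    (-1) ^+ s * \prod_(j < n) W (s (lshift n j)) (s (rshift n j)).

Lemma wedge_topE W : wedge_top W = (2 ^+ n)^-1 * pairing W.
Proof. by []. Qed.

(** The columns are basis vectors: [f j] names those in the two positions of the pair [j]. *)
Definition psel (f : {ffun 'I_n -> 'I_(n + n) * 'I_(n + n)}) : 'M[R]_(n + n) :=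
  \matrix_(a, i) match fintype.split i with
    | inl j => (a == (f j).1)%:R | inr j => (a == (f j).2)%:R end.

(** Expanding every factor and summing over permutations first leaves determinants of [D *m psel f],
    so [D] enters only through [\det D]. *)
Lemma pairing_conj W D :
  pairing (D *m W *m D^T) =
  \det D * \sum_(f : {ffun 'I_n -> 'I_(n + n) * 'I_(n + n)})
    (\prod_j W (f j).1 (f j).2) * \det (psel f).
Proof.
rewrite /pairing.
pose T (s : 'S_(n + n)) j (p : 'I_(n + n) * 'I_(n + n)) :=
  W p.1 p.2 * (D (s (lshift n j)) p.1 * D (s (rshift n j)) p.2).
have e (s : 'S_(n + n)) : \prod_(j < n) (D *m W *m D^T) (s (lshift n j)) (s (rshift n j))
   = \sum_(f : {ffun 'I_n -> 'I_(n + n) * 'I_(n + n)}) \prod_j T s j (f j).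
  rewrite -(bigA_distr_bigA (T s)); apply: eq_bigr => j _.
  rewrite mxE -(pair_bigA _ (fun a b => T s j (a, b))) exchange_big /=.
  apply: eq_bigr => b _; rewrite !mxE mulr_suml; apply: eq_bigr => a _.
  by rewrite /T /=; ring.
under eq_bigr do rewrite e mulr_sumr.
rewrite exchange_big mulr_sumr; apply: eq_bigr => f _ /=.
rewrite [RHS]mulrCA -det_mulmx -det_tr [in RHS]/determinant mulr_sumr.
apply: eq_bigr => s _; rewrite mulrCA; congr (_ * _).
rewrite /T big_split /=; congr (_ * _).
have col (a i c : 'I_(n + n)) : (forall b, psel f b i = (b == c)%:R) ->
    (D *m psel f) a i = D a c.
  move=> pc; rewrite mxE (bigD1 c) //= pc eqxx mulr1 big1 ?addr0 // => b bc.
  by rewrite pc (negPf bc) mulr0.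
rewrite big_split_ord [LHS]big_split /=; congr (_ * _); apply: eq_bigr => j _;
  rewrite mxE; apply/esym; apply: col => b; rewrite mxE.
  by rewrite (unsplitK (inl j)).
by rewrite (unsplitK (inr j)).
Qed.

Lemma wedge_top_conj W D : wedge_top (D *m W *m D^T) = \det D * wedge_top W.
Proof.
rewrite !wedge_topE pairing_conj.
have := pairing_conj W 1%:M; rewrite mul1mx trmx1 mulmx1 det1 mul1r => <-.
by rewrite mulrCA.
Qed.

Lemma det_Jmx : \det (Jmx R n) = 1.
Proof.
have -> : Jmx R n = block_mx 1%:M 1%:M 0 1%:M *m block_mx 1%:M 0 (- 1%:M) 1%:M *m
    block_mx 1%:M 1%:M 0 1%:M.
  rewrite !mulmx_block !mul1mx ?mulmx1 ?mulmx0 ?mul0mx ?addr0 ?add0r /Jmx.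
  by rewrite subrr ?mul0mx ?add0r ?addNr.
by rewrite !det_mulmx det_ublock det_lblock !det1 !mulr1.
Qed.

Lemma Jmx_tr : (Jmx R n)^T = - Jmx R n.
Proof.
by rewrite /Jmx tr_block_mx opp_block_mx !trmx0 !oppr0 linearN /= trmx1 opprK.
Qed.

Lemma Jmx_sq : Jmx R n *m Jmx R n = - 1%:M.
Proof.
rewrite /Jmx mulmx_block !mul0mx !mulmx0 !mul1mx !mulmx1 !add0r !addr0.
by rewrite [in RHS]scalar_mx_block opp_block_mx !oppr0.
Qed.

Lemma JmxK : Jmx R n *m (Jmx R n)^T = 1%:M.
Proof. by rewrite Jmx_tr mulmxN Jmx_sq opprK. Qed.

Lemma JmxKV : (Jmx R n)^T *m Jmx R n = 1%:M.
Proof. by rewrite Jmx_tr mulNmx Jmx_sq opprK. Qed.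

(* [J] is the sum over [k] of [dx_k dy_k] minus [dy_k dx_k]; expanding, every *)
(* term of [J^n] is the square of a determinant.                              *)
Lemma wedge_top_Jmx : 0 < wedge_top (Jmx R n).
Proof.
rewrite wedge_topE mulr_gt0 ?invr_gt0 ?exprn_gt0 //.
pose c (p : 'I_n * bool) : 'I_(n + n) := if p.2 then rshift n p.1 else lshift n p.1.
pose d (p : 'I_n * bool) : 'I_(n + n) := if p.2 then lshift n p.1 else rshift n p.1.
pose T (s : 'S_(n + n)) j (p : 'I_n * bool) : R :=
  (-1) ^+ p.2 * ((s (lshift n j) == c p)%:R * (s (rshift n j) == d p)%:R).
have JE a b : Jmx R n a b = \sum_(p : 'I_n * bool)
    (-1) ^+ p.2 * ((a == c p)%:R * (b == d p)%:R).
  rewrite -(pair_bigA _ (fun k (e : bool) =>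
    (-1) ^+ e * ((a == c (k, e))%:R * (b == d (k, e))%:R))) /=.
  under eq_bigr do rewrite big_bool /= expr1 expr0 mul1r mulN1r.
  rewrite /c /d /= /Jmx; case: (split_ordP a) => k ->; case: (split_ordP b) => l ->.
  - rewrite block_mxEul mxE big1 // => i _.
    by rewrite !eq_shift !(mul0r, mulr0, oppr0, addr0).
  - rewrite block_mxEur mxE (bigD1 l) //= big1 ?addr0 => [|i il];
      rewrite !eq_shift ?eqxx ?[l == i]eq_sym ?(negPf il);
      by rewrite !(mul0r, mulr0, oppr0, add0r, mulr1).
  - rewrite block_mxEdl !mxE (bigD1 l) //= big1 ?addr0 => [|i il];
      rewrite !eq_shift ?eqxx ?[l == i]eq_sym ?(negPf il);
      by rewrite !(mul0r, mulr0, oppr0, addr0, mulr1).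
  - rewrite block_mxEdr mxE big1 // => i _.
    by rewrite !eq_shift !(mul0r, mulr0, oppr0, addr0).
have e (s : 'S_(n + n)) : \prod_(j < n) Jmx R n (s (lshift n j)) (s (rshift n j))
   = \sum_(f : {ffun 'I_n -> 'I_n * bool}) \prod_j T s j (f j).
  by rewrite -(bigA_distr_bigA (T s)); apply: eq_bigr => j _; rewrite JE.
pose K (f : {ffun 'I_n -> 'I_n * bool}) : 'M[R]_n := \matrix_(j, k) (k == (f j).1)%:R.
have -> : pairing (Jmx R n) = \sum_(f : {ffun 'I_n -> 'I_n * bool}) (\det (K f)) ^+ 2.
  rewrite /pairing; under eq_bigr do rewrite e mulr_sumr.
  rewrite exchange_big; apply: eq_bigr => f _ /=.
  pose E : 'M[R]_n := diag_mx (\row_j ((f j).2)%:R).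
  (* The selection matrix of [f]: the right factor picks the index [(f j).1], and the left one
     exchanges the halves of the pair [j] when [(f j).2] holds. Its determinant is the sign carried
     by [T] times a square. *)
  pose S : 'M[R]_(n + n) := block_mx (1%:M - E) E E (1%:M - E) *m block_mx (K f) 0 0 (K f).
  have EK i k : (E *m K f) i k = ((f i).2)%:R * (k == (f i).1)%:R.
    by rewrite /E mul_diag_mx !mxE.
  have Sl j a : S (lshift n j) a = (a == c (f j))%:R.
    rewrite /S mulmx_block !mulmx0 !addr0 !add0r /c; case: (split_ordP a) => k ->.
      rewrite block_mxEul mulmxBl mul1mx mxE [X in _ + X]mxE EK mxE.
      by case: (f j).2; rewrite !eq_shift ?mul1r ?mul0r ?subrr ?subr0.
    by rewrite block_mxEur EK; case: (f j).2; rewrite !eq_shift ?mul1r ?mul0r.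
  have Sr j a : S (rshift n j) a = (a == d (f j))%:R.
    rewrite /S mulmx_block !mulmx0 !addr0 !add0r /d; case: (split_ordP a) => k ->.
      by rewrite block_mxEdl EK; case: (f j).2; rewrite !eq_shift ?mul1r ?mul0r.
    rewrite block_mxEdr mulmxBl mul1mx mxE [X in _ + X]mxE EK mxE.
    by case: (f j).2; rewrite !eq_shift ?mul1r ?mul0r ?subrr ?subr0.
  have detE : \det (block_mx (1%:M - E) E E (1%:M - E)) = \prod_j (-1) ^+ (f j).2.
    have -> : block_mx (1%:M - E) E E (1%:M - E) = block_mx 1%:M 0 1%:M 1%:M *m
        block_mx 1%:M E 0 (1%:M - E - E) *m block_mx 1%:M 0 (-1%:M) 1%:M.
      rewrite !mulmx_block !mul1mx !mulmx1 !mulmx0 !mul0mx !addr0 !add0r !mulmxN !mulmx1.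
      congr block_mx.
      - by rewrite [E + _]addrC subrK opprB addrCA subrr addr0.
      - by rewrite [E + _]addrC subrK.
    rewrite !det_mulmx !det_lblock det_ublock !det1 !mul1r !mulr1.
    have -> : 1%:M - E - E = diag_mx (\row_j (-1) ^+ (f j).2) :> 'M[R]_n.
      apply/matrixP => i j; rewrite !mxE; case: eqP => _ /=; last by rewrite !subr0.
      by case: (f i).2; rewrite !mulr1n ?expr1 ?expr0 ?subrr ?sub0r ?subr0.
    by rewrite det_diag; apply: eq_bigr => j _; rewrite mxE.
  transitivity (\prod_j (-1) ^+ (f j).2 * \det S).
    rewrite [in RHS]/determinant mulr_sumr; apply: eq_bigr => s _.
    rewrite mulrCA; congr (_ * _); rewrite /T big_split /=; congr (_ * _).
    rewrite big_split_ord [LHS]big_split /=.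
    by congr (_ * _); apply: eq_bigr => j _; rewrite ?Sl ?Sr.
  have q2 : (\prod_j (-1) ^+ (f j).2) ^+ 2 = 1 :> R.
    by rewrite -prodrXl big1 // => j _; exact: sqrr_sign.
  have -> : \det S = \prod_j (-1) ^+ (f j).2 * \det (K f) ^+ 2.
    by rewrite /S det_mulmx detE det_ublock.
  by move: q2; move: (\prod_j _) => q q2; rewrite mulrA -expr2 q2 mul1r.
rewrite (bigD1 [ffun j => (j, false)]) //=.
apply: ltr_pwDl; last by apply: sumr_ge0 => f _; exact: sqr_ge0.
suff -> : K [ffun j => (j, false)] = 1%:M by rewrite det1 expr1n.
by apply/matrixP => i j; rewrite !mxE ffunE /= eq_sym.
Qed.

Lemma is_derive_wedge (W : R -> 'M[R]_(n + n)) (dW : 'M[R]_(n + n)) (t : R) :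
  (forall i j, is_derive t (1 : R) ((fun s => W s i j) : R -> R^o) (dW i j)) ->
  is_derive t (1 : R) ((fun s => wedge_top (W s)) : R -> R^o)
   ((2 ^+ n)^-1 * \sum_(s : 'S_(n + n)) (-1) ^+ s *
     \sum_j dW (s (lshift n j)) (s (rshift n j)) *
       \prod_(i < n | i != j) W t (s (lshift n i)) (s (rshift n i))).
Proof.
move=> D.
have Ds (s : 'S_(n + n)) : is_derive t (1 : R)
    ((fun u => (-1) ^+ s * \prod_j W u (s (lshift n j)) (s (rshift n j))) : R -> R^o)
    ((-1) ^+ s * \sum_j dW (s (lshift n j)) (s (rshift n j)) *
       \prod_(i < n | i != j) W t (s (lshift n i)) (s (rshift n i))).
  apply: (@is_deriveZ _ _ _ (fun u => \prod_j W u (s (lshift n j)) (s (rshift n j)) : R^o)).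
  exact: (is_derive_prod_seq (index_enum_uniq _)
    (fun j => D (s (lshift n j)) (s (rshift n j)))).
have := @is_deriveZ _ _ _ _ (2 ^+ n)^-1 t 1 _ (is_derive_sum_seq (index_enum _) xpredT Ds).
by [].
Qed.

(* Infinitesimal form of [wedge_top_conj] for [D = 1 + s A].                  *)
Lemma wedge_derive (W : R -> 'M[R]_(n + n)) (dW : 'M[R]_(n + n)) (t : R) :
  (forall i j, is_derive t (1 : R) ((fun s => W s i j) : R -> R^o) (dW i j)) ->
  (W t)^T = - W t -> dW^T = - dW -> W t \in unitmx ->
  is_derive t (1 : R) ((fun s => wedge_top (W s)) : R -> R^o)
    (2^-1 * \tr (dW *m invmx (W t)) * wedge_top (W t)).
Proof.
move=> D WT dWT Wu.
pose A := 2^-1 *: (dW *m invmx (W t)).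
(* A path of conjugates of [W t] with the same value and derivative as [W] at [t]; along it
   [wedge_top] is a determinant times a constant. *)
pose C (s : R) := (1%:M + (s - t) *: A) *m W t *m (1%:M + (s - t) *: A)^T.
have AW : A *m W t + W t *m A^T = dW.
  rewrite /A linearZ /= trmx_mul -scalemxAl -scalemxAr mulmxKV // trmx_inv WT dWT.
  have -> : W t *m (invmx (- W t) *m - dW) = dW.
    rewrite mulmxA mulmxN -mulNmx -mulNmx mulmxV ?mul1mx //.
    by rewrite -WT unitmx_tr.
  by rewrite -scalerDl -[2^-1]mul1r -splitr scale1r.
have trA : \tr A = 2^-1 * \tr (dW *m invmx (W t)) by rewrite /A mxtraceZ.
clearbody A.
have DC i j : is_derive t (1 : R) ((fun s => C s i j) : R -> R^o) (dW i j).
  apply: (@quad_derive R _ _ _ `|(A *m W t *m A^T) i j|) => h.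
  have e s : C s = W t + (s - t) *: dW + (s - t) ^+ 2 *: (A *m W t *m A^T).
    rewrite /C; move: (s - t) => c.
    have -> : (1%:M + c *: A)^T = 1%:M + c *: A^T by rewrite linearD /= trmx1 linearZ.
    rewrite mulmxDl mul1mx mulmxDr mulmx1 mulmxDl -!scalemxAl -!scalemxAr.
    by rewrite scalerA -expr2 -AW scalerDr !addrA.
  have eh : C (t + h) = W t + h *: dW + h ^+ 2 *: (A *m W t *m A^T).
    by rewrite e [t + h]addrC addrK.
  have e0 : C t = W t by rewrite e subrr scale0r expr0n scale0r !addr0.
  rewrite eh e0; set B := A *m W t *m A^T; clearbody B; rewrite !mxE.
  rewrite (_ : _ - _ = h ^+ 2 * B i j); last by ring.
  by rewrite normrM ger0_norm ?sqr_ge0 // mulrC.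
have Ct : C t = W t by rewrite /C subrr scale0r addr0 trmx1 mulmx1 mul1mx.
have := is_derive_wedge DC; rewrite Ct => DC1.
have DW := is_derive_wedge D.
have [dC eC] := DC1; have [dWd eW] := DW; split => //; rewrite eW -eC.
have -> : (fun s => wedge_top (C s)) =
    (fun s => \det (1%:M + (s - t) *: A) * wedge_top (W t)).
  by apply/funext => s; rewrite wedge_top_conj.
have DA i j : is_derive t (1 : R) ((fun s => (1%:M + (s - t) *: A) i j) : R -> R^o) (A i j).
  apply: (@quad_derive R _ _ _ 0) => h; rewrite !mxE mul0r normr_le0.
  by apply/eqP; ring.
have := is_derive_det DA; rewrite subrr scale0r addr0 adj1 mulmx1 => DD.
have [_ <-] : is_derive t (1 : R) ((fun s => \det (1%:M + (s - t) *: A) * wedge_top (W t)) : R -> R^o)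
    (2^-1 * \tr (dW *m invmx (W t)) * wedge_top (W t)); last by [].
have := @is_deriveM _ _ _ _ t 1 _ _ DD (is_derive_cst (wedge_top (W t) : R^o) t 1).
congr is_derive; rewrite scaler0 add0r [_ *: _]mulrC; congr (_ * _).
exact: trA.
Qed.

Lemma metric_tr W : W^T = - W -> Jmx R n *m W *m (Jmx R n)^T = W -> (metric W)^T = metric W.
Proof.
move=> WT WJ; rewrite /metric trmx_mul trmxK WT mulmxN -[in RHS]WJ.
by rewrite -!mulmxA -trmx_mul Jmx_sq linearN /= trmx1 mulmxN mulmx1 mulmxN.
Qed.

Lemma posdef_metric W : real11 W -> form_pos W -> posdef (metric W).
Proof.
move=> [WT WJ] Wp; split; first exact: metric_tr.
move=> v /Wp; rewrite /form_app /bil /metric trmx_mul mulmxA.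
by rewrite -!mulmxA.
Qed.

Lemma det_metric W : \det (metric W) = \det W.
Proof. by rewrite /metric det_mulmx det_tr det_Jmx mulr1. Qed.

Lemma real11_Jmx : real11 (Jmx R n) /\ metric (Jmx R n) = 1%:M.
Proof.
split; last exact: JmxK.
by split; [exact: Jmx_tr|rewrite -mulmxA JmxK mulmx1].
Qed.

(** On the segment from [Jmx] to [W] the metrics stay positive definite, and both [wedge_top] and
    the square root of the determinant have half the same trace as logarithmic derivative. Their
    ratio is therefore constant, equal to its value at [Jmx]. *)
Lemma wedge_top_det W : real11 W -> form_pos W ->
  wedge_top W = wedge_top (Jmx R n) * Num.sqrt (\det W).
Proof.
move=> W11 Wp.
pose P t := Jmx R n + t *: (W - Jmx R n).
have [J11 gJ] := real11_Jmx.
have gP t : metric (P t) = (1 - t) *: 1%:M + t *: metric W.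
  rewrite -gJ /P /metric mulmxDl -scalemxAl mulmxBl.
  by move: (_ *m _) (W *m _) => a b; apply/matrixP => i j; rewrite !mxE; ring.
have PT t : (P t)^T = - P t.
  rewrite /P linearD /= linearZ /= linearB /= W11.1 J11.1.
  by apply/matrixP => i j; rewrite !mxE; ring.
have Pp (t : R) : 0 <= t <= 1 -> posdef (metric (P t)).
  move=> /andP[t0 t1]; have [gT gp] := posdef_metric W11 Wp; rewrite gP; split.
    by rewrite linearD /= !linearZ /= trmx1 gT.
  move=> v v0; rewrite bilDm !bilZm.
  have b1 := bil1_gt0 v0; have b2 := gp _ v0.
  have [->|tn] := eqVneq t 0; first by rewrite subr0 mul0r addr0 mul1r.
  apply: ltr_wpDl; first by rewrite mulr_ge0 ?subr_ge0 // ltW.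
  by rewrite mulr_gt0 // lt_neqAle eq_sym tn.
have Pd (t : R) : 0 <= t <= 1 -> 0 < \det (P t).
  by move=> /Pp/posdef_det; rewrite det_metric.
pose z t := wedge_top (P t) * (Num.sqrt (\det (P t)))^-1.
have DP t i j : is_derive t (1 : R) ((fun s => P s i j) : R -> R^o) ((W - Jmx R n) i j).
  apply: (@quad_derive R _ _ _ 0) => h; rewrite !mxE mul0r normr_le0.
  by apply/eqP; ring.
have dz (t : R) : 0 <= t <= 1 -> is_derive t (1 : R) (z : R -> R^o) 0.
  move=> t01; have d0 := Pd t t01; set d := \det (P t) in d0.
  have Pu : P t \in unitmx by rewrite unitmxE unitfE gt_eqF.
  have dWT : (W - Jmx R n)^T = - (W - Jmx R n).
    by rewrite linearB /= W11.1 J11.1; apply/matrixP => i j; rewrite !mxE; ring.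
  have D1 := wedge_derive (DP t) (PT t) dWT Pu.
  have D2 := is_derive_det (DP t).
  have -> : 0 = wedge_top (P t) *: (- (Num.sqrt d) ^- 2 *: ((2 * Num.sqrt d)^-1 * \tr ((W - Jmx R n) *m \adj (P t))))
     + (Num.sqrt d)^-1 *: (2^-1 * \tr ((W - Jmx R n) *m invmx (P t)) * wedge_top (P t)) :> R.
    have -> : \adj (P t) = d *: invmx (P t).
      by rewrite /invmx Pu scalerA mulfV ?scale1r // gt_eqF.
    have sd : d = Num.sqrt d ^+ 2 by rewrite sqr_sqrtr // ltW.
    have s0 : Num.sqrt d != 0 by rewrite gt_eqF // sqrtr_gt0.
    rewrite -scalemxAr mxtraceZ; move: (\tr _) (wedge_top _) => a b.
    move: (Num.sqrt d) sd s0 => q -> q0.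
    by rewrite /GRing.scale /=; field.
  have Ds := is_derive1_sqrt d0.
  have D3 := @is_derive1_comp R Num.sqrt (fun s => \det (P s)) t _ _ Ds D2.
  have s0 : (Num.sqrt \o (fun s => \det (P s))) t != 0 by rewrite /= gt_eqF // sqrtr_gt0.
  have D4 := is_deriveV s0 D3.
  exact: (is_deriveM D1 D4).
have z01 : z 1 = z 0.
  have cz (t : R) : 0 <= t <= 1 -> {for t, continuous z}.
    by move=> /dz[/derivable1_diffP/differentiable_continuous].
  have dI (t : R) : t \in `]0, 1[%R -> is_derive t (1 : R) (z : R -> R^o) 0.
    by rewrite in_itv /= => /andP[t0 t1]; apply: dz; rewrite !ltW.
  have wz : {within `[0, 1], continuous z}.
    by apply: continuous_in_subspaceT => s; rewrite inE /= in_itv /= => ?; exact: cz.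
  have [t _] := MVT_segment ler01 dI wz.
  by rewrite mul0r => /eqP; rewrite subr_eq0 => /eqP.
move: z01; rewrite /z /P scale0r addr0 scale1r addrCA subrr addr0 det_Jmx sqrtr1 invr1 mulr1.
move=> <-; rewrite mulfVK // gt_eqF // sqrtr_gt0 -det_metric.
exact/posdef_det/posdef_metric.
Qed.

End WedgeTop.

(** * The complex Hessian and holomorphic changes of coordinates *)

Section HolomorphicCalculus.
Variables (R : realType).

Lemma cont_det (T : topologicalType) k (W : T -> 'M[R]_k) x :
  (forall i j, {for x, continuous (fun y => W y i j)}) ->
  {for x, continuous (fun y => \det (W y))}.
Proof.
move=> cW; apply: cont_sum => s; apply: (@continuousM R _ (fun=> _)).
  exact: cvg_cst.
by apply: cont_prod => i; exact: cW.
Qed.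

Lemma cont_invmx (T : topologicalType) k (W : T -> 'M[R]_k) x i j :
  (forall i j, {for x, continuous (fun y => W y i j)}) -> W x \in unitmx ->
  {for x, continuous (fun y => invmx (W y) i j)}.
Proof.
move=> cW Wu; have cd := cont_det cW.
have d0 : \det (W x) != 0 by rewrite -unitfE -unitmxE.
apply: (@near_eq_cont _ _ (fun y => (\det (W y))^-1 * cofactor (W y) j i)).
  have dn : \forall y \near x, \det (W y) != 0.
    by have := cd _ (open_neq d0).
  by apply: filterS dn => y dy; rewrite /invmx unitmxE unitfE dy !mxE.
apply: (@continuousM R _ (fun y => (\det (W y))^-1)).
  by first [exact: (@continuousV R T _ x d0 cd) | exact: (@cvgV R T _ _ (fun y => \det (W y)) _ d0 cd) | apply: cvgV].
apply: (@continuousM R _ (fun=> _)); first exact: cvg_cst.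
apply: cont_det => a b.
have -> : (fun y => row' j (col' i (W y)) a b) = (fun y => W y (lift j a) (lift i b)).
  by apply/funext => y; rewrite !mxE.
exact: cW.
Qed.

Lemma C1_comp p m (V : set 'rV[R]_p) (V' : set 'rV[R]_m) (h : 'rV[R]_m -> R)
    (F : 'rV[R]_p -> 'rV[R]_m) :
  open V -> open V' -> Ck_on 1 V' h -> (forall b, Ck_on 1 V (fun y => F y 0 b)) ->
  (forall y, V y -> V' (F y)) -> Ck_on 1 V (fun y => h (F y)).
Proof.
move=> Vo V'o Ch CF FV.
have D y v : V y -> is_derive y v ((fun y => h (F y)) : 'rV[R]_p -> R^o)
    (\sum_b 'D_v (fun y => F y 0 b : R^o) y * partial b h (F y)).
  move=> Vy; apply: is_derive_comp; first exact: (C1_diff V'o Ch (FV y Vy)).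
  by move=> b; exact: (C1_diff Vo (CF b) Vy).
have cF y : V y -> {for y, continuous F}.
  by move=> Vy; apply: cont_row => b; exact: (C1_cont (CF b) Vy).
split.
  move=> y Vy; apply: (@continuous_comp _ _ _ F h); first exact: cF.
  exact: (C1_cont Ch (FV y Vy)).
move=> a; split; first by move=> y Vy; have [] := D y (delta_mx 0 a) Vy.
split => // y Vy.
apply: (@near_eq_cont R _ (fun y => \sum_b partial a (fun y => F y 0 b) y * partial b h (F y))).
  by apply: (open_near Vo Vy) => z Vz; have [_ <-] := D z (delta_mx 0 a) Vz.
apply: (@cont_sum R _ _ _ _ (fun b y => partial a (fun y => F y 0 b) y * partial b h (F y))) => b.
apply: (@continuousM R); first exact: (C1_contd (CF b) Vy).
apply: (@continuous_comp _ _ _ F (partial b h)); first exact: cF.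
exact: (C1_contd Ch (FV y Vy)).
Qed.

Lemma diff1_comp p m (V : set 'rV[R]_p) (V' : set 'rV[R]_m) (h : 'rV[R]_m -> R)
    (F : 'rV[R]_p -> 'rV[R]_m) y a :
  open V -> open V' -> Ck_on 1 V' h -> (forall b, Ck_on 1 V (fun y => F y 0 b)) ->
  V y -> V' (F y) ->
  partial a (fun y => h (F y)) y = \sum_b partial a (fun y => F y 0 b) y * partial b h (F y).
Proof.
move=> Vo V'o Ch CF Vy V'y.
by have [_] := is_derive_comp (delta_mx 0 a) (C1_diff V'o Ch V'y) (fun b => C1_diff Vo (CF b) Vy).
Qed.

Definition hess m (h : 'rV[R]_m -> R) (y : 'rV[R]_m) : 'M[R]_m :=
  \matrix_(a, b) partial a (partial b h) y.

Lemma hess_sym m (V : set 'rV[R]_m) h y : open V -> Ck_on 2 V h -> V y ->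
  (hess h y)^T = hess h y.
Proof.
by move=> Vo Ch Vy; apply/matrixP => a b; rewrite !mxE; exact: (partial_sym _ _ Vo Ch Vy).
Qed.

Lemma i_ddbar_hess n (V : set 'rV[R]_(n + n)) h y : open V -> Ck_on 2 V h -> V y ->
  i_ddbar h y = 2^-1 *: (Jmx R n *m hess h y - hess h y *m (Jmx R n)^T).
Proof.
move=> Vo Ch Vy; have HT := hess_sym Vo Ch Vy.
have e a b : partial a (fun z => (diff1 h z *m (Jmx R n)^T) 0 b) y =
    (hess h y *m (Jmx R n)^T) a b.
  have Cp c : Ck_on 1 V (fun z => partial c h z * Jmx R n b c).
    exact: (C1M Vo (Ck_partial c Ch) (C1_cst V _)).
  have -> : (fun z => (diff1 h z *m (Jmx R n)^T) 0 b) =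
      (fun z => \sum_c partial c h z * Jmx R n b c).
    by apply/funext => z; rewrite mxE; apply: eq_bigr => c _; rewrite !mxE.
  rewrite partial_sum => [|c]; last exact: (Ck_derivable (Cp c) Vy).
  rewrite mxE; apply: eq_bigr => c _.
  rewrite (partialM (Ck_derivable (Ck_partial c Ch) Vy) (Ck_derivable (C1_cst V _) Vy)).
  by rewrite partial_cst mulr0 add0r !mxE mulrC.
rewrite /i_ddbar; set E := ext_d _ _.
have -> : E = hess h y *m (Jmx R n)^T - (hess h y *m (Jmx R n)^T)^T.
  apply/matrixP => a b; rewrite /E [LHS]mxE !e [RHS]mxE; congr (_ + _).
  by rewrite [RHS]mxE; congr (- _); rewrite [RHS]mxE.
by rewrite trmx_mul trmxK HT -scalerN opprB.
Qed.

Lemma real11_ddbar n (V : set 'rV[R]_(n + n)) h y : open V -> Ck_on 2 V h -> V y ->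
  real11 (i_ddbar h y).
Proof.
move=> Vo Ch Vy; rewrite (i_ddbar_hess Vo Ch Vy).
have HT := hess_sym Vo Ch Vy; set H := hess h y in HT *.
split.
  by rewrite linearZ /= linearB /= !trmx_mul trmxK HT -scalerN opprB.
rewrite -scalemxAr -scalemxAl mulmxBr mulmxBl; congr (_ *: _).
rewrite !mulmxA Jmx_sq mulNmx mul1mx -!mulmxA -trmx_mul Jmx_sq.
by rewrite linearN /= trmx1 !mulmxN mulmx1 mulNmx opprK addrC.
Qed.

(** This is the [J]-invariant part of the Hessian, the only part that a [J]-invariant inverse metric
    sees in a trace. *)
Lemma metric_ddbar n (V : set 'rV[R]_(n + n)) h y : open V -> Ck_on 2 V h -> V y ->
  metric (i_ddbar h y) =
  2^-1 *: (hess h y + Jmx R n *m hess h y *m (Jmx R n)^T).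
Proof.
move=> Vo Ch Vy; rewrite (i_ddbar_hess Vo Ch Vy) /metric -scalemxAl mulmxBl.
by rewrite -[X in _ - X]mulmxA -trmx_mul Jmx_sq linearN /= trmx1 mulmxN mulmx1 opprK addrC.
Qed.

(** The chain rule for second derivatives has an extra term combining the Hessians of the components
    of [F]. Differentiating the Cauchy-Riemann equations shows that [J *m K c = K c *m J^T] for
    these Hessians, so that term does not contribute to [i_ddbar]. *)
Lemma ddbar_comp n (V V' : set 'rV[R]_(n + n)) (h : 'rV[R]_(n + n) -> R)
    (F : 'rV[R]_(n + n) -> 'rV[R]_(n + n)) y :
  open V -> open V' -> Ck_on 2 V' h -> (forall b, Ck_on 2 V (fun y => F y 0 b)) ->
  (forall y, V y -> V' (F y)) ->
  (forall y, V y -> jac F y *m Jmx R n = Jmx R n *m jac F y) -> V y ->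
  Ck_on 2 V (fun y => h (F y)) ->
  i_ddbar (fun y => h (F y)) y = jac F y *m i_ddbar h (F y) *m (jac F y)^T.
Proof.
move=> Vo V'o Ch CF FV hol Vy ChF.
rewrite (i_ddbar_hess Vo ChF Vy) (i_ddbar_hess V'o Ch (FV y Vy)).
set J := Jmx R n; set D := jac F y; set H := hess h (F y).
pose K b := hess (fun y => F y 0 b) y.
have KT b : (K b)^T = K b by exact: (hess_sym Vo (CF b) Vy).
have CF1 b : Ck_on 1 V (fun y => F y 0 b) by exact: Ck_onW (CF b).
have Ch1 := Ck_onW Ch.
have HE : hess (fun y => h (F y)) y = D *m H *m D^T + \sum_b partial b h (F y) *: K b.
  apply/matrixP => a c; rewrite mxE.
  have Cb b : Ck_on 1 V (fun z => partial b h (F z)).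
    exact: (C1_comp Vo V'o (Ck_partial b Ch) CF1 FV).
  have CP b : Ck_on 1 V (fun z => partial c (fun y => F y 0 b) z * partial b h (F z)).
    exact: (C1M Vo (Ck_partial c (CF b)) (Cb b)).
  rewrite (@near_partial _ _ _ _ (fun z => \sum_b partial c (fun y => F y 0 b) z * partial b h (F z))).
    rewrite partial_sum => [|b]; last exact: (Ck_derivable (CP b) Vy).
    rewrite mxE [X in _ = _ + X]summxE mxE -big_split /=; apply: eq_bigr => b _.
    rewrite (partialM (Ck_derivable (Ck_partial c (CF b)) Vy) (Ck_derivable (Cb b) Vy)).
    rewrite (diff1_comp a Vo V'o (Ck_partial b Ch) CF1 Vy (FV y Vy)).
    have -> : (D *m H) a b = \sum_d partial a (fun y => F y 0 d) y * partial d (partial b h) (F y).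
      by rewrite [LHS]mxE; apply: eq_bigr => d _; rewrite /D /H [jac _ _ _ _]mxE [hess _ _ _ _]mxE.
    have -> : D^T b c = partial c (fun y => F y 0 b) y.
      by rewrite [LHS]mxE /D [LHS]mxE.
    have -> : (partial b h (F y) *: K b) a c = partial b h (F y) * partial a (partial c (fun y => F y 0 b)) y.
      by rewrite [LHS]mxE /K [hess _ _ _ _]mxE.
    by rewrite mulrC.
  by apply: (open_near Vo Vy) => z Vz; exact: (diff1_comp c Vo V'o Ch1 CF1 Vz (FV z Vz)).
have hol' a c d : \sum_b K b d a * J b c = \sum_b J a b * K c d b.
  have := @near_partial R _ d (fun z => \sum_b partial a (fun y => F y 0 b) z * J b c)
     (fun z => \sum_b J a b * partial b (fun y => F y 0 c) z) y.
  have near : \forall z \near y, \sum_b partial a (fun y => F y 0 b) z * J b c =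
      \sum_b J a b * partial b (fun y => F y 0 c) z.
    apply: (open_near Vo Vy) => z Vz.
    transitivity ((jac F z *m J) a c).
      by rewrite [RHS]mxE; apply: eq_bigr => b _; rewrite [jac _ _ _ _]mxE.
    rewrite /J (hol z Vz) [LHS]mxE; apply: eq_bigr => b _.
    by rewrite [jac _ _ _ _]mxE.
  move=> /(_ near); have CC k b : Ck_on 1 V (fun=> k : R) by exact: C1_cst.
  rewrite !partial_sum => [e|b|b].
  - transitivity (\sum_b partial d (fun z => partial a (fun y => F y 0 b) z * J b c) y).
      apply: eq_bigr => b _.
      rewrite (partialM (Ck_derivable (Ck_partial a (CF b)) Vy) (Ck_derivable (C1_cst V _) Vy)).
      by rewrite partial_cst mulr0 add0r !mxE mulrC.
    rewrite e; apply: eq_bigr => b _.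
    rewrite (partialM (Ck_derivable (C1_cst V _) Vy) (Ck_derivable (Ck_partial b (CF c)) Vy)).
    by rewrite partial_cst mulr0 addr0 !mxE.
  - exact: (Ck_derivable (C1M Vo (C1_cst V _) (Ck_partial b (CF c))) Vy).
  - exact: (Ck_derivable (C1M Vo (Ck_partial a (CF b)) (C1_cst V _)) Vy).
(* The differentiated Cauchy-Riemann equation is used in both directions, with the symmetry of
   second derivatives in between. *)
have KJ c : J *m K c = K c *m J^T.
  have sK b a d : K b a d = K b d a by exact: sym_entry.
  apply/matrixP => d a; rewrite !mxE.
  transitivity (\sum_b J d b * K c a b); first by apply: eq_bigr => b _; rewrite [K c b a]sK.
  rewrite -hol'; under eq_bigr do rewrite sK; rewrite hol'.
  by apply: eq_bigr => b _; rewrite mulrC [J^T _ _]mxE.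
have DJ : J *m D = D *m J by rewrite /J /D hol.
have DJT : D^T *m J^T = J^T *m D^T by rewrite -!trmx_mul DJ.
rewrite HE mulmxDr mulmxDl mulmx_sumr mulmx_suml opprD addrACA -sumrB big1 ?addr0 => [|b _].
  rewrite -scalemxAr -scalemxAl; congr (_ *: _).
  by rewrite !mulmxA DJ -[X in _ - X]mulmxA DJT mulmxBr mulmxBl !mulmxA.
by rewrite -scalemxAr -scalemxAl KJ subrr.
Qed.

End HolomorphicCalculus.

(** * Weak divergence identity in a chart *)

Section WeakDivergence.
Variable R : realType.

Definition cube m (p : 'rV[R]_m) (r : R) : set 'rV[R]_m := [set y | `|y - p| < r].

Lemma cube_open m (p : 'rV[R]_m) r : open (cube p r).
Proof.
have -> : cube p r = ball p r.
  by apply/seteqP; split => y; rewrite /cube /= -ball_normE /ball_ /= distrC.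
exact: ball_open.
Qed.

(** A product of one-dimensional steps fits the cubes of the max norm: it is 1 on the cube of radius
    [r] and 0 off the cube of radius [2 * r]. *)
Definition bump m (p : 'rV[R]_m) (r : R) (y : 'rV[R]_m) : R :=
  \prod_a (step (2 - r^-1 * (y 0 a - p 0 a)) * step (2 + r^-1 * (y 0 a - p 0 a))).

Lemma bump_C1 m (p : 'rV[R]_m) r : Ck_on 1 setT (bump p r).
Proof.
apply: (C1_prod openT) => a.
have Cl c : Ck_on 1 setT (fun y : 'rV[R]_m => 2 + c * (y 0 a - p 0 a)).
  apply: (C1D openT (C1_cst _ _)).
  apply: (C1Z openT); apply: (C1B openT); first exact: C1_coord.
  exact: C1_cst.
apply: (C1M openT); apply: (C1_step openT); last exact: Cl.
by apply: (Ck_on_eq openT _ (Cl (- r^-1))) => y _; rewrite mulNr.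
Qed.

Lemma bump_ge0 m (p : 'rV[R]_m) r y : 0 <= bump p r y.
Proof. by apply: prodr_ge0 => a _; apply: mulr_ge0; exact: step_ge0. Qed.

Lemma bump_le1 m (p : 'rV[R]_m) r y : bump p r y <= 1.
Proof.
apply: prodr_ile1 => a _; rewrite mulr_ge0 ?step_ge0 //=.
by rewrite mulr_ile1 ?step_ge0 ?step_le1.
Qed.

Lemma bump1 m (p : 'rV[R]_m) r y : 0 < r -> `|y - p| <= r -> bump p r y = 1.
Proof.
move=> r0 yr; apply: big1 => a _.
have : `|r^-1 * (y 0 a - p 0 a)| <= 1.
  rewrite normrM gtr0_norm ?invr_gt0 // mulrC ler_pdivrMr // mul1r.
  by apply: le_trans yr; have := coord_le (y - p) a; rewrite !mxE.
rewrite ler_norml => /andP[l1 l2].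
by rewrite !step_ge1 ?mulr1 //; lra.
Qed.

Lemma bump0 m (p : 'rV[R]_m) r y : 0 < r -> 2 * r <= `|y - p| -> bump p r y = 0.
Proof.
move=> r0 yr; have [|a] := @norm_coord _ _ (y - p) (2 * r) _ yr; first by rewrite mulr_gt0.
rewrite !mxE => ya; rewrite /bump (bigD1 a) //=.
suff -> : step (2 - r^-1 * (y 0 a - p 0 a)) * step (2 + r^-1 * (y 0 a - p 0 a)) = 0.
  by rewrite mul0r.
have : 2 <= `|r^-1 * (y 0 a - p 0 a)|.
  by rewrite normrM gtr0_norm ?invr_gt0 // mulrC ler_pdivlMr.
have [l0|l0] := lerP 0 (r^-1 * (y 0 a - p 0 a)).
  by rewrite (ger0_norm l0) => l2; rewrite step_le0 ?mul0r //; lra.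
by rewrite (ltr0_norm l0) => l2; rewrite [X in _ * X]step_le0 ?mulr0 //; lra.
Qed.

Lemma cont_norm_sub m (p : 'rV[R]_m) : continuous (fun y : 'rV[R]_m => `|y - p|).
Proof.
move=> y; rewrite /continuous_at.
apply/(@cvgrPdist_le _ _ _ _ (nbhs_filter (y : 'rV[R]_m))) => e e0.
apply: (open_near (@cube_open m y e)) => [|z]; rewrite /cube /= ?subrr ?normr0 // distrC.
move=> /ltW; apply: le_trans.
by apply: le_trans (ler_dist_dist _ _) _; rewrite opprB addrA subrK.
Qed.

Lemma Ck_onD m k (V : set 'rV[R]_m) f g : open V -> Ck_on k V f -> Ck_on k V g ->
  Ck_on k V (fun y => f y + g y).
Proof.
move=> Vo; elim: k f g => [|k IH] f g [cf df] [cg dg].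
  by split=> // y Vy; apply: continuousD; [exact: cf | exact: cg].
split=> [y Vy|a]; first by apply: continuousD; [exact: cf | exact: cg].
have [dfa Cfa] := df a; have [dga Cga] := dg a.
split=> [y Vy|]; first by apply: derivableD; [exact: dfa | exact: dga].
apply: (Ck_on_eq Vo _ (IH _ _ Cfa Cga)) => y Vy.
by rewrite partialD //; [exact: dfa | exact: dga].
Qed.

Lemma Ck_on_cst m k (V : set 'rV[R]_m) c : Ck_on k V (fun=> c).
Proof.
elim: k c => [|k IH] c; first by split=> // y _; exact: cst_continuous.
split=> [y _|a]; first exact: cst_continuous.
split=> [y _|]; first exact: derivable_cst.
by have -> : partial a (fun=> c) = fun=> 0 by apply/funext => y; exact: partial_cst.
Qed.

Lemma Ck_onZ m k (V : set 'rV[R]_m) c f : open V -> Ck_on k V f ->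
  Ck_on k V (fun y => f y * c).
Proof.
move=> Vo; elim: k f => [|k IH] f [cf df].
  by split=> // y Vy; apply: continuousM; [exact: cf | exact: cst_continuous].
split=> [y Vy|a]; first by apply: continuousM; [exact: cf | exact: cst_continuous].
have [dfa Cfa] := df a.
have dc y : derivable ((fun=> c) : 'rV[R]_m -> R^o) y (delta_mx 0 a) by exact: derivable_cst.
split=> [y Vy|]; first by apply: derivableM; [exact: dfa | exact: dc].
apply: (Ck_on_eq Vo _ (IH _ Cfa)) => y Vy.
by rewrite (partialM (dfa y Vy) (dc y)) partial_cst mulr0 add0r mulrC.
Qed.

Lemma Ck_on_sum m k (V : set 'rV[R]_m) (I : Type) (r : seq I) (F : I -> 'rV[R]_m -> R) :
  open V -> (forall i, Ck_on k V (F i)) -> Ck_on k V (fun y => \sum_(i <- r) F i y).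
Proof.
move=> Vo CF; elim: r => [|i r IH].
  have -> : (fun y => \sum_(i <- [::]) F i y) = fun=> 0 by apply/funext => y; rewrite big_nil.
  exact: Ck_on_cst.
have -> : (fun y => \sum_(j <- i :: r) F j y) = fun y => F i y + \sum_(j <- r) F j y.
  by apply/funext => y; rewrite big_cons.
exact: Ck_onD.
Qed.

Lemma C1_extend m (p : 'rV[R]_m) s r f : s < r -> Ck_on 1 (cube p r) f ->
  (forall y, s <= `|y - p| -> f y = 0) -> Ck_on 1 setT f.
Proof.
move=> sr Cf f0; apply: Ck_on_cover => x _.
have [xr|xr] := ltP `|x - p| r; first by exists (cube p r).
exists [set y : 'rV[R]_m | s < `|y - p|]; split; first exact: lt_le_trans xr.
apply: (Ck_on_eq (f := fun=> 0)); last exact: C1_cst.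
  have cn := @cont_norm_sub m p.
  by apply: (open_comp (D := [set t : R | s < t])) => [y _|]; [exact: cn | exact: open_gt].
by move=> y /= sy; rewrite f0 // ltW.
Qed.

Lemma C1_bump_mul m (p : 'rV[R]_m) r f : 0 < r -> Ck_on 1 (cube p (3 * r)) f ->
  Ck_on 1 setT (fun y => bump p r y * f y).
Proof.
move=> r0 Cf; apply: (@C1_extend _ p (2 * r) (3 * r)); first by lra.
  by apply: (C1M (@cube_open _ p _) _ Cf); apply: Ck_on_sub (bump_C1 p r).
by move=> y yr; rewrite bump0 ?mul0r.
Qed.

Lemma Cc_local m (p : 'rV[R]_m) r f : continuous f ->
  (forall y, r <= `|y - p| -> f y = 0) -> Cc f.
Proof.
move=> cf f0; split=> //; exists (r + `|p|) => y yr; apply: f0.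
have := lerB_normD (y - p) p; have := ler_normD (y - p) p; rewrite subrK.
by move=> h _; lra.
Qed.

Lemma C1_continuous m (f : 'rV[R]_m -> R) : Ck_on 1 setT f -> continuous f.
Proof. by move=> Cf y; exact: (C1_cont Cf). Qed.

Lemma C1_partial_continuous m (f : 'rV[R]_m -> R) a :
  Ck_on 1 setT f -> continuous (partial a f).
Proof. by move=> Cf y; exact: (C1_contd Cf). Qed.

Lemma partial_local m (f : 'rV[R]_m -> R) p r a : (forall y, r <= `|y - p| -> f y = 0) ->
  forall y, r < `|y - p| -> partial a f y = 0.
Proof.
move=> f0 y yr; rewrite -(partial_cst a 0 y); apply: near_partial.
have cn := @cont_norm_sub m p y.
have : \forall z \near y, r < `|z - p| by exact: (cvgr_gt _ cn).
by apply: filterS => z /ltW; exact: f0.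
Qed.

Lemma moll_unif m (F : 'rV[R]_m -> R) e : Cc F -> 0 < e -> exists2 d, 0 < d &
  forall s, 0 < s -> s < d -> forall x, `|moll s F x - F x| <= e.
Proof.
move=> [cF [r sF]] e0; have [d d0 H] := unif_cont cF sF e0.
exists d => // s s0 sd x; apply: moll_avg => // v vs.
by apply: H; rewrite addrC addKr (lt_trans vs).
Qed.

Lemma moll_eq m (F G : 'rV[R]_m -> R) s x : 0 < s -> continuous F -> continuous G ->
  (forall v, `|v| < s -> F (x + v) = G (x + v)) -> moll s F x = moll s G x.
Proof.
move=> s0 cF cG FG; rewrite /moll !convE //; try exact: Cc_nkern.
congr Lint; apply/funext => v; have [vs|vs] := ltP `|v| s; first by rewrite FG.
by rewrite (nkern_supp s0 vs) !mulr0.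
Qed.

Lemma conj_diff_Ck n k (V : set 'rV[R]_(n + n)) v e : open V -> Ck_on k.+1 V v ->
  Ck_on k V (fun y => (diff1 v y *m (Jmx R n)^T) 0 e).
Proof.
move=> Vo Cv.
have -> : (fun y => (diff1 v y *m (Jmx R n)^T) 0 e) =
    (fun y => \sum_b partial b v y * Jmx R n e b).
  by apply/funext => z; rewrite mxE; apply: eq_bigr => d _; rewrite mxE [X in _ * X]mxE.
by apply: Ck_on_sum => // d; apply: Ck_onZ => //; exact: (Ck_partial d Cv).
Qed.

Lemma i_ddbar_entry n (v : 'rV[R]_(n + n) -> R) a b :
  (fun y => i_ddbar v y a b) =
  (fun y => - 2^-1 * (partial a (fun y => (diff1 v y *m (Jmx R n)^T) 0 b) y
                      - partial b (fun y => (diff1 v y *m (Jmx R n)^T) 0 a) y)).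
Proof.
by apply/funext => y; rewrite /i_ddbar [LHS]mxE [X in - X]mxE [X in _ * X]mxE mulNr.
Qed.

Lemma i_ddbar_cont n (V : set 'rV[R]_(n + n)) v a b y : open V -> Ck_on 2 V v -> V y ->
  {for y, continuous (fun y => i_ddbar v y a b)}.
Proof.
move=> Vo Cv Vy; rewrite i_ddbar_entry.
apply: (@continuousM R _ (fun=> _)); first exact: cst_continuous.
by apply: (@continuousB R); apply: (C1_contd _ Vy); exact: conj_diff_Ck.
Qed.

Lemma i_ddbar_C1 n (V : set 'rV[R]_(n + n)) v a b : open V -> Ck_on 3 V v ->
  Ck_on 1 V (fun y => i_ddbar v y a b).
Proof.
move=> Vo Cv; rewrite i_ddbar_entry; apply: (C1Z Vo); apply: (C1B Vo).
  exact: (Ck_partial a (conj_diff_Ck b Vo Cv)).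
exact: (Ck_partial b (conj_diff_Ck a Vo Cv)).
Qed.

Lemma closed_i_ddbar n (V : set 'rV[R]_(n + n)) v : open V -> Ck_on 3 V v ->
  closed_form (i_ddbar v) V.
Proof.
move=> Vo Cv x Vx a b c.
have Ca e : Ck_on 2 V (fun y => (diff1 v y *m (Jmx R n)^T) 0 e) by exact: conj_diff_Ck.
rewrite !i_ddbar_entry; set al := fun e y => (diff1 v y *m (Jmx R n)^T) 0 e in Ca.
rewrite -/(al a) -/(al b) -/(al c).
have Cd e a' : Ck_on 1 V (partial a' (al e)) by exact: (Ck_partial a' (Ca e)).
have D e a' d := Ck_derivable (a := d) (Cd e a') Vx.
have P e a' b' : partial e (fun y => - 2^-1 * (partial a' (al b') y - partial b' (al a') y)) x =
    - 2^-1 * (partial e (partial a' (al b')) x - partial e (partial b' (al a')) x).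
  rewrite (partialM (Ck_derivable (C1_cst V _) Vx)
    (Ck_derivable (C1B Vo (Cd b' a') (Cd a' b')) Vx)).
  by rewrite partial_cst mulr0 addr0 (partialB (D _ _ _) (D _ _ _)).
rewrite !P -!mulrDr.
rewrite (partial_sym a b Vo (Ca c) Vx) (partial_sym a c Vo (Ca b) Vx).
rewrite (partial_sym b c Vo (Ca a) Vx).
move: (partial _ _ _) (partial _ (partial _ (al b)) _) (partial _ (partial _ (al a)) _).
by move=> u1 u2 u3; ring.
Qed.

Lemma sqrt_inv_continuous (T : topologicalType) k (W : T -> 'M[R]_k) x a c :
  (forall i j, {for x, continuous (fun y => W y i j)}) -> 0 < \det (W x) ->
  {for x, continuous (fun y => Num.sqrt (\det (W y)) * invmx (W y) a c)}.
Proof.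
move=> cW d0; apply: (@continuousM R).
  apply: (@continuous_comp _ _ _ (fun y => \det (W y)) Num.sqrt); first exact: cont_det.
  exact: sqrt_continuous.
by apply: cont_invmx => //; rewrite unitmxE unitfE gt_eqF.
Qed.

Lemma mxentry_le p q (A : 'M[R]_(p, q)) e : 0 <= e ->
  (forall a b, `|A a b| <= e) -> `|A| <= e.
Proof.
move=> e0 H; rewrite [leLHS]/Num.norm /= mx_normrE.
by apply/bigmax_leP; split => // -[a b] _; exact: H.
Qed.

Lemma cont_extend m (p : 'rV[R]_m) s r (f : 'rV[R]_m -> R) : s < r ->
  (forall y, cube p r y -> {for y, continuous f}) ->
  (forall y, s <= `|y - p| -> f y = 0) -> continuous f.
Proof.
move=> sr cf f0 x; have [xr|xr] := ltP `|x - p| r; first exact: cf.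
have : \forall y \near x, s < `|y - p|.
  exact: (cvgr_gt _ (@cont_norm_sub m p x) _ (lt_le_trans sr xr)).
move=> H; apply: (@near_eq_cont R _ (fun=> 0)); last exact: cst_continuous.
by apply: filterS H => y /ltW /f0.
Qed.

(** The kernel is of class C^1, so mollifying gains one derivative: one falls on [F], the other on
    the kernel. *)
Lemma Ck2_moll m (F : 'rV[R]_m -> R) s (V : set 'rV[R]_m) : 0 < s -> Ck_on 1 setT F ->
  Ck_on 2 V (moll s F).
Proof.
move=> s0 CF; have C := moll_C1 s0 (C1_continuous CF).
split=> [y _|a]; first exact: (C1_continuous C).
split=> [y _|]; first exact: (Ck_derivable C).
have -> : partial a (moll s F) = moll s (partial a F).
  by apply/funext => y; exact: partial_moll.
exact: (Ck_on_sub (@subsetT _ V) (moll_C1 s0 (C1_partial_continuous CF))).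
Qed.

Lemma closed_formD m (V : set 'rV[R]_m) (W1 W2 : 'rV[R]_m -> 'M[R]_m) :
  (forall a b, Ck_on 1 V (fun y => W1 y a b)) -> (forall a b, Ck_on 1 V (fun y => W2 y a b)) ->
  closed_form W1 V -> closed_form W2 V -> closed_form (fun y => W1 y + W2 y) V.
Proof.
move=> C1 C2 c1 c2 x Vx a b c.
have E i j d : partial d (fun y => (W1 y + W2 y) i j) x =
    partial d (fun y => W1 y i j) x + partial d (fun y => W2 y i j) x.
  have -> : (fun y => (W1 y + W2 y) i j) = (fun y => W1 y i j + W2 y i j).
    by apply/funext => y; rewrite mxE.
  exact: (partialD (Ck_derivable (C1 i j) Vx) (Ck_derivable (C2 i j) Vx)).
rewrite !E; have := c1 x Vx a b c; have := c2 x Vx a b c.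
move: (partial _ _ _) (partial _ _ _) (partial _ _ _) (partial _ _ _) (partial _ _ _) (partial _ _ _).
by move=> *; lra.
Qed.

Lemma sub_shift (Z : zmodType) (A B C D : Z) : A - B = C - D + ((A - C) + (D - B)).
Proof. by rewrite addrACA [C + _]addrC subrK addKr. Qed.

(** The volume density times the inverse of the form: for smooth closed [Om] its columns are the
    divergence-free fields of [symplectic_divergence]. *)
Definition conormal m (Om : 'rV[R]_m -> 'M[R]_m) a c (y : 'rV[R]_m) : R :=
  Num.sqrt (\det (Om y)) * invmx (Om y) a c.

Definition flux m (Om : 'rV[R]_m -> 'M[R]_m) chi c (y : 'rV[R]_m) : R :=
  \sum_a conormal Om a c y * partial a chi y.

(** * Approximation by smooth closed forms *)

Section Approximation.
Variables (n : nat) (p : 'rV[R]_(n + n)) (r : R) (V : set 'rV[R]_(n + n)).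
Variables (W : 'rV[R]_(n + n) -> 'M[R]_(n + n)) (u : 'rV[R]_(n + n) -> R).
Hypotheses (r0 : 0 < r) (Vo : open V) (pV : cube p (6 * r) `<=` V).
Hypothesis CW : forall a b, Ck_on 1 V (fun y => W y a b).
Hypothesis rW : forall y, V y -> real11 (W y).
Hypothesis clW : closed_form W V.
Hypothesis Cu : Ck_on 2 V u.
Let Om y := W y + i_ddbar u y.
Hypothesis dOm : forall y, V y -> 0 < \det (Om y).
Let J := Jmx R n.
(** The form obtained when the Hessian of [u] is altered by [D]; closeness of forms is thus reduced
    to closeness of Hessians. *)
Let pert (D : 'M[R]_(n + n)) y := Om y + 2^-1 *: (J *m D - D *m J^T).
Let N := cube p (3 / 2 * r).
(** As [b] is 1 on the cube of radius [2 * r], mollifying [b u] at a scale below [r / 2] sees only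
    [u] at points of [N]. *)
Let b := bump p (2 * r).
Let us s := moll s (fun y => b y * u y).
Let fa a y := b y * partial a u y.

Lemma cubeS s t : s <= t -> cube p s `<=` cube p t.
Proof. by move=> st y /lt_le_trans; apply. Qed.

Lemma NV : N `<=` V.
Proof. by move=> y Ny; apply: pV; apply: cubeS Ny; have := r0; lra. Qed.

Lemma Cf0 : Ck_on 1 setT (fun y => b y * u y).
Proof.
apply: C1_bump_mul; first by have := r0; lra.
by apply: Ck_on_sub (Ck_onW Cu) => y; rewrite mulrA; move=> Ny; apply: pV; apply: cubeS Ny; have := r0; lra.
Qed.

Lemma Cfa a : Ck_on 1 setT (fa a).
Proof.
apply: C1_bump_mul; first by have := r0; lra.
by apply: Ck_on_sub (Ck_partial a Cu) => y; rewrite mulrA; move=> Ny; apply: pV; apply: cubeS Ny; have := r0; lra.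
Qed.

Lemma b1 y : `|y - p| < 2 * r -> \forall z \near y, b z = 1.
Proof.
move=> yr; apply: (open_near (@cube_open _ p (2 * r)) yr) => z /ltW zr.
by apply: bump1 => //; have := r0; lra.
Qed.

Lemma partial_f a y : `|y - p| < 2 * r -> partial a (fun y => b y * u y) y = fa a y.
Proof.
move=> yr; rewrite /fa (nbhs_singleton (b1 yr)) mul1r; apply: near_partial.
by apply: filterS (b1 yr) => z ->; rewrite mul1r.
Qed.

Lemma partial_fa a c y : `|y - p| < 2 * r -> partial c (fa a) y = partial c (partial a u) y.
Proof.
move=> yr; apply: near_partial.
by apply: filterS (b1 yr) => z; rewrite /fa => ->; rewrite mul1r.
Qed.

Lemma partial_us s a y : 0 < s -> s < r / 2 -> N y -> partial a (us s) y = moll s (fa a) y.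
Proof.
move=> s0 sr Ny; rewrite (partial_moll _ _ s0 Cf0).
apply: moll_eq => // [||v vs]; first exact: (C1_partial_continuous Cf0).
  exact: (C1_continuous (Cfa a)).
apply: partial_f; rewrite addrAC; apply: le_lt_trans (ler_normD _ _) _.
by move: Ny; rewrite /N /cube /= => Ny; have := r0; lra.
Qed.

(** On [N] each first derivative of the mollified function is the mollification of the C^1 function
    [fa a], hence of class C^2. The smooth divergence identity needs this third derivative, since it
    differentiates [i_ddbar]. *)
Lemma us_C3 s : 0 < s -> s < r / 2 -> Ck_on 3 N (us s).
Proof.
move=> s0 sr; have C := moll_C1 s0 (C1_continuous Cf0).
split=> [y _|a]; first exact: (C1_continuous C).
split=> [y _|]; first exact: (Ck_derivable C).
apply: (Ck_on_eq (@cube_open _ p _) _ (@Ck2_moll _ _ s N s0 (Cfa a))) => y Ny.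
by rewrite partial_us.
Qed.

Lemma hess_us s y a c : 0 < s -> s < r / 2 -> N y ->
  hess (us s) y a c = moll s (partial a (fa c)) y.
Proof.
move=> s0 sr Ny; rewrite mxE -(partial_moll _ _ s0 (Cfa c)); apply: near_partial.
by apply: (open_near (@cube_open _ p _) Ny) => z Nz; rewrite partial_us.
Qed.

Lemma Cc_fab a c : Cc (partial a (fa c)).
Proof.
apply: (@Cc_local _ p (5 * r)); first exact: (C1_partial_continuous (Cfa c)).
move=> y yr; apply: (@partial_local _ _ p (4 * r)); last by have := r0; lra.
by move=> z zr; rewrite /fa /b bump0 ?mul0r //; have := r0; lra.
Qed.

Lemma pert_us s : 0 < s -> s < r / 2 -> forall y, N y ->
  W y + i_ddbar (us s) y = pert (hess (us s) y - hess u y) y.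
Proof.
move=> s0 sr y Ny.
rewrite (i_ddbar_hess (@cube_open _ p _) (Ck_onW (us_C3 s0 sr)) Ny).
rewrite /pert /Om (i_ddbar_hess Vo Cu (NV Ny)) -addrA -scalerDr; congr (_ + _ *: _).
rewrite mulmxBr mulmxBl opprB -/J.
exact: sub_shift.
Qed.

Lemma Om_cont y i j : V y -> {for y, continuous (fun y => Om y i j)}.
Proof.
move=> Vy.
have -> : (fun y => Om y i j) = (fun y => W y i j + i_ddbar u y i j).
  by apply/funext => z; rewrite mxE.
apply: (@continuousD R); first exact: (C1_cont (CW i j) Vy).
exact: (@i_ddbar_cont _ V u i j y Vo Cu Vy).
Qed.

Lemma pert_entry_cont y i j : V y ->
  {for ((0 : 'M[R]_(n + n)), y), continuous (fun q : 'M[R]_(n + n) * 'rV[R]_(n + n) => pert q.1 q.2 i j)}.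
Proof.
move=> Vy.
have -> : (fun q : 'M[R]_(n + n) * 'rV[R]_(n + n) => pert q.1 q.2 i j) =
    (fun q => Om q.2 i j + 2^-1 * (\sum_k J i k * q.1 k j - \sum_k q.1 i k * J j k)).
  apply/funext => q; rewrite /pert mxE [X in _ + X]mxE; congr (_ + _ * _).
  rewrite mxE [X in _ + X]mxE mxE; congr (_ - _); rewrite mxE.
  by apply: eq_bigr => k _; rewrite [X in _ * X]mxE.
have c1 k l : {for ((0 : 'M[R]_(n + n)), y),
    continuous (fun q : 'M[R]_(n + n) * 'rV[R]_(n + n) => q.1 k l)}.
  by apply: cont_coord; exact: cvg_fst.
apply: (@continuousD R).
  apply: (@continuous_comp _ _ _ snd (fun y => Om y i j)); first exact: cvg_snd.
  exact: Om_cont.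
apply: (@continuousM R _ (fun=> _)); first exact: cst_continuous.
apply: (@continuousB R).
  apply: (@cont_sum R ('M[R]_(n + n) * 'rV[R]_(n + n))%type _ _ _ (fun k q => J i k * q.1 k j)) => k.
  by apply: (@continuousM R _ (fun=> _)); [exact: cst_continuous | exact: c1].
apply: (@cont_sum R ('M[R]_(n + n) * 'rV[R]_(n + n))%type _ _ _ (fun k q => q.1 i k * J j k)) => k.
by apply: (@continuousM R); [exact: c1 | exact: cst_continuous].
Qed.

Lemma pert0 y : pert 0 y = Om y.
Proof. by rewrite /pert mulmx0 mul0mx subrr scaler0 addr0. Qed.

Lemma N_compact : compact [set y | `|y - p| <= 3 / 2 * r].
Proof.
have -> : [set y | `|y - p| <= 3 / 2 * r] = (fun v => v + p) @` [set x | `|x| <= 3 / 2 * r].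
  apply/seteqP; split => y /=; last by move=> [v vr <-]; rewrite addrK.
  by move=> yr; exists (y - p) => //; rewrite subrK.
apply: continuous_compact; last exact: ball_compact.
apply: continuous_subspaceT => v.
by apply: continuousD => //; exact: cst_continuous.
Qed.

Lemma pert_small e c : 0 < e -> exists2 d, 0 < d & forall D, `|D| < d -> forall y, N y ->
  0 < \det (pert D y) /\
  forall a, `|conormal Om a c y - conormal (pert D) a c y| <= e.
Proof.
move=> e0; set K := [set y | `|y - p| <= 3 / 2 * r].
have KV y : K y -> V y.
  by move=> Ky; apply: pV; rewrite /cube /=; move: Ky; rewrite /K /=; have := r0; lra.
have U1 a : \forall D \near (0 : 'M[R]_(n + n)), forall y, K y ->
    `|conormal (pert 0) a c y - conormal (pert D) a c y| <= e.
  apply: (param_unif (F := fun D y => conormal (pert D) a c y) N_compact) => // y Ky.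
  apply: (@sqrt_inv_continuous _ _ (fun q : 'M[R]_(n + n) * 'rV[R]_(n + n) => pert q.1 q.2)).
    by move=> i j; apply: pert_entry_cont; exact: KV.
  by rewrite /= pert0; exact: dOm (KV y Ky).
(* Dividing by [\det (Om y)] makes the limit the constant 1, so an error of one half keeps the
   determinants positive at all points at once. *)
have U2 : \forall D \near (0 : 'M[R]_(n + n)), forall y, K y ->
    `|\det (pert 0 y) / \det (Om y) - \det (pert D y) / \det (Om y)| <= 2^-1.
  apply: (param_unif (F := fun D y => \det (pert D y) / \det (Om y)) N_compact) => [y Ky|].
    have d0 := dOm (KV y Ky).
    apply: (@continuousM R).
      apply: (@cont_det R _ _ (fun q : 'M[R]_(n + n) * 'rV[R]_(n + n) => pert q.1 q.2)) => i j.
      by apply: pert_entry_cont; exact: KV.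
    apply: (@continuous_comp _ _ _ snd (fun y => (\det (Om y))^-1)); first exact: cvg_snd.
    have d0' : \det (Om y) != 0 by rewrite gt_eqF.
    have cd : {for y, continuous (fun y => \det (Om y))}.
      by apply: cont_det => i j; exact: Om_cont (KV y Ky).
    by first [exact: (@continuousV R _ _ y d0' cd) | exact: (@cvgV R _ _ _ (fun y => \det (Om y)) _ d0' cd) | apply: cvgV].
  by rewrite invr_gt0.
have /nbhs_ballP[d /= d0 H] : nbhs (0 : 'M[R]_(n + n)) (fun D => (forall a y, K y ->
      `|conormal (pert 0) a c y - conormal (pert D) a c y| <= e) /\ (forall y, K y ->
    `|\det (pert 0 y) / \det (Om y) - \det (pert D y) / \det (Om y)| <= 2^-1)).
  have U1' := @filter_forall _ _ _ _ (nbhs_filter (0 : 'M[R]_(n + n))) U1.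
  exact: (@filterI _ _ (nbhs_filter (0 : 'M[R]_(n + n))) _ _ U1' U2).
exists d => // D Dd y Ny; have Ky : K y by exact: ltW.
have [|h1 h2] := H D; first by rewrite -ball_normE /ball_ /= sub0r normrN.
have {}h2 := h2 y Ky; have d1 := dOm (KV y Ky); split.
  move: h2; rewrite pert0 divff ?gt_eqF // ler_norml => /andP[_ h2].
  have : 0 < \det (pert D y) / \det (Om y) by lra.
  by rewrite pmulr_lgt0 // invr_gt0.
by move=> a; have := h1 a y Ky; rewrite /conormal pert0.
Qed.

(* [W + i_ddbar u] is merely continuous; it is the uniform limit of the closed *)
(* smooth forms in which [u] is mollified.                                     *)
Lemma weak_divergence chi c : Ck_on 1 setT chi -> (forall y, r <= `|y - p| -> chi y = 0) ->
  Lint (flux Om chi c) = 0.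
Proof.
move=> Cchi chi0.
have ch0 a y : r < `|y - p| -> partial a chi y = 0 by exact: partial_local.
(* For a C^1 closed form, the flux is the divergence of [chi] times a divergence-free field with
   compact support. *)
have smooth (A : 'rV[R]_(n + n) -> 'M[R]_(n + n)) : (forall i j, Ck_on 1 N (fun y => A y i j)) ->
    (forall y, N y -> 0 < \det (A y)) -> (forall y, N y -> (A y)^T = - A y) -> closed_form A N ->
    Lint (flux A chi c) = 0.
  move=> CA dA tA clA; have No : open N by exact: cube_open.
  have Cn a : Ck_on 1 N (conormal A a c).
    apply: (C1M No); first exact: (C1_sqrt No (C1_det No CA) dA).
    by apply: (C1_invmx No _ _ CA) => y Ny; rewrite unitmxE unitfE gt_eqF ?dA.
  have z0 a y : r <= `|y - p| -> chi y * conormal A a c y = 0 by move=> /chi0 ->; rewrite mul0r.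
  have CX a : Ck_on 1 setT (fun y => chi y * conormal A a c y).
    apply: (@C1_extend _ p r (3 / 2 * r)) => //; first by have := r0; lra.
      by apply: (C1M No _ (Cn a)); exact: Ck_on_sub Cchi.
    exact: z0.
  have CcX a : Cc (fun y => chi y * conormal A a c y).
    exact: (Cc_local (C1_continuous (CX a)) (z0 a)).
  transitivity (Lint (fun y => \sum_a partial a (fun y => chi y * conormal A a c y) y)).
    congr Lint; apply/funext => y; have [yr|yr] := ltP r `|y - p|.
      rewrite [LHS]big1 => [|a _]; last by rewrite ch0 ?mulr0.
      by symmetry; apply: big1 => a _; exact: (partial_local a (z0 a) yr).
    have Ny : N y by rewrite /N /cube /=; have := r0; lra.
    have -> : \sum_a partial a (fun y => chi y * conormal A a c y) y =
        \sum_a (chi y * partial a (conormal A a c) y + conormal A a c y * partial a chi y).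
      apply: eq_bigr => a _.
      by rewrite (partialM (Ck_derivable Cchi _) (Ck_derivable (Cn a) Ny)).
    rewrite big_split /= -mulr_sumr.
    by rewrite (symplectic_divergence c No Ny CA dA tA clA) mulr0 add0r.
  rewrite Lint_sum => [|a]; last exact: (Cc_partial a (CX a) (CcX a)).
  by apply: big1 => a _; exact: (Lint_partial a (CX a) (CcX a)).
have fl0 A y : r < `|y - p| -> flux A chi c y = 0.
  by move=> yr; apply: big1 => a _; rewrite ch0 ?mulr0.
have Ccchi a : Cc (partial a chi) by apply: Cc_partial => //; exact: Cc_local (C1_continuous Cchi) chi0.
have [C C0 HC] := @Lint_bound R (n + n) (2 * r + `|p|).
have [B B0 HB] : exists2 B, 0 <= B & forall y, \sum_a `|partial a chi y| <= B.
  have cs : continuous (fun y => \sum_a `|partial a chi y|).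
    move=> y; apply: (@cont_sum R _ _ _ _ (fun a y => `|partial a chi y|)) => a.
    by have h := C1_partial_continuous (a := a) Cchi (x := y); exact: (cvg_norm h).
  have [B B0 HB] := cont_bounded (2 * r + `|p|) cs.
  exists B => // y; have [yr|yr] := lerP `|y| (2 * r + `|p|).
    by apply: le_trans (HB y yr); exact: ler_norm.
  rewrite big1 // => a _; rewrite ch0 ?normr0 //.
  have := ler_normD (y - p) p; rewrite subrK; have := r0; lra.
have cI (A : 'rV[R]_(n + n) -> 'M[R]_(n + n)) : (forall i j y, N y -> {for y, continuous (fun y => A y i j)}) ->
    (forall y, N y -> 0 < \det (A y)) -> Cc (flux A chi c).
  move=> cA dA.
  have z0 y : 4 / 3 * r <= `|y - p| -> flux A chi c y = 0.
    by move=> yr; apply: fl0; have := r0; lra.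
  apply: (Cc_local _ z0); apply: (cont_extend (r := 3 / 2 * r) _ _ z0) => [|y Ny]; first by have := r0; lra.
  apply: (cont_sum (F := fun a y => conormal A a c y * partial a chi y)) => a.
  apply: (@continuousM R); last exact: (C1_partial_continuous Cchi).
  by apply: sqrt_inv_continuous => [i j|]; [exact: cA | exact: dA].
(* With [chi] fixed, the integrands for [Om] and for the mollified form differ by at most [B e] on a
   common support, and the second integral is zero. *)
have key e : 0 < e -> `|Lint (flux Om chi c)| <= C * B * e.
  move=> e0.
  have [d d0 Hd] : exists2 d, 0 < d & forall D, `|D| < d -> forall y, N y ->
      0 < \det (pert D y) /\ forall a, `|conormal Om a c y - conormal (pert D) a c y| <= e.
    exact: pert_small.
  have [s [s0 sr Hs]] : exists s, [/\ 0 < s, s < r / 2 &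
      forall y, N y -> `|hess (us s) y - hess u y| < d].
    have d2 : 0 < d / 2 by rewrite divr_gt0.
    have H a e' : \forall s \near 0^'+, forall y,
        `|moll s (partial a (fa e')) y - partial a (fa e') y| <= d / 2.
      have [d' d'0 Hd'] := moll_unif (Cc_fab a e') d2.
      near=> s; apply: Hd'; first by near: s; exact: nbhs_right_gt.
      by near: s; exact: nbhs_right_lt.
    have Hex : \forall s \near (0 : R)^'+, ((forall a e' y,
        `|moll s (partial a (fa e')) y - partial a (fa e') y| <= d / 2) /\ 0 < s) /\ s < r / 2.
      near=> s; split; first split.
        by near: s; apply: filter_forall => a; apply: filter_forall => e'; exact: H.
        by near: s; exact: nbhs_right_gt.
      by near: s; apply: nbhs_right_lt; have := r0; lra.
    have [s [[sH s0] sr]] := @filter_ex _ _ (at_right_proper_filter (0 : R)) _ Hex.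
    exists s; split => // y Ny; apply: (@le_lt_trans _ _ (d / 2)); last by lra.
    apply: mxentry_le => [|a e']; first exact: ltW.
    have -> : (hess (us s) y - hess u y) a e' = hess (us s) y a e' - hess u y a e'.
      by move: (hess (us s) y) (hess u y) => A1 A2; rewrite !mxE.
    rewrite (hess_us a e' s0 sr Ny).
    have -> : hess u y a e' = partial a (fa e') y.
      rewrite [LHS]mxE partial_fa //.
      by move: Ny; rewrite /N /cube /=; have := r0; lra.
    exact: sH.
  pose A y := W y + i_ddbar (us s) y.
  have AE y : N y -> A y = pert (hess (us s) y - hess u y) y by exact: pert_us.
  have No : open N by exact: cube_open.
  have C2 := Ck_onW (us_C3 s0 sr).
  have CA i j : Ck_on 1 N (fun y => A y i j).
    have -> : (fun y => A y i j) = (fun y => W y i j + i_ddbar (us s) y i j).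
      by apply/funext => z; rewrite mxE.
    apply: (C1D No); first exact: Ck_on_sub NV (CW i j).
    exact: (i_ddbar_C1 _ _ No (us_C3 s0 sr)).
  have dA y : N y -> 0 < \det (A y).
    by move=> Ny; rewrite AE //; have [] := Hd _ (Hs y Ny) y Ny.
  have tA y : N y -> (A y)^T = - A y.
    move=> Ny; rewrite /A linearD /= opprD.
    by rewrite (rW (NV Ny)).1 (real11_ddbar No C2 Ny).1.
  have clA : closed_form A N.
    apply: closed_formD; last exact: (closed_i_ddbar No (us_C3 s0 sr)).
    - by move=> i j; apply: Ck_on_sub NV (CW i j).
    - by move=> i j; exact: (i_ddbar_C1 _ _ No (us_C3 s0 sr)).
    - by move=> y Ny; exact: clW (NV Ny).
  clearbody A; clear C2.
  have cOm : Cc (flux Om chi c).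
    apply: cI => [i j y Ny|y Ny]; last exact: dOm (NV Ny).
    exact: Om_cont (NV Ny).
  have cA : Cc (flux A chi c).
    by apply: cI => // i j y Ny; exact: (C1_cont (CA i j) Ny).
  have -> : Lint (flux Om chi c) = Lint (fun y => flux Om chi c y - flux A chi c y).
    by rewrite (LintB cOm cA) (smooth A CA dA tA clA) subr0.
  have [cF sF] := CcB cOm cA.
  rewrite -mulrA; apply: HC => // [y yr|y].
    by rewrite !fl0 ?subr0 //; have := ler_normD (y - p) p; rewrite subrK; have := r0; lra.
  have [yr|yr] := ltP r `|y - p|.
    by rewrite !fl0 // subr0 normr0; apply: mulr_ge0 => //; exact: ltW.
  have Ny : N y by rewrite /N /cube /=; have := r0; lra.
  rewrite /flux -sumrB; apply: le_trans (ler_norm_sum _ _ _) _.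
  apply: (@le_trans _ _ (\sum_a `|partial a chi y| * e)); last first.
    by rewrite -mulr_suml; apply: ler_wpM2r (HB y); exact: ltW.
  apply: ler_sum => a _; rewrite -mulrBl normrM mulrC; apply: ler_wpM2l => //.
  have [_ /(_ a)] := Hd _ (Hs y Ny) y Ny.
  by rewrite /conormal AE.
have : `|Lint (flux Om chi c)| <= 0 by apply: (small_le (C := C * B)) => //; exact: mulr_ge0.
by rewrite normr_le0 => /eqP.
Unshelve. all: by end_near.
Qed.

End Approximation.

End WeakDivergence.

(** * Trace inequalities and the weak inequality in a chart *)

Section ChartInequality.
Variable R : realType.

Lemma real11_comm n (W : 'M[R]_(n + n)) : real11 W -> W *m Jmx R n = Jmx R n *m W.
Proof.
by move=> [_ e]; rewrite -[in LHS]e -!mulmxA JmxKV mulmx1.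
Qed.

Lemma real11D n (W1 W2 : 'M[R]_(n + n)) : real11 W1 -> real11 W2 -> real11 (W1 + W2).
Proof.
move=> [t1 j1] [t2 j2]; split; first by rewrite linearD /= t1 t2 opprD.
by rewrite mulmxDr mulmxDl j1 j2.
Qed.

Lemma metricD n (W1 W2 : 'M[R]_(n + n)) : metric (W1 + W2) = metric W1 + metric W2.
Proof. by rewrite /metric mulmxDl. Qed.

Lemma invmx_metric n (W : 'M[R]_(n + n)) : real11 W -> W \in unitmx ->
  invmx (metric W) = invmx W *m Jmx R n.
Proof.
move=> rW Wu; have Ju : (Jmx R n)^T \in unitmx.
  by rewrite unitmx_tr unitmxE det_Jmx unitr1.
have Gu : metric W \in unitmx by rewrite /metric unitmx_mul Wu.
have e : metric W *m (invmx W *m Jmx R n) = 1%:M.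
  rewrite /metric mulmxA -[W *m _ *m _]mulmxA.
  have -> : (Jmx R n)^T *m invmx W = invmx W *m (Jmx R n)^T.
    have c : W *m (Jmx R n)^T = (Jmx R n)^T *m W.
      by rewrite Jmx_tr mulmxN mulNmx real11_comm.
    apply: (can_inj (mulKmx Wu)); rewrite mulmxA c -mulmxA mulmxV // mulmx1.
    by rewrite mulmxA mulmxV // mul1mx.
  by rewrite mulmxA mulmxV // mul1mx JmxKV.
by rewrite -[LHS]mulmx1 -e mulmxA mulVmx // mul1mx.
Qed.

Lemma trace_J n (A H : 'M[R]_(n + n)) : Jmx R n *m A *m (Jmx R n)^T = A ->
  \tr (A *m (Jmx R n *m H *m (Jmx R n)^T)) = \tr (A *m H).
Proof.
move=> e; rewrite !mulmxA mxtrace_mulC !mulmxA.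
have -> : (Jmx R n)^T *m A *m Jmx R n = A.
  by rewrite -[in LHS]e !mulmxA JmxKV mul1mx -!mulmxA JmxKV mulmx1.
by [].
Qed.

Lemma metric_inv_J n (W : 'M[R]_(n + n)) : real11 W -> form_pos W ->
  Jmx R n *m invmx (metric W) *m (Jmx R n)^T = invmx (metric W).
Proof.
move=> rW pW; apply: inv_invariant => //; rewrite ?Jmx_tr ?Jmx_sq //.
  exact: posdef_metric.
rewrite -Jmx_tr /metric !mulmxA.
have [_ e] := rW; rewrite e //.
Qed.

Lemma sqrt_det_gt0 n (W : 'M[R]_(n + n)) : real11 W -> form_pos W -> 0 < \det W.
Proof. by move=> rW pW; rewrite -det_metric; apply: posdef_det; exact: posdef_metric. Qed.

Lemma trace_ddbar n (V : set 'rV[R]_(n + n)) (W : 'M[R]_(n + n)) h y :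
  open V -> Ck_on 2 V h -> V y -> real11 W -> form_pos W ->
  \tr (invmx (metric W) *m metric (i_ddbar h y)) = \tr (invmx (metric W) *m hess h y).
Proof.
move=> Vo Ch Vy rW pW; rewrite (metric_ddbar Vo Ch Vy) -scalemxAr mulmxDr linearZ /= linearD /=.
by rewrite (trace_J _ (metric_inv_J rW pW)); lra.
Qed.

(** By [wedge_top_det] the hypothesis compares determinants with ratio [expR t ^+ 2], so
    [trace_ge_det] applies with [c = expR (t / n)]. Of the resulting trace, [W] itself accounts for
    exactly [n + n]. *)
Lemma subsolution_trace n (V : set 'rV[R]_(n + n)) (W : 'M[R]_(n + n)) h y (t : R) :
  (0 < n)%N -> open V -> Ck_on 2 V h -> V y -> real11 W -> form_pos W ->
  form_pos (W + i_ddbar h y) -> expR t * wedge_top W <= wedge_top (W + i_ddbar h y) ->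
  (n + n)%:R * (expR (t / n%:R) - 1) <= \tr (invmx (metric W) *m hess h y).
Proof.
move=> n0 Vo Ch Vy rW pW pO; have rO := real11D rW (real11_ddbar Vo Ch Vy).
rewrite (wedge_top_det rW pW) (wedge_top_det rO pO) mulrCA ler_pM2l ?wedge_top_Jmx // => le.
have d1 := sqrt_det_gt0 rW pW; have d2 := sqrt_det_gt0 rO pO.
have := @trace_ge_det R _ (metric W) (metric (W + i_ddbar h y)) (expR (t / n%:R)).
rewrite !det_metric => /(_ _ (posdef_metric rW pW) (posdef_metric rO pO) (expR_ge0 _)).
rewrite addn_gt0 n0 => /(_ isT) H.
have /H : expR (t / n%:R) ^+ (n + n) * \det W <= \det (W + i_ddbar h y).
  have nn : n%:R != 0 :> R by rewrite pnatr_eq0 -lt0n.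
  have E : expR (t / n%:R) ^+ n = expR t.
    by rewrite -expRM_natl; congr expR; rewrite mulrC divfK.
  rewrite exprD E.
  rewrite -(sqr_sqrtr (ltW d1)) -(sqr_sqrtr (ltW d2)) -expr2 -exprMn.
  by rewrite lerXn2r // ?nnegrE ?mulr_ge0 ?expR_ge0 ?sqrtr_ge0.
rewrite metricD mulmxDr linearD /= (trace_ddbar Vo Ch Vy rW pW).
rewrite mulVmx ?posdef_unit //; last exact: posdef_metric.
by rewrite mxtrace1 mulrBr mulr1 lerBlDl.
Qed.

(** The same argument with the two forms exchanged and [c = 1]: [W] is the perturbed form minus
    [i_ddbar u]. *)
Lemma supersolution_trace n (V : set 'rV[R]_(n + n)) (W : 'M[R]_(n + n)) u y :
  (0 < n)%N -> open V -> Ck_on 2 V u -> V y -> real11 W -> form_pos W ->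
  form_pos (W + i_ddbar u y) -> wedge_top (W + i_ddbar u y) <= wedge_top W ->
  \tr (invmx (metric (W + i_ddbar u y)) *m hess u y) <= 0.
Proof.
move=> n0 Vo Cu Vy rW pW pO; have rO := real11D rW (real11_ddbar Vo Cu Vy).
rewrite (wedge_top_det rW pW) (wedge_top_det rO pO) ler_pM2l ?wedge_top_Jmx // => le.
have d1 := sqrt_det_gt0 rW pW; have d2 := sqrt_det_gt0 rO pO.
have := @trace_ge_det R _ (metric (W + i_ddbar u y)) (metric W) 1.
rewrite !det_metric => /(_ _ (posdef_metric rO pO) (posdef_metric rW pW) ler01).
rewrite addn_gt0 n0 expr1n mul1r mulr1 => /(_ isT) H.
have /H : \det (W + i_ddbar u y) <= \det W.
  rewrite -(sqr_sqrtr (ltW d1)) -(sqr_sqrtr (ltW d2)).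
  by rewrite lerXn2r // ?nnegrE ?sqrtr_ge0.
have -> : metric W = metric (W + i_ddbar u y) - metric (i_ddbar u y).
  by rewrite metricD addrK.
rewrite mulmxBr linearB /= (trace_ddbar Vo Cu Vy rO pO).
rewrite mulVmx ?posdef_unit //; last exact: posdef_metric.
by rewrite mxtrace1 lerBrDl gerDr.
Qed.

Section WeakIdentity.
Variables (n : nat) (p : 'rV[R]_(n + n)) (r : R) (V : set 'rV[R]_(n + n)).
Variables (W : 'rV[R]_(n + n) -> 'M[R]_(n + n)) (u h psi : 'rV[R]_(n + n) -> R).
Hypotheses (r0 : 0 < r) (Vo : open V) (pV : cube p (6 * r) `<=` V).
Hypothesis CW : forall a b, Ck_on 1 V (fun y => W y a b).
Hypothesis rW : forall y, V y -> real11 (W y).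
Hypothesis clW : closed_form W V.
Hypotheses (Cu : Ck_on 2 V u) (Ch : Ck_on 2 V h).
Let Om y := W y + i_ddbar u y.
Hypothesis pOm : forall y, V y -> form_pos (Om y).
Hypothesis Cpsi : Ck_on 1 setT psi.
Hypothesis psi0 : forall y, r <= `|y - p| -> psi y = 0.

Definition grad_term y :=
  Num.sqrt (\det (Om y)) * bil (invmx (metric (Om y))) (diff1 psi y) (diff1 h y).

Definition trace_term y :=
  Num.sqrt (\det (Om y)) * \tr (invmx (metric (Om y)) *m hess h y).

Lemma rOm y : V y -> real11 (Om y).
Proof. by move=> Vy; apply: real11D (rW Vy) _; exact: (real11_ddbar Vo Cu Vy). Qed.

Lemma dOm y : V y -> 0 < \det (Om y).
Proof. by move=> Vy; apply: sqrt_det_gt0; [exact: rOm | exact: pOm]. Qed.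

(** Since [G^-1 = Om^-1 J], pairing the components of [psi J dh] with the divergence-free columns of
    [Om^-1] assembles the divergence of [psi G^-1 dh] without any derivative of [Om]. *)
Let chi d y := psi y * \sum_b Jmx R n d b * partial b h y.

Lemma chi_near d : Ck_on 1 V (fun y => \sum_b Jmx R n d b * partial b h y).
Proof.
by apply: (C1_sum Vo) => b; apply: (C1Z Vo); exact: (Ck_partial b Ch).
Qed.

Lemma chi0 d y : r <= `|y - p| -> chi d y = 0.
Proof. by move=> yr; rewrite /chi psi0 ?mul0r. Qed.

Lemma chi_C1 d : Ck_on 1 setT (chi d).
Proof.
apply: (@C1_extend _ _ p r (6 * r)); first by have := r0; lra.
  apply: (C1M (@cube_open _ _ p _)); first exact: Ck_on_sub Cpsi.
  exact: (Ck_on_sub pV (chi_near d)).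
exact: chi0.
Qed.

Lemma sum_flux y : \sum_d flux Om (chi d) d y = grad_term y + psi y * trace_term y.
Proof.
have [yr|yr] := ltP r `|y - p|.
  rewrite /grad_term psi0 ?ltW // mul0r addr0.
  have -> : diff1 psi y = 0.
    by apply/rowP => a; rewrite !mxE (partial_local a psi0 yr).
  rewrite /bil !mul0mx mxE mulr0 big1 // => d _; apply: big1 => a _.
  by rewrite (partial_local a (@chi0 d) yr) mulr0.
have Vy : V y by apply: pV; rewrite /cube /=; have := r0; lra.
have HT := hess_sym Vo Ch Vy.
have Ou : Om y \in unitmx by rewrite unitmxE unitfE gt_eqF ?dOm.
have GE a b : invmx (metric (Om y)) a b = \sum_d invmx (Om y) a d * Jmx R n d b.
  by rewrite (invmx_metric (rOm Vy) Ou) mxE.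
have PE d a : partial a (chi d) y = partial a psi y * (\sum_b Jmx R n d b * partial b h y)
   + psi y * (\sum_b Jmx R n d b * hess h y a b).
  rewrite (partialM (Ck_derivable Cpsi I) (Ck_derivable (chi_near d) Vy)) addrC.
  congr (_ + _); first by rewrite mulrC.
  rewrite partial_sum => [|b]; last exact: (Ck_derivable (C1Z Vo _ (Ck_partial b Ch)) Vy).
  congr (_ * _); apply: eq_bigr => b _.
  rewrite (partialM (Ck_derivable (C1_cst V _) Vy) (Ck_derivable (Ck_partial b Ch) Vy)).
  by rewrite partial_cst mulr0 addr0 [hess _ _ _ _]mxE.
transitivity (Num.sqrt (\det (Om y)) *
    (\sum_a \sum_b invmx (metric (Om y)) a b *
       (partial a psi y * partial b h y + psi y * hess h y a b))); last first.
  rewrite /grad_term /trace_term bil_sum mulrCA -mulrDr; congr (_ * _).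
  have -> : \tr (invmx (metric (Om y)) *m hess h y) =
      \sum_a \sum_b invmx (metric (Om y)) a b * hess h y a b.
    apply: eq_bigr => a _; rewrite mxE; apply: eq_bigr => b _.
    by rewrite (sym_entry b a HT).
  rewrite mulr_sumr -big_split /=; apply: eq_bigr => a _.
  rewrite mulr_sumr -big_split /=; apply: eq_bigr => b _.
  by rewrite [diff1 _ _ _ _]mxE [diff1 h _ _ _]mxE; ring.
rewrite mulr_sumr /flux exchange_big /=; apply: eq_bigr => a _.
transitivity (\sum_d \sum_b Num.sqrt (\det (Om y)) * (invmx (Om y) a d * Jmx R n d b) *
       (partial a psi y * partial b h y + psi y * hess h y a b)).
  apply: eq_bigr => d _; rewrite PE /conormal !mulr_sumr -big_split /= mulr_sumr.
  by apply: eq_bigr => b _; ring.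
rewrite exchange_big /= mulr_sumr; apply: eq_bigr => b _.
by rewrite GE mulrA mulr_sumr mulr_suml.
Qed.

Lemma weak_identity : Lint (fun y => grad_term y + psi y * trace_term y) = 0.
Proof.
have Cf d : Cc (flux Om (chi d) d).
  have z0 y : 2 * r <= `|y - p| -> flux Om (chi d) d y = 0.
    move=> yr; apply: big1 => a _; rewrite (partial_local a (@chi0 d)) ?mulr0 //.
    by have := r0; lra.
  apply: (Cc_local _ z0); apply: (cont_extend (r := 6 * r) _ _ z0) => [|y Ny].
    by have := r0; lra.
  apply: (cont_sum (F := fun a y => conormal Om a d y * partial a (chi d) y)) => a.
  apply: (@continuousM R); last exact: (C1_partial_continuous (chi_C1 d)).
  apply: sqrt_inv_continuous => [i j|]; last exact: dOm (pV Ny).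
  exact: (Om_cont Vo CW Cu (pV Ny)).
have -> : (fun y => grad_term y + psi y * trace_term y) =
    (fun y => \sum_d flux Om (chi d) d y) by apply/funext => y; rewrite sum_flux.
rewrite Lint_sum //; apply: big1 => d _.
exact: (weak_divergence r0 Vo pV CW rW clW Cu dOm d (chi_C1 d) (@chi0 d)).
Qed.

Lemma weak_inequality (k : 'rV[R]_(n + n) -> R) : (forall y, 0 <= psi y) ->
  (forall y, V y -> {for y, continuous k}) ->
  (forall y, V y -> k y <= trace_term y) ->
  Cc grad_term /\ Lint grad_term <= - Lint (fun y => psi y * k y).
Proof.
move=> psi_ge0 ck kle.
have inv_cont y a b : V y -> {for y, continuous (fun y => invmx (metric (Om y)) a b)}.
  move=> Vy; apply: cont_invmx => [i j|]; last by rewrite unitmxE det_metric unitfE gt_eqF ?dOm.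
  have -> : (fun y => metric (Om y) i j) = (fun y => \sum_k Om y i k * (Jmx R n)^T k j).
    by apply/funext => z; rewrite /metric mxE.
  apply: (@cont_sum R _ _ _ _ (fun k y => Om y i k * (Jmx R n)^T k j)) => l.
  apply: (@continuousM R _ _ (fun=> _)); last exact: cst_continuous.
  exact: (Om_cont Vo CW Cu Vy).
have sqrt_cont y : V y -> {for y, continuous (fun y => Num.sqrt (\det (Om y)))}.
  move=> Vy; apply: (@continuous_comp _ _ _ (fun y => \det (Om y)) Num.sqrt).
    by apply: cont_det => i j; exact: (Om_cont Vo CW Cu Vy).
  exact: sqrt_continuous.
have local (f : 'rV[R]_(n + n) -> R) : (forall y, 2 * r <= `|y - p| -> f y = 0) ->
    (forall y, V y -> {for y, continuous f}) -> Cc f.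
  move=> z0 cf; apply: (Cc_local _ z0); apply: (cont_extend (r := 6 * r) _ _ z0) => [|y /pV /cf //].
  by have := r0; lra.
have dpsi0 y : 2 * r <= `|y - p| -> diff1 psi y = 0.
  by move=> yr; apply/rowP => a; rewrite !mxE (partial_local a psi0) //; have := r0; lra.
have psi0' y : 2 * r <= `|y - p| -> psi y = 0.
  by move=> yr; apply: psi0; have := r0; lra.
have Cg : Cc grad_term.
  apply: local => [y yr|y Vy].
    by rewrite /grad_term dpsi0 // /bil !mul0mx mxE mulr0.
  apply: (@continuousM R); first exact: sqrt_cont.
  have -> : (fun y => bil (invmx (metric (Om y))) (diff1 psi y) (diff1 h y)) =
     (fun y => \sum_a \sum_b partial a psi y * invmx (metric (Om y)) a b * partial b h y).
    apply/funext => z; rewrite bil_sum; apply: eq_bigr => a _; apply: eq_bigr => b _.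
    by rewrite [diff1 _ _ _ _]mxE [diff1 h _ _ _]mxE.
  apply: (@cont_sum R _ _ _ _ (fun a y => \sum_b partial a psi y * invmx (metric (Om y)) a b * partial b h y)) => a.
  apply: (@cont_sum R _ _ _ _ (fun b y => partial a psi y * invmx (metric (Om y)) a b * partial b h y)) => b.
  apply: (@continuousM R); last exact: (C1_contd (Ck_onW Ch) Vy).
  by apply: (@continuousM R); [exact: (C1_partial_continuous Cpsi) | exact: inv_cont].
have Ct : Cc (fun y => psi y * trace_term y).
  apply: local => [y yr|y Vy]; first by rewrite psi0' ?mul0r.
  apply: (@continuousM R); first exact: (C1_continuous Cpsi).
  apply: (@continuousM R); first exact: sqrt_cont.
  have -> : (fun y => \tr (invmx (metric (Om y)) *m hess h y)) =
     (fun y => \sum_a \sum_b invmx (metric (Om y)) a b * partial b (partial a h) y).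
    apply/funext => z; apply: eq_bigr => a _; rewrite mxE; apply: eq_bigr => b _.
    by rewrite [hess _ _ _ _]mxE.
  apply: (@cont_sum R _ _ _ _ (fun a y => \sum_b invmx (metric (Om y)) a b * partial b (partial a h) y)) => a.
  apply: (@cont_sum R _ _ _ _ (fun b y => invmx (metric (Om y)) a b * partial b (partial a h) y)) => b.
  apply: (@continuousM R); first exact: inv_cont.
  exact: (C1_contd (Ck_partial a Ch) Vy).
have Ck : Cc (fun y => psi y * k y).
  apply: local => [y yr|y Vy]; first by rewrite psi0' ?mul0r.
  by apply: (@continuousM R); [exact: (C1_continuous Cpsi) | exact: ck].
split=> //; rewrite -subr_le0 opprK -LintD // -weak_identity.
apply: Lint_le; [exact: CcD | exact: CcD | move=> y].
rewrite lerD2l; have [yr|yr] := leP r `|y - p|; first by rewrite psi0 ?mul0r.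
by apply: ler_wpM2l => //; apply: kle; apply: pV; rewrite /cube /=; have := r0; lra.
Qed.
End WeakIdentity.
End ChartInequality.

(** * Metrics and energies on the manifold *)

Section ManifoldCharts.
Variables (R : realType) (M : ptopologicalType) (n : nat).
Variable X : complex_manifold R M n.
Implicit Types (i j : chart X) (u v : M -> R) (x : M) (y p : 'rV[R]_(n + n)).

Definition trans i j : 'rV[R]_(n + n) -> 'rV[R]_(n + n) := fun y => Defs.coord j (param i y).

Definition ovl i j : set 'rV[R]_(n + n) := chart_cod i `&` param i @^-1` chart_dom j.

Lemma open_nbhs1 (T : topologicalType) (V : set T) (z : T) : open V -> V z -> nbhs z V.
Proof. by move=> Vo Vz; exact: open_nbhs_nbhs. Qed.

Lemma param_preimage_open i (U : set M) : open U -> open (chart_cod i `&` param i @^-1` U).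
Proof.
move=> Uo; rewrite openE => y [cy Uy]; rewrite /interior.
apply: (@filterI _ _ (nbhs_filter (y : 'rV[R]_(n + n)))).
  exact: open_nbhs1 (@chart_cod_open _ _ _ X i) cy.
by apply: (param_continuous cy); exact: open_nbhs1 Uo Uy.
Qed.

Lemma ovl_open i j : open (ovl i j).
Proof. by apply: param_preimage_open; exact: chart_dom_open. Qed.

Lemma trans_cod i j y : ovl i j y -> chart_cod j (trans i j y).
Proof. by move=> [_ d]; exact: coord_cod. Qed.

Lemma param_trans i j y : ovl i j y -> param j (trans i j y) = param i y.
Proof. by move=> [_ d]; exact: coordK. Qed.

Lemma trans_ovl i j y : ovl i j y -> ovl j i (trans i j y).
Proof.
move=> oy; split; first exact: trans_cod.
by rewrite /preimage /= param_trans //; apply: param_dom; case: oy.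
Qed.

Lemma transK i j y : ovl i j y -> trans j i (trans i j y) = y.
Proof. by move=> oy; rewrite /trans param_trans // paramK //; case: oy. Qed.

Lemma coord_ovl i j x : chart_dom i x -> chart_dom j x ->
  ovl i j (Defs.coord i x) /\ trans i j (Defs.coord i x) = Defs.coord j x.
Proof.
move=> di dj; rewrite /trans coordK //; split=> //.
by split; [exact: coord_cod | rewrite /preimage /= coordK].
Qed.

Lemma trans_Ck k i j b : Ck_on k (ovl i j) (fun y => trans i j y 0 b).
Proof. exact: transition_smooth. Qed.

Lemma in_chart_trans i j u y : ovl i j y -> in_chart i u y = in_chart j u (trans i j y).
Proof. by move=> oy; rewrite /in_chart param_trans. Qed.

Lemma diff1_trans i j u y : Ck_on 1 (chart_cod j) (in_chart j u) -> ovl i j y ->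
  diff1 (in_chart i u) y = diff1 (in_chart j u) (trans i j y) *m (jac (trans i j) y)^T.
Proof.
move=> Cu oy; apply/rowP => a; rewrite !mxE.
rewrite (@near_partial _ _ _ _ (fun y => in_chart j u (trans i j y))); last first.
  by apply: (open_near (@ovl_open i j) oy) => z; exact: in_chart_trans.
rewrite (diff1_comp a (@ovl_open i j) (@chart_cod_open _ _ _ X j) Cu (@trans_Ck 1 i j) oy).
  by apply: eq_bigr => b _; rewrite !mxE mulrC.
exact: trans_cod.
Qed.

Lemma jac_trans_unit i j y : ovl i j y -> jac (trans i j) y \in unitmx.
Proof.
move=> oy; suff /mulmx1_unit[] : jac (trans i j) y *m jac (trans j i) (trans i j y) = 1%:M by [].
apply/matrixP => a c; rewrite !mxE.
have e := diff1_comp a (@ovl_open i j) (@ovl_open j i) (@trans_Ck 1 j i c) (@trans_Ck 1 i j)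
  oy (trans_ovl oy).
rewrite -[RHS](partial_coord a c y).
transitivity (partial a (fun y => trans j i (trans i j y) 0 c) y).
  by rewrite e; apply: eq_bigr => b _; rewrite !mxE.
apply: near_partial; apply: (open_near (@ovl_open i j) oy) => z oz.
by rewrite transK.
Qed.

Lemma jac_trans_J i j y : ovl i j y ->
  jac (trans i j) y *m Jmx R n = Jmx R n *m jac (trans i j) y.
Proof. by move=> [cy dy]; exact: (transition_holomorphic cy dy). Qed.

Definition MC1 u := forall i, Ck_on 1 (chart_cod i) (in_chart i u).

Lemma MC1_cst (c : R) : MC1 (fun=> c).
Proof. by move=> i; exact: C1_cst. Qed.

Lemma MC1D u v : MC1 u -> MC1 v -> MC1 (fun x => u x + v x).
Proof. by move=> Cu Cv i; exact: (C1D (@chart_cod_open _ _ _ _ i) (Cu i) (Cv i)). Qed.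

Lemma MC1M u v : MC1 u -> MC1 v -> MC1 (fun x => u x * v x).
Proof. by move=> Cu Cv i; exact: (C1M (@chart_cod_open _ _ _ _ i) (Cu i) (Cv i)). Qed.

Lemma MC1B u v : MC1 u -> MC1 v -> MC1 (fun x => u x - v x).
Proof. by move=> Cu Cv i; exact: (C1B (@chart_cod_open _ _ _ _ i) (Cu i) (Cv i)). Qed.

Lemma MC1_continuous u : MC1 u -> continuous u.
Proof.
move=> Cu x; have d := chart_at_dom X x; set i := chart_at X x in d.
apply: (@near_eq_cont R _ (fun z => in_chart i u (Defs.coord i z))).
  by apply: (open_near (chart_dom_open i) d) => z dz; rewrite /in_chart coordK.
apply: (@continuous_comp _ _ _ (Defs.coord i) (in_chart i u)); first exact: Defs.coord_continuous.
exact: (C1_cont (Cu i) (coord_cod d)).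
Qed.

Lemma chart_continuous i (f : 'rV[R]_(n + n) -> R) (g : M -> R) x : chart_dom i x ->
  (forall z, chart_dom i z -> g z = f (Defs.coord i z)) ->
  {for Defs.coord i x, continuous f} -> {for x, continuous g}.
Proof.
move=> d e cf; apply: (@near_eq_cont R _ (fun z => f (Defs.coord i z))).
  by apply: (open_near (chart_dom_open i) d) => z dz; rewrite e.
by apply: (@continuous_comp _ _ _ (Defs.coord i) f) => //; exact: Defs.coord_continuous.
Qed.

Definition ccube p (r : R) : set 'rV[R]_(n + n) := [set y | `|y - p| <= r].

Lemma ccube_compact p r : compact (ccube p r).
Proof.
have -> : ccube p r = (fun z => z + p) @` [set x | `|x| <= r].
  apply/seteqP; split => y /=; last by move=> [v vr <-]; rewrite /ccube /= addrK.
  by move=> yr; exists (y - p) => //; rewrite subrK.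
apply: continuous_compact; last exact: ball_compact.
apply: continuous_subspaceT => v.
by apply: continuousD => //; exact: cst_continuous.
Qed.

Lemma param_ccube_compact i p r : ccube p r `<=` chart_cod i ->
  compact (param i @` ccube p r).
Proof.
move=> sub; apply: continuous_compact; last exact: ccube_compact.
apply: continuous_in_subspaceT => y; rewrite inE => cy.
exact: param_continuous (sub y cy).
Qed.

Definition push i (f : 'rV[R]_(n + n) -> R) : M -> R :=
  fun x => if x \in chart_dom i then f (Defs.coord i x) else 0.

Definition pull i u : 'rV[R]_(n + n) -> R :=
  fun y => if y \in chart_cod i then u (param i y) else 0.

Lemma pushE i f x : chart_dom i x -> push i f x = f (Defs.coord i x).
Proof. by move=> d; rewrite /push mem_set. Qed.

Lemma pullE i u y : chart_cod i y -> pull i u y = u (param i y).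
Proof. by move=> d; rewrite /pull mem_set. Qed.

(** The closed cube is carried to a compact, hence closed, set. Off it the function is locally zero,
    and inside the chart domain it is [f] composed with a transition map. *)
Lemma push_C1 i f p r : ccube p r `<=` chart_cod i -> Ck_on 1 setT f ->
  (forall y, r <= `|y - p| -> f y = 0) -> MC1 (push i f).
Proof.
move=> sub Cf f0 j; apply: Ck_on_cover => y cy.
have Kc : closed (param i @` ccube p r).
  by apply: compact_closed; [exact: cm_hausdorff X | exact: param_ccube_compact].
have [d|nd] := pselect (chart_dom i (param j y)).
  exists (ovl j i); split=> //; apply: (Ck_on_eq (f := fun y => f (trans j i y))).
  - exact: ovl_open.
  - by move=> z [_ dz]; rewrite /in_chart pushE.
  - by apply: (C1_comp (@ovl_open j i) openT Cf (@trans_Ck 1 j i)).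
exists (chart_cod j `&` param j @^-1` (~` (param i @` ccube p r))); split.
  split=> //= -[z zr e]; apply: nd; rewrite -e; apply: param_dom; exact: sub.
apply: (Ck_on_eq (f := fun=> 0)); last exact: C1_cst.
  by apply: param_preimage_open; rewrite openC.
move=> z [cz nz]; rewrite /in_chart /push; case: ifPn => //; rewrite inE => dz.
rewrite f0 //; case: (leP r) => // zr; exfalso; apply: nz.
by exists (Defs.coord i (param j z)); [exact: ltW | exact: coordK].
Qed.

Definition csupp i p r u := forall x, u x != 0 -> chart_dom i x /\ `|Defs.coord i x - p| < r.

Lemma push_csupp i f p r : (forall y, r <= `|y - p| -> f y = 0) -> csupp i p r (push i f).
Proof.
move=> f0 x; rewrite /push; case: ifPn => [|_]; last by rewrite eqxx.
rewrite inE => d fx; split=> //; rewrite ltNge; apply/negP => /f0 e.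
by rewrite e eqxx in fx.
Qed.

Lemma csuppM i p r u v : csupp i p r v -> csupp i p r (fun x => u x * v x).
Proof. by move=> sv x; rewrite mulf_eq0 negb_or => /andP[_]; exact: sv. Qed.

Lemma pull0 i p r u y : csupp i p r u -> r <= `|y - p| -> pull i u y = 0.
Proof.
move=> su yr; rewrite /pull; case: ifPn => //; rewrite inE => cy.
apply/eqP; case: eqP => // /eqP /su [_]; rewrite paramK //.
by rewrite ltNge yr.
Qed.

Lemma pull_C1 i p r s u : r < s -> cube p s `<=` chart_cod i -> MC1 u -> csupp i p r u ->
  Ck_on 1 setT (pull i u).
Proof.
move=> rs sub Cu su; apply: (C1_extend (p := p) rs); last by move=> y; exact: pull0.
apply: (Ck_on_eq (f := in_chart i u)); first exact: cube_open.
  by move=> y /sub cy; rewrite pullE.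
exact: Ck_on_sub sub (Cu i).
Qed.

Lemma pull_continuous i p r s u : r < s -> cube p s `<=` chart_cod i -> continuous u ->
  csupp i p r u -> continuous (pull i u).
Proof.
move=> rs sub cu su; apply: (cont_extend (p := p) rs); last by move=> y; exact: pull0.
move=> y Ny; apply: (@near_eq_cont R _ (in_chart i u)).
  by apply: (open_near (@cube_open _ _ p s) Ny) => z /sub cz; rewrite pullE.
apply: (@continuous_comp _ _ _ (param i) u); first exact: param_continuous (sub y Ny).
exact: cu.
Qed.

Lemma chart_room i x : chart_dom i x ->
  exists2 r, 0 < r & cube (Defs.coord i x) r `<=` chart_cod i.
Proof.
move=> d; have := open_nbhs_nbhs (conj (@chart_cod_open _ _ _ _ i) (coord_cod d)).
move=> /nbhs_ballP[r /= r0 sub]; exists r => // y yr; apply: sub.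
by rewrite -ball_normE /ball_ /= distrC.
Qed.

(** Covers both [w] and [w + i ddbar phi]; continuity is the regularity that the latter has for
    [phi] of class C^2. *)
Record metric_field (Om : chart X -> 'rV[R]_(n + n) -> 'M[R]_(n + n)) : Prop := {
  mf_real11 : forall i y, chart_cod i y -> real11 (Om i y);
  mf_pos : forall i y, chart_cod i y -> form_pos (Om i y);
  mf_compat : forall i j y, ovl i j y ->
    Om i y = jac (trans i j) y *m Om j (trans i j y) *m (jac (trans i j) y)^T;
  mf_cont : forall i y a b, chart_cod i y -> {for y, continuous (fun y => Om i y a b)}
}.

Variable w : kahler_form X.

Lemma kform_field : metric_field (kform w).
Proof.
split.
- exact: kform_real11.
- exact: kform_pos.
- by move=> i j y [cy dy]; exact: (kform_compat w cy dy).
- by move=> i y a b cy; have [c _] := @kform_smooth _ _ _ _ w i a b 0; exact: c.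
Qed.

Lemma kform_phi_field phi : C2_manifold X phi ->
  (forall i y, chart_cod i y -> form_pos (kform_phi w phi i y)) ->
  metric_field (kform_phi w phi).
Proof.
move=> C2 pos; split=> //.
- move=> i y cy; apply: real11D; first exact: kform_real11.
  exact: (real11_ddbar (@chart_cod_open _ _ _ _ i) (C2 i) cy).
- move=> i j y oy; have [cy dy] := oy.
  rewrite /kform_phi mulmxDr mulmxDl; congr (_ + _); first exact: (kform_compat w cy dy).
  have E z : ovl i j z -> in_chart i phi z = in_chart j phi (trans i j z).
    exact: in_chart_trans.
  have Cc' : Ck_on 2 (ovl i j) (fun y => in_chart j phi (trans i j y)).
    apply: (Ck_on_eq (f := in_chart i phi)) => //; first exact: ovl_open.
    by apply: Ck_on_sub (C2 i) => z [].
  rewrite -(ddbar_comp (@ovl_open i j) (@chart_cod_open _ _ _ X j) (C2 j)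
    (@trans_Ck 2 i j) (@trans_cod i j) (@jac_trans_J i j) oy Cc').
  have Ci : Ck_on 2 (ovl i j) (in_chart i phi) by apply: Ck_on_sub (C2 i) => z [].
  rewrite (i_ddbar_hess (@ovl_open i j) Ci oy) (i_ddbar_hess (@ovl_open i j) Cc' oy).
  suff -> : hess (in_chart i phi) y = hess (fun y => in_chart j phi (trans i j y)) y by [].
  apply/matrixP => a b; rewrite [LHS]mxE [RHS]mxE; apply: near_partial.
  apply: (open_near (@ovl_open i j) oy) => z oz; apply: near_partial.
  exact: (open_near (@ovl_open i j) oz).
- move=> i y a b cy.
  have -> : (fun y => kform_phi w phi i y a b) =
      (fun y => kform w i y a b + i_ddbar (in_chart i phi) y a b).
    by apply/funext => z; rewrite mxE.
  apply: (@continuousD R).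
    by have [c _] := @kform_smooth _ _ _ _ w i a b 0; exact: c.
  exact: (@i_ddbar_cont _ _ _ _ _ _ _ (@chart_cod_open _ _ _ _ i) (C2 i) cy).
Qed.

Lemma metric_conj (D W : 'M[R]_(n + n)) : D *m Jmx R n = Jmx R n *m D ->
  metric (D *m W *m D^T) = D *m metric W *m D^T.
Proof.
move=> e; rewrite /metric -!mulmxA; congr (_ *m (_ *m _)).
by rewrite -!trmx_mul e.
Qed.

Lemma bil_inv_conj (D G : 'M[R]_(n + n)) (xi eta : 'rV[R]_(n + n)) :
  D \in unitmx -> G \in unitmx ->
  bil (invmx (D *m G *m D^T)) (xi *m D^T) (eta *m D^T) = bil (invmx G) xi eta.
Proof.
move=> Du Gu; have DTu : D^T \in unitmx by rewrite unitmx_tr.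
have -> : invmx (D *m G *m D^T) = invmx D^T *m invmx G *m invmx D.
  have DGu : D *m G *m D^T \in unitmx by rewrite !unitmx_mul Du Gu.
  apply: (can_inj (mulKmx DGu)); rewrite mulmxV // -!mulmxA (mulmxA D^T) mulmxV // mul1mx.
  by rewrite (mulmxA G) mulmxV // mul1mx mulmxV.
rewrite /bil trmx_mul trmxK !mulmxA; congr (fun_of_matrix _ 0 0).
rewrite -[xi *m D^T *m invmx D^T]mulmxA mulmxV // mulmx1.
by rewrite -[_ *m invmx D *m D]mulmxA mulVmx // mulmx1.
Qed.

Section EnergyForm.
Variable Om : chart X -> 'rV[R]_(n + n) -> 'M[R]_(n + n).
Hypothesis fO : metric_field Om.

Lemma field_posdef i y : chart_cod i y -> posdef (metric (Om i y)).
Proof. by move=> cy; apply: posdef_metric; [exact: mf_real11 | exact: mf_pos]. Qed.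

Lemma field_det_gt0 i y : chart_cod i y -> 0 < \det (Om i y).
Proof. by move=> cy; rewrite -det_metric; apply: posdef_det; exact: field_posdef. Qed.

Definition pairing_at u v i y : R :=
  bil (invmx (metric (Om i y))) (diff1 (in_chart i u) y) (diff1 (in_chart i v) y).

Lemma pairing_trans u v i j y : MC1 u -> MC1 v -> ovl i j y ->
  pairing_at u v i y = pairing_at u v j (trans i j y).
Proof.
move=> Cu Cv oy; rewrite /pairing_at (mf_compat fO oy) metric_conj; last exact: jac_trans_J.
rewrite (diff1_trans (Cu j) oy) (diff1_trans (Cv j) oy) bil_inv_conj //.
  exact: jac_trans_unit.
by apply: posdef_unit; apply: field_posdef; exact: trans_cod.
Qed.

(** By [wedge_top_det], the ratio of the volume form of [Om] to that of [w]. *)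
Definition density_at i y : R := Num.sqrt (\det (Om i y)) / Num.sqrt (\det (kform w i y)).

Lemma density_trans i j y : ovl i j y -> density_at i y = density_at j (trans i j y).
Proof.
move=> oy; rewrite /density_at (mf_compat fO oy) (mf_compat kform_field oy).
rewrite !det_mulmx !det_tr; set d := \det (jac _ _).
have d0 : d != 0 by rewrite /d -unitfE -unitmxE; exact: jac_trans_unit.
have e t : Num.sqrt (d * t * d) = `|d| * Num.sqrt t.
  by rewrite mulrC mulrA -expr2 sqrtrM ?sqr_ge0 // sqrtr_sqr.
by rewrite !e -mulf_div divff ?mul1r // normr_eq0.
Qed.

(** The inner product of differentials in the metric of [Om], weighted by the relative volume, so
    that all integrals can be taken against the measure of [w]. *)
Definition energy u v x : R :=
  let i := chart_at X x in density_at i (Defs.coord i x) * pairing_at u v i (Defs.coord i x).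

Lemma energyE i u v x : MC1 u -> MC1 v -> chart_dom i x ->
  energy u v x = density_at i (Defs.coord i x) * pairing_at u v i (Defs.coord i x).
Proof.
move=> Cu Cv d; rewrite /energy; have d' := chart_at_dom X x.
have [ov e] := coord_ovl d d'.
by rewrite (density_trans ov) (pairing_trans Cu Cv ov) e.
Qed.

Lemma inv_field_cont i y a b : chart_cod i y ->
  {for y, continuous (fun y => invmx (metric (Om i y)) a b)}.
Proof.
move=> cy; apply: cont_invmx => [k l|]; last by apply: posdef_unit; exact: field_posdef.
have -> : (fun y => metric (Om i y) k l) = (fun y => \sum_c Om i y k c * (Jmx R n)^T c l).
  by apply/funext => z; rewrite /metric mxE.
apply: (@cont_sum R _ _ _ _ (fun c y => Om i y k c * (Jmx R n)^T c l)) => c.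
apply: (@continuousM R _ _ (fun=> _)); last exact: cst_continuous.
exact: mf_cont.
Qed.

Lemma energy_continuous u v : MC1 u -> MC1 v -> continuous (energy u v).
Proof.
move=> Cu Cv x; have d := chart_at_dom X x; set i := chart_at X x in d.
apply: (chart_continuous (f := fun y => density_at i y * pairing_at u v i y) d).
  by move=> z dz; exact: energyE.
have cy := coord_cod d.
apply: (@continuousM R).
  apply: (@continuousM R).
    apply: (@continuous_comp _ _ _ (fun y => \det (Om i y)) Num.sqrt); last exact: sqrt_continuous.
    by apply: cont_det => a b; exact: mf_cont.
  have s0 : Num.sqrt (\det (kform w i (Defs.coord i x))) != 0.
    rewrite gt_eqF // sqrtr_gt0 -det_metric; apply: posdef_det; apply: posdef_metric.
      exact: kform_real11.
    exact: kform_pos.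
  have cs : {for Defs.coord i x, continuous (fun y => Num.sqrt (\det (kform w i y)))}.
    apply: (@continuous_comp _ _ _ (fun y => \det (kform w i y)) Num.sqrt); last exact: sqrt_continuous.
    by apply: cont_det => a b; exact: (mf_cont kform_field).
  by first [exact: (@continuousV R _ _ _ s0 cs) | exact: (@cvgV R _ _ _ (fun y => Num.sqrt (\det (kform w i y))) _ s0 cs) | apply: cvgV].
have -> : pairing_at u v i = (fun y => \sum_a \sum_b partial a (in_chart i u) y *
     invmx (metric (Om i y)) a b * partial b (in_chart i v) y).
  apply/funext => z; rewrite /pairing_at bil_sum; apply: eq_bigr => a _; apply: eq_bigr => b _.
  by rewrite [diff1 _ _ _ _]mxE [diff1 (in_chart i v) _ _ _]mxE.
apply: (@cont_sum R _ _ _ _ (fun a y => \sum_b partial a (in_chart i u) y *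
     invmx (metric (Om i y)) a b * partial b (in_chart i v) y)) => a.
apply: (@cont_sum R _ _ _ _ (fun b y => partial a (in_chart i u) y *
     invmx (metric (Om i y)) a b * partial b (in_chart i v) y)) => b.
apply: (@continuousM R); last exact: (C1_contd (Cv i) cy).
by apply: (@continuousM R); [exact: (C1_contd (Cu i) cy) | exact: inv_field_cont].
Qed.

End EnergyForm.

Lemma grad_sqE u x : MC1 u -> grad_sq w u x = energy (kform w) u u x.
Proof.
move=> Cu; rewrite /energy /grad_sq; set i := chart_at X x; set y := Defs.coord i x.
have cy : chart_cod i y by exact: coord_cod (chart_at_dom X x).
have d0 := field_det_gt0 kform_field cy.
rewrite /density_at divff ?mul1r; last by rewrite gt_eqF // sqrtr_gt0.
have pG := field_posdef kform_field cy.
rewrite /metric_sq /form_app /gradient /pairing_at /bil trmx_mul.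
rewrite (invmx_tr_sym pG.1) -[_ *m invmx _ *m metric _]mulmxA mulVmx ?posdef_unit // mulmx1.
by rewrite mulmxA.
Qed.

End ManifoldCharts.

(** * The Riemannian distance *)

Section Curves.
Variable R : realType.
Implicit Types (s t : R).

Lemma bil_CS m (A : 'M[R]_m) xi eta : posdef A ->
  (bil A xi eta) ^+ 2 <= bil A xi xi * bil A eta eta.
Proof.
move=> pA; have [->|e0] := eqVneq eta 0.
  by rewrite /bil trmx0 !mulmx0 !mxE expr0n mulr0.
have a0 : 0 < bil A eta eta by exact: (pA.2 _ e0).
have := posdef_ge0 (bil A eta eta *: xi - bil A xi eta *: eta) pA.
rewrite bilDl !bilDr -!scaleNr !(bilZl, bilZr) (bil_sym eta xi pA.1).
set a := bil A eta eta in a0 *; set b := bil A xi eta; set c := bil A xi xi => h.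
have : 0 <= a * (c * a - b ^+ 2) by move: h; congr (_ <= _); ring.
by rewrite pmulr_rge0 // subr_ge0.
Qed.

Lemma dotl_CS m (G : 'M[R]_m) (xi v : 'rV[R]_m) : posdef G ->
  `|dotl xi v| <= Num.sqrt (bil (invmx G) xi xi) * Num.sqrt (bil G v v).
Proof.
move=> pG; have Gu := posdef_unit pG.
have e1 : dotl xi v = bil (invmx G) xi (v *m G).
  rewrite /bil trmx_mul pG.1 !mulmxA -[xi *m _ *m G]mulmxA mulVmx // mulmx1 mxE.
  by apply: eq_bigr => a _; rewrite mxE mulrC.
have e2 : bil G v v = bil (invmx G) (v *m G) (v *m G).
  by rewrite /bil trmx_mul pG.1 !mulmxA -[v *m G *m invmx G]mulmxA mulmxV // mulmx1.
rewrite e2 -sqrtrM; last exact: posdef_ge0 (posdef_inv pG).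
rewrite -sqrtr_sqr e1; apply: ler_wsqrtr.
exact: bil_CS (posdef_inv pG).
Qed.

(** The speed of a piece is controlled only over [[0, 1]]; composing with this retraction makes it
    continuous on the line, as [primitive] asks. *)
Definition clamp (t : R) : R := (`|t| - `|t - 1| + 1) / 2.

Lemma clampE t : 0 <= t <= 1 -> clamp t = t.
Proof.
move=> /andP[t0 t1]; rewrite /clamp ger0_norm // ler0_norm; last by lra.
by lra.
Qed.

Lemma clamp_itv t : 0 <= clamp t <= 1.
Proof.
rewrite /clamp; have [t0|t0] := lerP 0 t; have [t1|t1] := lerP 0 (t - 1).
- by rewrite !ger0_norm //; lra.
- by rewrite ger0_norm // ltr0_norm //; lra.
- by rewrite ltr0_norm // ger0_norm //; lra.
- by rewrite !ltr0_norm //; lra.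
Qed.

Lemma clamp_continuous : continuous clamp.
Proof.
move=> t; apply: cvgMl; apply: cvgD; last exact: cvg_cst.
apply: cvgB; first by apply: cvg_norm; exact: cvg_id.
by apply: cvg_norm; apply: cvgB; [exact: cvg_id | exact: cvg_cst].
Qed.

Lemma primitive (f : R -> R) : continuous f -> exists L : R -> R, forall t, -1 < t -> t < 2 ->
  is_derive t (1 : R) (L : R -> R^o) (f t).
Proof.
move=> cf.
exists (fun x => (\int[@lebesgue_measure R]_(t in [set` `[(-1 : R), x]]) (f t))%R).
move=> t t1 t2.
have fi : (@lebesgue_measure R).-integrable [set` `[(-1 : R), 2]] (EFin \o f).
  apply: continuous_compact_integrable; first exact: segment_compact.
  exact: continuous_subspaceT.
have [|d e] := continuous_FTC1 t2 fi _ (cf t).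
  by first [by rewrite lte_fin | by rewrite lte_fin ltW].
rewrite derive1E in e; exact: (DeriveDef d e).
Qed.

Lemma is_derive_cont (L : R -> R) t d : is_derive t (1 : R) (L : R -> R^o) d ->
  {for t, continuous L}.
Proof.
move=> [dL _]; apply: differentiable_continuous; exact/derivable1_diffP.
Qed.

Lemma integral01 (f L : R -> R) : (forall t, 0 <= t <= 1 -> {for t, continuous f}) ->
  (forall t, 0 <= t <= 1 -> is_derive t (1 : R) (L : R -> R^o) (f t)) ->
  Rintegral (@lebesgue_measure R) `[0, 1]%classic f = L 1 - L 0.
Proof.
move=> cf dL; rewrite /Rintegral.
have cL t : 0 <= t <= 1 -> {for t, continuous L} by move=> /dL; exact: is_derive_cont.
rewrite (@continuous_FTC2 _ f L) //.
- by apply: continuous_in_subspaceT => t; rewrite inE /= in_itv /= => /cf.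
- split.
  + by move=> t; rewrite in_itv /= => /andP[t0 t1]; have [] := dL t; rewrite ?(ltW t0) ?(ltW t1).
  + by apply: cvg_at_right_filter; apply: cL; rewrite lexx ler01.
  + by apply: cvg_at_left_filter; apply: cL; rewrite lexx ler01.
- move=> t; rewrite in_itv /= => /andP[t0 t1]; rewrite derive1E.
  by have [] := dL t; rewrite ?(ltW t0) ?(ltW t1).
Qed.

Lemma increasing01 (k k' : R -> R) s t : 0 <= s -> s <= t -> t <= 1 ->
  (forall t, 0 <= t <= 1 -> is_derive t (1 : R) (k : R -> R^o) (k' t)) ->
  (forall t, 0 <= t <= 1 -> 0 <= k' t) -> k s <= k t.
Proof.
move=> s0 st t1 dk k0.
have D x : x \in `]s, t[%R -> is_derive x (1 : R) (k : R -> R^o) (k' x).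
  by rewrite in_itv /= => /andP[? ?]; apply: dk; lra.
have cK : {within `[s, t], continuous k}.
  apply: continuous_in_subspaceT => z; rewrite inE /= in_itv /= => /andP[? ?].
  by apply: (is_derive_cont (dk z _)); lra.
have [x xs e] := @MVT_segment R k k' s t st D cK.
rewrite -subr_ge0 e mulr_ge0 ?subr_ge0 //.
by apply: k0; move: xs; rewrite in_itv /= => /andP[? ?]; lra.
Qed.

Lemma derive_affine m (c : R -> 'rV[R]_m) (al ka t : R) :
  (forall t, derivable (c : R^o -> 'rV[R]_m) t 1) ->
  derivable ((fun s => c (al + ka * s)) : R^o -> 'rV[R]_m) t 1 /\
  'D_1 ((fun s => c (al + ka * s)) : R^o -> 'rV[R]_m) t =
  ka *: 'D_1 (c : R^o -> 'rV[R]_m) (al + ka * t).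
Proof.
move=> dc; pose g := (fun s : R^o => al + ka * s : R^o).
have dg : is_derive t (1 : R^o) g ka.
  have -> : g = (cst al + ka \*: id)%R by apply/funext.
  by apply: is_derive_eq; rewrite add0r /GRing.scale /= mulr1.
have Dg : differentiable g t by apply/derivable1_diffP; case: dg.
have Dc : differentiable (c : R^o -> 'rV[R]_m) (g t) by apply/derivable1_diffP; exact: dc.
have Dcg : differentiable ((c : R^o -> 'rV[R]_m) \o g) t by exact: differentiable_comp.
split; first by apply/derivable1_diffP.
rewrite (deriveE _ Dcg) (diff_comp Dg Dc) /= -(deriveE _ Dg).
have [_ ->] := dg; rewrite (deriveE _ Dc).
transitivity ('d (c : R^o -> 'rV[R]_m) (g t) (ka *: (1 : R^o))).
  by rewrite [ka *: _]/GRing.scale /= mulr1.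
exact: linearZ.
Qed.

End Curves.

(** * Curves and their lengths *)

Section Lengths.
Variables (R : realType) (M : ptopologicalType) (n : nat).
Variable X : complex_manifold R M n.
Variable w : kahler_form X.
Implicit Types (i j : chart X) (u : M -> R) (x y z : M) (c : R -> 'rV[R]_(n + n)) (l s t C al ka : R).

Definition vel c (t : R) : 'rV[R]_(n + n) := 'D_1 (c : R^o -> 'rV[R]_(n + n)) t.

Definition speed i c t := Num.sqrt (metric_sq (kform w i (c t)) (vel c t)).

Record piece i c : Prop := {
  pc_derivable : forall t, derivable (c : R^o -> 'rV[R]_(n + n)) t 1;
  pc_continuous : continuous (vel c);
  pc_cod : forall t, 0 <= t <= 1 -> chart_cod i (c t) }.

Definition plen i c := Rintegral (@lebesgue_measure R) `[0, 1]%classic (speed i c).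

Lemma piece_joined i c z l : piece i c -> joined w (param i (c 1)) z l ->
  joined w (param i (c 0)) z (plen i c + l).
Proof. by move=> [h1 h2 h3] h4; exact: joined_step h4. Qed.

Lemma joined_trans x y z l l' : joined w x y l -> joined w y z l' -> joined w x z (l + l').
Proof.
move=> H; elim: H => [a|a b k i c d cd cc e _ IH] h; first by rewrite add0r.
by rewrite -addrA; apply: joined_step (IH h).
Qed.

Lemma plen_ge0 i c : 0 <= plen i c.
Proof. by apply: Rintegral_ge0 => t _; exact: sqrtr_ge0. Qed.

Lemma joined_ge0 x y l : joined w x y l -> 0 <= l.
Proof.
by elim=> // a b k i c d cd cc e _ IH; apply: addr_ge0 => //; exact: plen_ge0.
Qed.

Lemma curve_continuous c t : (forall t, derivable (c : R^o -> 'rV[R]_(n + n)) t 1) ->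
  {for t, continuous c}.
Proof.
by move=> d; apply: differentiable_continuous; apply/derivable1_diffP; exact: d.
Qed.

Lemma speed_continuous i c t : piece i c -> 0 <= t <= 1 -> {for t, continuous (speed i c)}.
Proof.
move=> pc t01; have cy := pc_cod pc t01; have cc := curve_continuous (t := t) (pc_derivable pc).
apply: (@continuous_comp _ _ _ (fun t => metric_sq (kform w i (c t)) (vel c t)) Num.sqrt).
  have -> : (fun t => metric_sq (kform w i (c t)) (vel c t)) = (fun t => \sum_a \sum_b
      vel c t 0 a * (\sum_d kform w i (c t) a d * (Jmx R n)^T d b) * vel c t 0 b).
    apply/funext => s; rewrite /metric_sq /form_app -/(bil _ _ _) bil_sum.
    by apply: eq_bigr => a _; apply: eq_bigr => b _; rewrite /metric [(_ *m _) a b]mxE.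
  have cv a : {for t, continuous (fun t => vel c t 0 a)}.
    by apply: cont_coord; exact: (pc_continuous pc).
  apply: (@cont_sum R _ _ _ _ (fun a t => \sum_b
      vel c t 0 a * (\sum_d kform w i (c t) a d * (Jmx R n)^T d b) * vel c t 0 b)) => a.
  apply: (@cont_sum R _ _ _ _ (fun b t =>
      vel c t 0 a * (\sum_d kform w i (c t) a d * (Jmx R n)^T d b) * vel c t 0 b)) => b.
  apply: (@continuousM R); last exact: cv.
  apply: (@continuousM R); first exact: cv.
  apply: (@cont_sum R _ _ _ _ (fun d t => kform w i (c t) a d * (Jmx R n)^T d b)) => d.
  apply: (@continuousM R _ _ (fun=> _)); last exact: cst_continuous.
  exact: (cvg_comp _ _ cc (@mf_cont _ _ _ _ _ (kform_field w) i (c t) a d cy)).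
exact: sqrt_continuous.
Qed.

Lemma length_primitive i c : piece i c -> exists L : R -> R,
  (forall t, 0 <= t <= 1 -> is_derive t (1 : R) (L : R -> R^o) (speed i c t)) /\
  plen i c = L 1 - L 0.
Proof.
move=> pc; have [|L HL] := @primitive R (fun t => speed i c (clamp t)).
  move=> t; have cs := speed_continuous pc (clamp_itv t).
  exact: (cvg_comp _ _ (@clamp_continuous R t) cs).
have dL t : 0 <= t <= 1 -> is_derive t (1 : R) (L : R -> R^o) (speed i c t).
  by move=> t01; rewrite -{2}(clampE t01); apply: HL; lra.
exists L; split => //; apply: integral01 => // t t01; exact: speed_continuous.
Qed.

(** Affine reparametrisation, by which pieces are cut and, for negative [ka], reversed; [s] is the
    sign of [ka]. *)
Lemma subpiece i c (L : R -> R) al ka s : piece i c ->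
  (forall t, 0 <= t <= 1 -> is_derive t (1 : R) (L : R -> R^o) (speed i c t)) ->
  0 <= al <= 1 -> 0 <= al + ka <= 1 -> s * ka = `|ka| ->
  piece i (fun t => c (al + ka * t)) /\
  plen i (fun t => c (al + ka * t)) = s * (L (al + ka) - L al).
Proof.
move=> pc dL al01 be01 sk.
have D t := derive_affine al ka t (pc_derivable pc).
have in01 t : 0 <= t <= 1 -> 0 <= al + ka * t <= 1.
  by move=> /andP[t0 t1]; move: al01 be01 => /andP[? ?] /andP[? ?]; nra.
have velE : vel (fun t => c (al + ka * t)) = (fun t => ka *: vel c (al + ka * t)).
  by apply/funext => t; have [] := D t.
have aff : continuous (fun t : R => al + ka * t).
  by move=> t; apply: cvgD; [exact: cvg_cst | apply: cvgMr; exact: cvg_id].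
have pc' : piece i (fun t => c (al + ka * t)).
  split; first by move=> t; have [] := D t.
    rewrite velE => t; apply: cvgZr.
    by apply: (@continuous_comp _ _ _ (fun t => al + ka * t) (vel c)); [exact: aff | exact: (pc_continuous pc)].
  by move=> t t01; apply: (pc_cod pc); exact: in01.
split=> //.
have spE t : speed i (fun t => c (al + ka * t)) t = s * (ka * speed i c (al + ka * t)).
  rewrite /speed velE mulrA sk; set v := vel _ _; set W := kform _ _ _.
  rewrite /metric_sq /form_app -/(bil _ _ _) -/(bil _ _ _) bilZl bilZr mulrA -expr2.
  by rewrite sqrtrM ?sqr_ge0 // sqrtr_sqr.
have dM t : 0 <= t <= 1 -> is_derive t (1 : R) ((fun t => s * L (al + ka * t)) : R -> R^o)
    (speed i (fun t => c (al + ka * t)) t).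
  move=> t01; rewrite spE.
  have dg : is_derive t (1 : R) ((fun t => al + ka * t) : R -> R^o) ka.
    have -> : (fun t : R => al + ka * t) = (cst al + ka \*: (@id R^o))%R by apply/funext.
    by apply: is_derive_eq; rewrite add0r /GRing.scale /= mulr1.
  have dLg : is_derive t (1 : R) ((fun t => L (al + ka * t)) : R -> R^o) (ka * speed i c (al + ka * t)).
    have h := dL _ (in01 t t01).
    by have hh := @is_derive1_comp R L (fun t => al + ka * t) t _ _ h dg; rewrite mulrC; exact: hh.
  have -> : (fun t => s * L (al + ka * t)) = (s \*: ((fun t => L (al + ka * t)) : R -> R^o)).
    by apply/funext.
  by apply: is_derive_eq; rewrite /GRing.scale.
have cS t : 0 <= t <= 1 -> {for t, continuous (speed i (fun t => c (al + ka * t)))}.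
  by move=> t01; exact: speed_continuous.
by rewrite /plen (integral01 cS dM) mulr1 mulr0 addr0 mulrBr.
Qed.

Lemma joined_sym x y l : joined w x y l -> joined w y x l.
Proof.
elim=> [a|a b k i c d cd cc e _ IH]; first exact: joined_refl.
have pc : piece i c by [].
have [L [dL lE]] := length_primitive pc.
have [||| pc' lE'] := @subpiece i c L 1 (-1) (-1) pc dL; first lra; first lra.
  by rewrite normrN normr1 mulrNN mulr1.
rewrite addrC; apply: (joined_trans IH).
have := piece_joined pc' (joined_refl w _); rewrite addr0 /= !(mulr0, addr0, mulr1, subrr).
rewrite lE' subrr e; congr joined; rewrite -/(plen i c) lE; ring.
Qed.

(** The length [t] is reached inside one of the pieces, where the intermediate value theorem for arc
    length finds the cutting time. *)
Lemma joined_split x z l t : joined w x z l -> 0 <= t <= l ->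
  exists y, joined w x y t /\ joined w y z (l - t).
Proof.
move=> H; elim: H t => [a|a b k i c d cd cc e jb IH] t.
  move=> t0; have -> : t = 0 by lra.
  by exists a; rewrite subrr; split; exact: joined_refl.
rewrite -/(plen i c) => /andP[t0 tl]; have pc : piece i c by [].
have [tp|tp] := lerP t (plen i c); last first.
  have [|y [j1 j2]] := IH (t - plen i c); first by lra.
  exists y; split; first by rewrite -e -(subrKC (plen i c) t); exact: (piece_joined pc j1).
  by have -> : plen i c + k - t = k - (t - plen i c) by ring.
have [L [dL lE]] := length_primitive pc.
have Linc s r : 0 <= s -> s <= r -> r <= 1 -> L s <= L r.
  by move=> *; apply: (increasing01 (k' := speed i c)) => // q _; exact: sqrtr_ge0.
have [|||s s01 sE] := @IVT R L 0 1 (L 0 + t) => //.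
- apply: continuous_in_subspaceT => q; rewrite inE /= in_itv /= => q01.
  exact: is_derive_cont (dL q q01).
- have L01 := Linc 0 1 (lexx _) ler01 (lexx _).
  by rewrite (min_idPl L01) (max_idPr L01); lra.
have {}s01 : 0 <= s <= 1 by move: s01; rewrite in_itv.
have [||| p1 l1] := @subpiece i c L 0 s 1 pc dL; first lra; first lra.
  by rewrite mul1r ger0_norm //; lra.
have e1 : s + (1 - s) = 1 by rewrite addrC subrK.
have s1 : 0 <= s + (1 - s) <= 1 by rewrite e1 ler01 lexx.
have [|p2 l2] := @subpiece i c L s (1 - s) 1 pc dL s01 s1.
  by rewrite mul1r ger0_norm // subr_ge0; case/andP: s01.
exists (param i (c s)); split.
  have := piece_joined p1 (joined_refl w _); rewrite addr0 /= mulr0 mulr1 !add0r e l1 add0r sE.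
  by congr joined; ring.
have := piece_joined (z := b) (l := k) p2; rewrite /= mulr1 mulr0 addr0 e1 => /(_ jb).
by congr joined; rewrite l2 e1 sE lE; ring.
Qed.

Lemma grad_sq_chart u i (y : 'rV[R]_(n + n)) : MC1 X u -> chart_cod i y ->
  grad_sq w u (param i y) = pairing_at (kform w) u u i y.
Proof.
move=> Cu cy; rewrite grad_sqE // (@energyE R M n X w (kform w) (kform_field w) i u u (param i y) Cu Cu (param_dom cy)).
rewrite paramK // /density_at divff ?mul1r // gt_eqF // sqrtr_gt0.
exact: (field_det_gt0 (kform_field w)).
Qed.

(** By Cauchy-Schwarz for the metric, [C] times the arc length plus or minus [u] along the piece is
    nondecreasing. *)
Lemma piece_lipschitz u i c C : MC1 X u -> 0 <= C -> piece i c ->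
  (forall t, 0 <= t <= 1 -> grad_sq w u (param i (c t)) <= C ^+ 2) ->
  `|u (param i (c 1)) - u (param i (c 0))| <= C * plen i c.
Proof.
move=> Cu C0 pc gC; have [L [dL lE]] := length_primitive pc.
pose g t := in_chart i u (c t); pose g' t := dotl (diff1 (in_chart i u) (c t)) (vel c t).
have dg t : 0 <= t <= 1 -> is_derive t (1 : R) (g : R -> R^o) (g' t).
  move=> t01; apply: is_derive_curve; last exact: (pc_derivable pc).
  exact: (C1_diff (@chart_cod_open _ _ _ X i) (Cu i) (pc_cod pc t01)).
have g's t : 0 <= t <= 1 -> `|g' t| <= C * speed i c t.
  move=> t01; have cy := pc_cod pc t01.
  apply: le_trans (dotl_CS _ _ (field_posdef (kform_field w) cy)) _.
  apply: ler_wpM2r; first exact: sqrtr_ge0.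
  rewrite -[leRHS](ger0_norm C0) -sqrtr_sqr; apply: ler_wsqrtr.
  by rewrite -/(pairing_at _ _ _ _ _) -grad_sq_chart //; exact: gC.
have mono (s : R) : `|s| = 1 -> C * L 0 + s * g 0 <= C * L 1 + s * g 1.
  move=> s1; apply: (@increasing01 _ (fun t => C * L t + s * g t)
      (fun t => C * speed i c t + s * g' t)) => // t t01.
    have h1 := dL t t01; have h2 := dg t t01.
    have -> : (fun t => C * L t + s * g t) = (C \*: (L : R -> R^o) + s \*: (g : R -> R^o))%R.
      by apply/funext.
    by apply: is_derive_eq.
  have := g's t t01; have := ler_norm (- (s * g' t)); rewrite normrN normrM s1 mul1r => h1 h2.
  by lra.
have := mono 1 (normr1 _); have := mono (-1); rewrite normrN normr1 => /(_ erefl).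
rewrite lE -/(g 1) -/(g 0) ler_norml; have -> : u (param i (c 1)) = g 1 by [].
have -> : u (param i (c 0)) = g 0 by [].
by move=> h1 h2; apply/andP; split; lra.
Qed.

Lemma joined_lipschitz u C x y l : MC1 X u -> 0 <= C -> (forall x, grad_sq w u x <= C ^+ 2) ->
  joined w x y l -> `|u y - u x| <= C * l.
Proof.
move=> Cu C0 gC; elim=> [a|a b k i c d cd cc e _ IH]; first by rewrite subrr normr0 mulr0.
have pc : piece i c by [].
have := piece_lipschitz Cu C0 pc (fun t _ => gC _); rewrite e -/(plen i c) mulrDr => h.
rewrite -[u b - u a](subrKA (u (param i (c 1)))).
by apply: le_trans (ler_normD _ _) _; rewrite addrC; exact: lerD.
Qed.

End Lengths.

(** * Distance, topology and precompactness of balls *)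

Section DistanceTopology.
Variables (R : realType) (M : ptopologicalType) (n : nat).
Variable X : complex_manifold R M n.
Variable w : kahler_form X.
Implicit Types (i j : chart X) (u : M -> R) (x z : M) (p : 'rV[R]_(n + n)) (l r s t C e L S : R).

Lemma energy_local (Om : chart X -> 'rV[R]_(n + n) -> 'M[R]_(n + n)) u (v : M -> R) x :
  (\forall z \near x, u z = 0) -> energy w Om u v x = 0.
Proof.
move=> u0; rewrite /energy; set i := chart_at X x; set y := Defs.coord i x.
have d : chart_dom i x by exact: chart_at_dom.
have cy : chart_cod i y by exact: coord_cod.
suff -> : pairing_at Om u v i y = 0 by rewrite mulr0.
rewrite /pairing_at; suff -> : diff1 (in_chart i u) y = 0 by rewrite /bil !mul0mx mxE.
apply/rowP => a; rewrite !mxE -(partial_cst a 0 y); apply: near_partial.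
have := param_continuous cy; rewrite /prop_for /continuous_at coordK // => /(_ _ u0).
by [].
Qed.

Lemma outside_support i p r u x : ccube p r `<=` chart_cod i -> csupp i p r u ->
  ~ (param i @` ccube p r) x -> \forall z \near x, u z = 0.
Proof.
move=> sub su nx.
have Kc : closed (param i @` ccube p r).
  by apply: compact_closed; [exact: cm_hausdorff X | exact: param_ccube_compact].
have : open (~` (param i @` ccube p r)) by rewrite openC.
move=> /(@open_near _ _ x) /(_ nx); apply => z nz.
apply/eqP; apply/negP => /negP uz; have [d dz] := su z uz; apply: nz.
by exists (Defs.coord i z); [exact: ltW | exact: coordK].
Qed.

Lemma csupp_energy (Om : chart X -> 'rV[R]_(n + n) -> 'M[R]_(n + n)) i p r s u (v : M -> R) : r < s ->
  ccube p r `<=` chart_cod i -> csupp i p r u -> csupp i p s (energy w Om u v).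
Proof.
move=> rs sub su x ex.
have [[y yr e]|nx] := pselect ((param i @` ccube p r) x); last first.
  by rewrite (energy_local _ _ (outside_support sub su nx)) eqxx in ex.
rewrite -e; split; first by apply: param_dom; exact: sub.
by rewrite paramK; [exact: le_lt_trans rs | exact: sub].
Qed.

Lemma csupp_bounded i p r s (g : M -> R) : r < s -> cube p s `<=` chart_cod i ->
  continuous g -> csupp i p r g -> exists2 B, 0 <= B & forall x, `|g x| <= B.
Proof.
move=> rs sub cg sg; have cp := pull_continuous rs sub cg sg.
have [B B0 HB] := cont_bounded (r + `|p|) cp; exists B => // x.
have [->|gx] := eqVneq (g x) 0; first by rewrite normr0.
have [d xr] := sg x gx; have := HB (Defs.coord i x); rewrite pullE; last exact: coord_cod.
rewrite coordK //; apply.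
by rewrite -(subrK p (Defs.coord i x)); apply: le_trans (ler_normD _ _) _; rewrite lerD2r ltW.
Qed.

Lemma bump_grad_bound i p r : 0 < r -> cube p (4 * r) `<=` chart_cod i ->
  exists2 C, 0 < C & forall x, grad_sq w (push i (bump p r)) x <= C ^+ 2.
Proof.
move=> r0 sub; have subK : ccube p (2 * r) `<=` chart_cod i.
  by move=> y yr; apply: sub; rewrite /cube /=; move: yr; rewrite /ccube /=; lra.
have b0 y : 2 * r <= `|y - p| -> bump p r y = 0 by exact: bump0.
have Cb : MC1 X (push i (bump p r)) by exact: push_C1 subK (@bump_C1 _ _ _ _) b0.
have [|||B B0 HB] := @csupp_bounded i p (3 * r) (4 * r) (energy w (kform w) (push i (bump p r)) (push i (bump p r))) _ sub.
- by lra.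
- exact: (energy_continuous (kform_field w) Cb Cb).
- by apply: csupp_energy subK _; [lra | exact: push_csupp].
exists (B + 1); first by lra.
move=> x; rewrite grad_sqE //; apply: le_trans (ler_norm _) _; apply: le_trans (HB x) _.
by rewrite expr2; nra.
Qed.

(** A bump equal to 1 on the small cube and 0 off the large one has bounded gradient, so a curve
    between them has length at least the inverse of that bound. *)
Lemma separation i p r : 0 < r -> cube p (4 * r) `<=` chart_cod i ->
  exists2 d, 0 < d & forall x z l, (param i @` ccube p r) x -> joined w x z l -> l < d ->
    (param i @` cube p (2 * r)) z.
Proof.
move=> r0 sub; have [C C0 HC] := bump_grad_bound r0 sub.
have subK : ccube p (2 * r) `<=` chart_cod i.
  by move=> y yr; apply: sub; rewrite /cube /=; move: yr; rewrite /ccube /=; lra.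
have b0 y : 2 * r <= `|y - p| -> bump p r y = 0 by exact: bump0.
have Cb : MC1 X (push i (bump p r)) by exact: push_C1 subK (@bump_C1 _ _ _ _) b0.
exists C^-1; first by rewrite invr_gt0.
move=> x z l [y yr <-] J lC; have cy : chart_cod i y.
  by apply: subK; move: yr; rewrite /ccube /=; lra.
have := joined_lipschitz Cb (ltW C0) HC J.
rewrite (pushE _ (param_dom cy)) paramK // (bump1 r0 yr) => h.
have [|e0] := eqVneq (push i (bump p r) z) 0.
  move=> e; move: h; rewrite e sub0r normrN normr1 => h.
  have : C * l < 1 by rewrite -(mulfV (lt0r_neq0 C0)) ltr_pM2l.
  by rewrite ltNge h.
have [d zr] := push_csupp (f := bump p r) (i := i) b0 e0.
by exists (Defs.coord i z) => //; exact: coordK.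
Qed.

Lemma metric_bound i p r : 0 < r -> cube p (3 * r) `<=` chart_cod i ->
  exists2 L, 0 < L & forall (y v : 'rV[R]_(n + n)), ccube p r y ->
    Num.sqrt (metric_sq (kform w i y) v) <= L * `|v|.
Proof.
move=> r0 sub.
pose S y := \sum_a \sum_b `|metric (kform w i y) a b|.
have cS : continuous (fun y => bump p r y * S y).
  have z0 y : 2 * r <= `|y - p| -> bump p r y * S y = 0 by move=> yr; rewrite bump0 ?mul0r.
  apply: (cont_extend (r := 3 * r) _ _ z0) => [|y Ny]; first lra.
  apply: (@continuousM R); first exact: (C1_continuous (@bump_C1 _ _ _ _)).
  apply: (@cont_sum R _ _ _ _ (fun a y => \sum_b `|metric (kform w i y) a b|)) => a.
  apply: (@cont_sum R _ _ _ _ (fun b y => `|metric (kform w i y) a b|)) => b.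
  have h : {for y, continuous (fun y => metric (kform w i y) a b)}.
    have -> : (fun y => metric (kform w i y) a b) = (fun y => \sum_c kform w i y a c * (Jmx R n)^T c b).
      by apply/funext => z; rewrite /metric mxE.
    apply: (@cont_sum R _ _ _ _ (fun c y => kform w i y a c * (Jmx R n)^T c b)) => c.
    apply: (@continuousM R _ _ (fun=> _)); last exact: cst_continuous.
    exact: (mf_cont (kform_field w) (sub y Ny)).
  exact: (cvg_norm h).
have [B B0 HB] := cont_bounded (r + `|p|) cS.
exists (B + 1); first by lra.
move=> y v yr; have Sy : S y <= B.
  have := HB y; rewrite (bump1 r0 yr) mul1r => h; apply: le_trans (ler_norm _) (h _).
  by rewrite -(subrK p y); apply: le_trans (ler_normD _ _) _; rewrite lerD2r.
apply: (@le_trans _ _ (Num.sqrt (((B + 1) * `|v|) ^+ 2))); last first.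
  by rewrite sqrtr_sqr ger0_norm // mulr_ge0 //; lra.
apply: ler_wsqrtr; rewrite /metric_sq /form_app -/(bil _ _ _) bil_sum.
apply: (@le_trans _ _ (S y * `|v| ^+ 2)); last first.
  by rewrite exprMn; apply: ler_wpM2r; [exact: sqr_ge0 | nra].
rewrite /S mulr_suml; apply: ler_sum => a _; rewrite mulr_suml; apply: ler_sum => b _.
apply: le_trans (ler_norm _) _; rewrite !normrM mulrAC mulrC expr2.
apply: ler_wpM2l => //.
by apply: ler_pM => //; exact: coord_le.
Qed.

Lemma segment_joined i p r S (y z : 'rV[R]_(n + n)) : ccube p r `<=` chart_cod i ->
  ccube p r y -> ccube p r z ->
  (forall y', ccube p r y' -> Num.sqrt (metric_sq (kform w i y') (z - y)) <= S) ->
  exists l, joined w (param i y) (param i z) l /\ l <= S.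
Proof.
move=> sub yr zr HS.
pose c t : 'rV[R]_(n + n) := y + t *: (z - y).
have c0 : c 0 = y by rewrite /c scale0r addr0.
have c1 : c 1 = z by rewrite /c scale1r addrC subrK.
have dc t : is_derive (t : R^o) (1 : R^o) (c : R^o -> 'rV[R]_(n + n)) (z - y).
  have cv : (fun h : R^o => h^-1 *: ((c \o shift t) (h *: (1 : R^o)) - c t)) @ 0^' --> z - y.
    apply: cvg_near_cst; near=> h; have h0 : h != 0 by near: h; exact: nbhs_dnbhs_neq.
    rewrite /c /= [h *: 1]/GRing.scale /= mulr1 opprD addrACA subrr add0r -scalerBl addrK.
    by rewrite scalerA mulVf // scale1r.
  apply: DeriveDef; first exact: (cvgP _ cv).
  exact: (cvg_lim _ cv).
have vE t : vel c t = z - y by have [_] := dc t.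
have cr t : 0 <= t <= 1 -> ccube p r (c t).
  move=> /andP[t0 t1]; rewrite /ccube /=.
  have -> : c t - p = (1 - t) *: (y - p) + t *: (z - p).
    by apply/rowP => a; rewrite !mxE; ring.
  apply: le_trans (ler_normD _ _) _; rewrite !normrZ (ger0_norm t0) (ger0_norm (x := 1 - t)) ?subr_ge0 //.
  move: yr zr; rewrite /ccube /= => yr zr; nra.
have pc : piece i c.
  split; first by move=> t; have [] := dc t.
    have -> : vel c = cst (z - y) by apply/funext => t; exact: vE.
    exact: cst_continuous.
  by move=> t /cr; exact: sub.
exists (plen w i c); split.
  by have := piece_joined pc (joined_refl w _); rewrite addr0 c0 c1.
have [F [dF ->]] := length_primitive w pc.
have := @increasing01 R (fun t => t * S - F t) (fun t => S - speed w i c t) 0 1.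
rewrite mul0r mul1r sub0r lexx ler01 => H.
have : - F 0 <= S - F 1; last by lra.
apply: H => // t t01.
  have h := dF t t01.
  have -> : (fun t : R => t * S - F t) = (S \*: (@id R^o) - (F : R -> R^o))%R.
    by apply/funext => q; rewrite /= mulrC.
  by apply: is_derive_eq; rewrite /GRing.scale /= mulr1.
by rewrite subr_ge0 /speed vE; apply: HS; exact: cr.
Unshelve. all: by end_near.
Qed.

Lemma chart_window x : exists i r L, [/\ 0 < r, 0 < L, chart_dom i x,
  cube (Defs.coord i x) (6 * r) `<=` chart_cod i &
  forall (y v : 'rV[R]_(n + n)), ccube (Defs.coord i x) r y -> Num.sqrt (metric_sq (kform w i y) v) <= L * `|v|].
Proof.
have d := chart_at_dom X x; set i := chart_at X x in d; have [r r0 sub] := chart_room d.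
have r6 : 0 < r / 6 by lra.
have [|L L0 HL] := metric_bound (i := i) (p := Defs.coord i x) r6.
  by move=> y yr; apply: sub; move: yr; rewrite /cube /=; lra.
by exists i, (r / 6), L; split => //; rewrite mulrC divfK.
Qed.

Lemma window_nbhs i x r : 0 < r -> chart_dom i x ->
  \forall z \near x, chart_dom i z /\ cube (Defs.coord i x) r (Defs.coord i z).
Proof.
move=> r0 d.
have h1 : \forall z \near x, chart_dom i z by exact: (open_nbhs1 (chart_dom_open i) d).
have h2 : \forall z \near x, cube (Defs.coord i x) r (Defs.coord i z).
  apply: (Defs.coord_continuous d); apply: (open_nbhs1 (@cube_open _ _ _ _)).
  by rewrite /cube /= subrr normr0.
exact: filterI h1 h2.
Qed.

Lemma near_joined x e : 0 < e -> \forall z \near x, exists2 l, joined w x z l & l < e.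
Proof.
move=> e0; have [i [r [L [r0 L0 d sub HL]]]] := chart_window x.
pose q := Num.min r (e / (2 * L)).
have q0 : 0 < q by rewrite lt_min r0 /= divr_gt0 // mulr_gt0.
have := window_nbhs q0 d; apply: filterS => z [dz zq].
have subK : ccube (Defs.coord i x) r `<=` chart_cod i.
  by move=> y; rewrite /ccube /= => yr; apply: sub; rewrite /cube /=; lra.
have [|||l [J lL]] := @segment_joined i _ r (L * `|Defs.coord i z - Defs.coord i x|) (Defs.coord i x) (Defs.coord i z) subK.
- by rewrite /ccube /= subrr normr0 ltW.
- by rewrite /ccube /=; move: zq; rewrite /cube /= lt_min => /andP[/ltW].
- by move=> y' y'r; exact: HL.
exists l; first by move: J; rewrite !coordK.
apply: le_lt_trans lL _; move: zq; rewrite /cube /= lt_min => /andP[_ zq].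
apply: (@lt_le_trans _ _ (L * (e / (2 * L)))); first by rewrite ltr_pM2l.
have Ln : L != 0 by rewrite gt_eqF.
have -> : L * (e / (2 * L)) = e / 2 by field.
by lra.
Qed.

(** Nearby points are joined by short segments, so the set of points reachable from [x] is open and
    closed in the connected manifold. *)
Lemma all_joined x z : exists l, joined w x z l.
Proof.
pose A : set M := [set z | exists l, joined w x z l].
have Ao : open A.
  rewrite openE => a [l J]; rewrite /interior.
  apply: filterS (near_joined a ltr01) => b [l' J' _].
  by exists (l + l'); exact: joined_trans J J'.
have Ac : open (~` A).
  rewrite openE => a nA; rewrite /interior.
  apply: filterS (near_joined a ltr01) => b [l' J' _] [l J]; apply: nA.
  by exists (l + l'); apply: joined_trans J (joined_sym J').
have := cm_connected X; move=> /(_ A) H.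
have AT : A = setT.
  apply: H; first by exists x; exists 0; exact: joined_refl.
    by exists A => //; rewrite setTI.
  by exists A; [rewrite -openC | rewrite setTI].
by have : A z by rewrite AT.
Qed.

Notation d := (dist w).

Lemma dist_lb x z : has_lbound [set l | joined w x z l].
Proof. by exists 0 => l /joined_ge0. Qed.

Lemma dist_le x z l : joined w x z l -> d x z <= l.
Proof. by move=> J; apply: ge_inf => //; exact: dist_lb. Qed.

Lemma dist_ge0 x z : 0 <= d x z.
Proof.
apply: lb_le_inf; first exact: all_joined.
by move=> l /joined_ge0.
Qed.

Lemma dist_approx x z e : 0 < e -> exists2 l, joined w x z l & l < d x z + e.
Proof.
move=> e0; have [|l J h] := @inf_adherent _ [set l | joined w x z l] e e0.
  by split; [exact: all_joined | exact: dist_lb].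
by exists l.
Qed.

Lemma dist_lt x z e : d x z < e -> exists2 l, joined w x z l & l < e.
Proof.
move=> h; have [|l J le] := @dist_approx x z (e - d x z); first by rewrite subr_gt0.
by exists l => //; move: le; rewrite addrC subrK.
Qed.

Lemma dist_refl x : d x x = 0.
Proof. by apply/eqP; rewrite eq_le dist_ge0 andbT; apply: dist_le; exact: joined_refl. Qed.

Lemma dist_sym x z : d x z = d z x.
Proof.
suff H a b : d a b <= d b a by apply/eqP; rewrite eq_le !H.
apply: le_trans (lexx _); apply/ler_addgt0Pr => e e0.
have [l J le] := dist_approx b a e0; apply: le_trans (ltW le).
by apply: dist_le; exact: joined_sym.
Qed.

Lemma dist_triangle x (y : M) z : d x z <= d x y + d y z.
Proof.
apply/ler_addgt0Pr => e e0; have e2 : 0 < e / 2 by lra.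
have [l J le] := dist_approx x y e2; have [l' J' le'] := dist_approx y z e2.
by apply: le_trans (dist_le (joined_trans J J')) _; lra.
Qed.

Lemma dist_lipschitz u C x z : MC1 X u -> 0 <= C -> (forall x, grad_sq w u x <= C ^+ 2) ->
  `|u z - u x| <= C * d x z.
Proof.
move=> Cu C0 gC; apply/ler_addgt0Pr => e e0.
have q0 : 0 < e / (C + 1) by rewrite divr_gt0 //; lra.
have [l J le] := dist_approx x z q0.
apply: le_trans (joined_lipschitz Cu C0 gC J) _.
apply: (@le_trans _ _ (C * (d x z + e / (C + 1)))); first by apply: ler_wpM2l => //; exact: ltW.
rewrite mulrDr lerD2l mulrCA -[leRHS]mulr1; apply: ler_wpM2l; first exact: ltW.
by rewrite ler_pdivrMr ?mul1r; lra.
Qed.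

Lemma near_dist x e : 0 < e -> \forall z \near x, d x z < e.
Proof.
move=> e0; apply: filterS (near_joined x e0) => z [l J le].
by apply: le_lt_trans le; exact: dist_le.
Qed.

Lemma gball_open x r : open (gball w x r).
Proof.
rewrite openE => z zr; rewrite /interior.
have e0 : 0 < r - d x z by rewrite subr_gt0.
apply: filterS (near_dist z e0) => b h; rewrite /gball /=.
by apply: le_lt_trans (dist_triangle x z b) _; lra.
Qed.

Definition precompact (B : set M) := exists2 K, compact K & B `<=` K.

Lemma precompact_seq (B : M -> set M) (q : seq M) : (forall y : M, y \in q -> precompact (B y)) ->
  precompact [set z | exists2 y : M, y \in q & B y z].
Proof.
elim: q => [|a q IH] H; first by exists set0; [exact: compact0 | move=> z [y]; rewrite in_nil].
have [|K Kc KB] := IH; first by move=> y yq; apply: H; rewrite in_cons yq orbT.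
have [|K' K'c K'B] := H a; first exact: mem_head.
exists (K' `|` K); first exact: compactU.
move=> z [y]; rewrite in_cons => /orP[/eqP-> Bz|yq Bz]; first by left; exact: K'B.
by right; apply: KB; exists y.
Qed.

Lemma precompactS (B B' : set M) : B `<=` B' -> precompact B' -> precompact B.
Proof. by move=> h [K Kc KB]; exists K => //; exact: subset_trans h KB. Qed.

Lemma local_precompact x : exists2 r, 0 < r & precompact (gball w x r).
Proof.
have [i [r [L [r0 L0 dx sub HL]]]] := chart_window x.
have [|e e0 H] := separation (i := i) (p := Defs.coord i x) r0.
  by move=> y yr; apply: sub; move: yr; rewrite /cube /=; lra.
have subK : ccube (Defs.coord i x) (2 * r) `<=` chart_cod i.
  by move=> y yr; apply: sub; move: yr; rewrite /cube /ccube /=; lra.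
exists e => //; exists (param i @` ccube (Defs.coord i x) (2 * r)).
  exact: param_ccube_compact.
move=> z /dist_lt [l J le]; have [|y yr <-] := H x z l _ J le.
  exists (Defs.coord i x); last exact: coordK.
  by rewrite /ccube /= subrr normr0 ltW.
by exists y => //; exact: ltW.
Qed.

(** Finitely many balls of radius [e] centred in the ball of radius [k e] cover its compact closure.
    Cutting a curve of length below [(k + 1) e] at length [e] before its end shows that the end lies
    within [3 e] of one of these centres. *)
Lemma precompact_step x e (k : nat) : 0 < e -> (0 < k)%N ->
  (forall y : M, d x y < k%:R * e -> precompact (gball w y (3 * e))) ->
  precompact (gball w x (k%:R * e)) -> precompact (gball w x (k.+1%:R * e)).
Proof.
move=> e0 k0 H [K Kc KB]; set B := gball w x (k%:R * e) in KB.
have Kcl : closed K by apply: compact_closed => //; exact: cm_hausdorff X.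
have BK : closure B `<=` K by rewrite (closure_id K).1 //; exact: closureS.
have clc : compact (closure B) by apply: subclosed_compact BK => //; exact: closed_closure.
move: clc; rewrite compact_cover => /(_ M B (fun y => gball w y e)).
case=> [y _||D DB cov]; first exact: gball_open.
  move=> z Bz; have zz : gball w z e z by rewrite /gball /= dist_refl.
  have [y [By yz]] := Bz _ (open_nbhs1 (@gball_open z e) zz).
  by exists y => //; rewrite /gball /= dist_sym.
apply: (@precompactS _ [set z | exists2 y : M, y \in finmap.enum_fset D & gball w y (3 * e) z]); last first.
  apply: precompact_seq => y yD; apply: H.
  by have := DB y yD; rewrite inE.
move=> z /dist_lt [l J le].
have l0 := joined_ge0 J.
have kk : 1 <= k%:R :> R by rewrite ler1n.
(* The maximum with 0 handles curves shorter than [e]. *)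
have [y [J1 J2]] : exists y, joined w x y (Num.max 0 (l - e)) /\ joined w y z (l - Num.max 0 (l - e)).
  by apply: joined_split J _; rewrite le_max lexx /= ge_max l0 /=; lra.
have By : B y.
  rewrite /B /gball /=; apply: le_lt_trans (dist_le J1) _.
  move: le; rewrite -natr1 mulrDl mul1r => le.
  by rewrite gt_max; apply/andP; split; nra.
have [b bD bz] := cov y (@subset_closure _ B y By).
exists b => //; rewrite /gball /=; apply: le_lt_trans (dist_triangle b y z) _.
have := dist_le J2; move: bz; rewrite /gball /= => h1 h2.
have : l - Num.max 0 (l - e) <= e by rewrite lerBlDr -lerBlDl le_max lexx orbT.
by lra.
Qed.

(* Hopf-Rinow: iterating this step from a ball that is not precompact produces *)
(* a Cauchy sequence no limit of which has a precompact neighbourhood.         *)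
Lemma bad_ball_step x s : 0 < s -> ~ precompact (gball w x s) ->
  exists y, d x y <= s /\ ~ precompact (gball w y (s / 2)).
Proof.
move=> s0 bad; apply: contrapT => H.
have good y : d x y <= s -> precompact (gball w y (s / 2)).
  by move=> h; apply: contrapT => nb; apply: H; exists y.
(* Eight enlargements by [s / 8] reach the radius [s], and [3 * (s / 8) <= s / 2] keeps the required
   small balls precompact. *)
have e0 : 0 < s / 8 by lra.
have sub y r r' : r <= r' -> gball w y r `<=` gball w y r'.
  by move=> rr z; rewrite /gball /= => /lt_le_trans; apply.
have G (k : nat) : (0 < k)%N -> (k <= 8)%N -> precompact (gball w x (k%:R * (s / 8))).
  elim: k => // k IH _ k8; have [k0|k0] := posnP k.
    rewrite k0; apply: precompactS (good x _); last by rewrite dist_refl ltW.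
    by apply: sub; lra.
  have kR : k%:R <= 7 :> R by rewrite (ler_nat R k 7).
  apply: precompact_step => // [y xy|]; last by apply: IH => //; exact: ltnW.
  apply: precompactS (good y _); first by apply: sub; lra.
  by nra.
apply: bad; have := G 8 isT isT; congr precompact; congr gball.
by rewrite mulrC divfK.
Qed.

Lemma gball_precompact x r : complete_metric w -> precompact (gball w x r).
Proof.
move=> cm; apply: contrapT => bad.
have r0 : 0 < r.
  rewrite ltNge; apply/negP => r0; apply: bad; exists set0; first exact: compact0.
  by move=> z; rewrite /gball /= => h; have := dist_ge0 x z; lra.
pose s (k : nat) := r / 2 ^+ k.
have s0 k : 0 < s k by rewrite divr_gt0 // exprn_gt0.
have sS k : s k.+1 = s k / 2 by rewrite /s exprSr invfM mulrA.
have /choice [F HF] : forall a : M * nat, exists y, ~ precompact (gball w a.1 (s a.2)) ->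
    d a.1 y <= s a.2 /\ ~ precompact (gball w y (s a.2.+1)).
  move=> [a k] /=; have [g|b] := pselect (precompact (gball w a (s k))); first by exists a.
  by have [y [h1 h2]] := bad_ball_step (s0 k) b; exists y => _; rewrite sS.
(* The balls of radius [s k] about [q k] are all bad, and consecutive centres are within [s k], a
   convergent geometric series. *)
pose q := fix q (k : nat) := if k is k'.+1 then F (q k', k') else x.
have qbad k : ~ precompact (gball w (q k) (s k)).
  elim: k => [|k IH] /=; first by rewrite /s expr0 divr1.
  by have [] := HF (q k, k) IH.
have qstep k : d (q k) (q k.+1) <= s k by have [] := HF (q k, k) (qbad k).
have qd k (j : nat) : d (q k) (q (k + j)%N) <= 2 * s k - 2 * s (k + j)%N.
  elim: j => [|j IH]; first by rewrite addn0 dist_refl subrr.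
  rewrite addnS; apply: le_trans (dist_triangle _ (q (k + j)%N) _) _.
  by have := qstep (k + j)%N; rewrite sS; lra.
have sto e : 0 < e -> exists N : nat, forall k, (N <= k)%N -> s k < e.
  move=> e0; exists (Num.bound (r / e)) => k Nk; rewrite /s ltr_pdivrMr ?exprn_gt0 //.
  rewrite mulrC -ltr_pdivrMr //.
  apply: lt_trans (archi_boundP _) _; first by rewrite divr_ge0 ?ltW.
  by rewrite -natrX ltr_nat; apply: leq_ltn_trans Nk _; exact: ltn_expl.
have [|x0 cvg0] := cm q.
  move=> e e0; have [|N HN] := sto (e / 2); first by lra.
  have H a b : (N <= a)%N -> (a <= b)%N -> d (q a) (q b) < e.
    move=> Na ab; have := qd a (b - a)%N; rewrite subnKC // => h.
    by have := HN a Na; have := s0 b; lra.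
  exists N => a b Na Nb; have [ab|ba] := leqP a b; first exact: H.
  by rewrite dist_sym; apply: H => //; exact: ltnW.
have [e e0 g] := local_precompact x0.
have e2 : 0 < e / 2 by lra.
have [N1 HN1] := sto _ e2.
have : \forall k \near \oo, d (q k) x0 < e / 2.
  exact: (cvgr_lt _ cvg0).
move=> [N2 _ HN2]; pose k := maxn N1 N2.
apply: (qbad k); apply: precompactS g => z; rewrite /gball /= => h.
apply: le_lt_trans (dist_triangle x0 (q k) z) _; rewrite dist_sym.
have := HN1 k (leq_maxl _ _); have /= := HN2 k (leq_maxr _ _).
by lra.
Qed.

End DistanceTopology.

(** * The volume measure *)

Section LowerIntegral.
Local Open Scope ereal_scope.
Context d (T : measurableType d) (R : realType) (mu : {measure set T -> \bar R}).
Import HBNNSimple.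
Implicit Types (f g : T -> \bar R).

Lemma lower_integral f B : (forall x, 0 <= f x) ->
  (forall s : {nnsfun T >-> R}, (forall x, (s x)%:E <= f x) -> sintegral mu s <= B) ->
  \int[mu]_(x in setT) f x <= B.
Proof.
move=> f0 H; rewrite (ge0_integralTE _ f0); apply/ge_ereal_sup => _ [s sf <-].
exact: H.
Qed.

Lemma sintegral_le_integral f (s : {nnsfun T >-> R}) : (forall x, (s x)%:E <= f x) ->
  sintegral mu s <= \int[mu]_(x in setT) f x.
Proof.
move=> sf; have f0 x : 0 <= f x by apply: le_trans (sf x); rewrite lee_fin.
by rewrite (ge0_integralTE _ f0); apply: ereal_sup_ubound; exists s.
Qed.

Lemma integral_mono f g : (forall x, 0 <= f x) -> (forall x, f x <= g x) ->
  \int[mu]_(x in setT) f x <= \int[mu]_(x in setT) g x.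
Proof.
move=> f0 fg; apply: lower_integral => // s sf; apply: sintegral_le_integral => x.
exact: le_trans (sf x) (fg x).
Qed.

(** For a nonnegative integrand that need not be measurable the integral is a supremum over simple
    functions below it, hence superadditive. This applies to slices of arbitrary functions. *)
Lemma integral_superadd f g : (forall x, 0 <= f x) -> (forall x, 0 <= g x) ->
  \int[mu]_(x in setT) f x + \int[mu]_(x in setT) g x <= \int[mu]_(x in setT) (f x + g x).
Proof.
move=> f0 g0; set B := \int[mu]_(x in setT) (f x + g x).
have fg0 x : 0 <= f x + g x by exact: adde_ge0.
have B0 : 0 <= B by apply: integral_ge0 => x _.
have [->|Boo] := eqVneq B +oo; first exact: leey.
have Bfin : B \is a fin_num by rewrite ge0_fin_numE // ltey.
have gB : \int[mu]_(x in setT) g x <= B.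
  by apply: integral_mono => // x; rewrite leeDr.
have gfin : \int[mu]_(x in setT) g x \is a fin_num.
  by rewrite ge0_fin_numE ?integral_ge0 //; apply: le_lt_trans gB _; rewrite ltey.
rewrite -leeBrDr //; apply: lower_integral => // s sf.
rewrite leeBrDr //.
have sB : sintegral mu s <= B.
  by apply: sintegral_le_integral => x; apply: le_trans (sf x) _; rewrite leeDl.
have sfin : sintegral mu s \is a fin_num.
  by rewrite ge0_fin_numE ?sintegral_ge0 //; apply: le_lt_trans sB _; rewrite ltey.
rewrite -leeBrDl //; apply: lower_integral => // s' sg; rewrite leeBrDl //.
rewrite -sintegralD; apply: (sintegral_le_integral (s := add_nnsfun s s')) => x /=.
by rewrite EFinD; exact: leeD.
Qed.

Lemma integral_scale_le f (c : R) : (0 < c)%R -> (forall x, 0 <= f x) ->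
  c%:E * \int[mu]_(x in setT) f x <= \int[mu]_(x in setT) (c%:E * f x).
Proof.
move=> c0 f0; rewrite -lee_pdivlMl //; apply: lower_integral => // s sf.
rewrite lee_pdivlMl // -sintegralrM.
apply: (sintegral_le_integral (s := scale_nnsfun s (ltW c0))) => x /=.
by rewrite EFinM; apply: lee_wpmul2l => //; rewrite lee_fin ltW.
Qed.

End LowerIntegral.

(** * The iterated integral of arbitrary nonnegative functions *)

Section LebesgueInt.
Variable R : realType.
Local Open Scope ereal_scope.
Implicit Types (c : R).

Lemma lebesgue_int_ge0 m (h : 'rV[R]_m -> \bar R) : (forall y, 0 <= h y) ->
  0 <= lebesgue_int h.
Proof.
elim: m h => [|m IH] h h0 /=; first exact: h0.
by apply: integral_ge0 => t _; apply: IH.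
Qed.

Lemma lebesgue_int_mono m (h k : 'rV[R]_m -> \bar R) : (forall y, 0 <= h y) ->
  (forall y, h y <= k y) -> lebesgue_int h <= lebesgue_int k.
Proof.
elim: m h k => [|m IH] h k h0 hk /=; first exact: hk.
apply: integral_mono => t; first exact: lebesgue_int_ge0.
by apply: IH.
Qed.

Lemma lebesgue_int_superadd m (h k : 'rV[R]_m -> \bar R) : (forall y, 0 <= h y) ->
  (forall y, 0 <= k y) -> lebesgue_int h + lebesgue_int k <= lebesgue_int (fun y => h y + k y).
Proof.
elim: m h k => [|m IH] h k h0 k0 //=.
apply: le_trans (integral_superadd _ _ _) _.
- by move=> t; exact: lebesgue_int_ge0.
- by move=> t; exact: lebesgue_int_ge0.
apply: integral_mono => t; first by apply: adde_ge0; exact: lebesgue_int_ge0.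
by apply: IH.
Qed.

Lemma lebesgue_int_scale_le m (h : 'rV[R]_m -> \bar R) c : (0 < c)%R -> (forall y, 0 <= h y) ->
  c%:E * lebesgue_int h <= lebesgue_int (fun y => c%:E * h y).
Proof.
move=> c0; elim: m h => [|m IH] h h0 //=.
apply: le_trans (integral_scale_le _ c0 _) _ => [t|]; first exact: lebesgue_int_ge0.
apply: integral_mono => t; last by apply: IH.
by apply: mule_ge0; [rewrite lee_fin ltW | exact: lebesgue_int_ge0].
Qed.

Lemma lebesgue_int_scale_ge m (h : 'rV[R]_m -> \bar R) c : (0 < c)%R -> (forall y, 0 <= h y) ->
  lebesgue_int (fun y => c%:E * h y) <= c%:E * lebesgue_int h.
Proof.
move=> c0 h0; rewrite -lee_pdivrMl //.
apply: le_trans (lebesgue_int_scale_le _ _) _; first by rewrite invr_gt0.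
  by move=> y; apply: mule_ge0; [rewrite lee_fin ltW | exact: h0].
apply: lebesgue_int_mono => y.
  rewrite muleA -EFinM mulVf ?gt_eqF // mul1e; exact: h0.
by rewrite muleA -EFinM mulVf ?gt_eqF // mul1e.
Qed.

Lemma lebesgue_int_sum m (I : Type) (q : seq I) (h : I -> 'rV[R]_m -> \bar R) :
  (forall i y, 0 <= h i y) ->
  \sum_(i <- q) lebesgue_int (h i) <= lebesgue_int (fun y => \sum_(i <- q) h i y).
Proof.
move=> h0; elim: q => [|i q IH].
  by rewrite big_nil; apply: lebesgue_int_ge0 => y; rewrite big_nil.
rewrite big_cons; apply: le_trans (leeD2l _ IH) _.
apply: le_trans (lebesgue_int_superadd _ _) _ => // [y|].
  by apply: sume_ge0 => j _; exact: h0.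
apply: lebesgue_int_mono => y; last by rewrite big_cons.
by apply: adde_ge0; [exact: h0 | apply: sume_ge0 => j _; exact: h0].
Qed.

End LebesgueInt.

(** * Integration against the volume measure in a chart *)

Section VolumeIntegral.
Import HBNNSimple.
Variables (R : realType) (M : ptopologicalType) (n : nat).
Variable X : complex_manifold R M n.
Variable w : kahler_form X.
Variable mu : {measure set (borel M) -> \bar R}.
Hypothesis hmu : is_volume w mu.
Implicit Types (i j : chart X) (u : M -> R) (x z : M) (p : 'rV[R]_(n + n)) (l r s t c e : R).

Lemma open_borel (U : set M) : open U -> measurable (U : set (borel M)).
Proof. by move=> Uo; exact: sub_sigma_algebra. Qed.

Lemma closed_borel (U : set M) : closed U -> measurable (U : set (borel M)).
Proof.
by move=> Uc; rewrite -[U]setCK; apply: measurableC; apply: open_borel; rewrite openC.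
Qed.

Lemma continuous_borel u : continuous u -> measurable_fun setT (u : borel M -> R).
Proof.
move=> cu mT; apply: (measurability _ (RGenOInfty.measurableE R)) => //.
move=> /= _ [_ [t ->] <-]; rewrite setTI; apply: open_borel.
by apply: open_comp => [x _|]; [exact: cu | exact: interval_open].
Qed.

Let dens i y : R := wedge_top (kform w i y).

Lemma dens_gt0 i y : chart_cod i y -> 0 < dens i y.
Proof.
move=> cy; rewrite /dens wedge_top_det; [|exact: kform_real11|exact: kform_pos].
by rewrite mulr_gt0 ?wedge_top_Jmx // sqrtr_gt0; apply: (field_det_gt0 (kform_field w)).
Qed.

Lemma dens_cont i y : chart_cod i y -> {for y, continuous (dens i)}.
Proof.
move=> cy; apply: (@near_eq_cont R _ (fun y => wedge_top (Jmx R n) * Num.sqrt (\det (kform w i y)))).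
  apply: (open_near (@chart_cod_open _ _ _ X i) cy) => z cz.
  by rewrite /dens [RHS]wedge_top_det; [|exact: kform_real11|exact: kform_pos].
apply: (@continuousM R _ (fun=> _)); first exact: cst_continuous.
apply: (@continuous_comp _ _ _ (fun y => \det (kform w i y)) Num.sqrt).
  by apply: cont_det => a b; exact: (mf_cont (kform_field w)).
exact: sqrt_continuous.
Qed.

Definition chart_integrand i u y : R := dens i y * pull i u y.

Lemma chart_integrand_ge0 i u y : (forall x, 0 <= u x) -> 0 <= chart_integrand i u y.
Proof.
move=> u0; rewrite /chart_integrand /pull; case: ifPn => [|_]; last by rewrite mulr0.
by rewrite inE => cy; apply: mulr_ge0 => //; exact: ltW (dens_gt0 cy).
Qed.

(** For a simple function below [u], [is_volume] gives the measure of each level set, and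
    superadditivity of [lebesgue_int] adds them up below the integral of [u] in the chart. *)
Lemma integral_le_chart i u : (forall x, 0 <= u x) -> (forall x, u x != 0 -> chart_dom i x) ->
  (\int[mu]_(x in setT) (u x)%:E <= lebesgue_int (fun y => (chart_integrand i u y)%:E))%E.
Proof.
move=> u0 su; apply: lower_integral => [x|s su']; first by rewrite lee_fin.
have s0 x : 0 <= s x by [].
have sle x : s x <= u x by rewrite -lee_fin.
have sdom x : s x != 0 -> chart_dom i x.
  move=> sx; apply: su; apply: contraNneq sx => ux.
  by rewrite eq_le s0 andbT -ux sle.
pose A (a : R) : set M := s @^-1` [set a].
have term a y : 0 <= a -> 0 <= dens i y * (a * \1_(Defs.coord i @` A a) y).
  move=> a0; have [->|an0] := eqVneq a 0; first by rewrite mul0r mulr0.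
  rewrite indicE; case: (boolP (y \in _)) => /= yA; last by rewrite !mulr0.
  move: yA; rewrite inE => -[z Az <-]; rewrite mulr1; apply: mulr_ge0 => //; apply: ltW; apply: dens_gt0.
  by apply: coord_cod; apply: sdom; rewrite (_ : s z = a).
rewrite sintegralE fsbig_finite //=.
set q := finmap.enum_fset (fset_set (range s)).
have q0 a : a \in q -> 0 <= a.
  by rewrite /q in_fset_set // inE => -[x _ <-].
(* The test on the sign of [a] makes the family nonnegative for every real [a], as
   [lebesgue_int_sum] asks, and is vacuous on the list of values. *)
apply: (@le_trans _ _ (\sum_(a <- q) lebesgue_int (fun y =>
    (if 0 <= a then dens i y * (a * \1_(Defs.coord i @` A a) y) else 0)%:E))%E).
  rewrite big_seq [leRHS]big_seq; apply: lee_sum => a aq; rewrite q0 //.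
  have [->|an0] := eqVneq a 0.
    by rewrite mul0e; apply: lebesgue_int_ge0 => y; rewrite mul0r mulr0.
  have a0 : 0 < a by rewrite lt0r an0 q0.
  have mA : measurable (A a : set (borel M)) by exact: measurable_sfunP.
  rewrite (hmu (i := i) mA); last by move=> z Az; apply: sdom; rewrite (_ : s z = a).
  apply: le_trans (lebesgue_int_scale_le a0 _) _.
    move=> y; rewrite lee_fin; have := term a y (ltW a0).
    by rewrite mulrCA pmulr_rge0.
  apply: lebesgue_int_mono => y; first by rewrite -EFinM lee_fin mulrCA; exact: term (ltW a0).
  by rewrite -EFinM lee_fin mulrCA.
apply: le_trans (lebesgue_int_sum _ _) _.
  by move=> a y; rewrite lee_fin; case: ifPn => // /term.
apply: lebesgue_int_mono => y.
  by apply: sume_ge0 => a _; rewrite lee_fin; case: ifPn => // /term.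
rewrite sumEFin lee_fin.
have uq : uniq q by exact: finmap.fset_uniq.
have [[z dz e]|nz] := pselect (exists2 z, chart_dom i z & Defs.coord i z = y); last first.
  rewrite big1_seq; first exact: chart_integrand_ge0.
  move=> a /andP[_ aq]; rewrite q0 //; have [->|an0] := eqVneq a 0; first by rewrite mul0r mulr0.
  rewrite indicE memNset ?mulr0 // => -[z Az zy]; apply: nz; exists z => //.
  by apply: sdom; rewrite (_ : s z = a).
have cy : chart_cod i y by rewrite -e; exact: coord_cod.
have py : param i y = z by rewrite -e coordK.
rewrite /chart_integrand pullE // py.
apply: (@le_trans _ _ (dens i y * s z)); last by apply: ler_wpM2l => //; exact: ltW (dens_gt0 cy).
have zq : s z \in q by rewrite /q in_fset_set // inE; exists z.
rewrite (bigD1_seq (s z)) //= q0 // [X in _ + X]big1_seq ?addr0; last first.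
  move=> a /andP[na aq]; rewrite q0 //; have [->|an0] := eqVneq a 0; first by rewrite mul0r mulr0.
  rewrite indicE memNset ?mulr0 // => -[z' Az' zy]; move: na; rewrite -(_ : s z' = a) //.
  suff -> : z' = z by rewrite eqxx.
  have dz' : chart_dom i z' by apply: sdom; rewrite (_ : s z' = a).
  by rewrite -(coordK dz') zy -e coordK.
apply: ler_wpM2l; first exact: ltW (dens_gt0 cy).
by apply: ler_piMr => //; rewrite indicE; case: (_ \in _).
Qed.

Section Window.
Variables (i : chart X) (p : 'rV[R]_(n + n)) (r : R).
Hypotheses (r0 : 0 < r) (sub : cube p (3 * r) `<=` chart_cod i).
Let S : set M := param i @` ccube p r.

Lemma window_sub : ccube p r `<=` chart_cod i.
Proof.
by move=> y yr; apply: sub; rewrite /cube /=; move: yr; rewrite /ccube /=; have := r0; lra.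
Qed.

Lemma window_dom : S `<=` chart_dom i.
Proof. by move=> x [y yr <-]; apply: param_dom; exact: window_sub. Qed.

Lemma window_measurable : measurable (S : set (borel M)).
Proof.
apply: closed_borel; apply: compact_closed; first exact: cm_hausdorff X.
by apply: param_ccube_compact; exact: window_sub.
Qed.

Lemma chart_integrand_Cc u : continuous u -> csupp i p r u -> Cc (chart_integrand i u).
Proof.
move=> cu su.
have z0 y : r <= `|y - p| -> chart_integrand i u y = 0.
  by move=> yr; rewrite /chart_integrand (pull0 su yr) mulr0.
apply: (Cc_local _ z0); apply: (cont_extend (r := 3 * r) _ _ z0) => [|y Ny].
  by have := r0; lra.
apply: (@continuousM R); first exact: dens_cont (sub Ny).
have r3 : r < 3 * r by have := r0; lra.
exact: (pull_continuous r3 sub cu su).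
Qed.

Lemma window_bump_Cc : Cc (fun y => dens i y * bump p r y).
Proof.
have z0 y : 2 * r <= `|y - p| -> dens i y * bump p r y = 0.
  by move=> yr; rewrite bump0 ?mulr0.
apply: (Cc_local _ z0); apply: (cont_extend (r := 3 * r) _ _ z0) => [|y Ny].
  by have := r0; lra.
apply: (@continuousM R); first exact: dens_cont (sub Ny).
exact: (C1_continuous (@bump_C1 _ _ _ _)).
Qed.

Lemma window_indic y : 0 <= dens i y * \1_(Defs.coord i @` S) y <= dens i y * bump p r y /\
  (Defs.coord i @` S) y = ccube p r y.
Proof.
have E : (Defs.coord i @` S) y = ccube p r y.
  apply/propext; split.
    by move=> [x [z zr <-] <-]; rewrite paramK //; exact: window_sub.
  move=> yr; exists (param i y); first by exists y.
  by rewrite paramK //; exact: window_sub.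
split=> //; rewrite indicE.
have [yr|yr] := leP `|y - p| r.
  have h : (Defs.coord i @` S) y by rewrite E.
  by rewrite (mem_set h) /= (bump1 r0 yr) mulr1 lexx andbT; apply: ltW; apply: dens_gt0; exact: window_sub.
have h : ~ (Defs.coord i @` S) y.
  by rewrite E /ccube /= => h; move: yr; rewrite ltNge h.
rewrite (memNset h) /= mulr0 lexx /=; have [y3|y3] := leP (3 * r) `|y - p|.
  by rewrite bump0 ?mulr0 //; have := r0; lra.
by apply: mulr_ge0; [apply: ltW; apply: dens_gt0; exact: sub | exact: bump_ge0].
Qed.

Lemma window_finite : (mu S < +oo)%E.
Proof.
rewrite (hmu (i := i) window_measurable window_dom).
apply: (@le_lt_trans _ _ (lebesgue_int (fun y => (dens i y * bump p r y)%:E))).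
  by apply: lebesgue_int_mono => y; rewrite lee_fin; have [/andP[]] := window_indic y.
by rewrite (Lint_fin window_bump_Cc) ltry.
Qed.

(** One inequality is [integral_le_chart]. It also holds for the complement [g = c 1_S - u], while
    the two integrals against [mu] add up to [c mu(S)], which bounds the sum of the two chart
    integrals. Both inequalities must then be equalities. *)
Lemma chart_integral_ge0 u : continuous u -> csupp i p r u -> (forall x, 0 <= u x) ->
  (\int[mu]_(x in setT) (u x)%:E = (Lint (chart_integrand i u))%:E)%E.
Proof.
move=> cu su u0.
have r3 : r < 3 * r by have := r0; lra.
have [B B0 HB] := csupp_bounded r3 sub cu su.
pose c := B + 1; have c0 : 0 < c by rewrite /c; lra.
have uc x : u x <= c by apply: le_trans (ler_norm _) _; apply: le_trans (HB x) _; rewrite /c; lra.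
have uS x : u x != 0 -> S x.
  by move=> /su [d xr]; exists (Defs.coord i x); [exact: ltW | exact: coordK].
pose g x := c * \1_S x - u x.
have g0 x : 0 <= g x.
  rewrite /g indicE; have [Sx|nS] := pselect (S x); first by rewrite mem_set // mulr1 subr_ge0.
  rewrite memNset // mulr0 sub0r oppr_ge0.
  by have [->//|ux] := eqVneq (u x) 0; case: nS; exact: uS.
have gS x : g x != 0 -> chart_dom i x.
  move=> gx; apply: window_dom; apply: contrapT => nS; move: gx.
  rewrite /g indicE memNset // mulr0 sub0r oppr_eq0 => /uS; exact: nS.
have mu' : measurable_fun setT (u : borel M -> R) by exact: continuous_borel.
have mS : measurable_fun setT (\1_S : borel M -> R).
  by apply: measurable_indic; exact: window_measurable.
have mg : measurable_fun setT (g : borel M -> R).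
  by apply: measurable_funB => //; apply: measurable_funM => //; exact: measurable_cst.
have Lu := integral_le_chart u0 (fun x h => (su x h).1).
have Lg := integral_le_chart g0 gS.
have fin := window_finite.
have sumE : (\int[mu]_(x in setT) (u x)%:E + \int[mu]_(x in setT) (g x)%:E = c%:E * mu S)%E.
  rewrite -ge0_integralD //; [|by move=> x _; rewrite lee_fin|exact/measurable_EFinP
    |by move=> x _; rewrite lee_fin|exact/measurable_EFinP].
  transitivity (\int[mu]_(x in setT) (c%:E * (\1_S x)%:E))%E.
    by apply: eq_integral => x _; rewrite -EFinD /g addrC subrK EFinM.
  rewrite ge0_integralZl_EFin //; [|exact/measurable_EFinP|exact: ltW].
  by rewrite integral_indic // ?setIT //; exact: window_measurable.
have sumL : (lebesgue_int (fun y => (chart_integrand i u y)%:E) +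
   lebesgue_int (fun y => (chart_integrand i g y)%:E) <= c%:E * mu S)%E.
  apply: le_trans (lebesgue_int_superadd _ _) _.
  - by move=> y; rewrite lee_fin; exact: chart_integrand_ge0.
  - by move=> y; rewrite lee_fin; exact: chart_integrand_ge0.
  rewrite (hmu (i := i) window_measurable window_dom).
  apply: le_trans _ (lebesgue_int_scale_ge c0 _); last first.
    by move=> y; rewrite lee_fin; have [/andP[]] := window_indic y.
  apply: lebesgue_int_mono => y.
    by rewrite -EFinD lee_fin addr_ge0 //; exact: chart_integrand_ge0.
  rewrite -EFinD -EFinM lee_fin /chart_integrand -mulrDr mulrCA -/(dens i y).
  have [cy|ncy] := pselect (chart_cod i y); last first.
    rewrite /pull memNset // addr0 mulr0 mulrCA mulr_ge0 ?(ltW c0) //.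
    by have [/andP[]] := window_indic y.
  rewrite !pullE // /g addrC subrK.
  have -> // : \1_S (param i y) = \1_(Defs.coord i @` S) y :> R.
  rewrite !indicE; congr ((_ : bool)%:R); apply/idP/idP; rewrite !inE.
    by move=> h; exists (param i y) => //; exact: paramK.
  have [_ ->] := window_indic y; by move=> yr; exists y.
have Ccu := chart_integrand_Cc cu su.
rewrite (Lint_fin Ccu) in Lu sumL.
apply/eqP; rewrite eq_le Lu /=.
set a := (\int[mu]_(x in setT) (u x)%:E)%E in Lu sumE *.
set b := (\int[mu]_(x in setT) (g x)%:E)%E in Lg sumE.
have a0 : (0 <= a)%E by apply: integral_ge0 => x _; rewrite lee_fin.
have b0 : (0 <= b)%E by apply: integral_ge0 => x _; rewrite lee_fin.
have abfin : (a + b < +oo)%E by rewrite sumE lte_mul_pinfty // ?lee_fin ?ltW.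
have bfin : b \is a fin_num by rewrite ge0_fin_numE //; apply: le_lt_trans abfin; rewrite leeDr.
rewrite -(leeD2rE _ _ bfin) sumE; apply: le_trans sumL; exact: leeD2l.
Qed.

Lemma window_integrable u : continuous u -> csupp i p r u ->
  mu.-integrable setT (EFin \o u).
Proof.
move=> cu su.
have ca : continuous (fun x => `|u x|) by move=> x; apply: cvg_norm; exact: cu.
have sa : csupp i p r (fun x => `|u x|) by move=> x; rewrite normr_eq0; exact: su.
apply/integrableP; split; first by apply/measurable_EFinP; exact: continuous_borel.
have := chart_integral_ge0 ca sa (fun x => normr_ge0 (u x)).
by rewrite /= => ->; exact: ltry.
Qed.

Lemma chart_integral u : continuous u -> csupp i p r u ->
  Rintegral mu setT u = Lint (chart_integrand i u).
Proof.
move=> cu su.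
have ca : continuous (fun x => `|u x|) by move=> x; apply: cvg_norm; exact: cu.
have sa : csupp i p r (fun x => `|u x|) by move=> x; rewrite normr_eq0; exact: su.
pose v x := `|u x| + u x.
have cv : continuous v by apply: cont_add.
have sv : csupp i p r v.
  by move=> x; rewrite /v; have [->|ux _] := eqVneq (u x) 0; [rewrite normr0 addr0 eqxx | exact: su].
have v0 x : 0 <= v x by rewrite /v -lerBlDr sub0r; have := ler_norm (- u x); rewrite normrN.
have -> : u = (fun x => v x - `|u x|) by apply/funext => x; rewrite /v addrAC subrr add0r.
rewrite RintegralB //; [|exact: window_integrable|exact: window_integrable].
rewrite /Rintegral (chart_integral_ge0 cv sv v0) (chart_integral_ge0 ca sa) //=.
rewrite -LintB; [|exact: chart_integrand_Cc|exact: chart_integrand_Cc].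
congr Lint; apply/funext => y; rewrite /chart_integrand -mulrBr; congr (_ * _).
by rewrite /pull /v; case: ifP => _ //; rewrite ?subrr // addrAC subrr add0r.
Qed.

End Window.

End VolumeIntegral.

(** * Windows, localisation and the global weak inequality *)

Section Windows.
Variables (R : realType) (M : ptopologicalType) (n : nat).
Variable X : complex_manifold R M n.
Variable w : kahler_form X.
Implicit Types (i j : chart X) (u v : M -> R) (x z : M) (p : 'rV[R]_(n + n)) (r s t c e : R).

(* The factor 4 makes lengths of coordinate segments in a window comparable    *)
(* with their lengths in the metric frozen at any point of the window.         *)
Record window := Window {
  win_chart : chart X;
  win_center : 'rV[R]_(n + n);
  win_radius : R;
  win_gt0 : 0 < win_radius;
  win_sub : cube win_center (6 * win_radius) `<=` chart_cod win_chart;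
  win_compare : forall y y' v : 'rV[R]_(n + n),
    cube win_center (6 * win_radius) y -> cube win_center (6 * win_radius) y' ->
    metric_sq (kform w win_chart y') v <= 4 * metric_sq (kform w win_chart y) v }.

Definition win_bump (W : window) : M -> R :=
  push (win_chart W) (bump (win_center W) (win_radius W / 2)).

Definition wsupp (W : window) u := csupp (win_chart W) (win_center W) (win_radius W) u.

Lemma win_half (W : window) : 0 < win_radius W / 2.
Proof. by have := win_gt0 W; lra. Qed.

Lemma bump_half (W : window) y : win_radius W <= `|y - win_center W| ->
  bump (win_center W) (win_radius W / 2) y = 0.
Proof. by move=> h; apply: bump0; [exact: win_half | rewrite mulrC divfK]. Qed.

Lemma win_ccube (W : window) c : c < 6 * win_radius W ->
  ccube (win_center W) c `<=` chart_cod (win_chart W).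
Proof. by move=> cW y yc; apply: win_sub; apply: le_lt_trans yc cW. Qed.

Lemma win_ccube1 (W : window) : ccube (win_center W) (win_radius W) `<=` chart_cod (win_chart W).
Proof. by apply: win_ccube; have := win_gt0 W; lra. Qed.

Lemma win_bump_MC1 W : MC1 X (win_bump W).
Proof. exact: push_C1 (@win_ccube1 W) (@bump_C1 _ _ _ _) (@bump_half W). Qed.

Lemma win_cobump_MC1 W : MC1 X (fun x => 1 - win_bump W x).
Proof. by apply: MC1B; [exact: MC1_cst | exact: win_bump_MC1]. Qed.

Lemma win_bump_supp W : wsupp W (win_bump W).
Proof. exact: push_csupp (@bump_half W). Qed.

Lemma win_bump_ge0 W x : 0 <= win_bump W x.
Proof. by rewrite /win_bump /push; case: ifP => // _; exact: bump_ge0. Qed.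

Lemma win_bump_le1 W x : win_bump W x <= 1.
Proof. by rewrite /win_bump /push; case: ifP => // _; exact: bump_le1. Qed.

Lemma entry_cauchy (G : 'M[R]_(n + n)) (v : 'rV[R]_(n + n)) a : posdef G ->
  `|v 0 a| <= Num.sqrt (invmx G a a) * Num.sqrt (bil G v v).
Proof.
move=> pG; have := dotl_CS (delta_mx 0 a) v pG; rewrite bil_delta.
suff -> : dotl (delta_mx 0 a) v = v 0 a by [].
rewrite /dotl (bigD1 a) //= big1 => [|b ba]; first by rewrite mxE !eqxx mulr1 addr0.
by rewrite mxE (negPf ba) andbF mulr0.
Qed.

(** The entries of the metric are continuous, and [|v|^2 <= L bil G v v] converts a small entrywise
    error into a small multiple of the metric at [p]. *)
Lemma metric_compare i p : chart_cod i p -> exists2 r, 0 < r &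
  cube p r `<=` chart_cod i /\ forall y v : 'rV[R]_(n + n), cube p r y ->
    metric_sq (kform w i p) v / 2 <= metric_sq (kform w i y) v <= 2 * metric_sq (kform w i p) v.
Proof.
move=> cp; set G := metric (kform w i p).
have pG : posdef G by exact: (field_posdef (kform_field w) cp).
pose L := \sum_a invmx G a a.
have iG a : 0 <= invmx G a a by rewrite -bil_delta; exact: posdef_ge0 (posdef_inv pG).
have L0 : 0 <= L by apply: sumr_ge0.
have vL (v : 'rV[R]_(n + n)) : `|v| ^+ 2 <= L * bil G v v.
  have b0 := posdef_ge0 v pG.
  have : `|v| <= Num.sqrt (L * bil G v v).
    apply: mxnorm_le => [|a]; first exact: sqrtr_ge0.
    apply: le_trans (entry_cauchy v a pG) _; rewrite -sqrtrM //; apply: ler_wsqrtr.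
    apply: ler_wpM2r => //; rewrite /L (bigD1 a) //= lerDl; exact: sumr_ge0.
  rewrite -(@ler_pXn2r _ 2) ?nnegrE ?sqrtr_ge0 // sqr_sqrtr //; exact: mulr_ge0.
pose m2 := \sum_(a < n + n) \sum_(b < n + n) (1 : R).
have m20 : 0 <= m2 by apply: sumr_ge0 => a _; apply: sumr_ge0.
(* Here [m2] is the number of entries; the choice makes the total error at most half of
   [bil G v v]. *)
pose e := (2 * (m2 * L + 1))^-1.
have mL0 : 0 <= m2 * L by exact: mulr_ge0.
have e0 : 0 < e by rewrite invr_gt0; lra.
have H : \forall y \near p, chart_cod i y /\ forall a b, `|G a b - metric (kform w i y) a b| <= e.
  apply: (@filterI _ _ (nbhs_filter (p : 'rV[R]_(n + n)))).
    exact: open_nbhs1 (@chart_cod_open _ _ _ X i) cp.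
  apply: (@filter_forall _ _ _ _ (nbhs_filter (p : 'rV[R]_(n + n)))) => a.
  apply: (@filter_forall _ _ _ _ (nbhs_filter (p : 'rV[R]_(n + n)))) => b.
  have c : {for p, continuous (fun y => metric (kform w i y) a b)}.
    have -> : (fun y => metric (kform w i y) a b) = (fun y => \sum_k kform w i y a k * (Jmx R n)^T k b).
      by apply/funext => z; rewrite /metric mxE.
    apply: (@cont_sum R _ _ _ _ (fun k y => kform w i y a k * (Jmx R n)^T k b)) => k.
    apply: (@continuousM R _ _ (fun=> _)); last exact: cst_continuous.
    exact: (mf_cont (kform_field w) cp).
  exact: (@cvgr_dist_le _ _ _ _ (nbhs_filter (p : 'rV[R]_(n + n))) _ _ c e e0).
move/nbhs_ballP: H => [r /= r0 H].
have H' y : cube p r y -> chart_cod i y /\ forall a b, `|G a b - metric (kform w i y) a b| <= e.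
  by move=> yr; apply: H; rewrite -ball_normE /ball_ /= distrC.
exists r => //; split=> [y /H' []//|y v /H' [_ He]].
rewrite /metric_sq /form_app -!/(bil _ _ _) -/G; set G' := metric (kform w i y) in He *.
have D : `|bil G v v - bil G' v v| <= bil G v v / 2.
  have -> : bil G v v - bil G' v v = \sum_a \sum_b v 0 a * (G a b - G' a b) * v 0 b.
    rewrite !bil_sum -sumrB; apply: eq_bigr => a _; rewrite -sumrB; apply: eq_bigr => b _.
    by rewrite mulrBr mulrBl.
  apply: (@le_trans _ _ (m2 * (e * `|v| ^+ 2))).
    apply: le_trans (ler_norm_sum _ _ _) _; rewrite /m2 mulr_suml; apply: ler_sum => a _.
    apply: le_trans (ler_norm_sum _ _ _) _; rewrite mulr_suml; apply: ler_sum => b _.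
    rewrite mul1r !normrM expr2 mulrCA -mulrA; apply: ler_pM => //; first exact: coord_le.
    by apply: ler_pM => //; exact: coord_le.
  apply: (@le_trans _ _ (m2 * (e * (L * bil G v v)))).
    apply: ler_wpM2l => //; apply: ler_wpM2l; [exact: ltW | exact: vL].
  have -> : m2 * (e * (L * bil G v v)) = (m2 * L * e) * bil G v v by ring.
  rewrite mulrC; apply: ler_wpM2l; first exact: posdef_ge0.
  rewrite /e invfM mulrA ler_pdivrMr; last by lra.
  by lra.
by move: D; rewrite ler_norml => /andP[? ?]; apply/andP; split; lra.
Qed.

Lemma window_at x : exists W : window, \forall z \near x, win_bump W z = 1.
Proof.
have d := chart_at_dom X x; set i := chart_at X x in d; set p := Defs.coord i x.
have [r r0 [sub cmp]] := metric_compare (coord_cod d).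
have r6 : 0 < r / 6 by lra.
have e6 : 6 * (r / 6) = r by rewrite mulrC divfK.
have sub6 : cube p (6 * (r / 6)) `<=` chart_cod i by rewrite e6.
have cmp6 (y y' v : 'rV[R]_(n + n)) : cube p (6 * (r / 6)) y -> cube p (6 * (r / 6)) y' ->
    metric_sq (kform w i y') v <= 4 * metric_sq (kform w i y) v.
  rewrite e6 => /(cmp y v)/andP[h1 h2] /(cmp y' v)/andP[h3 h4]; lra.
exists (Window r6 sub6 cmp6).
have r12 : 0 < r / 6 / 2 by lra.
apply: filterS (window_nbhs r12 d) => z [dz zr].
by rewrite /win_bump /= pushE //; apply: bump1 => //; exact: ltW.
Qed.

(** The product vanishes exactly when some bump of the list equals 1 at [x]. *)
Definition covered (q : seq window) x := \prod_(W <- q) (1 - win_bump W x) = 0.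

Lemma compact_windows (K : set M) : compact K ->
  exists q : seq window, forall x, K x -> covered q x.
Proof.
have /choice [F HF] := window_at.
rewrite compact_cover => /(_ M setT (fun x => interior [set z | win_bump (F x) z = 1])).
case=> [x _|x Kx|D _ cov]; first exact: open_interior.
  by exists x => //; exact: HF.
exists (map F (finmap.enum_fset D)) => x /cov [a aD /interior_subset /= e].
apply/eqP; rewrite /covered big_map prodf_seq_eq0; apply/hasP.
by exists a => //=; rewrite e subrr.
Qed.

(** In place of a partition of unity, [u] is split as [u b + u (1 - b)] for one bump [b] after
    another. Each first part lies in a window, and the last remainder carries the full product of
    the [1 - b], which vanishes on the support of [u]. *)
Lemma window_induction (Q Pr : (M -> R) -> Prop) :
  (forall u W, Q u -> Q (fun x => u x * win_bump W x)) ->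
  (forall u W, Q u -> Q (fun x => u x * (1 - win_bump W x))) ->
  Pr (fun=> 0) -> (forall u v, Q u -> Q v -> Pr u -> Pr v -> Pr (fun x => u x + v x)) ->
  (forall u W, Q u -> wsupp W u -> Pr u) ->
  forall u (K : set M), Q u -> compact K -> (forall x, u x != 0 -> K x) -> Pr u.
Proof.
move=> QM QM' P0 PD PW u K Qu /compact_windows [q cov] uK.
have {cov uK} : forall x, u x * \prod_(W <- q) (1 - win_bump W x) = 0.
  move=> x; have [->|/uK /cov ->] := eqVneq (u x) 0; by rewrite ?mul0r ?mulr0.
elim: q u Qu => [|W q IH] u Qu cov.
  suff -> : u = fun=> 0 by [].
  by apply/funext => x; have := cov x; rewrite big_nil mulr1.
have -> : u = (fun x => u x * win_bump W x + u x * (1 - win_bump W x)).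
  by apply/funext => x; rewrite -mulrDr addrC subrK mulr1.
apply: PD; [exact: QM | exact: QM' | |].
  apply: (PW _ W); first exact: QM.
  exact: csuppM (@win_bump_supp W).
apply: IH; first exact: QM'.
by move=> x; have := cov x; rewrite big_cons mulrA.
Qed.

Definition compactly_supported u := exists2 K : set M, compact K & forall x, u x != 0 -> K x.

Lemma compactly_supportedM u v : compactly_supported u -> compactly_supported (fun x => u x * v x).
Proof. by move=> [K Kc uK]; exists K => // x; rewrite mulf_eq0 negb_or => /andP[/uK]. Qed.

Lemma compactly_supportedD u v : compactly_supported u -> compactly_supported v ->
  compactly_supported (fun x => u x + v x).
Proof.
move=> [K Kc uK] [K' Kc' vK]; exists (K `|` K'); first exact: compactU.
by move=> x; have [->|/uK] := eqVneq (u x) 0; [rewrite add0r => /vK; right | left].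
Qed.

Lemma compactly_supported_energy (Om : chart X -> 'rV[R]_(n + n) -> 'M[R]_(n + n)) u v :
  compactly_supported u -> compactly_supported (energy w Om u v).
Proof.
move=> [K Kc uK]; exists K => // x ex; apply: contrapT => nK.
have Kcl : closed K by apply: compact_closed => //; exact: cm_hausdorff X.
have : open (~` K) by rewrite openC.
move=> /(@open_near _ _ x) /(_ nK) H; move: ex.
rewrite energy_local ?eqxx //; apply: H => z nKz.
by have [//|/uK] := eqVneq (u z) 0.
Qed.

Variable mu : {measure set (borel M) -> \bar R}.
Hypothesis hmu : is_volume w mu.

Lemma win_sub3 (W : window) : cube (win_center W) (3 * win_radius W) `<=` chart_cod (win_chart W).
Proof.
by move=> y yr; apply: win_sub; apply: lt_le_trans yr _; have := win_gt0 W; lra.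
Qed.

Lemma compact_integrable u : continuous u -> compactly_supported u ->
  mu.-integrable setT (EFin \o u).
Proof.
move=> cu [K Kc uK].
apply: (window_induction (Q := fun u : M -> R => continuous u)
  (Pr := fun u => mu.-integrable setT (EFin \o u))) Kc uK => //.
- by move=> v W cv; apply: cont_mul => //; exact: MC1_continuous (@win_bump_MC1 W).
- move=> v W cv; apply: cont_mul => //.
  exact: MC1_continuous (@win_cobump_MC1 W).
- exact: integrable0.
- move=> a b _ _ ia ib; have := integrableD measurableT ia ib.
  by apply: eq_integrable => // x _; rewrite /= EFinD.
- by move=> v W cv; apply: (window_integrable hmu (win_gt0 W) (@win_sub3 W)).
Qed.

(** A positive value at [x] would give a positive Lebesgue integral in a window around [x]. *)
Lemma compact_integral_eq0 u x : continuous u -> compactly_supported u -> (forall x, 0 <= u x) ->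
  Rintegral mu setT u <= 0 -> u x = 0.
Proof.
move=> cu su u0 I0; apply/eqP; apply: contraT => ux.
have ux0 : 0 < u x by rewrite lt0r ux u0.
have [W H] := window_at x; have bx := nbhs_singleton H.
pose v z := u z * win_bump W z.
have cb : continuous (win_bump W) by exact: MC1_continuous (@win_bump_MC1 W).
have cv : continuous v by exact: cont_mul.
have sv : wsupp W v by exact: csuppM (@win_bump_supp W).
have v0 z : 0 <= v z by apply: mulr_ge0 => //; exact: win_bump_ge0.
have vu z : v z <= u z by apply: ler_piMr => //; exact: win_bump_le1.
have : Rintegral mu setT v <= Rintegral mu setT u.
  have iu := compact_integrable cu su.
  have iv := compact_integrable cv (compactly_supportedM _ su).
  exact: (le_Rintegral measurableT iv iu (fun z _ => vu z)).
rewrite (chart_integral hmu (win_gt0 W) (@win_sub3 W) cv sv) leNgt => /negP[].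
apply: le_lt_trans I0 _.
have dx : chart_dom (win_chart W) x.
  by apply: (@win_bump_supp W x _).1; rewrite bx oner_neq0.
apply: (@Lint_gt0 _ _ _ (Defs.coord (win_chart W) x)).
- exact: (chart_integrand_Cc w (win_gt0 W) (@win_sub3 W) cv sv).
- by move=> y; exact: chart_integrand_ge0.
rewrite /chart_integrand pullE ?coordK //; last exact: coord_cod.
by rewrite mulr_gt0 // ?(dens_gt0 w (coord_cod dx)) // /v bx mulr1.
Qed.

Section WeakInequality.
Variables (u h q : M -> R).
Hypotheses (Cu : C2_manifold X u) (Ch : C2_manifold X h) (cq : continuous q).
Hypothesis pos : forall i y, chart_cod i y -> form_pos (kform_phi w u i y).
Hypothesis trace_ge : forall i y, chart_cod i y ->
  Num.sqrt (\det (kform w i y)) * q (param i y) <=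
  Num.sqrt (\det (kform_phi w u i y)) *
    \tr (invmx (metric (kform_phi w u i y)) *m hess (in_chart i h) y).
Let Om := kform_phi w u.

Lemma C2_MC1 v : C2_manifold X v -> MC1 X v.
Proof. by move=> Cv i; exact: Ck_onW (Cv i). Qed.

Lemma Om_field : metric_field Om.
Proof. exact: kform_phi_field. Qed.

Lemma weak_inequality_window psi W : MC1 X psi -> (forall x, 0 <= psi x) -> wsupp W psi ->
  Rintegral mu setT (energy w Om psi h) <= - Rintegral mu setT (fun x => psi x * q x).
Proof.
move=> Cp p0 sp; set i := win_chart W; set p := win_center W; set r := win_radius W.
have r0 : 0 < r := win_gt0 W.
have r6 : r < 6 * r by lra.
have CP := pull_C1 r6 (@win_sub W) Cp sp.
have CW a b : Ck_on 1 (chart_cod i) (fun y => kform w i y a b) by exact: kform_smooth.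
pose k y := Num.sqrt (\det (kform w i y)) * q (param i y).
have ck y : chart_cod i y -> {for y, continuous k}.
  move=> cy; apply: (@continuousM R).
    apply: (@continuous_comp _ _ _ (fun y => \det (kform w i y)) Num.sqrt).
      by apply: cont_det => a b; exact: (mf_cont (kform_field w)).
    exact: sqrt_continuous.
  by apply: (@continuous_comp _ _ _ (param i) q); [exact: param_continuous | exact: cq].
have P0 y : 0 <= pull i psi y by rewrite /pull; case: ifP.
have [Cg le] := weak_inequality r0 (@chart_cod_open _ _ _ X i) (@win_sub W) CW
  (@kform_real11 _ _ _ _ w i) (@kform_closed _ _ _ _ w i) (Cu i) (Ch i) (@pos i) CP
  (fun y => pull0 sp) P0 ck (@trace_ge i).
(* The measure has density [cJ * sqrt (det)] in the chart, so the chart inequality is multiplied by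
   this positive constant on both sides. *)
set cJ := wedge_top (Jmx R n).
have cJ0 : 0 < cJ by exact: wedge_top_Jmx.
have wE y : chart_cod i y -> wedge_top (kform w i y) = cJ * Num.sqrt (\det (kform w i y)).
  by move=> cy; apply: wedge_top_det; [exact: kform_real11 | exact: kform_pos].
have Cpsih : continuous (energy w Om psi h) by exact: (energy_continuous Om_field Cp (C2_MC1 Ch)).
have se : csupp i p (2 * r) (energy w Om psi h).
  by apply: csupp_energy (@win_ccube1 W) sp; rewrite -/r; lra.
have r20 : 0 < 2 * r by lra.
have sub32 : cube p (3 * (2 * r)) `<=` chart_cod i.
  by rewrite mulrA -natrM; exact: (@win_sub W).
have -> : Rintegral mu setT (energy w Om psi h) = cJ * Lint (grad_term (kform w i) (in_chart i u) (in_chart i h) (pull i psi)).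
  rewrite (chart_integral hmu r20 sub32 Cpsih se) -LintZ //; congr Lint; apply/funext => y.
  have [cy|ncy] := pselect (chart_cod i y); last first.
    rewrite /chart_integrand /pull memNset // mulr0 /grad_term.
    suff -> : diff1 (pull i psi) y = 0 by rewrite /bil !mul0mx mxE !mulr0.
    apply/rowP => a; rewrite !mxE; apply: (partial_local (r := r) (p := p)).
      by move=> z; exact: pull0.
    rewrite ltNge; apply/negP => yr; apply: ncy; exact: win_ccube1.
  rewrite /grad_term; have -> : diff1 (pull i psi) y = diff1 (in_chart i psi) y.
    apply/rowP => a; rewrite !mxE; apply: near_partial.
    by apply: (open_near (@chart_cod_open _ _ _ X i) cy) => z cz; rewrite pullE.
  rewrite /chart_integrand pullE // (energyE w Om_field Cp (C2_MC1 Ch) (param_dom cy)) paramK //.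
  rewrite wE // /density_at /pairing_at -/(Om i y) -mulrA; congr (_ * _).
  rewrite -/(kform_phi w u i y) -/(Om i y) mulrA; congr (_ * _).
  rewrite mulrC divfK // gt_eqF // sqrtr_gt0.
  exact: (field_det_gt0 (kform_field w) cy).
have -> : Rintegral mu setT (fun x => psi x * q x) = cJ * Lint (fun y => pull i psi y * k y).
  have cpq : continuous (fun x => psi x * q x).
    by apply: cont_mul => //; exact: MC1_continuous.
  have spq : csupp i p r (fun x => psi x * q x).
    by move=> x; rewrite mulf_eq0 negb_or => /andP[/sp].
  have CcP : Cc (fun y => pull i psi y * k y).
    have z0 y : r <= `|y - p| -> pull i psi y * k y = 0.
      by move=> yr; rewrite (pull0 sp yr) mul0r.
    apply: (Cc_local _ z0); apply: (cont_extend r6 _ z0) => y Ny.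
    by apply: (@continuousM R); [exact: (C1_continuous CP) | exact: ck (win_sub Ny)].
  rewrite (chart_integral hmu (win_gt0 W) (@win_sub3 W) cpq spq) -LintZ //.
  congr Lint; apply/funext => y; rewrite /chart_integrand /pull; case: ifPn => [|_].
    by rewrite inE => cy; rewrite wE // /k; ring.
  by rewrite mul0r !mulr0.
by rewrite -mulrN ler_pM2l.
Qed.

Lemma energyDl v1 v2 v x : MC1 X v1 -> MC1 X v2 ->
  energy w Om (fun x => v1 x + v2 x) v x = energy w Om v1 v x + energy w Om v2 v x.
Proof.
move=> C1 C2; rewrite /energy -mulrDr; congr (_ * _).
set i := chart_at X x; have cy := coord_cod (chart_at_dom X x).
rewrite /pairing_at -bilDl; congr bil; apply/rowP => a; rewrite !mxE.
exact: (partialD (Ck_derivable (C1 i) cy) (Ck_derivable (C2 i) cy)).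
Qed.

(** Both sides are additive in [psi], and multiplication by a bump or by its complement to 1
    preserves [psi >= 0], so windows suffice. *)
Lemma weak_inequality_global psi : MC1 X psi -> (forall x, 0 <= psi x) -> compactly_supported psi ->
  Rintegral mu setT (energy w Om psi h) <= - Rintegral mu setT (fun x => psi x * q x).
Proof.
move=> Cp p0 sp; have [K Kc pK] := sp.
apply: (window_induction (Q := fun v : M -> R => [/\ MC1 X v, forall x, 0 <= v x & compactly_supported v])
  (Pr := fun v => Rintegral mu setT (energy w Om v h) <= - Rintegral mu setT (fun x => v x * q x))
  _ _ _ _ _ _ Kc pK) => //.
- move=> v W [Cv v0 sv]; split; first exact: MC1M Cv (@win_bump_MC1 W).
    by move=> x; apply: mulr_ge0 => //; exact: win_bump_ge0.
  exact: compactly_supportedM.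
- move=> v W [Cv v0 sv]; split; first exact: MC1M Cv (@win_cobump_MC1 W).
    by move=> x; apply: mulr_ge0 => //; rewrite subr_ge0; exact: win_bump_le1.
  exact: compactly_supportedM.
- have -> : energy w Om (fun=> 0) h = cst 0.
    by apply/funext => x; apply: energy_local; exact: nearW.
  have -> : (fun x => 0 * q x) = cst 0 by apply/funext => x; rewrite mul0r.
  by rewrite Rintegral_cst // mul0r oppr0.
- move=> v1 v2 [C1 _ s1] [C2 _ s2] h1 h2.
  have ie v : MC1 X v -> compactly_supported v -> mu.-integrable setT (EFin \o energy w Om v h).
    move=> Cv sv; apply: compact_integrable; last exact: compactly_supported_energy.
    exact: (energy_continuous Om_field Cv (C2_MC1 Ch)).
  have iq v : MC1 X v -> compactly_supported v -> mu.-integrable setT (EFin \o (fun x => v x * q x)).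
    move=> Cv sv; apply: compact_integrable; last exact: compactly_supportedM.
    by apply: cont_mul => //; exact: MC1_continuous.
  have -> : energy w Om (fun x => v1 x + v2 x) h = (fun x => energy w Om v1 h x + energy w Om v2 h x).
    by apply/funext => x; exact: energyDl.
  have -> : (fun x => (v1 x + v2 x) * q x) = (fun x => v1 x * q x + v2 x * q x).
    by apply/funext => x; rewrite mulrDl.
  rewrite (RintegralD measurableT (ie _ C1 s1) (ie _ C2 s2)).
  rewrite (RintegralD measurableT (iq _ C1 s1) (iq _ C2 s2)) opprD.
  exact: lerD.
- by move=> v W [Cv v0 _]; exact: weak_inequality_window.
Qed.

End WeakInequality.
End Windows.

(** * Cutoff functions at large scale *)

Section Cutoff.
Variables (R : realType) (M : ptopologicalType) (n : nat).
Variable X : complex_manifold R M n.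
Variable w : kahler_form X.
Implicit Types (i j : chart X) (u : M -> R) (x z : M) (p : 'rV[R]_(n + n)) (r s t c e : R).

Definition gnorm u x : R := Num.sqrt (grad_sq w u x).

Lemma grad_sq_at i u x : MC1 X u -> chart_dom i x ->
  grad_sq w u x = pairing_at (kform w) u u i (Defs.coord i x).
Proof. by move=> Cu d; rewrite -{1}(coordK d) grad_sq_chart //; exact: coord_cod. Qed.

Lemma grad_sq_ge0 u x : MC1 X u -> 0 <= grad_sq w u x.
Proof.
move=> Cu; rewrite (grad_sq_at Cu (chart_at_dom X x)); apply: posdef_ge0; apply: posdef_inv.
exact: (field_posdef (kform_field w) (coord_cod (chart_at_dom X x))).
Qed.

Lemma bil_gradient m (G : 'M[R]_m) (xi : 'rV[R]_m) : posdef G ->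
  bil G (xi *m invmx G) (xi *m invmx G) = bil (invmx G) xi xi.
Proof.
move=> pG; rewrite /bil trmx_mul (invmx_tr_sym pG.1) !mulmxA -[xi *m invmx G *m G]mulmxA.
by rewrite mulVmx ?posdef_unit // mulmx1.
Qed.

Lemma mix_dist (b T g f e e' : R) : 0 <= b <= 1 -> `|T - f| <= e' -> `|g - f| <= e' -> e' <= e ->
  `|T + b * (g - T) - f| <= e.
Proof.
move=> /andP[b0 b1] h1 h2 ee.
have -> : T + b * (g - T) - f = (1 - b) * (T - f) + b * (g - f) by ring.
apply: le_trans (ler_normD _ _) _; rewrite !normrM (ger0_norm b0) ger0_norm ?subr_ge0 //.
have h3 : (1 - b) * `|T - f| <= (1 - b) * e' by apply: ler_wpM2l => //; rewrite subr_ge0.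
have h4 : b * `|g - f| <= b * e' by apply: ler_wpM2l.
by lra.
Qed.

Lemma mix_norm (b T g D B C e e' q : R) : 0 <= b <= 1 -> T <= 2 + e' -> g <= 2 ->
  0 <= D -> D <= 2 * e' -> 0 <= B -> B <= C -> 0 <= e' -> e' <= e / 2 -> e' * C <= e / 4 ->
  q <= (1 - b) * T + b * g + D * B -> q <= 2 + e.
Proof.
move=> /andP[b0 b1] h1 h2 D0 h3 B0 h4 e0 h5 h6 hq.
have h7 : D * B <= 2 * e' * C by exact: ler_pM.
have h8 : (1 - b) * T <= (1 - b) * (2 + e') by apply: ler_wpM2l => //; rewrite subr_ge0.
have h9 : b * g <= b * 2 by apply: ler_wpM2l.
have h10 : 0 <= b * e' by exact: mulr_ge0.
by lra.
Qed.

Lemma dist_third (g T f e : R) : `|g - f| <= e -> `|T - f| <= e -> `|g - T| <= 2 * e.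
Proof.
rewrite !ler_norml => /andP[? ?] /andP[? ?]; by apply/andP; split; lra.
Qed.

Lemma bil_minkowski m (A : 'M[R]_m) xi eta : posdef A ->
  Num.sqrt (bil A (xi + eta) (xi + eta)) <= Num.sqrt (bil A xi xi) + Num.sqrt (bil A eta eta).
Proof.
move=> pA; have s1 := sqrtr_ge0 (bil A xi xi); have s2 := sqrtr_ge0 (bil A eta eta).
rewrite -(@ler_pXn2r _ 2) ?nnegrE ?addr_ge0 ?sqrtr_ge0 // sqr_sqrtr; last exact: posdef_ge0.
rewrite sqrrD !sqr_sqrtr; try exact: posdef_ge0.
rewrite bilDl !bilDr (bil_sym eta xi pA.1).
have : bil A xi eta <= Num.sqrt (bil A xi xi) * Num.sqrt (bil A eta eta).
  rewrite -sqrtrM; last exact: posdef_ge0.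
  apply: le_trans (ler_norm _) _; rewrite -sqrtr_sqr; apply: ler_wsqrtr; exact: bil_CS.
by rewrite mulr2n; lra.
Qed.

Lemma bil_scale_norm m (A : 'M[R]_m) c xi :
  Num.sqrt (bil A (c *: xi) (c *: xi)) = `|c| * Num.sqrt (bil A xi xi).
Proof. by rewrite bilZl bilZr mulrA -expr2 sqrtrM ?sqr_ge0 // sqrtr_sqr. Qed.

Lemma partial_min m (V : set 'rV[R]_m) (h : 'rV[R]_m -> R) y (a : 'I_m) : open V -> Ck_on 1 V h -> V y ->
  (forall z : 'rV[R]_m, V z -> h y <= h z) -> partial a h y = 0.
Proof.
move=> Vo Ch Vy hmin.
have [r r0 sub] : exists2 r : R, 0 < r & forall z : 'rV[R]_m, `|z - y| < r -> V z.
  have := open_nbhs1 Vo Vy; move=> /nbhs_ballP[r /= r0 sub]; exists r => // z zr; apply: sub.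
  by rewrite -ball_normE /ball_ /= distrC.
have line t : `|t| < r -> V (y + t *: delta_mx 0 a).
  by move=> tr; apply: sub; rewrite addrC addKr; exact: le_lt_trans (norm_scale_delta _ _) tr.
have D t : `|t| < r -> is_derive t (1 : R) ((fun s => h (y + s *: delta_mx 0 a)) : R -> R^o)
    (partial a h (y + t *: delta_mx 0 a)).
  by move=> /line Vt; exact: (is_derive_line (Ck_derivable Ch Vt)).
have := @derive1_at_min R (fun s => h (y + s *: delta_mx 0 a)) (- r) r 0.
have r0' : - r < r by lra.
move=> /(_ (ltW r0')); have in0 : (0 : R) \in `](- r), r[%R by rewrite in_itv /=; lra.
have nr t : t \in `](- r), r[%R -> `|t| < r by rewrite in_itv /= ltr_norml.
move=> H; have [||_ e] := H _ in0 _.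
- by move=> t /nr /D [].
- by move=> t /nr /line; rewrite scale0r addr0; exact: hmin.
have n0 : `|(0 : R)| < r by rewrite normr0.
have [_ e'] := D 0 n0.
by move: e'; rewrite scale0r addr0 => <-; exact: e.
Qed.

Lemma gnorm_min u x : MC1 X u -> (forall z, u x <= u z) -> gnorm u x = 0.
Proof.
move=> Cu umin; have d := chart_at_dom X x.
rewrite /gnorm (grad_sq_at Cu d) /pairing_at.
suff -> : diff1 (in_chart (chart_at X x) u) (Defs.coord (chart_at X x) x) = 0.
  by rewrite /bil !mul0mx mxE sqrtr0.
apply/rowP => a; rewrite !mxE.
apply: (partial_min a (@chart_cod_open _ _ _ X _) (Cu _) (coord_cod d)) => z cz.
by rewrite /in_chart coordK.
Qed.

Lemma gnorm_opp u x : MC1 X u -> gnorm (fun z => - u z) x = gnorm u x.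
Proof.
move=> Cu; have d := chart_at_dom X x; set i := chart_at X x in d; have cy := coord_cod d.
have CN : MC1 X (fun z => - u z) by move=> j; exact: (C1N (@chart_cod_open _ _ _ X j) (Cu j)).
rewrite /gnorm (grad_sq_at CN d) (grad_sq_at Cu d) /pairing_at; congr Num.sqrt.
have -> : diff1 (in_chart i (fun z => - u z)) (Defs.coord i x) =
    (-1) *: diff1 (in_chart i u) (Defs.coord i x).
  apply/rowP => a; rewrite !mxE mulN1r; exact: (partialN (Ck_derivable (Cu i) cy)).
by rewrite bilZl bilZr mulrA mulrNN !mul1r.
Qed.

Lemma gnorm_mix u (v b : M -> R) x : MC1 X u -> MC1 X v -> MC1 X b -> 0 <= b x <= 1 ->
  gnorm (fun z => v z + b z * (u z - v z)) x <=
  (1 - b x) * gnorm v x + b x * gnorm u x + `|u x - v x| * gnorm b x.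
Proof.
move=> Cu Cv Cb /andP[b0 b1].
have Cuv := MC1B Cu Cv; have CT := MC1D Cv (MC1M Cb Cuv).
have d := chart_at_dom X x; set i := chart_at X x in d; have cy := coord_cod d.
set y := Defs.coord i x in cy; have Vo := @chart_cod_open _ _ _ X i.
rewrite /gnorm !(grad_sq_at _ d) // /pairing_at -/y.
have pA : posdef (invmx (metric (kform w i y))).
  by apply: posdef_inv; exact: (field_posdef (kform_field w) cy).
set A := invmx _ in pA *.
have ux : in_chart i u y = u x by rewrite /in_chart coordK.
have vx : in_chart i v y = v x by rewrite /in_chart coordK.
have bx : in_chart i b y = b x by rewrite /in_chart coordK.
have uvx : in_chart i (fun z => u z - v z) y = u x - v x by rewrite /in_chart coordK.
have -> : diff1 (in_chart i (fun z => v z + b z * (u z - v z))) y =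
    ((1 - b x) *: diff1 (in_chart i v) y + b x *: diff1 (in_chart i u) y)
    + (u x - v x) *: diff1 (in_chart i b) y.
  apply/rowP => a; rewrite !mxE.
  have e1 := partialD (a := a) (Ck_derivable (Cv i) cy) (Ck_derivable (C1M Vo (Cb i) (Cuv i)) cy).
  have e2 := partialM (a := a) (Ck_derivable (Cb i) cy) (Ck_derivable (Cuv i) cy).
  have e3 := partialB (a := a) (Ck_derivable (Cu i) cy) (Ck_derivable (Cv i) cy).
  rewrite [LHS]e1 e2 [X in _ + (_ * X + _)]e3 bx uvx.
  by ring.
apply: le_trans (bil_minkowski _ _ pA) _; rewrite bil_scale_norm lerD2r.
apply: le_trans (bil_minkowski _ _ pA) _; rewrite !bil_scale_norm.
by rewrite ger0_norm ?subr_ge0 // (ger0_norm b0).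
Qed.

Definition lipschitz1 (f : M -> R) := forall x z, `|f z - f x| <= dist w x z.

Lemma lipschitz1_continuous f : lipschitz1 f -> continuous f.
Proof.
move=> Lf x; apply/cvgrPdist_le => e e0.
apply: filterS (near_dist w x e0) => z /ltW h; rewrite distrC.
exact: le_trans (Lf x z) h.
Qed.

(** Mollify [f] in the chart. Coordinate segments have length at most twice their length in the
    metric frozen at [y], so the Lipschitz bound gives all directional slopes of the mollification
    at most twice the length of the direction; testing with the gradient itself bounds it by 2. *)
Lemma smooth_window (W : window w) f e : lipschitz1 f -> 0 < e -> exists2 g, MC1 X g &
  forall x, win_bump W x != 0 -> `|g x - f x| <= e /\ gnorm g x <= 2.
Proof.
move=> Lf e0; set i := win_chart W; set p := win_center W; set r := win_radius W.
have r0 : 0 < r := win_gt0 W.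
have cf := lipschitz1_continuous Lf.
have sub4 : ccube p (4 * r) `<=` chart_cod i by apply: win_ccube; rewrite -/r; lra.
have sub2 : ccube p (2 * r) `<=` chart_cod i by apply: win_ccube; rewrite -/r; lra.
have r20 : 0 < 2 * r by lra.
have b20 y : 4 * r <= `|y - p| -> bump p (2 * r) y = 0.
  by move=> yr; apply: bump0 => //; rewrite mulrA -natrM.
pose b2 := push i (bump p (2 * r)).
have Cb2 : MC1 X b2 by exact: push_C1 sub4 (@bump_C1 _ _ _ _) b20.
have sb2 : csupp i p (4 * r) (fun x => f x * b2 x) by exact: csuppM (push_csupp b20).
pose F := pull i (fun x => f x * b2 x).
have cF : continuous F.
  apply: (@pull_continuous _ _ _ _ i p (4 * r) (6 * r)) => //; first lra.
    exact: win_sub.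
  by apply: cont_mul => //; exact: MC1_continuous.
have CcF : Cc F by apply: (Cc_local cF (p := p) (r := 4 * r)) => y; exact: pull0.
have FE y : ccube p (2 * r) y -> F y = f (param i y).
  move=> yr; have cy := sub2 y yr; rewrite /F pullE // /b2 (pushE _ (param_dom cy)) paramK //.
  by rewrite bump1 // mulr1.
have [d1 d10 Hd1] := moll_unif CcF e0.
(* Below [d1] for the accuracy [e], and at most [r / 2] so that translated points stay in the cube
   of radius [2 * r], where [F] is [f]. *)
pose s := Num.min d1 r / 2.
have mn0 : 0 < Num.min d1 r by rewrite lt_min d10.
have mnd : Num.min d1 r <= d1 by rewrite ge_min lexx.
have mnr : Num.min d1 r <= r by rewrite ge_min lexx orbT.
have s0 : 0 < s by rewrite /s; lra.
have sd : s < d1 by rewrite /s; lra.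
have sr : s <= r / 2 by rewrite /s; lra.
have Cm := moll_C1 s0 cF.
have b10 y : 2 * r <= `|y - p| -> bump p r y * moll s F y = 0.
  by move=> yr; rewrite bump0 ?mul0r.
have Cg : MC1 X (push i (fun y => bump p r y * moll s F y)).
  by apply: push_C1 sub2 _ b10; apply: (C1M openT _ Cm); exact: bump_C1.
exists (push i (fun y => bump p r y * moll s F y)) => // x bx.
have [d yr] := win_bump_supp bx; rewrite -/i -/p -/r in d yr.
have cy := coord_cod d; set y := Defs.coord i x in yr cy.
have yr' : `|y - p| <= r by exact: ltW.
have Fx : F y = f x.
  by rewrite FE ?coordK // /ccube /=; move: yr' r0; clear; lra.
split; first by rewrite pushE // bump1 // mul1r -Fx; exact: Hd1.
rewrite /gnorm (grad_sq_at Cg d) /pairing_at -/y.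
have -> : diff1 (in_chart i (push i (fun y => bump p r y * moll s F y))) y = diff1 (moll s F) y.
  apply/rowP => a; rewrite !mxE; apply: near_partial.
  apply: (open_near (@cube_open _ _ p r) yr) => z zr.
  have cz : chart_cod i z by apply: sub2; move: zr r0; rewrite /cube /ccube /=; clear; lra.
  by rewrite /in_chart (pushE _ (param_dom cz)) paramK // bump1 ?mul1r //; exact: ltW.
set xi := diff1 _ _; set G := metric (kform w i y).
have pG : posdef G by exact: (field_posdef (kform_field w) cy).
have slope v : dotl xi v <= 2 * Num.sqrt (bil G v v).
  apply: moll_slope s0 cF _.
  have v1 : 0 < `|v| + 1 by have := normr_ge0 v; lra.
  exists (r / (2 * (`|v| + 1))); first by rewrite divr_gt0 // mulr_gt0.
  move=> t z t0 tlt zs.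
  have tv : t * `|v| <= r / 2.
    have : t * (2 * (`|v| + 1)) <= r by rewrite -ler_pdivlMr ?mulr_gt0 // ltW.
    by move: t0; clear; lra.
  have in1 : ccube p (2 * r) (y + z).
    rewrite /ccube /= addrAC; apply: le_trans (ler_normD _ _) _.
    by move: yr zs sr r0; clear; lra.
  have in2 : ccube p (2 * r) (y + t *: v + z).
    rewrite /ccube /=; have -> : y + t *: v + z - p = (y - p) + (t *: v + z).
      by rewrite -!addrA; congr (_ + _); rewrite [RHS]addrC addrA.
    apply: le_trans (ler_normD _ _) _; apply: le_trans (lerD (lexx _) (ler_normD _ _)) _.
    by rewrite normrZ (gtr0_norm t0); move: yr zs sr r0 tv; clear; lra.
  rewrite !FE //; apply: le_trans (ler_norm _) _; apply: le_trans (Lf _ _) _.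
  have [|l [J lS]] := @segment_joined R M n X w i p (2 * r) (t * (2 * Num.sqrt (bil G v v)))
    (y + z) (y + t *: v + z) sub2 in1 in2.
    move=> y' y'r.
    have -> : y + t *: v + z - (y + z) = t *: v 
      by rewrite opprD addrACA subrr addr0 addrAC subrr add0r.
    rewrite /metric_sq /form_app -/(bil _ _ _) bil_scale_norm (gtr0_norm t0).
    apply: ler_wpM2l; first exact: ltW.
    have -> : 2 * Num.sqrt (bil G v v) = Num.sqrt (4 * bil G v v).
      rewrite sqrtrM // (_ : 4 = 2 ^+ 2 :> R) ?sqrtr_sqr ?ger0_norm //.
      by rewrite -natrX.
    have c1 : cube (win_center W) (6 * win_radius W) y.
      by rewrite /cube /= -/p -/r; move: yr r0; clear; lra.
    have c2 : cube (win_center W) (6 * win_radius W) y'.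
      by rewrite /cube /= -/p -/r; move: y'r r0; rewrite /ccube /=; clear; lra.
    by apply: ler_wsqrtr; exact: (win_compare v c1 c2).
  by apply: le_trans (dist_le J) lS.
(* On the gradient the slope bound reads [a <= 2 * Num.sqrt a]. *)
have := slope (xi *m invmx G); set a := bil (invmx G) xi xi.
have -> : dotl xi (xi *m invmx G) = a.
  by rewrite /a /bil mxE /dotl; apply: eq_bigr => k _; rewrite [X in _ = _ * X]mxE.
have -> : bil G (xi *m invmx G) (xi *m invmx G) = a.
  exact: bil_gradient.
have a0 : 0 <= a by apply: posdef_ge0; exact: posdef_inv.
have sa := sqrtr_ge0 a; have := sqr_sqrtr a0; move: sa; move: (Num.sqrt a) => q q0 <- h.
by rewrite leNgt; apply/negP => q2; nra.
Qed.

Lemma win_bump_gnorm (W : window w) : exists2 C, 0 < C & forall x, gnorm (win_bump W) x <= C.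
Proof.
have [|C C0 HC] := bump_grad_bound w (i := win_chart W) (p := win_center W) (win_half W).
  by move=> y yr; apply: win_sub; apply: lt_le_trans yr _; have := win_gt0 W; lra.
exists C => // x; rewrite -[leRHS](ger0_norm (ltW C0)) -sqrtr_sqr; apply: ler_wsqrtr.
exact: HC.
Qed.

(** Local approximations are blended in one at a time as [T + b (g - T)]. Besides a convex
    combination of gradients this costs [|g - T|] times the gradient of [b], which is small once the
    previous approximation is accurate enough; where [b] is 0 or 1 it has an extremum and the cost
    vanishes. The constant [c0] starts the induction where [f] has saturated. *)
Lemma smooth_list f c0 (q : seq (window w)) : lipschitz1 f -> forall e, 0 < e ->
  exists2 T, MC1 X T & forall x, covered q x \/ f x = c0 ->
    `|T x - f x| <= e /\ gnorm T x <= 2 + e.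
Proof.
move=> Lf; elim: q => [|W q IH] e e0.
  exists (fun=> c0); first exact: MC1_cst.
  move=> x [|->]; first by rewrite /covered big_nil => /eqP; rewrite oner_eq0.
  rewrite subrr normr0 gnorm_min //; last exact: MC1_cst.
  by split; lra.
have [C C0 HC] := win_bump_gnorm W.
(* The blending costs at most [2 e' C <= e / 2], and the first bound on [e'] reserves the other half
   of [e] for the previous gradient error. *)
pose e' := Num.min (e / 2) (e / (4 * C)).
have e'0 : 0 < e' by rewrite lt_min !divr_gt0 ?mulr_gt0.
have e'1 : e' <= e / 2 by rewrite ge_min lexx.
have e'2 : e' * C <= e / 4.
  have h : e' <= e / (4 * C) by rewrite ge_min lexx orbT.
  have : e' * (4 * C) <= e by rewrite -ler_pdivlMr // mulr_gt0.
  by lra.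
have e'lt : e' < e by lra.
clearbody e'; have [T CT HT] := IH e' e'0; have [g Cg Hg] := smooth_window W Lf e'0.
pose b := win_bump W; have Cb : MC1 X b by exact: win_bump_MC1.
exists (fun x => T x + b x * (g x - T x)).
  exact: (MC1D CT (MC1M Cb (MC1B Cg CT))).
move=> x good; have b0 := win_bump_ge0 W x; have b1 := win_bump_le1 W x; rewrite -/b in b0 b1.
have b01 : 0 <= b x <= 1 by rewrite b0.
have mix := gnorm_mix Cg CT Cb b01.
have gT0 : 0 <= gnorm T x by exact: sqrtr_ge0.
have gb0 : 0 <= gnorm b x by exact: sqrtr_ge0.
have [bx|bx] := eqVneq (b x) 0.
  have gb : gnorm b x = 0 by apply: gnorm_min => // z; rewrite bx; exact: win_bump_ge0.
  have [|h1 h2] := HT x.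
    by case: good => [|->]; [rewrite /covered big_cons -/b bx subr0 mul1r; left | right].
  split; first by rewrite bx mul0r addr0; apply: le_trans h1 _; exact: ltW.
  apply: le_trans mix _; rewrite gb bx subr0 mul1r mul0r mulr0 !addr0.
  by apply: le_trans h2 _; rewrite lerD2l ltW.
have [h1 h2] := Hg x bx.
have [gq|ngq] := pselect (covered q x \/ f x = c0).
  have [k1 k2] := HT x gq; split; first exact: (mix_dist b01 k1 h1 (ltW e'lt)).
  exact: (mix_norm b01 k2 h2 (normr_ge0 _) (dist_third h1 k1) gb0 (HC x) (ltW e'0) e'1 e'2 mix).
(* Only [W] covers [x] here, so its bump equals 1 there and the new function has the value of [g]
   and the gradient bound of [g]. *)
have bx1 : b x = 1.
  case: good => [|fx]; last by case: ngq; right.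
  rewrite /covered big_cons => /eqP; rewrite mulf_eq0 => /orP[|/eqP h].
    by rewrite subr_eq0 => /eqP h; rewrite /b -h.
  by case: ngq; left.
have gb : gnorm b x = 0.
  rewrite -gnorm_opp //; apply: gnorm_min.
    by move=> j; exact: (C1N (@chart_cod_open _ _ _ X j) (Cb j)).
  by move=> z; rewrite lerN2 bx1; exact: win_bump_le1.
split.
  by rewrite bx1 mul1r addrCA subrr addr0; apply: le_trans h1 _; exact: ltW.
apply: le_trans mix _; rewrite gb bx1 subrr mul0r add0r mul1r mulr0 addr0.
by apply: le_trans h2 _; rewrite lerDl ltW.
Qed.

Variable o : M.
Hypothesis cm : complete_metric w.

Lemma truncated_dist_lipschitz1 c : lipschitz1 (fun x => Num.min (dist w o x) c).
Proof.
move=> x z; have h1 := dist_triangle w o x z; have h2 := dist_triangle w o z x.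
rewrite [dist w z x]dist_sym in h2; rewrite ler_norml.
by case: (leP (dist w o x) c) => ?; case: (leP (dist w o z) c) => ?; apply/andP; split; have := dist_ge0 w x z; lra.
Qed.

(** A step function of the smoothed distance to [o]. Truncating the distance at [3 * rho] makes it
    constant off a precompact ball, so finitely many windows suffice to smooth it. *)
Lemma cutoff : exists2 C, 0 <= C & forall rho : R, 0 < rho -> exists eta : M -> R,
  [/\ MC1 X eta /\ compactly_supported eta, forall x, 0 <= eta x <= 1,
      forall x, dist w o x < rho -> eta x = 1,
      forall x, 2 * rho <= dist w o x -> eta x = 0 &
      forall x, grad_sq w eta x <= C / rho ^+ 2 /\
        (~ (gball w o (2 * rho) `\` gball w o rho) x -> grad_sq w eta x = 0)].
Proof.
have [st' [B [B0 Dst Bst st0]]] := step_derive R.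
exists ((5 * B) ^+ 2); first exact: sqr_ge0.
move=> rho rho0; pose f x := Num.min (dist w o x) (3 * rho).
have Lf : lipschitz1 f by exact: truncated_dist_lipschitz1.
have [K Kc KB] := gball_precompact o (3 * rho) cm.
have [q cov] := compact_windows w Kc.
have e0 : 0 < Num.min 1 (rho / 10) by rewrite lt_min ltr01 divr_gt0.
have [T CT HT] := smooth_list (3 * rho) q Lf e0.
have good x : covered q x \/ f x = 3 * rho.
  have [h|h] := ltP (dist w o x) (3 * rho); first by left; apply: cov; apply: KB.
  by right; rewrite /f; exact/min_idPr.
have Tf x : `|T x - f x| <= rho / 10.
  by have [h _] := HT x (good x); apply: le_trans h _; rewrite ge_min lexx orbT.
have gT x : gnorm T x <= 3.
  have [_ h] := HT x (good x); apply: le_trans h _.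
  have : Num.min 1 (rho / 10) <= 1 by rewrite ge_min lexx.
  by lra.
(* With [T] within [rho / 10] of the truncated distance, [3 - c T] is at least [7 / 6] on the inner
   ball and at most [- 1 / 6] off the outer one. With gradient of [T] at most 3, that of the cutoff
   is at most [c * B * 3 = 5 * B / rho]. *)
pose c := 5 / (3 * rho); have rn : rho != 0 by rewrite gt_eqF.
have cr : c * rho = 5 / 3 by rewrite /c; field.
have c0 : 0 < c by rewrite /c divr_gt0 // mulr_gt0.
pose s x := 3 - c * T x.
have Cs : MC1 X s.
  by move=> i; apply: (C1B (@chart_cod_open _ _ _ X i) (C1_cst _ _)); exact: (C1Z (@chart_cod_open _ _ _ X i) c (CT i)).
have Ceta : MC1 X (fun x => step (s x)).
  by move=> i; exact: (C1_step (@chart_cod_open _ _ _ X i) (Cs i)).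
have inner x : dist w o x < rho -> 1 < s x.
  move=> h; have fx : f x <= dist w o x by rewrite /f ge_min lexx.
  have := Tf x; rewrite ler_norml => /andP[_ h2].
  have : T x <= 11 / 10 * rho by lra.
  by move=> /(ler_wpM2l (ltW c0)); rewrite /s mulrCA cr; lra.
have outer x : 2 * rho <= dist w o x -> s x < 0.
  move=> h; have fx : 2 * rho <= f x by rewrite /f le_min h /=; lra.
  have := Tf x; rewrite ler_norml => /andP[h2 _].
  have : 19 / 10 * rho <= T x by lra.
  by move=> /(ler_wpM2l (ltW c0)); rewrite /s mulrCA cr; lra.
exists (fun x => step (s x)); split.
- split=> //; have [K' K'c K'B] := gball_precompact o (2 * rho) cm.
  exists K' => // x sx; apply: K'B; rewrite /gball /= ltNge; apply/negP => /outer h.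
  by move: sx; rewrite step_le0 ?eqxx // ltW.
- by move=> x; rewrite step_ge0 step_le1.
- by move=> x /inner h; apply: step_ge1; exact: ltW.
- by move=> x /outer h; apply: step_le0; exact: ltW.
move=> x.
have E : grad_sq w (fun x => step (s x)) x = (c * st' (s x)) ^+ 2 * grad_sq w T x.
  have d := chart_at_dom X x; set i := chart_at X x in d; have cy := coord_cod d.
  rewrite (grad_sq_at Ceta d) (grad_sq_at CT d) /pairing_at; set y := Defs.coord i x in cy *.
  have sx : in_chart i s y = s x by rewrite /in_chart coordK.
  have -> : diff1 (in_chart i (fun x => step (s x))) y = (- (c * st' (s x))) *: diff1 (in_chart i T) y.
    apply/rowP => a; rewrite !mxE.
    have [_ ->] := partial_comp1 a (C1_diff (@chart_cod_open _ _ _ X i) (Cs i) cy) (Dst (in_chart i s y)).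
    have e1 := partialB (a := a) (Ck_derivable (C1_cst (chart_cod i) (3 : R)) cy)
      (Ck_derivable (C1Z (@chart_cod_open _ _ _ X i) c (CT i)) cy).
    have e2 := partialM (a := a) (Ck_derivable (C1_cst (chart_cod i) c) cy) (Ck_derivable (CT i) cy).
    rewrite [X in _ * X]e1 partial_cst e2 partial_cst mulr0 addr0 sub0r sx.
    by ring.
  by rewrite bilZl bilZr mulrA mulrNN -expr2.
split.
  rewrite E -(sqr_sqrtr (grad_sq_ge0 x CT)) -/(gnorm T x) -exprMn.
  have -> : (5 * B) ^+ 2 / rho ^+ 2 = (5 * B / rho) ^+ 2 by rewrite !exprMn exprVn.
  rewrite -[leLHS]real_normK ?num_real // lerXn2r ?nnegrE ?divr_ge0 ?mulr_ge0 ?(ltW rho0) //.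
  rewrite normrM (ger0_norm (sqrtr_ge0 _)) normrM (gtr0_norm c0).
  apply: (@le_trans _ _ (c * B * 3)).
    apply: ler_pM; [by apply: mulr_ge0 => //; exact: ltW | exact: sqrtr_ge0 | | exact: gT].
    by apply: ler_wpM2l (Bst _); exact: ltW.
  have -> : c * B * 3 = 5 * B / rho by rewrite /c; field.
  by [].
move=> nA; rewrite E.
have -> : st' (s x) = 0; last by rewrite mulr0 expr0n mul0r.
apply: st0; have [h|h] := ltP (dist w o x) rho; first by right; exact: inner.
left; apply: outer; rewrite leNgt; apply/negP => h2; apply: nA; split => //=.
by rewrite /gball /= ltNge h.
Qed.

End Cutoff.

(** Young's inequality with weight [s]. *)
Lemma cross_term_le (R : realType) (P Q Y s : R) : 0 <= P -> 0 <= Q -> 0 < s -> Y ^+ 2 <= 4 * (P * Q) ->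
  - Y <= s * P + s^-1 * Q.
Proof.
move=> P0 Q0 s0 h; have s1 : 0 < s^-1 by rewrite invr_gt0.
have pq : 0 <= s * P + s^-1 * Q by apply: addr_ge0; apply: mulr_ge0 => //; exact: ltW.
apply: le_trans (ler_norm _) _; rewrite normrN -(@ler_pXn2r _ 2) ?nnegrE // real_normK ?num_real //.
apply: le_trans h _; have -> : P * Q = (s * P) * (s^-1 * Q) by field; rewrite gt_eqF.
by have := sqr_ge0 (s * P - s^-1 * Q); lra.
Qed.

(** As [E] is bounded, [E l] can be chosen within [s ^+ 2] of the supremum. The increment
    [E k - E l] is then at most [s ^+ 2], even after division by [s] it contributes only [s], and
    [s] is arbitrary. *)
Lemma absorb_limit (R : realType) (E : nat -> R) (N : nat) (T Q S : R) :
  (forall k, (N <= k)%N -> E k <= T) -> 0 <= Q ->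
  (forall j l, (N <= j)%N -> (N <= l)%N -> exists2 k, (N <= k)%N & E j <= E k /\
     forall s, 0 < s -> E k <= S + s^-1 * (E k - E l) + s * Q) ->
  forall j, (N <= j)%N -> E j <= S.
Proof.
move=> bT Q0 H j Nj.
pose A := [set E k | k in [set k | (N <= k)%N]].
have hA : has_sup A.
  by split; [exists (E N); exists N => /= | exists T => _ [k Nk <-]; exact: bT].
have ub k : (N <= k)%N -> E k <= sup A by move=> Nk; apply: (ub_le_sup hA.2); exists k.
apply/ler_addgt0Pr => e e0; pose s := e / (1 + Q).
have q1 : 0 < 1 + Q by lra.
have s0 : 0 < s by rewrite divr_gt0.
have [_ [l Nl <-] le] := sup_adherent (exprn_gt0 2 s0) hA.
have [k Nk [jk /(_ _ s0) h]] := H j l Nj Nl.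
apply: le_trans jk _; apply: le_trans h _.
have : s^-1 * (E k - E l) <= s.
  by rewrite mulrC ler_pdivrMr // -expr2; have := ub k Nk; lra.
have -> : e = s * (1 + Q) by rewrite /s divfK // gt_eqF.
by rewrite [s * (1 + Q)]mulrDr mulr1; lra.
Qed.

Lemma half_absorb (R : realType) (e a p S B C : R) : p <= S -> B * a <= B * C ->
  e <= p + 2^-1 * e + 2 * B * a -> e <= 2 * S + 4 * (B * C).
Proof. lra. Qed.

Lemma scaled_absorb (R : realType) (e l a p s S B C : R) : p <= S -> s * (B * a) <= s * (B * C) ->
  e <= p + s^-1 * e + - s^-1 * l + s * B * a -> e <= S + s^-1 * (e - l) + s * (B * C).
Proof. lra. Qed.

(** * Energy estimate *)

Section Energy.
Variables (R : realType) (M : ptopologicalType) (n : nat).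
Variable X : complex_manifold R M n.
Variable w : kahler_form X.
Implicit Types (i j : chart X) (u v : M -> R) (x z : M).

Section Field.
Variable Om : chart X -> 'rV[R]_(n + n) -> 'M[R]_(n + n).
Hypothesis fO : metric_field Om.

Lemma density_ge0 i y : 0 <= density_at w Om i y.
Proof. by apply: divr_ge0; exact: sqrtr_ge0. Qed.

Lemma energy_ge0 v x : 0 <= energy w Om v v x.
Proof.
apply: mulr_ge0; first exact: density_ge0.
apply: posdef_ge0; apply: posdef_inv.
exact: (field_posdef fO (coord_cod (chart_at_dom X x))).
Qed.

Lemma energy_CS u v x : (energy w Om u v x) ^+ 2 <= energy w Om u u x * energy w Om v v x.
Proof.
rewrite /energy /=; set c := density_at _ _ _ _.
have -> (a b : R) : c * a * (c * b) = c ^+ 2 * (a * b) by ring.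
rewrite exprMn; apply: ler_wpM2l; first exact: sqr_ge0.
apply: bil_CS; apply: posdef_inv.
exact: (field_posdef fO (coord_cod (chart_at_dom X x))).
Qed.

Lemma energyMl u v h x : MC1 X u -> MC1 X v ->
  energy w Om (fun z => u z * v z) h x = u x * energy w Om v h x + v x * energy w Om u h x.
Proof.
move=> Cu Cv; have d := chart_at_dom X x; have cy := coord_cod d.
rewrite /energy /pairing_at; set i := chart_at X x; set y := Defs.coord i x.
have -> : diff1 (in_chart i (fun z => u z * v z)) y =
    u x *: diff1 (in_chart i v) y + v x *: diff1 (in_chart i u) y.
  apply/rowP => a; rewrite !mxE.
  have := partialM (a := a) (Ck_derivable (Cu i) cy) (Ck_derivable (Cv i) cy).
  by rewrite /in_chart coordK.
by rewrite bilDl !bilZl; ring.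
Qed.

Lemma energyBc v (c : R) h x : MC1 X v -> energy w Om (fun z => v z - c) h x = energy w Om v h x.
Proof.
move=> Cv; have d := chart_at_dom X x; have cy := coord_cod d.
rewrite /energy /pairing_at; set i := chart_at X x; set y := Defs.coord i x.
have -> // : diff1 (in_chart i (fun z => v z - c)) y = diff1 (in_chart i v) y.
apply/rowP => a; rewrite !mxE.
have e := partialB (a := a) (Ck_derivable (Cv i) cy) (Ck_derivable (@MC1_cst R M n X c i) cy).
by rewrite [LHS]e partial_cst subr0.
Qed.

(** [cofactor_bound] divided by the volume density of [w]. *)
Lemma energy_le_grad (K : R) v x : 0 < K ->
  (forall i y, chart_cod i y -> form_le (Om i y) (K *: kform w i y)) -> MC1 X v ->
  energy w Om v v x <= K ^+ n / K * grad_sq w v x.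
Proof.
move=> K0 le Cv; have d := chart_at_dom X x; have cy := coord_cod d.
rewrite (grad_sq_at _ Cv d) /energy /pairing_at; set i := chart_at X x in d cy *.
set y := Defs.coord i x in cy *; set xi := diff1 _ _.
have pG := field_posdef fO cy; have pg := field_posdef (kform_field w) cy.
have Jinv (W : 'M[R]_(n + n)) : real11 W -> Jmx R n *m metric W *m (Jmx R n)^T = metric W.
  by move=> [_ WJ]; rewrite /metric !mulmxA WJ.
have bil_le (t : 'rV[R]_(n + n)) : bil (metric (Om i y)) t t <= K * bil (metric (kform w i y)) t t.
  have := le i y cy t.
  by rewrite /form_app -scalemxAr -scalemxAl [X in _ <= X]mxE /bil /metric trmx_mul !mulmxA.
have := cofactor_bound xi (@Jmx_tr R n) (@Jmx_sq R n) pG pg (Jinv _ (mf_real11 fO cy))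
  (Jinv _ (kform_real11 w cy)) K0 bil_le.
rewrite !det_metric => h.
have s0 : 0 < Num.sqrt (\det (kform w i y)) by rewrite sqrtr_gt0 (field_det_gt0 (kform_field w) cy).
by rewrite /density_at mulrAC ler_pdivrMr // mulrAC.
Qed.

End Field.

Variable mu : {measure set (borel M) -> \bar R}.
Hypothesis hmu : is_volume w mu.
Hypothesis cm : complete_metric w.
Variables (o : M) (rho : nat -> R).
Hypothesis rho0 : forall k, 0 < rho k.
Hypothesis rho_oo : rho @ \oo --> +oo.
Hypothesis hvol : (c_vol w mu o rho < +oo)%E.

(** The upper limit is the infimum of the suprema of tails, so when it is finite some tail is
    bounded. *)
Lemma annulus_volume : exists2 c : R, 0 <= c &
  \forall k \near \oo, (mu (annulus w o rho k) <= (c * rho k ^+ 2)%:E)%E.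
Proof.
move: hvol; rewrite /c_vol; set U := (fun k => _).
rewrite limn_esup_lim => lt.
have e : limn (esups U) = ereal_inf (range (esups U)).
  by apply: cvg_lim => //; apply: ereal_nonincreasing_cvgn; exact: nonincreasing_esups.
move: lt; rewrite e => /ereal_inf_lt[_ [N _ <-]] lt.
have U0 k : (0 <= U k)%E by apply: mule_ge0 => //; rewrite lee_fin invr_ge0 sqr_ge0.
have UN k : (N <= k)%N -> (U k <= esups U N)%E.
  by move=> Nk; apply: ereal_sup_ubound; exists k.
have s0 : (0 <= esups U N)%E by apply: le_trans (U0 N) (UN _ (leqnn N)).
have fn : esups U N \is a fin_num by rewrite ge0_fin_numE.
exists (fine (esups U N)); first exact: fine_ge0.
exists N => // k /= Nk.
have r0 : 0 < rho k ^+ 2 by rewrite exprn_gt0.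
rewrite EFinM fineK // -lee_pdivrMr //.
exact: UN.
Qed.

Definition test u := continuous u /\ compactly_supported u.

Lemma testD u v : test u -> test v -> test (fun x => u x + v x).
Proof.
move=> [cu su] [cv sv]; split; last exact: compactly_supportedD.
by move=> x; apply: continuousD; [exact: cu | exact: cv].
Qed.

Lemma testM u v : continuous u -> test v -> test (fun x => u x * v x).
Proof.
move=> cu [cv sv]; split; first exact: cont_mul.
by have := compactly_supportedM u sv; congr compactly_supported; apply/funext => x; rewrite mulrC.
Qed.

Lemma testZ (c : R) u : test u -> test (fun x => c * u x).
Proof. by apply: testM => x; exact: cst_continuous. Qed.

Lemma test_integrable u : test u -> mu.-integrable setT (EFin \o u).
Proof. by move=> [cu su]; exact: (compact_integrable hmu). Qed.

Lemma test_le u v : test u -> test v -> (forall x, u x <= v x) ->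
  Rintegral mu setT u <= Rintegral mu setT v.
Proof.
by move=> /test_integrable iu /test_integrable iv uv; exact: (le_Rintegral measurableT iu iv).
Qed.

Lemma test_integralD u v : test u -> test v ->
  Rintegral mu setT (fun x => u x + v x) = Rintegral mu setT u + Rintegral mu setT v.
Proof. by move=> /test_integrable iu /test_integrable iv; exact: (RintegralD measurableT iu iv). Qed.

Lemma test_integralZ (c : R) u : test u ->
  Rintegral mu setT (fun x => c * u x) = c * Rintegral mu setT u.
Proof. by move=> /test_integrable iu; exact: (RintegralZl _ measurableT iu). Qed.

Lemma test_axpy (c : R) u v : test u -> test v -> test (fun x => u x + c * v x) /\
  Rintegral mu setT (fun x => u x + c * v x) = Rintegral mu setT u + c * Rintegral mu setT v.
Proof.
move=> tu tv; have tcv := testZ c tv; split; first exact: testD.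
by rewrite (test_integralD tu tcv) test_integralZ.
Qed.

Section EnergyEstimate.
Variables (u h q : M -> R).
Hypotheses (Cu : C2_manifold X u) (Ch : C2_manifold X h) (cq : continuous q).
Hypothesis pos : forall i y, chart_cod i y -> form_pos (kform_phi w u i y).
Hypothesis trace_ge : forall i y, chart_cod i y ->
  Num.sqrt (\det (kform w i y)) * q (param i y) <=
  Num.sqrt (\det (kform_phi w u i y)) *
    \tr (invmx (metric (kform_phi w u i y)) *m hess (in_chart i h) y).
Variable K : R.
Hypothesis K0 : 0 < K.
Hypothesis le_K : forall i y, chart_cod i y -> form_le (kform_phi w u i y) (K *: kform w i y).
Variables (m0 B S : R).
Hypothesis hB : forall x, 0 <= h x - m0 <= B.
Hypothesis hS : forall psi, MC1 X psi -> compactly_supported psi -> (forall x, 0 <= psi x <= B) ->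
  - Rintegral mu setT (fun x => psi x * q x) <= S.
Let Om := kform_phi w u.

Let fO : metric_field Om.
Proof. exact: kform_phi_field. Qed.

Let Ch1 : MC1 X h.
Proof. exact: C2_MC1. Qed.

Let Cht : MC1 X (fun x => h x - m0).
Proof. exact: (MC1B Ch1 (@MC1_cst R M n X m0)). Qed.

Definition cutoff_seq (eta : nat -> M -> R) (D : R) := forall k,
  [/\ MC1 X (eta k) /\ compactly_supported (eta k), forall x, 0 <= eta k x <= 1,
    forall x, dist w o x < rho k -> eta k x = 1,
    forall x, 2 * rho k <= dist w o x -> eta k x = 0 &
    forall x, grad_sq w (eta k) x <= D / rho k ^+ 2 /\
      (~ annulus w o rho k x -> grad_sq w (eta k) x = 0)].

Lemma cutoffs : exists2 D, 0 <= D & exists eta, cutoff_seq eta D.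
Proof.
have [D D0 H] := cutoff o cm; exists D => //.
have /choice[eta He] := fun k => H (rho k) (rho0 k).
by exists eta => k; exact: He.
Qed.

Variables (eta : nat -> M -> R) (D : R).
Hypotheses (D0 : 0 <= D) (heta : cutoff_seq eta D).

Let Ceta k : MC1 X (eta k).
Proof. by have [[]] := heta k. Qed.

Let seta k : compactly_supported (eta k).
Proof. by have [[]] := heta k. Qed.

Let eta01 k x : 0 <= eta k x <= 1.
Proof. by have [_] := heta k. Qed.

Let ceta k : continuous (eta k).
Proof. exact: MC1_continuous (Ceta k). Qed.

Let ahh x := energy w Om h h x.
Let aee k x := energy w Om (eta k) (eta k) x.
(** The test function: [eta k] squared times [h - m0], with values in [[0, B]] as [hS] requires. *)
Let psi k x := eta k x * eta k x * (h x - m0).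
Let dens k x := eta k x ^+ 2 * ahh x.

Let cahh : continuous ahh.
Proof. exact: (energy_continuous fO Ch1 Ch1). Qed.

Lemma test_aee k : test (aee k).
Proof.
split; first exact: (energy_continuous fO (Ceta k) (Ceta k)).
exact: compactly_supported_energy.
Qed.

Lemma psi_C1 k : MC1 X (psi k).
Proof. exact: (MC1M (MC1M (Ceta k) (Ceta k)) Cht). Qed.

Lemma psi_supp k : compactly_supported (psi k).
Proof. exact: (compactly_supportedM _ (compactly_supportedM _ (seta k))). Qed.

Lemma test_dens k : test (dens k).
Proof.
split; last exact: (compactly_supportedM _ (compactly_supportedM _ (seta k))).
by apply: cont_mul => //; apply: cont_mul; exact: ceta.
Qed.

Lemma test_psi_energy k : test (energy w Om (psi k) h).
Proof.
split; first exact: (energy_continuous fO (psi_C1 k) Ch1).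
exact: (@compactly_supported_energy R M n X w Om (psi k) h (psi_supp k)).
Qed.

Lemma psi_bounds k x : 0 <= psi k x <= B.
Proof.
have /andP[e0 e1] := eta01 k x; have /andP[h0 h1] := hB x.
apply/andP; split; first by apply: mulr_ge0 => //; exact: mulr_ge0.
apply: le_trans h1; apply: ler_piMl => //; exact: mulr_ile1.
Qed.

Lemma psi_energyE k x : energy w Om (psi k) h x =
  dens k x + 2 * eta k x * (h x - m0) * energy w Om (eta k) h x.
Proof.
rewrite (energyMl Om h x (MC1M (Ceta k) (Ceta k)) Cht) (energyMl Om h x (Ceta k) (Ceta k)).
by rewrite energyBc // /dens /ahh; ring.
Qed.

Lemma psi_energy_integral k : Rintegral mu setT (energy w Om (psi k) h) <= S.
Proof.
apply: le_trans (hS (psi_C1 k) (psi_supp k) (psi_bounds k)).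
apply: (weak_inequality_global hmu Cu Ch cq pos trace_ge (psi_C1 k) _ (psi_supp k)) => x.
by have /andP[] := psi_bounds k x.
Qed.

(** Expanding the energy of [psi] against [h] gives [dens] plus a cross term in [d eta] and [dh], to
    which Cauchy-Schwarz, [h - m0 <= B] and Young's inequality apply. *)
Lemma dens_le k s x : 0 < s ->
  dens k x <= energy w Om (psi k) h x + s * dens k x + s^-1 * B ^+ 2 * aee k x.
Proof.
move=> s0; rewrite -[s^-1 * _ * _]mulrA psi_energyE.
have a0 : 0 <= ahh x by exact: (energy_ge0 fO).
have e0 : 0 <= aee k x by exact: (energy_ge0 fO).
have /andP[h0 h1] := hB x.
have P0 : 0 <= dens k x by rewrite mulr_ge0 // sqr_ge0.
have Q0 : 0 <= B ^+ 2 * aee k x by rewrite mulr_ge0 // sqr_ge0.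
have := @cross_term_le R (dens k x) (B ^+ 2 * aee k x)
  (2 * eta k x * (h x - m0) * energy w Om (eta k) h x) s P0 Q0 s0.
set Y := 2 * _ * _ * _ => H; suff : Y ^+ 2 <= 4 * (dens k x * (B ^+ 2 * aee k x)) by move/H; lra.
have := energy_CS fO (eta k) h x; rewrite -/(aee k x) -/(ahh x) => cs.
have hB2 : (h x - m0) ^+ 2 <= B ^+ 2 by apply: lerXn2r; rewrite ?nnegrE //; exact: le_trans h0 h1.
have -> : Y ^+ 2 = 4 * (eta k x ^+ 2 * ((h x - m0) ^+ 2 * (energy w Om (eta k) h x) ^+ 2)).
  by rewrite /Y; ring.
have -> : dens k x * (B ^+ 2 * aee k x) = eta k x ^+ 2 * (B ^+ 2 * (aee k x * ahh x)).
  by rewrite /dens; ring.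
rewrite ler_pM2l //; apply: ler_wpM2l; first exact: sqr_ge0.
exact: (ler_pM (sqr_ge0 _) (sqr_ge0 _) hB2 cs).
Qed.

Let kap := K ^+ n / K.

Lemma kap_ge0 : 0 <= kap.
Proof. by rewrite divr_ge0 ?exprn_ge0 // ltW. Qed.

Lemma aee_outside k x : ~ annulus w o rho k x -> aee k x = 0.
Proof.
move=> nA; have [_ _ _ _ /(_ x)[_ /(_ nA) g0]] := heta k.
apply/eqP; rewrite eq_le (energy_ge0 fO) andbT.
by have := energy_le_grad fO x K0 le_K (Ceta k); rewrite g0 mulr0.
Qed.

(* The gradient of [eta k] is supported where [eta l] vanishes, so that only   *)
(* the energy [dens k - dens l] enters the absorption of the cross term.       *)
Lemma dens_le_far k l s x : 0 < s -> 2 * rho l <= rho k ->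
  dens k x <= energy w Om (psi k) h x + s^-1 * dens k x + - s^-1 * dens l x + s * B ^+ 2 * aee k x.
Proof.
move=> s0 lk; have a0 : 0 <= ahh x by exact: (energy_ge0 fO).
have [_ _ k1 k2 _] := heta k; have [_ _ l1 l2 _] := heta l.
have [A|nA] := pselect (annulus w o rho k x).
  have -> : dens l x = 0.
    rewrite /dens l2 ?expr0n ?mul0r //; apply: le_trans lk _.
    by case: A => _ /negP; rewrite -leNgt.
  rewrite mulr0 addr0; have si : 0 < s^-1 by rewrite invr_gt0.
  by have := @dens_le k s^-1 x si; rewrite invrK.
have cs := energy_CS fO (eta k) h x; rewrite -/(aee k x) (aee_outside nA) mul0r in cs.
have e0 : energy w Om (eta k) h x = 0.
  by apply/eqP; rewrite -sqrf_eq0 eq_le cs sqr_ge0.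
rewrite psi_energyE e0 (aee_outside nA) !mulr0 !addr0 -addrA lerDl [- s^-1 * _]mulNr -mulrBr.
apply: mulr_ge0; first by rewrite invr_ge0 ltW.
rewrite subr_ge0; apply: ler_wpM2r => //.
have /andP[ek0 ek1] := eta01 k x; have /andP[el0 el1] := eta01 l x.
apply: lerXn2r; rewrite ?nnegrE //.
have [lx|lx] := leP (2 * rho l) (dist w o x); first by rewrite (l2 _ lx).
by rewrite k1 //; exact: lt_le_trans lk.
Qed.

(** The gradient of the cutoff lives on the annulus with square at most [D / rho k ^+ 2], and the
    volume of the annulus is at most [c * rho k ^+ 2]; the powers of [rho k] cancel. *)
Lemma aee_bound : exists2 C1, 0 <= C1 &
  \forall k \near \oo, Rintegral mu setT (aee k) <= C1.
Proof.
have [c c0 Hc] := annulus_volume; have k0 := kap_ge0; exists (kap * D * c); first by apply: mulr_ge0 => //; exact: mulr_ge0.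
apply: filterS Hc => k Hc; have [cA sA] := test_aee k.
have r2 : 0 < rho k ^+ 2 by rewrite exprn_gt0.
have mA : measurable (annulus w o rho k : set (borel M)).
  by apply: measurableD; apply: open_borel; exact: gball_open.
pose cf := kap * (D / rho k ^+ 2).
have cf0 : 0 <= cf by rewrite mulr_ge0 ?kap_ge0 // divr_ge0 // ltW.
have le x : aee k x <= cf * \1_(annulus w o rho k) x.
  have [A|nA] := pselect (annulus w o rho k x); last by rewrite aee_outside // indicE memNset ?mulr0.
  rewrite indicE mem_set // mulr1.
  apply: le_trans (energy_le_grad fO x K0 le_K (Ceta k)) _.
  by apply: ler_wpM2l; [exact: kap_ge0 | have [_ _ _ _ /(_ x)[]] := heta k].
have I : (\int[mu]_x (aee k x)%:E <= (kap * D * c)%:E)%E.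
  apply: (@le_trans _ _ (\int[mu]_x (cf * \1_(annulus w o rho k) x)%:E)%E).
    apply: ge0_le_integral => //.
    - by move=> x _; rewrite lee_fin (energy_ge0 fO).
    - by apply/measurable_EFinP; exact: continuous_borel.
    - by apply/measurable_EFinP; apply: measurable_funM => //; exact: measurable_indic.
    - by move=> x _; rewrite lee_fin.
  under eq_integral do rewrite EFinM.
  rewrite ge0_integralZl // ?lee_fin //; last first.
    by apply/measurable_EFinP; exact: measurable_indic.
  rewrite integral_indic // setIT.
  apply: (@le_trans _ _ (cf%:E * (c * rho k ^+ 2)%:E)%E); first exact: lee_wpmul2l.
  rewrite -EFinM lee_fin (_ : cf * _ = kap * D * c) //.
  by rewrite /cf; field; rewrite gt_eqF.
rewrite /Rintegral -[leRHS]/(fine (kap * D * c)%:E); apply: fine_le => //.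
exact: (integrable_fin_num measurableT (test_integrable (test_aee k))).
Qed.

Lemma near_radius (a : R) : \forall k \near \oo, a <= rho k.
Proof. by move/cvgryPge : rho_oo. Qed.

Let E k := Rintegral mu setT (dens k).

Lemma dens_mono k l : 2 * rho l <= rho k -> forall x, dens l x <= dens k x.
Proof.
move=> lk x; have a0 : 0 <= ahh x by exact: (energy_ge0 fO).
have [_ _ k1 _ _] := heta k; have [_ _ _ l2 _] := heta l.
apply: ler_wpM2r => //.
have /andP[ek0 ek1] := eta01 k x; have /andP[el0 el1] := eta01 l x.
apply: lerXn2r; rewrite ?nnegrE //.
have [lx|lx] := leP (2 * rho l) (dist w o x); first by rewrite (l2 _ lx).
by rewrite k1 //; exact: lt_le_trans lk.
Qed.

(** With weight one half, [dens_le] bounds [E k] independently of [k]. Given this bound,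
    [dens_le_far] feeds [absorb_limit], which leaves [S] with no error term. *)
Lemma dens_integral_le : \forall k \near \oo, E k <= S.
Proof.
have [C1 C10 [N _ HC]] := aee_bound; exists N => // j Nj.
have tA k := test_aee k; have tD k := test_dens k; have tP k := test_psi_energy k.
apply: (@absorb_limit R E N (2 * S + 4 * (B ^+ 2 * C1)) (B ^+ 2 * C1) S) Nj => [k Nk||].
- have h2 : 0 < (2^-1 : R) by rewrite invr_gt0.
  have [t1 e1] := test_axpy 2^-1 (tP k) (tD k); have [t2 e2] := test_axpy (2 * B ^+ 2) t1 (tA k).
  have : E k <= _ := test_le (tD k) t2 _.
  rewrite e2 e1; have h3 : B ^+ 2 * Rintegral mu setT (aee k) <= B ^+ 2 * C1.
    by apply: ler_wpM2l; [exact: sqr_ge0 | exact: HC].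
  move=> H; have : E k <= Rintegral mu setT (energy w Om (psi k) h) + 2^-1 * E k
      + 2 * B ^+ 2 * Rintegral mu setT (aee k).
    by apply: H => x; have := dens_le k x h2; rewrite invrK.
  exact: half_absorb (psi_energy_integral k) h3.
- by apply: mulr_ge0 => //; exact: sqr_ge0.
move=> j' l Nj' Nl.
(* A radius beyond both doubled radii makes [dens] larger than at [j'] and separates the annulus
   from the support of the cutoff at [l]. *)
have [N' _ H'] : \forall k \near \oo, (N <= k)%N /\ 2 * rho j' + 2 * rho l <= rho k.
  by apply: filterI; [exists N | exact: near_radius].
have [Nk rk] := H' N' (leqnn N'); have pj := rho0 j'; have pl := rho0 l.
have jk : 2 * rho j' <= rho N' by apply: le_trans rk; rewrite lerDl mulr_ge0 // ltW.
have lk : 2 * rho l <= rho N' by apply: le_trans rk; rewrite lerDr mulr_ge0 // ltW.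
exists N' => //; split.
  by apply: test_le => // x; exact: dens_mono.
move=> s s0; have si : 0 < s^-1 by rewrite invr_gt0.
have [t1 e1] := test_axpy s^-1 (tP N') (tD N'); have [t2 e2] := test_axpy (- s^-1) t1 (tD l).
have [t3 e3] := test_axpy (s * B ^+ 2) t2 (tA N').
have : E N' <= _ := test_le (tD N') t3 _.
rewrite e3 e2 e1 => H; have : E N' <= Rintegral mu setT (energy w Om (psi N') h) + s^-1 * E N'
    + - s^-1 * E l + s * B ^+ 2 * Rintegral mu setT (aee N').
  by apply: H => x; exact: dens_le_far.
have h3 : s * (B ^+ 2 * Rintegral mu setT (aee N')) <= s * (B ^+ 2 * C1).
  by apply: (ler_wpM2l (ltW s0)); apply: ler_wpM2l; [exact: sqr_ge0 | exact: HC].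
exact: scaled_absorb (psi_energy_integral N') h3.
Qed.

Lemma dens_near x : \forall k \near \oo, dens k x = ahh x.
Proof.
apply: filterS (near_radius (dist w o x + 1)) => k le.
by have [_ _ k1 _ _] := heta k; rewrite /dens k1 ?expr1n ?mul1r //; lra.
Qed.

Lemma energy_eq0 x : S <= 0 -> energy w Om h h x = 0.
Proof.
move=> S0; have [N _ H] := filterI dens_integral_le (dens_near x).
have [le e] := H N (leqnn N); rewrite -/(ahh x) -e; have [cd sd] := test_dens N.
have d0 z : 0 <= dens N z by apply: mulr_ge0; [exact: sqr_ge0 | exact: (energy_ge0 fO)].
exact: (compact_integral_eq0 hmu x cd sd d0 (le_trans le S0)).
Qed.

(** Fatou's lemma: at each point the cut-off density eventually equals the energy density. *)
Lemma energy_integral_le : (\int[mu]_x (energy w Om h h x)%:E <= S%:E)%E.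
Proof.
have [N _ H] := dens_integral_le.
(* Shifting the index by [N] makes the bound by [S] hold for every term. *)
pose F k x : \bar R := (dens (k + N)%N x)%:E.
have mF k : measurable_fun setT (F k : borel M -> \bar R).
  by apply/measurable_EFinP; apply: continuous_borel; have [] := test_dens (k + N)%N.
have F0 k (x : borel M) : setT x -> (0 <= F k x)%E.
  by move=> _; rewrite lee_fin mulr_ge0 ?sqr_ge0 // (energy_ge0 fO).
have lim x : limn_einf (F^~ x) = (ahh x)%:E.
  apply: (cvg_limn_einf_sup _).1; apply: cvg_near_cst.
  have [N' _ H'] := dens_near x; exists N' => // k /= Nk; rewrite /F H' //=.
  exact: leq_trans (leq_addr _ _).
have := fatou mu measurableT mF F0.
under eq_integral do rewrite lim.
move/le_trans; apply; rewrite limn_einf_lim.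
apply: lime_le; first exact: is_cvg_einfs.
apply: nearW => k; apply: (@le_trans _ _ (\int[mu]_x F k x)%E).
  by apply: ereal_inf_lbound; exists k => /=.
have tk := test_dens (k + N)%N.
rewrite /= -(fineK (integrable_fin_num measurableT (test_integrable tk))) lee_fin.
by apply: H; exact: leq_addl.
Qed.

End EnergyEstimate.

Lemma energy_eq0_grad Om v x : metric_field Om -> MC1 X v -> energy w Om v v x = 0 -> grad_sq w v x = 0.
Proof.
move=> fO Cv; have d := chart_at_dom X x; have cy := coord_cod d.
rewrite (grad_sq_at _ Cv d) /energy /pairing_at; set i := chart_at X x in d cy *.
set y := Defs.coord i x in cy *; set xi := diff1 _ _ => /eqP.
have d0 : density_at w Om i y != 0.
  apply: lt0r_neq0; apply: divr_gt0; rewrite sqrtr_gt0.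
    exact: (field_det_gt0 fO cy).
  exact: (field_det_gt0 (kform_field w) cy).
rewrite mulf_eq0 (negbTE d0) /= => e.
have -> : xi = 0.
  apply/eqP; apply: contraT => xi0.
  have := (posdef_inv (field_posdef fO cy)).2 _ xi0.
  by rewrite (eqP e) ltxx.
by rewrite /bil !mul0mx mxE.
Qed.

Lemma grad_eq0_constant v : MC1 X v -> (forall x, grad_sq w v x = 0) -> forall x z, v x = v z.
Proof.
move=> Cv g0 x z; apply/eqP; rewrite -subr_eq0 -normr_le0.
have := dist_lipschitz (w := w) z x Cv (lexx 0); rewrite mul0r; apply => a.
by rewrite g0 expr0n.
Qed.

End Energy.

Lemma hessN (R : realType) m (V : set 'rV[R]_m) f y : open V -> Ck_on 2 V f -> V y ->
  hess (fun z => f z * (-1)) y = - hess f y.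
Proof.
move=> Vo Cf Vy; apply/matrixP => a b; rewrite !mxE.
rewrite (@near_partial _ _ _ _ (fun z => - partial b f z)); last first.
  apply: (open_near Vo Vy) => z Vz.
  have -> : (fun z => f z * (-1)) = (fun z => - f z) by apply/funext => x; rewrite mulrN1.
  exact: (partialN (Ck_derivable (Ck_onW Cf) Vz)).
exact: (partialN (Ck_derivable (Ck_partial b Cf) Vy)).
Qed.

(** * Liouville theorem and Dirichlet energy bound *)

Section Conclusion.
Variables (R : realType) (M : ptopologicalType) (n : nat).
Variable X : complex_manifold R M n.
Variable w : kahler_form X.
Variable mu : {measure set (borel M) -> \bar R}.
Hypothesis hmu : is_volume w mu.
Hypothesis cm : complete_metric w.
Variables (o : M) (rho : nat -> R).
Hypothesis rho0 : forall k, 0 < rho k.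
Hypothesis rho_oo : rho @ \oo --> +oo.
Hypothesis hvol : (c_vol w mu o rho < +oo)%E.

(** Makes the operator of [w] itself the instance [u = 0] of the energy estimate. *)
Lemma kform_phi0 : kform_phi w (fun=> 0) = kform w.
Proof.
apply/funext => i; apply/funext => y; rewrite /kform_phi.
suff -> : i_ddbar (in_chart i (fun=> 0)) y = 0 :> 'M[R]_(n + n) by rewrite addr0.
have e : in_chart i (fun=> 0) = (fun=> 0) :> ('rV[R]_(n + n) -> R) by [].
rewrite /i_ddbar e; have -> : diff1 (fun=> (0 : R)) = (fun=> 0 : 'rV[R]_(n + n)).
  by apply/funext => z; apply/rowP => a; rewrite !mxE partial_cst.
apply/matrixP => a b; rewrite !mxE.
by rewrite !partial_cst subrr mulr0 oppr0.
Qed.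

Lemma C2_manifold0 : C2_manifold X (fun=> 0 : R).
Proof. by move=> i; exact: Ck_on_cst. Qed.

(** The energy estimate with [q = 0], [m0 = - C], [B = 2 * C] and [S = 0]: the energy density
    vanishes, hence so does the gradient. *)
Lemma trace_nonneg_constant (u h : M -> R) (K C : R) :
  C2_manifold X u -> C2_manifold X h -> 0 < K ->
  (forall i y, chart_cod i y -> form_pos (kform_phi w u i y) /\
     form_le (kform_phi w u i y) (K *: kform w i y)) ->
  (forall x, `|h x| <= C) ->
  (forall i y, chart_cod i y ->
     0 <= \tr (invmx (metric (kform_phi w u i y)) *m hess (in_chart i h) y)) ->
  exists c, forall x, h x = c.
Proof.
move=> Cu Ch K0 Hu hC tr0; have Ch1 := C2_MC1 Ch.
have pos i y : chart_cod i y -> form_pos (kform_phi w u i y) by move=> /Hu[].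
have leK i y : chart_cod i y -> form_le (kform_phi w u i y) (K *: kform w i y) by move=> /Hu[].
have cq : continuous ((fun=> 0) : M -> R) by move=> x; exact: cst_continuous.
have tr i y : chart_cod i y -> Num.sqrt (\det (kform w i y)) * 0 <=
    Num.sqrt (\det (kform_phi w u i y)) *
      \tr (invmx (metric (kform_phi w u i y)) *m hess (in_chart i h) y).
  by move=> cy; rewrite mulr0 mulr_ge0 ?sqrtr_ge0 // tr0.
have hB x : 0 <= h x - (- C) <= 2 * C by have := hC x; rewrite ler_norml; lra.
have hS psi : MC1 X psi -> compactly_supported psi -> (forall x, 0 <= psi x <= 2 * C) ->
    - Rintegral mu setT (fun x => psi x * (0 : R)) <= 0.
  move=> _ _ _; have -> : (fun x => psi x * (0 : R)) = cst 0 by apply/funext => x; rewrite mulr0.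
  by rewrite Rintegral_cst // mul0r oppr0.
have [D D0 [eta heta]] := cutoffs cm o rho0.
exists (h o) => x; apply: (grad_eq0_constant (w := w) Ch1) => z.
apply: (energy_eq0_grad (kform_phi_field Cu pos) Ch1).
exact: (energy_eq0 hmu rho0 rho_oo hvol Cu Ch cq pos tr K0 leK hB hS D0 heta z (lexx 0)).
Qed.

Lemma bounded_subsolution_constant (phi : M -> R) K : (0 < n)%N ->
  bounded_C11_subsolution w (fun _ => 0) phi K -> exists c, forall x, phi x = c.
Proof.
move=> n0 [[Cphi K0 [C hC] Hphi] eq].
apply: (trace_nonneg_constant C2_manifold0 Cphi ltr01 _ hC) => i y cy; rewrite kform_phi0.
  by split; [exact: kform_pos | move=> v; rewrite scale1r].
have /Hphi[pos _] := cy.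
have := subsolution_trace n0 (@chart_cod_open _ _ _ X i) (Cphi i) cy (kform_real11 w cy)
  (kform_pos w cy) pos (eq i y cy).
by rewrite mul0r expR0 subrr mulr0.
Qed.

(** The constancy criterion is applied to [- phi], written as a product with [-1], and to the
    operator of [w + i ddbar phi]. *)
Lemma bounded_supersolution_constant (phi : M -> R) K : (0 < n)%N ->
  bounded_C11_supersolution w (fun _ => 0) phi K -> exists c, forall x, phi x = c.
Proof.
move=> n0 [[Cphi K0 [C hC] Hphi] eq].
have CN : C2_manifold X (fun x => phi x * (-1)).
  by move=> i; exact: (Ck_onZ (-1) (@chart_cod_open _ _ _ X i) (Cphi i)).
have hCN x : `|phi x * (-1)| <= C by rewrite mulrN1 normrN.
have [i y cy|c hc] := trace_nonneg_constant Cphi CN K0 Hphi hCN; last first.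
  by exists (- c) => x; rewrite -(hc x) mulrN1 opprK.
have Vo := @chart_cod_open _ _ _ X i; have /Hphi[pos _] := cy.
have le := eq i y cy; rewrite expR0 mul1r in le.
have := supersolution_trace n0 Vo (Cphi i) cy (kform_real11 w cy) (kform_pos w cy) pos le.
by rewrite (hessN Vo (Cphi i) cy) mulmxN linearN /= oppr_ge0.
Qed.

Lemma c_vol_ge0 : (0 <= c_vol w mu o rho)%E.
Proof.
apply: limf_esup_ge0 => [|k]; first exact: filter_not_empty.
by apply: mule_ge0 => //; rewrite lee_fin invr_ge0 sqr_ge0.
Qed.

Lemma norm_le_sup_norm (phi : M -> R) x : (exists C, forall z, `|phi z| <= C) ->
  `|phi x| <= sup_norm phi.
Proof.
by move=> [C hC]; apply: ub_le_sup; [exists C => _ [z _ <-] | exists x].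
Qed.

(** For [t >= 0] the right side is nonnegative, and for [t < 0] division by [n] increases [t]. This
    turns the lower bound on the trace into one by [|exp f - 1|]. *)
Lemma expR_div_ge (t : R) : (0 < n)%N -> - `|expR t - 1| <= expR (t / n%:R) - 1.
Proof.
move=> n0; have n1 : (1 : R) <= n%:R by rewrite ler1n.
have n2 : (0 : R) < n%:R by rewrite ltr0n.
have [t0|t0] := leP 0 t.
  apply: (@le_trans _ _ 0); first by rewrite oppr_le0.
  by rewrite subr_ge0 -expR0 ler_expR divr_ge0 // ltW.
apply: (@le_trans _ _ (expR t - 1)); first by rewrite lerNl -normrN ler_norm.
rewrite lerD2r ler_expR ler_pdivlMr //.
by rewrite -subr_ge0 -{1}[t]mulr1 -mulrBr mulr_le0 ?subr_le0 // ltW.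
Qed.

Variable f : M -> R.
Hypothesis hf : continuous f.

(** The energy estimate for [u = 0] and [q = 2 n (exp (f / n) - 1)]. Test functions are bounded by
    twice the sup norm of [phi], so [- \int psi q] is at most [2 n] times that bound times the L^1
    norm of [exp f - 1]. *)
Lemma dirichlet_energy_le (phi : M -> R) K : (0 < n)%N ->
  (L1_norm mu (fun x => (expR (f x) - 1)%R) < +oo)%E ->
  bounded_C11_solution w f phi K ->
  (dirichlet_energy w mu phi <=
   ((n + n)%:R * (2 * sup_norm phi))%:E * L1_norm mu (fun x => (expR (f x) - 1)%R))%E.
Proof.
move=> n0 L1 [[Cphi K0 hC Hphi] eq].
pose g x := `|expR (f x) - 1|.
have cexp (a : R) : continuous (fun x => expR (f x * a) - 1).
  move=> x; apply: (@continuousB R _ _ (fun x => expR (f x * a)) (fun=> 1)); last exact: cst_continuous.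
  apply: (@continuous_comp _ _ _ (fun x => f x * a) expR); last exact: continuous_expR.
  by apply: continuousM; [exact: hf | exact: cst_continuous].
have cg : continuous g.
  move=> x; apply: (@continuous_comp _ _ _ (fun x => expR (f x) - 1) (fun t : R => `|t|)).
    by have := cexp 1 x; congr continuous_at; apply/funext => z; rewrite mulr1.
  exact: norm_continuous.
have ig : mu.-integrable setT (EFin \o g).
  apply/integrableP; split; first by apply/measurable_EFinP; exact: continuous_borel.
  by move: L1; congr (_ < _)%E; apply: eq_integral => x _; rewrite /= normr_id.
pose q x := (n + n)%:R * (expR (f x * n%:R^-1) - 1).
have cq : continuous q by apply: cont_mul => //; move=> x; exact: cst_continuous.
have C1 := C2_MC1 Cphi.
have pos0 i y : chart_cod i y -> form_pos (kform_phi w (fun=> 0) i y).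
  by rewrite kform_phi0; exact: kform_pos.
have tr i y : chart_cod i y -> Num.sqrt (\det (kform w i y)) * q (param i y) <=
    Num.sqrt (\det (kform_phi w (fun=> 0) i y)) *
      \tr (invmx (metric (kform_phi w (fun=> 0) i y)) *m hess (in_chart i phi) y).
  move=> cy; rewrite kform_phi0; apply: ler_wpM2l; first exact: sqrtr_ge0.
  have /Hphi[pos _] := cy; have e := eq i y cy.
  apply: (subsolution_trace n0 (@chart_cod_open _ _ _ X i) (Cphi i) cy (kform_real11 w cy)
    (kform_pos w cy) pos); by rewrite -e.
have leK i y : chart_cod i y -> form_le (kform_phi w (fun=> 0) i y) (1 *: kform w i y).
  by move=> _ v; rewrite kform_phi0 scale1r.
set B := 2 * sup_norm phi; set m := (n + n)%:R.
have hB x : 0 <= phi x - (- sup_norm phi) <= B.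
  by have := norm_le_sup_norm x hC; rewrite ler_norml /B; lra.
have B0 : 0 <= B by have /andP[h0] := hB o; exact: le_trans.
have m0 : 0 <= m by exact: ler0n.
have e : ((m * B)%:E * L1_norm mu (fun x => (expR (f x) - 1)%R) = (m * B * Rintegral mu setT g)%:E)%E.
  rewrite [RHS]EFinM; congr (_ * _)%E; rewrite /Rintegral fineK //.
  exact: (integrable_fin_num measurableT ig).
rewrite e.
have hS psi : MC1 X psi -> compactly_supported psi -> (forall x, 0 <= psi x <= B) ->
    - Rintegral mu setT (fun x => psi x * q x) <= m * B * Rintegral mu setT g.
  move=> Cp sp pB; rewrite lerNl -mulNr -(RintegralZl _ measurableT ig).
  have ipq : mu.-integrable setT (EFin \o (fun x => psi x * q x)).
    apply: (compact_integrable hmu); last exact: compactly_supportedM.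
    by apply: cont_mul => //; exact: MC1_continuous.
  have icg : mu.-integrable setT (EFin \o (fun x => - (m * B) * g x)).
    have := integrableZl measurableT (- (m * B)) ig.
    by apply: eq_integrable => // x _; rewrite /= EFinM.
  apply: (le_Rintegral measurableT icg ipq) => x _.
  have /andP[p0 p1] := pB x; have g0 : 0 <= g x by exact: normr_ge0.
  apply: (@le_trans _ _ (psi x * (m * - g x))); last first.
    by apply: ler_wpM2l => //; apply: ler_wpM2l => //; exact: expR_div_ge.
  rewrite !mulrN mulNr lerN2 [m * B]mulrC -mulrA; apply: ler_wpM2r => //; exact: mulr_ge0.
have [D D0 [eta heta]] := cutoffs cm o rho0.
have := energy_integral_le hmu rho0 rho_oo hvol C2_manifold0 Cphi cq pos0 tr ltr01 leK hB hS D0 heta.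
rewrite /dirichlet_energy kform_phi0.
by under [in X in _ -> X]eq_integral do rewrite grad_sqE //.
Qed.

End Conclusion.

Theorem theorem1p1 (R : realType) (M : ptopologicalType) (n : nat)
  (X : complex_manifold R M n) (w : kahler_form X)
  (mu : {measure set (borel M) -> \bar R}) (o : M) (rho : nat -> R) (f : M -> R)
  (hn : (2 <= n)%N)
  (hmu : is_volume w mu)
  (hcomplete : complete_metric w)
  (hnoncompact : ~ compact [set: M])
  (hrho0 : forall i, 0 < rho i)
  (hrho : rho @ \oo --> +oo)
  (hvol : (c_vol w mu o rho < +oo)%E)
  (hf : continuous f)
  (hf_ub : exists C, forall x, f x <= C) :
  [/\ c_vol w mu o rho = 0%E ->
      forall (phi : M -> R) (K : R),
        [\/ bounded_C11_subsolution w (fun _ => 0) phi K,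
            bounded_C11_supersolution w (fun _ => 0) phi K
          | bounded_C11_solution w (fun _ => 0) phi K] ->
        exists c, forall x, phi x = c,
      (L1_norm mu (fun x => (expR (f x) - 1)%R) < +oo)%E ->
      forall (phi : M -> R) (K : R),
        bounded_C11_solution w f phi K ->
        (dirichlet_energy w mu phi <= c_DE w mu o rho f phi K)%E /\
        (c_DE w mu o rho f phi K < +oo)%E
    & weak_neumann_poincare w mu o rho ->
      forall (phi : M -> R) (K : R),
        bounded_C11_solution w (fun _ => 0) phi K ->
        exists c, forall x, phi x = c].
Proof.
have n0 : (0 < n)%N by exact: ltnW.
have sub phi K : bounded_C11_solution w (fun _ => 0) phi K -> bounded_C11_subsolution w (fun _ => 0) phi K.
  by move=> [H e]; split=> // i y cy; rewrite e.
split.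
- move=> _ phi K [H|H|/sub H].
  + exact: (bounded_subsolution_constant hmu hcomplete hrho0 hrho hvol n0 H).
  + exact: (bounded_supersolution_constant hmu hcomplete hrho0 hrho hvol n0 H).
  + exact: (bounded_subsolution_constant hmu hcomplete hrho0 hrho hvol n0 H).
- move=> L1 phi K H; have cv0 := c_vol_ge0 w mu o rho.
  have L0 : (0 <= L1_norm mu (fun x => (expR (f x) - 1)%R))%E.
    by apply: integral_ge0 => x _; rewrite lee_fin.
  have [[_ K0 hC _] _] := H.
  have s0 : 0 <= sup_norm phi by apply: le_trans (norm_le_sup_norm o hC).
  have k0 : 0 <= (1 + K) ^+ (2 * n) by rewrite exprn_ge0 // addr_ge0 // ltW.
  have D := dirichlet_energy_le hmu hcomplete hrho0 hrho hvol hf n0 L1 H.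
  rewrite /c_DE; set A := 1000 * n%:R ^+ (4 * n + 4) * sup_norm phi.
  have A0 : 0 <= A by exact: (mulr_ge0 (mulr_ge0 (ler0n R 1000) (exprn_ge0 _ (ler0n R n))) s0).
  (* The constant [4 n] of the energy bound is below [1000 n^(4n+4)]; the volume term of [c_DE],
     being nonnegative, can then be added. *)
  have leA : (n + n)%:R * (2 * sup_norm phi) <= A.
    rewrite /A mulrA; apply: ler_wpM2r => //.
    have n1 : (1 : R) <= n%:R by rewrite ler1n.
    have : (n%:R : R) <= n%:R ^+ (4 * n + 4) by rewrite -{1}[n%:R]expr1 ler_weXn2l // addnC.
    by rewrite natrD; lra.
  clearbody A; split; last first.
    by apply: lte_mul_pinfty => //; apply: lte_add_pinfty => //; exact: lte_mul_pinfty.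
  apply: le_trans D _; apply: (@le_trans _ _ (A%:E * L1_norm mu (fun x => (expR (f x) - 1)%R))%E).
    exact: lee_wpmul2r.
  by apply: lee_wpmul2l => //; rewrite leeDr // mule_ge0.
- move=> _ phi K /sub H.
  exact: (bounded_subsolution_constant hmu hcomplete hrho0 hrho hvol n0 H).
Qed.
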